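(* Let $1<p<\infty$, $n\in\mathbb N$, and $T(a)+H(b)\in\mathcal F_{TH}^p(-2n,2n)$ with subordinated pair $(c,d)$. Let $d=\boldsymbol\sigma(d)d_+t^{-2n}\tilde d_+^{-1}$ be the Wiener–Hopf factorization of $d$ in $L^p$, and define for $k=0,\dots,n-1$ $$\omega_k^{a,b}:=T^{-1}(ct^{-2n})\,T(\tilde a^{-1}t^{-n})\big(d_+^{-1}(t^{n-k-1}+\boldsymbol\sigma(d)t^{n+k})\big)$$ (here $T(ct^{-2n})$ is invertible on $H^p$), and the $n\times n$ matrix $W_n(a,b)=(\omega_{jk}^{a,b})_{j,k=0}^{n-1}$, $\omega_{jk}^{a,b}=\frac1{2\pi}\int_0^{2\pi}\omega_k^{a,b}(e^{i\theta})e^{-ij\theta}\,d\theta$. Define $W_n(\bar a,\widetilde{\bar b})$ analogously for the matching pair $(\bar a,\widetilde{\bar b})$ (for which $T(\bar a)+H(\widetilde{\bar b})\in\mathcal F^q_{TH}(-2n,2n)$), with $p$ replaced by $q=p/(p-1)$. Then: (a) $T(a)+H(b)$ is left-invertible iff $W_n(a,b)$ is nondegenerate; (b) $T(a)+H(b)$ is right-invertible iff $W_n(\bar a,\widetilde{\bar b})$ is nondegenerate; (c) $T(a)+H(b)$ is invertible iff both $W_n(a,b)$ and $W_n(\bar a,\widetilde{\bar b})$ are nondegenerate; (d) if $W_n(a,b)$ and $W_n(a,-b)$ are nondegenerate, then $T(a)+H(b)$ and $T(a)-H(b)$ are both invertible.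
   Context: $\mathbb T$ is the unit circle, $1<p<\infty$, $1/p+1/q=1$; $H^p=\{f\in L^p(\mathbb T):\hat f_n=0\ \forall n<0\}$, $\overline{H^p}=\{f\in L^p:\hat f_n=0\ \forall n>0\}$; $P$ is the Riesz projection onto $H^p$, $Q=I-P$, $(Jf)(t)=t^{-1}f(t^{-1})$, $\tilde a(t)=a(1/t)$, $\bar a$ is the complex conjugate; $t$ denotes $t\mapsto t$. On $H^p$: $T(a)f=P(af)$, $H(a)f=P(aQJf)$. A pair $(a,b)$ with $a\in GL^\infty(\mathbb T)$ (invertible in $L^\infty$) and $b\in L^\infty(\mathbb T)$ is a matching pair if $a\tilde a=b\tilde b$; the subordinated pair is $(c,d)$, $c:=a/b$, $d:=a/\tilde b$, with $c\tilde c=d\tilde d=1$. We write $T(a)+H(b)\in\mathcal F_{TH}^p(\kappa_1,\kappa_2)$ if $(a,b)$ is a matching pair whose subordinated operators $T(c),T(d)$ are Fredholm on $H^p$ with $\operatorname{ind}T(c)=\kappa_1$, $\operatorname{ind}T(d)=\kappa_2$. A Wiener–Hopf factorization of $a\in L^\infty$ in $L^p$ is $a=a_-t^ma_+$ with $m\in\mathbb Z$, $a_+\in H^q$, $a_+^{-1}\in H^p$, $a_-\in\overline{H^p}$, $a_-^{-1}\in\overline{H^q}$, and $\|a_+^{-1}P(a_+\varphi)\|_p\le c_p\|\varphi\|_p$ for all trigonometric polynomials $\varphi$. If $g$ satisfies $g\tilde g=1$ and $T(g)$ is Fredholm on $H^p$ with index $n$, its Wiener–Hopf factorization normalized by $g_-(\infty)=1$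 has the form $g=\boldsymbol\sigma(g)g_+t^{-n}\tilde g_+^{-1}$ with $\boldsymbol\sigma(g)=g_+(0)\in\{-1,1\}$ (the factorization signature) and plus factor $g_+$. *)

(* Defs.v *)
From HB Require Import structures.
From mathcomp Require Import all_boot all_order all_algebra.
From mathcomp Require Import all_classical all_reals all_analysis.
From mathcomp Require Import complex.
From Stdlib Require Import ClassicalEpsilon.

Set Implicit Arguments.
Unset Strict Implicit.
Unset Printing Implicit Defensive.

Import Order.TTheory GRing.Theory Num.Theory.
Import numFieldNormedType.Exports.
Local Open Scope classical_set_scope.
Local Open Scope ring_scope.

Section TH.
Variable R : realType.
Local Notation C := R[i].
Local Notation mu := (@lebesgue_measure R).

(** Functions on the unit circle are represented as functions [C -> C]
    that are only ever evaluated at points [circ θ = e^{iθ}], θ ∈ [0,2π]. *)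
Definition I02pi : set R := `[0, pi *+ 2]%classic.
Definition circ (th : R) : C := Complex (cos th) (sin th).
Definition absC (z : C) : R := Normc.normc z.

Definition reF (f : C -> C) (th : R) : R := complex.Re (f (circ th)).
Definition imF (f : C -> C) (th : R) : R := complex.Im (f (circ th)).

Definition measC (f : C -> C) : Prop :=
  measurable_fun I02pi (reF f) /\ measurable_fun I02pi (imF f).

(** a.e. equality on T (the elements of L^p are classes modulo this). *)
Definition aeq (f g : C -> C) : Prop :=
  {ae mu, forall th, I02pi th -> f (circ th) = g (circ th)}.

Definition inLp (p : R) (f : C -> C) : Prop :=
  measC f /\ (\int[mu]_(x in I02pi) ((absC (f (circ x))) `^ p)%:E < +oo)%E.
Definition normLp (p : R) (f : C -> C) : R :=
  ((pi *+ 2)^-1 * Rintegral mu I02pi (fun x => (absC (f (circ x))) `^ p))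
    `^ (p^-1).
Definition inLinf (f : C -> C) : Prop :=
  measC f /\ exists M : R, {ae mu, forall th, I02pi th -> absC (f (circ th)) <= M}.
Definition inGLinf (f : C -> C) : Prop :=
  inLinf f /\ inLinf (fun z => (f z)^-1).

Definition cint (f : C -> C) : C :=
  Complex (Rintegral mu I02pi (reF f)) (Rintegral mu I02pi (imF f)).
Definition fourier (f : C -> C) (j : int) : C :=
  Complex ((pi *+ 2)^-1) 0 * cint (fun z => f z * z ^ (- j)).

Definition inHp (p : R) (f : C -> C) : Prop :=
  inLp p f /\ forall n : int, n < 0 -> fourier f n = 0.
Definition inHpbar (p : R) (f : C -> C) : Prop :=
  inLp p f /\ forall n : int, 0 < n -> fourier f n = 0.

(** Riesz projection: P f is the (a.e. unique) L^1 function whose Fourier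
    coefficients are those of f for n >= 0 and 0 for n < 0. *)
Definition IsRiesz (f g : C -> C) : Prop :=
  inLp 1 g /\ forall n : int, fourier g n = if 0 <= n then fourier f n else 0.
Definition rieszP (f : C -> C) : C -> C :=
  epsilon (inhabits (fun _ => 0)) (IsRiesz f).
Definition rieszQ (f : C -> C) : C -> C := fun z => f z - rieszP f z.
Definition flipJ (f : C -> C) : C -> C := fun z => z^-1 * f z^-1.
Definition tilde (f : C -> C) : C -> C := fun z => f z^-1.
Definition fconj (f : C -> C) : C -> C := fun z => (f z)^*%C.

Definition Toep (a : C -> C) (f : C -> C) : C -> C :=
  rieszP (fun z => a z * f z).
Definition Hank (b : C -> C) (f : C -> C) : C -> C :=
  rieszP (fun z => b z * rieszQ (flipJ f) z).
Definition TH (a b : C -> C) (f : C -> C) : C -> C :=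
  fun z => Toep a f z + Hank b f z.

Definition isBLOp (p : R) (B : (C -> C) -> C -> C) : Prop :=
  (forall f, inHp p f -> inHp p (B f)) /\
  (forall f g (l : C), inHp p f -> inHp p g ->
      aeq (B (fun z => f z + l * g z)) (fun z => B f z + l * B g z)) /\
  (exists M : R, forall f, inHp p f -> normLp p (B f) <= M * normLp p f).
Definition leftInvertible (p : R) (A : (C -> C) -> C -> C) : Prop :=
  exists B, isBLOp p B /\ forall f, inHp p f -> aeq (B (A f)) f.
Definition rightInvertible (p : R) (A : (C -> C) -> C -> C) : Prop :=
  exists B, isBLOp p B /\ forall f, inHp p f -> aeq (A (B f)) f.
Definition invertible (p : R) (A : (C -> C) -> C -> C) : Prop :=
  exists B, isBLOp p B /\
    (forall f, inHp p f -> aeq (B (A f)) f) /\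
    (forall f, inHp p f -> aeq (A (B f)) f).

Definition lincomb (k : nat) (lam : 'I_k -> C) (e : 'I_k -> C -> C) : C -> C :=
  fun z => \sum_(i < k) lam i * e i z.
Definition kerDim (p : R) (A : (C -> C) -> C -> C) (k : nat) : Prop :=
  exists e : 'I_k -> C -> C,
    (forall i, inHp p (e i) /\ aeq (A (e i)) (fun _ => 0)) /\
    (forall lam, aeq (lincomb lam e) (fun _ => 0) -> forall i, lam i = 0) /\
    (forall f, inHp p f -> aeq (A f) (fun _ => 0) ->
       exists lam, aeq f (lincomb lam e)).
Definition cokerDim (p : R) (A : (C -> C) -> C -> C) (m : nat) : Prop :=
  exists u : 'I_m -> C -> C,
    (forall i, inHp p (u i)) /\
    (forall g, inHp p g -> exists f lam,
        inHp p f /\ aeq g (fun z => A f z + lincomb lam u z)) /\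
    (forall f lam, inHp p f -> aeq (fun z => A f z + lincomb lam u z) (fun _ => 0) ->
        forall i, lam i = 0).
Definition closedRange (p : R) (A : (C -> C) -> C -> C) : Prop :=
  forall (fs : nat -> C -> C) (g : C -> C),
    (forall k, inHp p (fs k)) -> inHp p g ->
    (fun k => normLp p (fun z => A (fs k) z - g z)) @ \oo --> (0 : R) ->
    exists f, inHp p f /\ aeq (A f) g.
Definition FredholmIndex (p : R) (A : (C -> C) -> C -> C) (kappa : int) : Prop :=
  exists k m : nat, kerDim p A k /\ cokerDim p A m /\ closedRange p A /\
    kappa = k%:Z - m%:Z.

Definition matching (a b : C -> C) : Prop :=
  inGLinf a /\ inLinf b /\
  aeq (fun z => a z * tilde a z) (fun z => b z * tilde b z).
Definition subc (a b : C -> C) : C -> C := fun z => a z / b z.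
Definition subd (a b : C -> C) : C -> C := fun z => a z / tilde b z.

Definition inFTH (p : R) (a b : C -> C) (k1 k2 : int) : Prop :=
  matching a b /\ FredholmIndex p (Toep (subc a b)) k1 /\
  FredholmIndex p (Toep (subd a b)) k2.

Definition conjexp (p : R) : R := p / (p - 1).

Definition trigpoly (phi : C -> C) : Prop :=
  exists (N : nat) (cf : 'I_N -> C) (e : 'I_N -> int),
    phi = fun z => \sum_(i < N) cf i * z ^ (e i).

Definition WHfact (p : R) (a am : C -> C) (m : int) (ap : C -> C) : Prop :=
  inHp (conjexp p) ap /\ inHp p (fun z => (ap z)^-1) /\
  inHpbar p am /\ inHpbar (conjexp p) (fun z => (am z)^-1) /\
  aeq a (fun z => am z * z ^ m * ap z) /\
  exists cp : R, forall phi, trigpoly phi ->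
    normLp p (fun z => (ap z)^-1 * rieszP (fun w => ap w * phi w) z)
      <= cp * normLp p phi.

(** factorization signature σ(g) = g_+(0) (value at 0 of the analytic
    extension = 0-th Fourier coefficient) *)
Definition signature (gp : C -> C) : C := fourier gp 0.

(** gp is the plus factor of the normalized (g_-(∞)=1) Wiener--Hopf
    factorization g = σ(g) g_+ t^{-2n} \tilde g_+^{-1} of g in L^p. *)
Definition normWHplus (p : R) (g : C -> C) (n : nat) (gp : C -> C) : Prop :=
  let gm := fun z => signature gp * (tilde gp z)^-1 in
  WHfact p g gm (- (2 * n)%:Z) gp /\ fourier gm 0 = 1.

Definition ToepInv (p : R) (c : C -> C) (h : C -> C) : C -> C :=
  epsilon (inhabits (fun _ => 0)) (fun g => inHp p g /\ aeq (Toep c g) h).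

(** ω_k^{a,b}, with dp the plus factor of d = a / \tilde b. *)
Definition omega (p : R) (n : nat) (a b dp : C -> C) (k : nat) : C -> C :=
  ToepInv p (fun z => subc a b z * z ^ (- (2 * n)%:Z))
    (Toep (fun z => (tilde a z)^-1 * z ^ (- n%:Z))
       (fun z => (dp z)^-1 * (z ^ (n%:Z - k%:Z - 1) + signature dp * z ^ (n + k)%:Z))).

Definition Wmat (p : R) (n : nat) (a b dp : C -> C) : 'M[C]_n :=
  \matrix_(j < n, k < n) fourier (omega p n a b dp k) j.

End TH.

(* Main.v *)
(* Write S = c t^(-2n), G = d t^(2n) and u = J(a f + b J f).  The matching
   condition turns (T(a) + H(b)) f = 0 into two conditions: u lies in H^p with
   d u = J u, and T(S)(t^n f) = T(1 / (\tilde a t^n)) u.  By Coburn's lemma the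
   index hypotheses say that T(S) and T(G) are bijective on H^p.  Bijectivity
   of T(G) together with G \tilde G = 1 forces T(G)^(-1) 1 = 1 / d_+ =: e, with
   G e = sigma \tilde e, so that the symmetric solutions u are exactly the
   combinations sum_k x_k e (t^(n-k-1) + sigma t^(n+k)).  Hence
   t^n f = sum_k x_k omega_k, and f lies in H^p iff the first n Fourier
   coefficients of the right-hand side vanish, that is iff W_n x = 0.  The same
   correction by the omega_k solves (T(a) + H(b)) f = h when W_n is
   nondegenerate, so injectivity, bijectivity and det W_n <> 0 are equivalent.
   The open mapping theorem provides bounded inverses, and right invertibility
   is left invertibility of the adjoint, which is T + H for the pair
   (\bar a, \tilde{\bar b}) on H^q.

   With 0^-1 = 0, invertibility in L^oo as defined still admits symbols that
   vanish on sets of positive measure.  The positive index of T(d) rules them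
   out: if f is in its kernel, then d f is antianalytic and vanishes where d
   does, so d f = 0 by the F. and M. Riesz theorem. *)

Require Import Defs.
From HB Require Import structures.
From mathcomp Require Import all_boot all_order all_algebra.
From mathcomp Require Import all_classical all_reals all_analysis.
From mathcomp Require Import measurable_realfun complex ring lra.
From Stdlib Require Import ClassicalEpsilon.

Set Implicit Arguments.
Unset Strict Implicit.
Unset Printing Implicit Defensive.

Import Order.TTheory GRing.Theory Num.Theory.
Import numFieldNormedType.Exports.
Local Open Scope classical_set_scope.
Local Open Scope ring_scope.

(** * Integration over the circle *)

Section RealIntegral.
Variable R : realType.
Local Notation mu := (@lebesgue_measure R).
Local Notation D := (@I02pi R).
Implicit Types (F G H : R -> R).

(** Everything happens on the circle, through Fourier coefficients; no extension to the disc enters.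
    The obstacle is the analysis that the algebra presupposes: the M. Riesz bound, bounded inverses
    and duality. Mean values of [F^2 / (F + u)], expanded geometrically, replace complex powers in
    the Riesz bound; a polynomial substitute for the exponential drives the F. and M. Riesz theorem;
    a converse Hoelder inequality with a weight [e] replaces the dual space of [L^p]. The delicate
    point is the adjoint: bijectivity of [T(G)] on [H^p] must give bijectivity of [T(\bar G)] on
    [H^q]. The operator [e P e^(-1) = T(G)^(-1) P G] is bounded, the weighted converse Hoelder
    inequality then puts [1 / e] in [L^q], and [1 / e] provides preimages of all monomials under
    [T(\bar G)]. The four claims become instances of one statement through the record [regular],
    which is stable under [b -> - b] and under passage to the adjoint pair. *)

Fact Lint_sealed : {L : (R -> R) -> Prop | forall F, L F <-> mu.-integrable D (EFin \o F)}.
Proof. by exists (fun F => mu.-integrable D (EFin \o F)). Qed.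
(* Sealed: unfolding integrability during unification is prohibitively slow. *)
Definition Lint F := sval Lint_sealed F.
Lemma LintE F : Lint F <-> mu.-integrable D (EFin \o F).
Proof. exact: (svalP Lint_sealed F). Qed.
Definition rint F : R := Rintegral mu D F.
Definition mfun F := measurable_fun (D : set (measurableTypeR R)) F.
Definition aeD (P : R -> Prop) := {ae mu, forall th, D th -> P th}.

Lemma mD : measurable (D : set (measurableTypeR R)).
Proof. exact: measurable_itv. Qed.
Hint Resolve mD : core.

Lemma aeD_all (P : R -> Prop) : (forall th, D th -> P th) -> aeD P.
Proof. by move=> h; apply: aeW => x; exact: h. Qed.

Lemma aeD1 (P Q : R -> Prop) : aeD P -> (forall th, D th -> P th -> Q th) -> aeD Q.
Proof.
move=> hP h; apply: (@filterS _ _ (ae_filter_ringOfSetsType mu)) hP => x Px Dx.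
by apply: h => //; exact: Px.
Qed.

Lemma aeD2 (P1 P2 Q : R -> Prop) : aeD P1 -> aeD P2 ->
  (forall th, D th -> P1 th -> P2 th -> Q th) -> aeD Q.
Proof.
move=> h1 h2 h; apply: (@filterS2 _ _ (ae_filter_ringOfSetsType mu)) h1 h2.
by move=> x p1 p2 Dx; apply: h => //; auto.
Qed.

Lemma aeD3 (P1 P2 P3 Q : R -> Prop) : aeD P1 -> aeD P2 -> aeD P3 ->
  (forall th, D th -> P1 th -> P2 th -> P3 th -> Q th) -> aeD Q.
Proof.
move=> h1 h2 h3 h; apply: (@filterS3 _ _ (ae_filter_ringOfSetsType mu)) h1 h2 h3.
by move=> x p1 p2 p3 Dx; apply: h => //; auto.
Qed.

Lemma aeDQ (P Q : R -> Prop) : aeD P -> (forall x, (D x -> P x) -> Q x) ->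
  {ae mu, forall x, Q x}.
Proof.
by move=> h hPQ; apply: (@filterS _ _ (ae_filter_ringOfSetsType mu)) h => x /hPQ.
Qed.

Lemma aeDP (P Q : R -> Prop) : {ae mu, forall x, P x} -> (forall x, D x -> P x -> Q x) ->
  aeD Q.
Proof.
move=> h hPQ; apply: (@filterS _ _ (ae_filter_ringOfSetsType mu)) h => x Px Dx.
exact: hPQ.
Qed.

Lemma aeD_nat (P : nat -> R -> Prop) : (forall n, aeD (P n)) -> aeD (fun x => forall n, P n x).
Proof.
move=> h; have := ae_foralln h => {}h; apply: (aeDP h) => x Dx hx n; exact: hx.
Qed.

Lemma Lint_m F : Lint F -> mfun F.
Proof. by move=> /LintE /measurable_int /measurable_EFinP. Qed.

Lemma Lint_add F G : Lint F -> Lint G -> Lint (fun x => F x + G x).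
Proof. by move=> /LintE hF /LintE hG; apply/LintE; exact: (integrableD mD hF hG). Qed.

Lemma Lint_scale (c : R) F : Lint F -> Lint (fun x => c * F x).
Proof. by move=> /LintE hF; apply/LintE; exact: (integrableZl mD c hF). Qed.

Lemma Lint_opp F : Lint F -> Lint (fun x => - F x).
Proof.
by move=> /(Lint_scale (-1)); under [fun x => _ * _]eq_fun do rewrite mulN1r.
Qed.

Lemma Lint_sub F G : Lint F -> Lint G -> Lint (fun x => F x - G x).
Proof. by move=> hF hG; apply: Lint_add => //; exact: Lint_opp. Qed.

Lemma Lint_le F G : mfun F -> Lint G -> (forall x, D x -> `|F x| <= G x) -> Lint F.
Proof.
move=> mF /LintE iG h; apply/LintE; apply: (le_integrable mD _ _ iG); first exact/measurable_EFinP.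
by move=> x Dx /=; rewrite lee_fin (le_trans (h x Dx))// ler_norm.
Qed.

Lemma Lint_abs F : Lint F -> Lint (fun x => `|F x|).
Proof. by move=> /LintE hF; apply/LintE; exact: integrable_norm. Qed.

Lemma mu_D : mu (D : set (measurableTypeR R)) = (pi *+ 2)%:E.
Proof.
rewrite /I02pi lebesgue_measure_itv /= lte_fin mulrn_wgt0 ?pi_gt0//.
by rewrite oppr0 adde0.
Qed.

Lemma Lint_cst c : Lint (fun=> c).
Proof.
apply/LintE; apply: measurable_bounded_integrable => //.
  by rewrite -[X in (X < _)%E]/(mu (D : set (measurableTypeR R))) mu_D ltry.
exists `|c|; split; first exact: num_real.
by move=> M hM x _ /=; exact: ltW.
Qed.

Lemma Lint_bdd F (M : R) : mfun F -> (forall x, D x -> `|F x| <= M) -> Lint F.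
Proof. by move=> mF h; exact: (Lint_le mF (Lint_cst M)). Qed.

Lemma Lint_ge0_lty F : mfun F -> (forall x, D x -> 0 <= F x) ->
  (\int[mu]_(x in D) (F x)%:E < +oo)%E -> Lint F.
Proof.
move=> mF F0 h; apply/LintE/integrableP; split; first exact/measurable_EFinP.
suff -> : (\int[mu]_(x in D) `|(EFin \o F) x| = \int[mu]_(x in D) (F x)%:E)%E by [].
by apply: eq_integral => x; rewrite inE => Dx /=; rewrite ger0_norm// F0.
Qed.

Lemma Lint_lty F : Lint F -> (\int[mu]_(x in D) (F x)%:E < +oo)%E.
Proof. by move=> /LintE h; exact: integrable_lty. Qed.

Lemma int_E F : Lint F -> ((rint F)%:E = \int[mu]_(x in D) (F x)%:E)%E.
Proof. by move=> /LintE h; rewrite /rint /Rintegral fineK //; exact: integrable_fin_num. Qed.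

Lemma int_add F G : Lint F -> Lint G -> rint (fun x => F x + G x) = rint F + rint G.
Proof. by move=> /LintE hF /LintE hG; exact: RintegralD. Qed.
Lemma int_sub F G : Lint F -> Lint G -> rint (fun x => F x - G x) = rint F - rint G.
Proof. by move=> /LintE hF /LintE hG; exact: RintegralB. Qed.
Lemma int_scale c F : Lint F -> rint (fun x => c * F x) = c * rint F.
Proof. by move=> /LintE hF; exact: RintegralZl. Qed.
Lemma int_opp F : Lint F -> rint (fun x => - F x) = - rint F.
Proof.
by move=> h; rewrite -mulN1r -int_scale//; congr rint; apply/funext => x; rewrite mulN1r.
Qed.
Lemma int_cst c : rint (fun=> c) = c * (pi *+ 2).
Proof. by rewrite /rint Rintegral_cst//; have /= -> := mu_D. Qed.
Lemma int_le F G : Lint F -> Lint G -> (forall x, D x -> F x <= G x) -> rint F <= rint G.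
Proof. by move=> /LintE hF /LintE hG h; exact: le_Rintegral. Qed.
Lemma int_ge0 F : (forall x, D x -> 0 <= F x) -> 0 <= rint F.
Proof. by move=> h; apply: Rintegral_ge0. Qed.
Lemma int_abs F : Lint F -> `|rint F| <= rint (fun x => `|F x|).
Proof. by move=> /LintE hF; exact: le_normr_Rintegral. Qed.
Lemma eq_int F G : (forall x, D x -> F x = G x) -> rint F = rint G.
Proof. by move=> h; apply: eq_Rintegral => x; rewrite inE => /h. Qed.
Lemma eq_Lint F G : (forall x, D x -> F x = G x) -> Lint F -> Lint G.
Proof.
move=> h /LintE hF; apply/LintE; apply: eq_integrable hF => // x.
by rewrite inE => Dx /=; rewrite h.
Qed.

Lemma int_aeq F G : mfun F -> mfun G -> aeD (fun x => F x = G x) -> rint F = rint G.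
Proof.
move=> mF mG h; congr fine; apply: ae_eq_integral => //; try exact/measurable_EFinP.
by apply: (aeDQ h) => x hx Dx /=; rewrite hx.
Qed.

Lemma ge0_eq_int F G : mfun F -> mfun G -> (forall x, D x -> 0 <= F x) ->
  (forall x, D x -> 0 <= G x) -> aeD (fun x => F x <= G x) -> Lint G -> Lint F.
Proof.
move=> mF mG F0 G0 h iG; apply: Lint_ge0_lty => //.
apply: le_lt_trans (Lint_lty iG).
by apply: ae_ge0_le_integral => //; try exact/measurable_EFinP.
Qed.

Lemma Lint_aele F G : mfun F -> Lint G -> aeD (fun x => `|F x| <= G x) -> Lint F.
Proof.
move=> mF iG h.
have : Lint (fun x => `|F x|).
  apply: (@ge0_eq_int _ (fun x => `|G x|)) => //.
  - exact: measurableT_comp.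
  - by apply: measurableT_comp => //; exact: Lint_m.
  - by apply: (aeD1 h) => x _ /le_trans; apply; exact: ler_norm.
  - exact: Lint_abs.
by move=> iF; apply: (Lint_le mF iF).
Qed.

Lemma int_aele F G : Lint F -> Lint G -> aeD (fun x => F x <= G x) -> rint F <= rint G.
Proof.
(* The pointwise maximum makes the inequality hold everywhere and leaves the integral of [G]
   unchanged. *)
move=> iF iG h; pose G' x := Num.max (F x) (G x).
have mG' : mfun G' by apply: measurable_maxr; exact: Lint_m.
have iG' : Lint G'.
  apply: (Lint_le mG' (Lint_add (Lint_abs iF) (Lint_abs iG))) => x _.
  by rewrite /G'; have [_|_] := lerP (F x) (G x); [rewrite ler_wpDl|rewrite ler_wpDr].
rewrite (_ : rint G = rint G'); last first.
  apply: int_aeq => //; first exact: Lint_m.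
  by apply: (aeD1 h) => x _ /max_idPr.
by apply: int_le => // x _; rewrite /G' le_max lexx.
Qed.

Lemma int_eq0 F : Lint F -> (forall x, D x -> 0 <= F x) -> rint F = 0 -> aeD (fun x => F x = 0).
Proof.
move=> iF F0 h.
have := @ae_eq_integral_abs _ _ R mu D mD (EFin \o F).
case; first by apply/measurable_EFinP; exact: Lint_m.
move=> + _ => h1; have {}h1 : ae_eq mu D (EFin \o F) (cst 0%E).
  apply: h1; transitivity (\int[mu]_(x in D) (F x)%:E)%E; last by rewrite -int_E// h.
  by apply: eq_integral => x; rewrite inE => Dx /=; rewrite ger0_norm// F0.
by apply: (aeDP h1) => x Dx /(_ Dx)[].
Qed.

Lemma Lint_abs_inv F : mfun F -> Lint (fun x => `|F x|) -> Lint F.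
Proof. by move=> mF /(Lint_le mF); apply. Qed.

Lemma rint_dominated_cvg (Fn : nat -> R -> R) F G : (forall n, mfun (Fn n)) -> mfun F -> Lint G ->
  aeD (fun x => forall n, `|Fn n x| <= G x) ->
  aeD (fun x => (fun n => Fn n x) @ \oo --> F x) ->
  Lint F /\ (fun n => rint (Fn n)) @ \oo --> rint F.
Proof.
move=> mFn mF iG hG hc.
have [|||||i1 _ i2] := @dominated_convergence _ _ R mu D mD (fun n => EFin \o Fn n)
  (EFin \o F) (EFin \o G).
- by move=> n; apply/measurable_EFinP; exact: mFn.
- by apply/measurable_EFinP; exact: mF.
- apply: (aeDQ hc) => x hx Dx /=; apply/fine_cvgP; split; first exact: nearW.
  exact: hx.
- by move/LintE : iG.
- by apply: (aeDQ hG) => x hx n Dx /=; rewrite lee_fin hx.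
split; first exact/LintE.
have iFn n : Lint (Fn n).
  by apply: (Lint_aele (mFn n) iG); apply: (aeD1 hG) => x _.
move/LintE: i1 => i1; move: i2; rewrite -(int_E i1) => /fine_cvgP[_].
by apply: cvg_trans; apply: near_eq_cvg; apply: nearW => n /=; rewrite -int_E.
Qed.

Lemma rint_monotone_cvg (Fn : nat -> R -> R) F (C : R) : (forall n, Lint (Fn n)) -> mfun F ->
  (forall n x, D x -> 0 <= Fn n x) ->
  (forall x, D x -> nondecreasing_seq (fun n => Fn n x)) ->
  aeD (fun x => (fun n => Fn n x) @ \oo --> F x) ->
  (forall n, rint (Fn n) <= C) -> Lint F /\ rint F <= C.
Proof.
move=> iFn mF F0 nd hc hC.
pose g := fun n => EFin \o Fn n.
have mg n : measurable_fun D (g n) by apply/measurable_EFinP; exact: Lint_m.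
have g0 n x : D x -> (0 <= g n x)%E by move=> Dx; rewrite lee_fin F0.
have ndg x : D x -> nondecreasing_seq (g^~ x).
  by move=> Dx m n mn; rewrite lee_fin; exact: nd.
have cv := @cvg_monotone_convergence _ _ R mu D mD g mg g0 ndg.
have hle : (\int[mu]_(x in D) limn (g^~ x) <= C%:E)%E.
  rewrite -(cvg_lim _ cv)//; apply: lime_le; first by apply: cvgP cv.
  by apply: nearW => n; rewrite -int_E// lee_fin.
have hl : aeD (fun x => limn (g^~ x) = (F x)%:E).
  apply: (aeD1 hc) => x Dx hx; apply/cvg_lim => //.
  by apply/fine_cvgP; split => //; exact: nearW.
(* [F] is the limit only almost everywhere and may be negative on a null set; [F'] is nonnegative
   everywhere and equals [F] almost everywhere. *)
pose F' x := `|F x|.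
have mF' : mfun F' by exact: measurableT_comp.
have eF : aeD (fun x => F' x = F x).
  apply: (aeD1 hc) => x Dx hx; rewrite /F' ger0_norm//.
  by rewrite -(cvg_lim _ hx)//; apply: limr_ge; [exact: cvgP hx|apply: nearW => n; exact: F0].
have e : (\int[mu]_(x in D) limn (g^~ x) = \int[mu]_(x in D) (F' x)%:E)%E.
  apply: ge0_ae_eq_integral => //.
  - apply: emeasurable_fun_cvg mg _ => x Dx.
    apply: ereal_nondecreasing_is_cvgn => m n mn; rewrite lee_fin; exact: nd.
  - exact/measurable_EFinP.
  - move=> x Dx; apply: lime_ge; last by apply: nearW => n; rewrite lee_fin F0.
    apply: ereal_nondecreasing_is_cvgn => m n mn; rewrite lee_fin; exact: nd.
  - by move=> x _; rewrite lee_fin; exact: normr_ge0.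
  - by apply: (aeDQ (aeD2 hl eF (fun x _ h1 h2 => conj h1 h2))) => x h Dx; have [-> ->] := h Dx.
have iF' : Lint F'.
  apply: Lint_ge0_lty => //; first by move=> x _; exact: normr_ge0.
  by rewrite -e (le_lt_trans hle)// ltry.
split; first by apply: Lint_abs_inv.
by rewrite -(int_aeq mF' mF eF) -lee_fin int_E// -e.
Qed.

(** The integrals of positive and negative part have infinite sum, so the extended integral is
    infinite, and [fine] maps both infinities to 0. This default value has to be reckoned with for
    unbounded symbols. *)
Lemma rint_nonint F : mfun F -> ~ Lint F -> rint F = 0.
Proof.
move=> mF nF; rewrite /rint /Rintegral.
rewrite integralE; set P := (\int[mu]_(x in D) _)%E; set M := (\int[mu]_(x in D) (_ ^\-)%E x)%E.
have mE : measurable_fun (D : set (measurableTypeR R)) (EFin \o F) by exact/measurable_EFinP.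
have P0 : (0 <= P)%E by apply: integral_ge0 => x _; exact: funepos_ge0.
have M0 : (0 <= M)%E by apply: integral_ge0 => x _; exact: funeneg_ge0.
have : (P + M = +oo)%E.
  apply/eqP; rewrite -leye_eq leNgt; apply/negP => h; apply: nF; apply/LintE/integrableP; split => //.
  rewrite (_ : (\int[mu]_(x in D) `|(EFin \o F) x|)%E = (P + M)%E) //.
  rewrite /P /M -ge0_integralD//; [|exact: measurable_funepos|exact: measurable_funeneg].
  by apply: eq_integral => x _; have /(congr1 (fun h => h x)) := fune_abse (EFin \o F).
move: P0 M0; case: P => [r| |] //; case: M => [s| |] //.
Qed.

End RealIntegral.

(** * Reflection of the circle; Hoelder and Minkowski inequalities *)

Section RealIntegral2.
Variable R : realType.
Local Notation mu := (@lebesgue_measure R).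
Local Notation D := (@I02pi R).
Local Notation T := (measurableTypeR R).
Implicit Types (F G H : R -> R).
Hint Resolve mD : core.

(** The map [z -> 1/z] in the angle coordinate; it reduces [tilde] and [flipJ] to a
    measure-preserving change of variable. *)
Definition reflect_angle (x : R) : R := pi *+ 2 - x.

Lemma rfl_D x : D x -> D (reflect_angle x).
Proof. by rewrite /I02pi /reflect_angle /= !in_itv /= subr_ge0 lerBlDr lerDl andbC. Qed.

Lemma rflK : involutive reflect_angle.
Proof. by move=> x; rewrite /reflect_angle opprB addrCA subrr addr0. Qed.

Lemma measurable_reflect : measurable_fun (setT : set T) (reflect_angle : T -> T).
Proof. by apply: measurable_funB => //; exact: measurable_id. Qed.

Lemma rfl_preimage : (reflect_angle : T -> T) @^-1` D = D.
Proof.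
apply/seteqP; split => x; last exact: rfl_D.
by move=> /= /rfl_D; rewrite rflK.
Qed.

(** Uniqueness of Lebesgue measure reduces this to half-open intervals; reflection swaps which
    endpoint is included but keeps the length. *)
Lemma rfl_measure (A : set T) : measurable A -> pushforward mu (reflect_angle : T -> T) A = mu A.
Proof.
pose ph : {mfun T >-> T} := HB.pack (reflect_angle : T -> T) (isMeasurableFun.Build _ _ _ _ _ measurable_reflect).
move=> mA; apply/esym.
apply: (@lebesgue_measure_unique R (pushforward mu ph)) => //= _ [[a b]] _ <-.
rewrite /pushforward /=.
rewrite (_ : reflect_angle @^-1` _ = `[reflect_angle b, reflect_angle a[%classic).
  rewrite !lebesgue_measure_itv /= !lte_fin /reflect_angle ltrD2l ltrN2.
  by case: ifPn => // _; rewrite -!EFinB; congr EFin; ring.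
apply/seteqP; split => x; rewrite /reflect_angle /= !in_itv /=; by move=> /andP[? ?]; apply/andP; split; lra.
Qed.

Lemma mfun_rfl F : mfun F -> mfun (F \o reflect_angle).
Proof.
move=> mF; rewrite /mfun; apply: (@measurable_comp _ _ _ T T R (D : set T) F (D : set T) (reflect_angle : T -> T)) => //.
  by move=> _ [x Dx <-]; exact: rfl_D.
by apply: measurable_funTS; exact: measurable_reflect.
Qed.

Lemma ge0_int_rfl F : mfun F -> (forall x, D x -> 0 <= F x) ->
  (\int[mu]_(x in D) (F (reflect_angle x))%:E = \int[mu]_(x in D) (F x)%:E)%E.
Proof.
move=> mF F0.
have e : (\int[pushforward mu (reflect_angle : T -> T)]_(y in D) (F y)%:E = \int[mu]_(x in D) (F x)%:E)%E.
  pose ph : {mfun T >-> T} := HB.pack (reflect_angle : T -> T) (isMeasurableFun.Build _ _ _ _ _ measurable_reflect).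
  apply: (@eq_measure_integral _ _ _ _ mu (pushforward mu ph)) => A mA _.
  exact: rfl_measure.
rewrite -e ge0_integral_pushforward//.
- by rewrite rfl_preimage.
- exact: measurable_reflect.
- by apply/measurable_EFinP; exact: mF.
- by move=> x; rewrite inE => Dx; rewrite lee_fin F0.
Qed.

Lemma Lint_rfl F : Lint F -> Lint (F \o reflect_angle).
Proof.
move=> iF; have mF := Lint_m iF; apply: Lint_abs_inv; first exact: (mfun_rfl mF).
apply: Lint_ge0_lty => //.
- by apply: measurableT_comp => //; exact: (mfun_rfl mF).
rewrite (@ge0_int_rfl (fun x => `|F x|)) //; first exact/Lint_lty/Lint_abs.
by apply: measurableT_comp.
Qed.

Lemma int_rfl F : Lint F -> rint (F \o reflect_angle) = rint F.
Proof.
move=> iF; have mF := Lint_m iF.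
(* The change of variables is available for nonnegative functions only, hence the splitting
   [F = (|F| + F) - |F|]. *)
pose P x := (`|F x| + F x); pose A x := `|F x|.
have iP : Lint P by apply: Lint_add => //; exact: Lint_abs.
have iA : Lint A by exact: Lint_abs.
have e G : (forall x, 0 <= G x) -> Lint G -> rint (G \o reflect_angle) = rint G.
  by move=> G0 iG; rewrite /rint /Rintegral ge0_int_rfl//; exact: Lint_m.
have -> : rint F = rint P - rint A.
  by rewrite -int_sub//; apply: eq_int => x _; rewrite /P /A addrC addKr.
rewrite -(e P)// -?(e A)//; last first.
- by move=> x; have := ler_norm (- F x); rewrite normrN /P; lra.
- by move=> x; exact: normr_ge0.
rewrite -int_sub; [|exact: Lint_rfl|exact: Lint_rfl].
by apply: eq_int => x _; rewrite /P /A /= addrC addKr.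
Qed.

Lemma aeD_rfl (P : R -> Prop) : aeD P -> aeD (P \o reflect_angle).
Proof.
move=> [N [mN N0 hN]]; exists (reflect_angle @^-1` N); split.
- have := @measurable_reflect measurableT _ mN; by rewrite setTI.
- by have := rfl_measure mN; rewrite /pushforward => ->.
- move=> x /= h; apply: hN => /= h2; apply: h => Dx; apply: h2; exact: rfl_D.
Qed.

Lemma Lnorm_int F p : 0 < p -> Lint (fun x => `|F x| `^ p) ->
  Lnorm mu p%:E (EFin \o (F \_ D)) = ((rint (fun x => `|F x| `^ p)) `^ p^-1)%:E.
Proof.
move=> p0 iF; rewrite Lnorm.unlock -(poweR_EFin (rint _)) (int_E iF); congr poweR.
rewrite [RHS]integral_mkcond; apply: eq_integral => x _ /=.
rewrite !patchE; case: ifPn => // _.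
by rewrite normr0 powR0// gt_eqF.
Qed.

Lemma mpow F p : mfun F -> mfun (fun x => `|F x| `^ p).
Proof.
move=> mF; rewrite /mfun; apply: (@measurableT_comp _ _ _ T R R (fun x => x `^ p)).
  exact: measurable_powR.
exact: measurableT_comp.
Qed.

Lemma mrest F : mfun F -> measurable_fun (setT : set T) (F \_ D : T -> R).
Proof.
by move=> mF; exact: ((@measurable_restrictT _ _ T R D F (@mD R)).1 mF).
Qed.

Lemma hoelder_int F G p q : 0 < p -> 0 < q -> p^-1 + q^-1 = 1 ->
  mfun F -> mfun G ->
  Lint (fun x => `|F x| `^ p) -> Lint (fun x => `|G x| `^ q) ->
  Lint (fun x => F x * G x) /\
  rint (fun x => `|F x * G x|) <=
    (rint (fun x => `|F x| `^ p)) `^ p^-1 * (rint (fun x => `|G x| `^ q)) `^ q^-1.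
Proof.
move=> p0 q0 pq mF mG iF iG.
have := @hoelder _ T R mu (F \_ D) (G \_ D) p q (mrest mF) (mrest mG) p0 q0 pq.
rewrite (Lnorm_int p0 iF) (Lnorm_int q0 iG) -EFinM Lnorm1.
have -> : (\int[mu]_x `|(EFin \o (F \_ D \* G \_ D)%R) x| =
   \int[mu]_(x in D) (`|F x * G x|)%:E)%E.
  rewrite [RHS]integral_mkcond; apply: eq_integral => x _ /=.
  by rewrite !patchE; case: ifPn => // _; rewrite mul0r normr0.
move=> h.
have mFG : mfun (fun x => F x * G x) by exact: measurable_funM.
have iFG : Lint (fun x => `|F x * G x|).
  apply: Lint_ge0_lty => //.
  - exact: measurableT_comp.
  - by rewrite (le_lt_trans h)// ltry.
split; first exact: Lint_abs_inv.
by rewrite -lee_fin int_E.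
Qed.

Lemma powRD_le (a b p : R) : 0 <= a -> 0 <= b -> 0 < p ->
  (a + b) `^ p <= (2 `^ p) * (a `^ p + b `^ p).
Proof.
move=> a0 b0 p0.
wlog ab : a b a0 b0 / a <= b.
  move=> h; have [ab|ba] := leP a b; first exact: h.
  by rewrite addrC [X in _ * X]addrC; apply: h => //; exact: ltW.
apply: (@le_trans _ _ ((2 * b) `^ p)).
  by apply: ge0_ler_powR; rewrite ?nnegrE ?addr_ge0 ?mulr_ge0// ?(ltW p0)//; lra.
by rewrite powRM// ler_wpM2l// ?powR_ge0// lerDr powR_ge0.
Qed.

Lemma minkowski_int F G p : 1 <= p -> mfun F -> mfun G ->
  Lint (fun x => `|F x| `^ p) -> Lint (fun x => `|G x| `^ p) ->
  Lint (fun x => `|F x + G x| `^ p) /\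
  (rint (fun x => `|F x + G x| `^ p)) `^ p^-1 <=
  (rint (fun x => `|F x| `^ p)) `^ p^-1 + (rint (fun x => `|G x| `^ p)) `^ p^-1.
Proof.
move=> p1 mF mG iF iG; have p0 : 0 < p by exact: lt_le_trans p1.
have iS : Lint (fun x => `|F x + G x| `^ p).
  apply: (@Lint_le _ _ (fun x => 2 `^ p * (`|F x| `^ p + `|G x| `^ p))).
  - by apply: mpow; exact: measurable_funD.
  - by apply: Lint_scale; exact: Lint_add.
  - move=> x _; rewrite ger0_norm ?powR_ge0//.
    apply: le_trans (powRD_le _ _ p0) => //.
    by apply: ge0_ler_powR; rewrite ?nnegrE ?addr_ge0 ?ler_normD// ltW.
split => //.
have h := minkowski_EFin mu (mrest mF) (mrest mG) p1.
have E : (F \_ D \+ G \_ D)%R = (fun x => F x + G x) \_ D.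
  by apply/funext => x /=; rewrite !patchE; case: ifPn => // _; rewrite addr0.
rewrite E (Lnorm_int p0 iF) (Lnorm_int p0 iG) (Lnorm_int p0 iS) -EFinD in h.
by rewrite lee_fin in h.
Qed.

End RealIntegral2.

(** * Measurable and [L^p] functions on the circle *)

Section CircleFunctions.
Variable R : realType.
Local Notation C := R[i].
Local Notation D := (@I02pi R).
Local Notation T := (measurableTypeR R).
Implicit Types (f g h : C -> C) (F G : R -> R) (z w : C) (p q : R).
Hint Resolve mD : core.

Lemma cReD z w : complex.Re (z + w) = complex.Re z + complex.Re w.
Proof. by case: z; case: w. Qed.
Lemma cImD z w : complex.Im (z + w) = complex.Im z + complex.Im w.
Proof. by case: z; case: w. Qed.
Lemma cReM z w : complex.Re (z * w) =
  complex.Re z * complex.Re w - complex.Im z * complex.Im w.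
Proof. by case: z; case: w. Qed.
Lemma cImM z w : complex.Im (z * w) =
  complex.Re z * complex.Im w + complex.Im z * complex.Re w.
Proof. by case: z; case: w. Qed.
Lemma cReC z : complex.Re (z^*)%C = complex.Re z.
Proof. by case: z. Qed.
Lemma cImC z : complex.Im (z^*)%C = - complex.Im z.
Proof. by case: z. Qed.
Lemma cReV z : complex.Re z^-1 = complex.Re z / (complex.Re z ^+ 2 + complex.Im z ^+ 2).
Proof. by case: z. Qed.
Lemma cImV z : complex.Im z^-1 = - (complex.Im z / (complex.Re z ^+ 2 + complex.Im z ^+ 2)).
Proof. by case: z => a b /=; rewrite ?mulNr. Qed.
Lemma eqCplx z w : complex.Re z = complex.Re w -> complex.Im z = complex.Im w -> z = w.
Proof. by case: z; case: w => a b c d /= -> ->. Qed.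

Lemma absCE z : absC z = Num.sqrt (complex.Re z ^+ 2 + complex.Im z ^+ 2).
Proof. by case: z. Qed.
Lemma absC_ge0 z : 0 <= absC z.
Proof. by rewrite absCE sqrtr_ge0. Qed.
Hint Resolve absC_ge0 : core.
Lemma absC_sqr z : absC z ^+ 2 = complex.Re z ^+ 2 + complex.Im z ^+ 2.
Proof. by rewrite absCE sqr_sqrtr// addr_ge0// sqr_ge0. Qed.
Lemma absCM z w : absC (z * w) = absC z * absC w.
Proof. exact: Normc.normcM. Qed.
Lemma absCV z : absC z^-1 = (absC z)^-1.
Proof. exact: Normc.normcV. Qed.
Lemma absC0 : absC (0 : C) = 0.
Proof. exact: Normc.normc0. Qed.
Lemma absC1 : absC (1 : C) = 1.
Proof. exact: Normc.normc1. Qed.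
Lemma absC_eq0 z : absC z = 0 -> z = 0.
Proof. exact: Normc.eq0_normc. Qed.
Lemma absC_gt0 z : z != 0 -> 0 < absC z.
Proof. by move=> z0; rewrite lt_neqAle absC_ge0 andbT eq_sym; apply: contra z0 => /eqP/absC_eq0->. Qed.
Lemma absCD z w : absC (z + w) <= absC z + absC w.
Proof. exact: le_normcD. Qed.
Lemma absCN z : absC (- z) = absC z.
Proof. exact: normcN. Qed.
Lemma absC_conj z : absC (z^*)%C = absC z.
Proof. by rewrite !absCE cReC cImC sqrrN. Qed.
Lemma absC_real (x : R) : absC (Complex x 0) = `|x|.
Proof. by rewrite absCE /= expr0n /= addr0 sqrtr_sqr. Qed.
Lemma absCX z n : absC (z ^+ n) = absC z ^+ n.
Proof. by elim: n => [|n IH]; rewrite ?expr0 ?absC1// !exprS absCM IH. Qed.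
Lemma absC_Re z : `|complex.Re z| <= absC z.
Proof. by rewrite absCE -sqrtr_sqr ler_wsqrtr// lerDl sqr_ge0. Qed.
Lemma absC_Im z : `|complex.Im z| <= absC z.
Proof. by rewrite absCE -sqrtr_sqr ler_wsqrtr// lerDr sqr_ge0. Qed.
Lemma absC_le z : absC z <= `|complex.Re z| + `|complex.Im z|.
Proof.
rewrite -[leRHS]ger0_norm ?addr_ge0// -sqrtr_sqr absCE ler_wsqrtr//.
by rewrite -(real_normK (num_real (complex.Re z))) -(real_normK (num_real (complex.Im z))) sqrrD lerD2r lerDl mulrn_wge0// mulr_ge0.
Qed.
Lemma absCB z w : `|absC z - absC w| <= absC (z - w).
Proof.
rewrite ler_norml; apply/andP; split.
  rewrite lerNl opprB lerBlDr -(absCN (z - w)) opprB.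
  by apply: le_trans (absCD _ _); rewrite subrK.
by rewrite lerBlDr; apply: le_trans (absCD _ _); rewrite subrK.
Qed.
Lemma absC_sum (I : Type) (s : seq I) (P : pred I) (F : I -> C) :
  absC (\sum_(i <- s | P i) F i) <= \sum_(i <- s | P i) absC (F i).
Proof.
apply: (big_ind2 (fun z x => absC z <= x)) => //; first by rewrite absC0.
by move=> z x w y h1 h2; apply: le_trans (absCD _ _) _; exact: lerD.
Qed.
Lemma mul_conjC z : z * (z^*)%C = Complex (absC z ^+ 2) 0.
Proof.
apply: eqCplx; last by rewrite /= cImM cReC cImC; ring.
by rewrite /= absC_sqr cReM cReC cImC; ring.
Qed.

Lemma absC_circ (x : R) : absC (circ x) = 1.
Proof. by rewrite absCE /= cos2Dsin2 sqrtr1. Qed.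
Lemma circ_neq0 (x : R) : circ x != 0.
Proof. by apply/eqP => h; have := absC_circ x; rewrite h absC0 => /eqP; rewrite eq_sym oner_eq0. Qed.
Lemma circ_conj (x : R) : (circ x)^-1 = ((circ x)^*)%C.
Proof.
have h := mul_conjC (circ x); rewrite absC_circ expr1n in h.
by apply: (mulfI (circ_neq0 x)); rewrite h mulfV ?circ_neq0.
Qed.
Lemma circ_rfl (x : R) : circ (reflect_angle x) = (circ x)^-1.
Proof.
rewrite circ_conj /circ /reflect_angle; apply: eqCplx => /=.
  by rewrite addrC cosD2pi cosN.
by rewrite addrC sinD2pi sinN.
Qed.
Lemma absC_circX (x : R) (k : int) : absC (circ x ^ k) = 1.
Proof.
case: k => n; rewrite /exprz /=; first by rewrite absCX absC_circ expr1n.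
by rewrite absCV absCX absC_circ expr1n invr1.
Qed.
Lemma circXn (x : R) n : circ x ^+ n = circ (n%:R * x).
Proof.
elim: n => [|n IH].
  by rewrite expr0 mul0r; apply: eqCplx; rewrite /= ?cos0 ?sin0.
rewrite exprS IH -addn1 natrD mulrDl mul1r.
by apply: eqCplx; rewrite /= ?cosD ?sinD; ring.
Qed.
Lemma circX (x : R) (k : int) : circ x ^ k = circ (k%:~R * x).
Proof.
case: k => n; first by rewrite -exprnP circXn.
rewrite NegzE -exprnN circXn circ_conj mulrNz mulNr -pmulrn.
by apply: eqCplx; rewrite /= ?cosN ?sinN.
Qed.

Definition ab f (x : R) : R := absC (f (circ x)).
Lemma ab_ge0 f x : 0 <= ab f x. Proof. exact: absC_ge0. Qed.
Hint Resolve ab_ge0 : core.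
Lemma ab_norm f x : `|ab f x| = ab f x. Proof. by rewrite ger0_norm. Qed.

Lemma mfunV F : mfun F -> mfun (fun x => (F x)^-1).
Proof.
(* [1/x = x (x^2)^(-1)], also at 0 under the convention [0^-1 = 0], and real powers are known to be
   measurable. *)
move=> mF; rewrite (_ : (fun x => _) = (fun x => F x * (F x * F x) `^ (- 1))); last first.
  apply/funext => x; rewrite powR_inv1 -?expr2 ?sqr_ge0//.
  have [->|h] := eqVneq (F x) 0; first by rewrite invr0 mul0r.
  by rewrite expr2 invfM mulrA mulfV// mul1r.
apply: measurable_funM => //.
apply: (@measurableT_comp _ _ _ T R R (fun x => x `^ (-1))).
  exact: measurable_powR.
exact: measurable_funM.
Qed.

Lemma measC_cst (c : C) : measC (fun=> c).
Proof. by split; exact: measurable_cst. Qed.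
Lemma measC_add f g : measC f -> measC g -> measC (fun z => f z + g z).
Proof.
move=> [rf jf] [rg jg]; split.
  rewrite (_ : reF _ = fun x => reF f x + reF g x); first exact: (@measurable_funD _ T).
  by apply/funext => x; rewrite /reF cReD.
rewrite (_ : imF _ = fun x => imF f x + imF g x); first exact: (@measurable_funD _ T).
by apply/funext => x; rewrite /imF cImD.
Qed.
Lemma measC_mul f g : measC f -> measC g -> measC (fun z => f z * g z).
Proof.
move=> [rf jf] [rg jg]; split.
  rewrite (_ : reF _ = fun x => reF f x * reF g x - imF f x * imF g x).
    by apply: (@measurable_funB _ T); exact: (@measurable_funM _ T).
  by apply/funext => x; rewrite /reF cReM.
rewrite (_ : imF _ = fun x => reF f x * imF g x + imF f x * reF g x).
  by apply: (@measurable_funD _ T); exact: (@measurable_funM _ T).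
by apply/funext => x; rewrite /imF cImM.
Qed.
Lemma measC_scale (c : C) f : measC f -> measC (fun z => c * f z).
Proof. by move=> mf; apply: measC_mul => //; exact: measC_cst. Qed.
Lemma measC_opp f : measC f -> measC (fun z => - f z).
Proof.
by move=> /(measC_scale (-1)); under eq_fun do rewrite mulN1r.
Qed.
Lemma measC_sub f g : measC f -> measC g -> measC (fun z => f z - g z).
Proof. by move=> mf /measC_opp mg; exact: measC_add. Qed.
Lemma measC_conj f : measC f -> measC (fconj f).
Proof.
move=> [rf jf]; split.
  by rewrite (_ : reF _ = reF f)//; apply/funext => x; rewrite /reF cReC.
rewrite (_ : imF _ = fun x => - imF f x); first exact: (@measurable_funN _ T).
by apply/funext => x; rewrite /imF cImC.
Qed.
Lemma measC_inv f : measC f -> measC (fun z => (f z)^-1).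
Proof.
move=> [rf jf].
have mn : mfun (fun x => reF f x ^+ 2 + imF f x ^+ 2).
  by apply: measurable_funD; apply: measurable_funX.
split.
  rewrite (_ : reF _ = fun x => reF f x * (reF f x ^+ 2 + imF f x ^+ 2)^-1).
    by apply: (@measurable_funM _ T) => //; exact: mfunV.
  by apply/funext => x; rewrite /reF cReV.
rewrite (_ : imF _ = fun x => - (imF f x * (reF f x ^+ 2 + imF f x ^+ 2)^-1)).
  by apply: (@measurable_funN _ T); apply: (@measurable_funM _ T) => //; exact: mfunV.
by apply/funext => x; rewrite /imF cImV.
Qed.
Lemma reF_tilde f : reF (tilde f) = reF f \o @reflect_angle R.
Proof. by apply/funext => x; rewrite /reF /tilde /= circ_rfl. Qed.
Lemma imF_tilde f : imF (tilde f) = imF f \o @reflect_angle R.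
Proof. by apply/funext => x; rewrite /imF /tilde /= circ_rfl. Qed.
Lemma ab_tilde f : ab (tilde f) = ab f \o @reflect_angle R.
Proof. by apply/funext => x; rewrite /ab /tilde /= circ_rfl. Qed.
Lemma measC_tilde f : measC f -> measC (tilde f).
Proof.
by move=> [rf jf]; split; rewrite ?reF_tilde ?imF_tilde; exact: mfun_rfl.
Qed.
Lemma measC_mon (k : int) : measC (fun z => z ^ k).
Proof.
split.
  rewrite (_ : reF _ = (@cos R \o (fun x => k%:~R * x))).
    apply: (@measurableT_comp _ _ _ R R R); last exact: measurable_funM.
    by apply: continuous_measurable_fun; exact: continuous_cos.
  by apply/funext => x; rewrite /reF circX.
rewrite (_ : imF _ = (@sin R \o (fun x => k%:~R * x))).
  apply: (@measurableT_comp _ _ _ R R R); last exact: measurable_funM.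
  by apply: continuous_measurable_fun; exact: continuous_sin.
by apply/funext => x; rewrite /imF circX.
Qed.
Lemma measC_sum (I : Type) (s : seq I) (F : I -> C -> C) :
  (forall i, measC (F i)) -> measC (fun z => \sum_(i <- s) F i z).
Proof.
move=> h; elim: s => [|i s IH].
  by under eq_fun do rewrite big_nil; exact: measC_cst.
by under eq_fun do rewrite big_cons; exact: measC_add.
Qed.
Lemma mab f : measC f -> mfun (ab f).
Proof.
move=> [rf jf].
rewrite (_ : ab f = @Num.sqrt R \o (fun x => reF f x ^+ 2 + imF f x ^+ 2)); last first.
  by apply/funext => x; rewrite /ab absCE.
rewrite /mfun; apply: (@measurableT_comp _ _ _ T R R).
  by apply: continuous_measurable_fun; exact: sqrt_continuous.
by apply: measurable_funD; apply: measurable_funX.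
Qed.
Lemma mabp f p : measC f -> mfun (fun x => ab f x `^ p).
Proof.
move=> /mab/(mpow p); under eq_fun do rewrite ab_norm.
by [].
Qed.

Fact Lp_sealed : {L : R -> (C -> C) -> Prop | forall p f,
  L p f <-> measC f /\ Lint (fun x => ab f x `^ p)}.
Proof. by exists (fun p f => measC f /\ Lint (fun x => ab f x `^ p)). Qed.
Definition Lp p f := sval Lp_sealed p f.
Lemma inLpP p f : Lp p f <-> measC f /\ Lint (fun x => ab f x `^ p).
Proof. exact: (svalP Lp_sealed p f). Qed.
Lemma LpE p f : Lp p f <-> inLp p f.
Proof.
rewrite inLpP; split=> -[mf h]; split => //; first exact: Lint_lty h.
by apply: Lint_ge0_lty => //; [exact: mabp|move=> x _; exact: powR_ge0].
Qed.

Lemma inLp_m p f : Lp p f -> measC f.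
Proof. by move=> /inLpP[]. Qed.

Lemma aeq_refl f : aeq f f.
Proof. exact: (@aeD_all R). Qed.
Lemma aeq_eq f g : (forall x, f (circ x) = g (circ x)) -> aeq f g.
Proof. by move=> h; apply: (@aeD_all R) => x _. Qed.
Lemma aeq_sym f g : aeq f g -> aeq g f.
Proof. by move=> h; apply: (aeD1 h) => x _ ->. Qed.
Lemma aeq_trans g f h : aeq f g -> aeq g h -> aeq f h.
Proof. by move=> h1 h2; apply: (aeD2 h1 h2) => x _ -> ->. Qed.
Lemma aeq_tilde f g : aeq f g -> aeq (tilde f) (tilde g).
Proof.
move=> /(@aeD_rfl R) h; apply: (aeD1 h) => x _ /=.
by rewrite circ_rfl /tilde.
Qed.
Lemma aeq_mul f g f' g' : aeq f f' -> aeq g g' -> aeq (fun z => f z * g z) (fun z => f' z * g' z).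
Proof. by move=> h1 h2; apply: (aeD2 h1 h2) => x _ -> ->. Qed.
Lemma aeq_ab f g : aeq f g -> aeD (fun x => ab f x = ab g x).
Proof. by move=> h; apply: (aeD1 h) => x _; rewrite /ab => ->. Qed.

Lemma inLp_aeq p f g : measC g -> aeq f g -> Lp p f -> Lp p g.
Proof.
move=> mg h /inLpP[mf hf]; apply/inLpP; split => //.
apply: Lint_aele hf _; first exact: mabp.
by apply: (aeD1 (aeq_ab h)) => x _ ->; rewrite ger0_norm ?powR_ge0.
Qed.
Lemma rint_ab_aeq p f g : measC f -> measC g -> aeq f g ->
  rint (fun x => ab f x `^ p) = rint (fun x => ab g x `^ p).
Proof.
by move=> mf mg h; apply: int_aeq; [exact: mabp|exact: mabp|apply: (aeD1 (aeq_ab h)) => x _ ->].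
Qed.
Lemma normLpE p f : normLp p f = ((pi *+ 2)^-1 * rint (fun x => ab f x `^ p)) `^ (p^-1).
Proof. by []. Qed.
Lemma normLp_aeq p f g : measC f -> measC g -> aeq f g -> normLp p f = normLp p g.
Proof. by move=> mf mg h; rewrite !normLpE (rint_ab_aeq p mf mg h). Qed.
Lemma pi2_gt0 : 0 < (pi *+ 2 : R).
Proof. by rewrite mulrn_wgt0// pi_gt0. Qed.
Lemma normLp_ge0 p f : 0 <= normLp p f.
Proof. by rewrite normLpE powR_ge0. Qed.
Lemma normLp_split p f : normLp p f = (pi *+ 2)^-1 `^ p^-1 * (rint (fun x => ab f x `^ p)) `^ p^-1.
Proof.
rewrite normLpE powRM// ?invr_ge0 ?(ltW pi2_gt0)//.
by apply: int_ge0 => x _; exact: powR_ge0.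
Qed.
Lemma normLpK p f : 0 < p -> rint (fun x => ab f x `^ p) = pi *+ 2 * normLp p f `^ p.
Proof.
move=> p0; rewrite normLpE -powRrM mulVf ?gt_eqF// powRr1; last first.
  by rewrite mulr_ge0 ?invr_ge0 ?(ltW pi2_gt0)//; apply: int_ge0 => x _; exact: powR_ge0.
by rewrite mulrA mulfV ?gt_eqF ?pi2_gt0// mul1r.
Qed.
Lemma inLp_scale p (c : C) f : 0 < p -> Lp p f -> Lp p (fun z => c * f z).
Proof.
move=> p0 /inLpP[mf hf]; apply/inLpP; split; first exact: measC_scale.
have -> : (fun x => ab (fun z => c * f z) x `^ p) = (fun x => absC c `^ p * ab f x `^ p).
  by apply/funext => x; rewrite /ab absCM powRM.
exact: Lint_scale.
Qed.
Lemma normLp_scale p (c : C) f : 0 < p -> Lp p f ->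
  normLp p (fun z => c * f z) = absC c * normLp p f.
Proof.
move=> p0 /inLpP[mf hf]; rewrite !normLp_split.
have -> : (fun x => ab (fun z => c * f z) x `^ p) = (fun x => absC c `^ p * ab f x `^ p).
  by apply/funext => x; rewrite /ab absCM powRM.
rewrite int_scale// powRM ?powR_ge0//; last by apply: int_ge0 => x _; exact: powR_ge0.
by rewrite -powRrM mulfV ?gt_eqF// powRr1// mulrCA.
Qed.
Lemma inLp_add p f g : 1 <= p -> Lp p f -> Lp p g -> Lp p (fun z => f z + g z).
Proof.
move=> p1 /inLpP[mf hf] /inLpP[mg hg]; apply/inLpP; split; first exact: measC_add.
have p0 : 0 < p by exact: lt_le_trans p1.
apply: (@Lint_le _ _ (fun x => 2 `^ p * (ab f x `^ p + ab g x `^ p))).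
- by apply: mabp; exact: measC_add.
- by apply: Lint_scale; exact: Lint_add.
- move=> x _; rewrite ger0_norm ?powR_ge0//.
  apply: le_trans (powRD_le _ _ p0) => //.
  by apply: ge0_ler_powR; rewrite ?nnegrE ?addr_ge0// ?absCD// ltW.
Qed.
Lemma normLp_add p f g : 1 <= p -> Lp p f -> Lp p g ->
  normLp p (fun z => f z + g z) <= normLp p f + normLp p g.
Proof.
move=> p1 hf hg; have /inLpP[_ hfg] := inLp_add p1 hf hg.
move: hf hg => /inLpP[mf hf] /inLpP[mg hg].
have p0 : 0 < p by exact: lt_le_trans p1.
rewrite !normLp_split -mulrDr ler_wpM2l ?powR_ge0//.
have [||h1 h2] := @minkowski_int R (ab f) (ab g) p p1 (mab mf) (mab mg).
- by under eq_fun do rewrite ab_norm.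
- by under eq_fun do rewrite ab_norm.
rewrite (_ : (fun x => `|ab f x| `^ p) = (fun x => ab f x `^ p)) in h2; last first.
  by apply/funext => x; rewrite ab_norm.
rewrite (_ : (fun x => `|ab g x| `^ p) = (fun x => ab g x `^ p)) in h2; last first.
  by apply/funext => x; rewrite ab_norm.
apply: le_trans h2; apply: ge0_ler_powR; rewrite ?nnegrE ?invr_ge0 ?(ltW p0)//.
- by apply: int_ge0 => x _; exact: powR_ge0.
- by apply: int_ge0 => x _; exact: powR_ge0.
apply: int_le => // x _; apply: ge0_ler_powR; rewrite ?nnegrE ?(ltW p0)//.
by rewrite ger0_norm ?addr_ge0// absCD.
Qed.
Lemma inLp_opp p f : 0 < p -> Lp p f -> Lp p (fun z => - f z).
Proof.
by move=> p0 /(inLp_scale (-1) p0); under eq_fun do rewrite mulN1r.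
Qed.
Lemma inLp_sub p f g : 1 <= p -> Lp p f -> Lp p g -> Lp p (fun z => f z - g z).
Proof.
move=> p1 hf hg; exact: (inLp_add p1 hf (inLp_opp (lt_le_trans ltr01 p1) hg)).
Qed.
Lemma normLp_opp p f : normLp p (fun z => - f z) = normLp p f.
Proof. by rewrite !normLpE (_ : ab _ = ab f)//; apply/funext => x; rewrite /ab absCN. Qed.
Lemma normLp_sub p f g : 1 <= p -> Lp p f -> Lp p g ->
  normLp p (fun z => f z - g z) <= normLp p f + normLp p g.
Proof.
move=> p1 hf hg; rewrite -(normLp_opp p g).
exact: (normLp_add p1 hf (inLp_opp (lt_le_trans ltr01 p1) hg)).
Qed.
Lemma normLp_distC p f g : normLp p (fun z => f z - g z) = normLp p (fun z => g z - f z).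
Proof. by rewrite -normLp_opp; under eq_fun do rewrite opprB. Qed.
Lemma normLp0 p : 0 < p -> normLp p (fun=> 0 : C) = 0.
Proof.
move=> p0; rewrite normLpE (_ : rint _ = 0) ?mulr0 ?powR0 ?gt_eqF ?invr_gt0//.
rewrite -[RHS](mul0r (pi *+ 2)) -int_cst; apply: eq_int => x _.
by rewrite /ab absC0 powR0// gt_eqF.
Qed.
Lemma normLp_eq0 p f : 0 < p -> Lp p f -> normLp p f = 0 -> aeq f (fun=> 0).
Proof.
move=> p0 /inLpP[mf hf] h0.
have := normLpK f p0; rewrite h0 powR0 ?gt_eqF// mulr0 => /(int_eq0 hf) h.
apply: (aeD1 (h _)) => [x _|x _ hx]; first exact: powR_ge0.
by apply: absC_eq0; apply: powR_eq0_eq0 hx.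
Qed.
Lemma normLp_aeq0 p f : 0 < p -> measC f -> aeq f (fun=> 0) -> normLp p f = 0.
Proof.
by move=> p0 mf h; rewrite (normLp_aeq p mf (measC_cst 0) h) normLp0.
Qed.
Lemma inLp0 p : 0 < p -> Lp p (fun=> 0 : C).
Proof.
move=> p0; apply/inLpP; split; first exact: measC_cst.
rewrite (_ : (fun x => _) = fun=> 0); first exact: Lint_cst.
by apply/funext => x; rewrite /ab absC0 powR0// gt_eqF.
Qed.
Lemma inLp_bdd p f (M : R) : 0 <= p -> measC f -> (forall x, D x -> ab f x <= M) -> Lp p f.
Proof.
move=> p0 mf h; apply/inLpP; split => //; apply: (@Lint_bdd _ _ (M `^ p)); first exact: mabp.
move=> x Dx; rewrite ger0_norm ?powR_ge0// ge0_ler_powR// ?nnegrE ?h//.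
by apply: le_trans (h x Dx).
Qed.
Lemma inLp_tilde p f : Lp p f -> Lp p (tilde f).
Proof.
move=> /inLpP[mf hf]; apply/inLpP; split; first exact: measC_tilde.
by rewrite ab_tilde; exact: (Lint_rfl hf).
Qed.
Lemma normLp_tilde p f : Lp p f -> normLp p (tilde f) = normLp p f.
Proof.
by move=> /inLpP[mf hf]; rewrite !normLpE ab_tilde; have /= -> := int_rfl hf.
Qed.
Lemma inLp_ab p f g : measC g -> (forall x, ab g x = ab f x) -> Lp p f -> Lp p g.
Proof.
by move=> mg h /inLpP[mf hf]; apply/inLpP; split => //; under eq_fun do rewrite h.
Qed.
Lemma normLp_ab p f g : (forall x, ab g x = ab f x) -> normLp p g = normLp p f.
Proof. by move=> h; rewrite !normLpE; under [fun x => ab g x `^ _]eq_fun do rewrite h. Qed.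
Lemma ab_conj f x : ab (fconj f) x = ab f x.
Proof. by rewrite /ab absC_conj. Qed.
Lemma ab_mon f (k : int) x : ab (fun z => f z * z ^ k) x = ab f x.
Proof. by rewrite /ab absCM absC_circX mulr1. Qed.
Lemma inLp_conj p f : Lp p f -> Lp p (fconj f).
Proof. by move=> h; apply: (inLp_ab _ _ h); [apply: measC_conj; exact: inLp_m h|exact: ab_conj]. Qed.
Lemma inLp_mon p f (k : int) : Lp p f -> Lp p (fun z => f z * z ^ k).
Proof.
move=> h; apply: (inLp_ab _ _ h); last exact: ab_mon.
by apply: measC_mul; [exact: inLp_m h|exact: measC_mon].
Qed.

Lemma inLp_Linf p f g (M : R) : 0 < p -> measC g -> aeD (fun x => ab g x <= M) ->
  Lp p f -> Lp p (fun z => g z * f z) /\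
  normLp p (fun z => g z * f z) <= `|M| * normLp p f.
Proof.
move=> p0 mg hM /inLpP[mf hf].
have hle : aeD (fun x => ab (fun z => g z * f z) x `^ p <= `|M| `^ p * ab f x `^ p).
  apply: (aeD1 hM) => x _ hx; rewrite -powRM//.
  apply: ge0_ler_powR; rewrite ?nnegrE ?mulr_ge0 ?(ltW p0)//.
  by rewrite /ab absCM ler_wpM2r// (le_trans hx)// ler_norm.
have mm : measC (fun z => g z * f z) by exact: measC_mul.
have iM : Lint (fun x => `|M| `^ p * ab f x `^ p) by exact: Lint_scale.
have hL : Lint (fun x => ab (fun z => g z * f z) x `^ p).
  apply: Lint_aele iM _; first exact: mabp.
  by apply: (aeD1 hle) => x _ h; rewrite ger0_norm ?powR_ge0.
split; first by apply/inLpP.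
rewrite !normLp_split mulrCA ler_wpM2l ?powR_ge0//.
have -> : `|M| = (`|M| `^ p) `^ p^-1 by rewrite -powRrM mulfV ?gt_eqF// powRr1.
rewrite -powRM ?powR_ge0//; last by apply: int_ge0 => x _; exact: powR_ge0.
rewrite -int_scale//; apply: ge0_ler_powR; rewrite ?nnegrE ?invr_ge0 ?(ltW p0)//.
- by apply: int_ge0 => x _; exact: powR_ge0.
- by apply: int_ge0 => x _; rewrite mulr_ge0 ?powR_ge0.
exact: int_aele.
Qed.

Lemma inL1P f : Lp 1 f <-> measC f /\ Lint (ab f).
Proof.
have e : (fun x => ab f x `^ 1) = ab f by apply/funext => x; rewrite powRr1.
by rewrite inLpP e.
Qed.
Lemma inL1_re f : Lp 1 f -> Lint (reF f).
Proof.
move=> /inL1P[[rf jf] hf]; apply: (Lint_le _ hf) => // x _; exact: absC_Re.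
Qed.
Lemma inL1_im f : Lp 1 f -> Lint (imF f).
Proof.
move=> /inL1P[[rf jf] hf]; apply: (Lint_le _ hf) => // x _; exact: absC_Im.
Qed.
Lemma inL1_reim f : Lint (reF f) -> Lint (imF f) -> Lp 1 f.
Proof.
move=> rf jf; apply/inL1P.
have mf : measC f by split; exact: Lint_m.
split => //.
apply: (Lint_le (mab mf) (Lint_add (Lint_abs rf) (Lint_abs jf))) => x _.
by rewrite ab_norm absC_le.
Qed.

Lemma hoelderC p q f g : 0 < p -> 0 < q -> p^-1 + q^-1 = 1 -> Lp p f -> Lp q g ->
  Lp 1 (fun z => f z * g z) /\
  rint (ab (fun z => f z * g z)) <= pi *+ 2 * normLp p f * normLp q g.
Proof.
move=> p0 q0 pq /inLpP[mf hf] /inLpP[mg hg].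
have [||h1 h2] := @hoelder_int R (ab f) (ab g) p q p0 q0 pq (mab mf) (mab mg).
- by under eq_fun do rewrite ab_norm.
- by under eq_fun do rewrite ab_norm.
have e : ab (fun z => f z * g z) = (fun x => ab f x * ab g x).
  by apply/funext => x; rewrite /ab absCM.
split; first by apply/inL1P; split; [exact: measC_mul|rewrite e].
have e1 : (fun x => `|ab f x| `^ p) = (fun x => ab f x `^ p).
  by apply/funext => x; rewrite ab_norm.
have e2 : (fun x => `|ab g x| `^ q) = (fun x => ab g x `^ q).
  by apply/funext => x; rewrite ab_norm.
have e3 : (fun x => `|ab f x * ab g x|) = ab (fun z => f z * g z).
  by apply/funext => x; rewrite e ger0_norm// mulr_ge0.
rewrite e1 e2 e3 in h2; apply: (le_trans h2).
have E r h : 0 < r -> rint (fun x => ab h x `^ r) `^ r^-1 = (pi *+ 2) `^ r^-1 * normLp r h.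
  move=> r0; rewrite (normLpK h r0) powRM; [|exact: (ltW pi2_gt0)|exact: powR_ge0].
  by rewrite -powRrM mulfV ?gt_eqF// powRr1// normLp_ge0.
rewrite le_eqVlt; apply/orP; left; apply/eqP.
transitivity (((pi *+ 2) `^ p^-1 * normLp p f) * ((pi *+ 2) `^ q^-1 * normLp q g)).
  by congr (_ * _); exact: E.
rewrite mulrACA mulrA; congr (_ * _ * _).
rewrite -powRD; last by apply/implyP => _; rewrite gt_eqF// pi2_gt0.
by rewrite pq powRr1 ?(ltW pi2_gt0).
Qed.

Lemma absC_const p (c : C) : 0 < p -> normLp p (fun=> c) = absC c.
Proof.
move=> p0; rewrite normLpE /ab int_cst mulrCA mulVf ?gt_eqF ?pi2_gt0// mulr1.
by rewrite -powRrM mulfV ?gt_eqF// powRr1.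
Qed.
Lemma inLp_cst p (c : C) : 0 <= p -> Lp p (fun=> c).
Proof. by move=> p0; apply: (@inLp_bdd _ _ (absC c)) => //; exact: measC_cst. Qed.

Lemma conj_exp p : 1 < p -> [/\ 1 < conjexp p, p^-1 + (conjexp p)^-1 = 1 &
  conjexp (conjexp p) = p].
Proof.
move=> p1; have p0 : 0 < p by exact: lt_trans p1.
have pn : p != 0 by rewrite gt_eqF.
have p1n : p - 1 != 0 by rewrite subr_eq0 gt_eqF.
have p1p : 0 < p - 1 by rewrite subr_gt0.
split.
- by rewrite /conjexp ltr_pdivlMr// mul1r ltrBlDr ltrDl.
- by rewrite /conjexp; field; rewrite pn p1n.
- rewrite /conjexp; field; rewrite p1n /=.
  by rewrite (_ : p + -1 * (p - 1) = 1) ?oner_eq0//; ring.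
Qed.

Lemma inLp_L1 p f : 1 < p -> Lp p f -> Lp 1 f /\
  rint (ab f) <= pi *+ 2 * normLp p f.
Proof.
move=> p1 hf; have [q1 pq _] := conj_exp p1.
have p0 : 0 < p by exact: lt_trans p1.
have q0 : 0 < conjexp p by exact: lt_trans q1.
have := hoelderC p0 q0 pq hf (inLp_cst 1 (ltW q0)).
by rewrite absC_const// absC1 mulr1; under eq_fun do rewrite mulr1.
Qed.

Lemma eq_aeD_Linf f : inLinf f -> measC f /\ exists M, aeD (fun x => ab f x <= M).
Proof. by []. Qed.

End CircleFunctions.
#[export] Hint Resolve absC_ge0 ab_ge0 : core.
(** * Fourier coefficients and trigonometric polynomials *)

Section Fourier.
Variable R : realType.
Local Notation C := R[i].
Local Notation D := (@I02pi R).
Implicit Types (f g h : C -> C) (F G : R -> R) (z w : C) (p q : R) (k n m : int).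
Hint Resolve mD : core.

Lemma cintE f : cint f = Complex (rint (reF f)) (rint (imF f)).
Proof. by []. Qed.
Lemma eq_cint f g : (forall x, D x -> f (circ x) = g (circ x)) -> cint f = cint g.
Proof.
by move=> h; rewrite /cint; congr Complex; apply: eq_int => x Dx; rewrite /reF /imF h.
Qed.
Lemma cint_aeq f g : measC f -> measC g -> aeq f g -> cint f = cint g.
Proof.
move=> [r1 i1] [r2 i2] h; rewrite /cint; congr Complex; apply: int_aeq => //.
  by apply: (aeD1 h) => x _; rewrite /reF => ->.
by apply: (aeD1 h) => x _; rewrite /imF => ->.
Qed.
Lemma cint_add f g : Lp 1 f -> Lp 1 g -> cint (fun z => f z + g z) = cint f + cint g.
Proof.
move=> hf hg; apply: eqCplx; rewrite /= ?cReD ?cImD /=.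
  rewrite -int_add; [|exact: inL1_re|exact: inL1_re].
  by apply: eq_int => x _; rewrite /reF cReD.
rewrite -int_add; [|exact: inL1_im|exact: inL1_im].
by apply: eq_int => x _; rewrite /imF cImD.
Qed.
Lemma cint_scale (c : C) f : Lp 1 f -> cint (fun z => c * f z) = c * cint f.
Proof.
move=> hf; have ir := inL1_re hf; have ii := inL1_im hf.
apply: eqCplx.
  rewrite cReM !cintE /= -!int_scale// -int_sub; [|exact: Lint_scale|exact: Lint_scale].
  by apply: eq_int => x _; rewrite /reF cReM.
rewrite cImM !cintE /= -!int_scale// -int_add; [|exact: Lint_scale|exact: Lint_scale].
by apply: eq_int => x _; rewrite /imF cImM.
Qed.
Lemma cint0 : cint (fun=> 0 : C) = 0.
Proof. by apply: eqCplx; rewrite /= -[RHS](mul0r (pi *+ 2)) -int_cst; apply: eq_int. Qed.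
(** Real and imaginary part are estimated separately, which costs the factor 2; later estimates only
    need some constant. *)
Lemma cint_abs f : Lp 1 f -> absC (cint f) <= 2 * rint (ab f).
Proof.
move=> hf; have /inL1P[mf iab] := hf; apply: (le_trans (absC_le _)).
rewrite mulrDl mul1r /=; apply: lerD.
  apply: (le_trans (int_abs (inL1_re hf))); apply: int_le => //.
    by apply: Lint_abs; exact: inL1_re.
  by move=> x _; exact: absC_Re.
apply: (le_trans (int_abs (inL1_im hf))); apply: int_le => //.
  by apply: Lint_abs; exact: inL1_im.
by move=> x _; exact: absC_Im.
Qed.
Lemma cint_tilde f : Lp 1 f -> cint (tilde f) = cint f.
Proof.
move=> hf; rewrite !cintE reF_tilde imF_tilde; congr Complex.
  by rewrite int_rfl//; exact: inL1_re.
by rewrite int_rfl//; exact: inL1_im.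
Qed.
Lemma cint_conj f : Lp 1 f -> cint (fconj f) = ((cint f)^*)%C.
Proof.
move=> hf; apply: eqCplx; rewrite ?cReC ?cImC /=.
  by apply: eq_int => x _; rewrite /reF cReC.
rewrite -int_opp; last exact: inL1_im.
by apply: eq_int => x _; rewrite /imF cImC.
Qed.

Lemma rint_cos k : k != 0 -> rint (fun x => cos (k%:~R * x) : R) = 0.
Proof.
move=> k0; have kR0 : (k%:~R : R) != 0 by rewrite intr_eq0.
pose Fa (x : R) := (k%:~R)^-1 * sin (k%:~R * x).
have dF x : is_derive (x : R^o) (1 : R^o) (Fa : R^o -> R^o) (cos (k%:~R * x)).
  rewrite /Fa; apply: is_derive_eq; rewrite /GRing.scale /=.
  by rewrite !(mulr0, add0r, mulr1, addr0) ?[_ * k%:~R]mulrC mulrA mulVf// mul1r.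
have cF : continuous Fa.
  by move=> x; apply/differentiable_continuous/derivable1_diffP; have [] := dF x.
have := @continuous_FTC2 R (fun x => cos (k%:~R * x)) Fa 0 (pi *+ 2) (pi2_gt0 R).
rewrite /rint /Rintegral => ->.
- rewrite /= /Fa mulr0 sin0 mulr0 subr0.
  have -> : sin (k%:~R * (pi *+ 2)) = 0 :> R; last by rewrite mulr0.
  have := circX (pi *+ 2 : R) k.
  have -> : circ (pi *+ 2) = 1 :> C by apply: eqCplx; rewrite /= ?cos2pi ?sin2pi.
  by rewrite exp1rz => -[].
- apply: continuous_subspaceT => x.
  apply: continuous_comp; last exact: continuous_cos.
  exact: mulrl_continuous.
- split.
  + by move=> x _; have [] := dF x.
  + exact: cvg_at_right_filter (cF _).
  + exact: cvg_at_left_filter (cF _).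
- by move=> x _; rewrite derive1E; apply: derive_val.
Qed.

#[global] Opaque Rintegral.

(** The integrand changes sign under [reflect_angle], so the integral is its own opposite; this
    covers [k = 0] as well. *)
Lemma rint_sin k : rint (fun x => sin (k%:~R * x) : R) = 0.
Proof.
have i1 : Lint (fun x => sin (k%:~R * x) : R).
  apply: (@Lint_bdd _ _ 1); last by move=> x _; rewrite sin_max.
  have [_ h] := @measC_mon R k.
  rewrite (_ : (fun x => _) = imF (fun z => z ^ k))//.
  by apply/funext => x; rewrite /imF circX.
have := int_rfl i1; rewrite (@eq_int _ _ (fun x => - sin (k%:~R * x))).
  by rewrite int_opp// => /eqP; rewrite eq_sym -addr_eq0 -mulr2n mulrn_eq0 => /eqP.
move=> x _ /=; have := circX (reflect_angle x) k; have := circX x k.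
rewrite circ_rfl exprz_inv -exprz_inv => h1.
have -> : (circ x)^-1 ^ k = (circ x ^ k)^-1 by rewrite exprz_inv invr_expz.
rewrite h1 circ_conj => h2.
by have := congr1 (@complex.Im _) h2; rewrite cImC /= => ->.
Qed.

Lemma cint_mon k : cint (fun z => z ^ k) = if k == 0 then Complex (pi *+ 2) 0 else 0.
Proof.
have e1 : rint (reF (fun z : C => z ^ k)) = rint (fun x => cos (k%:~R * x)).
  by apply: eq_int => x _; rewrite /reF circX.
have e2 : rint (imF (fun z : C => z ^ k)) = rint (fun x => sin (k%:~R * x)).
  by apply: eq_int => x _; rewrite /imF circX.
rewrite cintE e1 e2 rint_sin; case: eqP => [->|/eqP k0]; last by rewrite rint_cos.
congr Complex; rewrite -[RHS]mul1r -int_cst; apply: eq_int => x _.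
by rewrite mul0r cos0.
Qed.

Definition c2pi : C := Complex (pi *+ 2)^-1 0.
Lemma fourierE f n : fourier f n = c2pi * cint (fun z => f z * z ^ (- n)).
Proof. by []. Qed.
Lemma c2piK : c2pi * Complex (pi *+ 2) 0 = 1 :> C.
Proof.
apply: eqCplx; rewrite /= ?mulr0 ?mul0r ?subr0 ?addr0// mulVf// gt_eqF// pi2_gt0//.
Qed.
Lemma absC_c2pi : absC c2pi = (pi *+ 2)^-1 :> R.
Proof. by rewrite absC_real ger0_norm// invr_ge0 ltW// pi2_gt0. Qed.

Lemma eq_fourier f g n : (forall x, f (circ x) = g (circ x)) -> fourier f n = fourier g n.
Proof. by move=> h; rewrite !fourierE; congr (_ * _); apply: eq_cint => x _; rewrite h. Qed.
Lemma fourier_add f g n : Lp 1 f -> Lp 1 g ->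
  fourier (fun z => f z + g z) n = fourier f n + fourier g n.
Proof.
move=> hf hg; rewrite !fourierE -mulrDr -(cint_add (inLp_mon (- n) hf) (inLp_mon (- n) hg)).
by congr (_ * _); apply: eq_cint => x _; rewrite mulrDl.
Qed.
Lemma fourier_scale (c : C) f n : Lp 1 f -> fourier (fun z => c * f z) n = c * fourier f n.
Proof.
move=> hf; rewrite !fourierE mulrCA -(cint_scale c (inLp_mon (- n) hf)).
by congr (_ * _); apply: eq_cint => x _; rewrite mulrA.
Qed.
Lemma fourier_opp f n : Lp 1 f -> fourier (fun z => - f z) n = - fourier f n.
Proof.
move=> hf; rewrite -mulN1r -(fourier_scale (-1) n hf).
by apply: eq_fourier => x; rewrite mulN1r.
Qed.
Lemma fourier_sub f g n : Lp 1 f -> Lp 1 g ->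
  fourier (fun z => f z - g z) n = fourier f n - fourier g n.
Proof.
move=> hf hg; rewrite (fourier_add n hf (inLp_opp ltr01 hg)).
by rewrite fourier_opp.
Qed.
Lemma fourier_aeq f g n : measC f -> measC g -> aeq f g -> fourier f n = fourier g n.
Proof.
move=> mf mg h; rewrite !fourierE; congr (_ * _); apply: cint_aeq.
- by apply: measC_mul => //; exact: measC_mon.
- by apply: measC_mul => //; exact: measC_mon.
- by apply: aeq_mul => //; exact: aeq_refl.
Qed.
Lemma circXD (x : R) k n : circ x ^ k * circ x ^ n = circ x ^ (k + n).
Proof. by rewrite expfzDr// circ_neq0. Qed.
Lemma fourier_mon f k n : fourier (fun z => f z * z ^ k) n = fourier f (n - k).
Proof.
rewrite !fourierE; congr (_ * _); apply: eq_cint => x _.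
by rewrite -mulrA circXD opprB.
Qed.
Lemma circVX (x : R) k : (circ x)^-1 ^ k = circ x ^ (- k).
Proof. by rewrite exprz_inv. Qed.
Lemma fourier_tilde f n : Lp 1 f -> fourier (tilde f) n = fourier f (- n).
Proof.
move=> hf; rewrite !fourierE -cint_tilde; last exact/inLp_mon/inLp_tilde.
congr (_ * _); apply: eq_cint => x _.
by rewrite /tilde invrK circVX.
Qed.
Lemma conj_circX (x : R) k : ((circ x ^ k)^*)%C = circ x ^ (- k).
Proof. by rewrite -invr_expz !circX -circ_conj. Qed.
Lemma conjM z w : ((z * w)^*)%C = (z^*)%C * (w^*)%C.
Proof. exact: rmorphM. Qed.
Lemma conjD z w : ((z + w)^*)%C = (z^*)%C + (w^*)%C.
Proof. exact: rmorphD. Qed.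
Lemma fourier_conj f n : Lp 1 f -> fourier (fconj f) n = ((fourier f (- n))^*)%C.
Proof.
move=> hf; rewrite !fourierE conjM -cint_conj; last exact: inLp_mon.
congr (_ * _).
  by apply: eqCplx; rewrite /= ?oppr0.
by apply: eq_cint => x _; rewrite /fconj conjM conj_circX opprK.
Qed.
Lemma fourier_abs f n : Lp 1 f -> absC (fourier f n) <= rint (ab f).
Proof.
move=> hf; rewrite fourierE absCM absC_c2pi.
apply: (le_trans (ler_wpM2l _ (cint_abs (inLp_mon _ hf)))).
  by rewrite invr_ge0 ltW// pi2_gt0.
have -> : rint (ab (fun z => f z * z ^ (- n))) = rint (ab f).
  by apply: eq_int => x _; rewrite ab_mon.
rewrite mulrA ler_piMl//; first by apply: int_ge0 => x _.
(* The factor 2 of [cint_abs] is absorbed by the normalisation [1 / (2 pi)]. *)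
have h2 : (2 : R) <= pi by exact: pi_ge2.
have p2 := pi2_gt0 R.
by rewrite ler_pdivrMl// mulr1 mulr2n; lra.
Qed.
Lemma fourier_norm p f n : 1 < p -> Lp p f -> absC (fourier f n) <= pi *+ 2 * normLp p f.
Proof.
by move=> p1 /(inLp_L1 p1)[h1 h2]; exact: le_trans (fourier_abs n h1) h2.
Qed.

(** A trigonometric polynomial is a list of pairs (coefficient, exponent) in which exponents may
    repeat: sums are concatenations, products are lists of pairs, projections are filters, and
    identities follow by induction on the list. *)
Definition tp (s : seq (C * int)) : C -> C := fun z => \sum_(x <- s) x.1 * z ^ x.2.

Lemma tp_nil z : tp [::] z = 0. Proof. by rewrite /tp big_nil. Qed.
Lemma tp_cons x s z : tp (x :: s) z = x.1 * z ^ x.2 + tp s z.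
Proof. by rewrite /tp big_cons. Qed.
Lemma tp_cat s t z : tp (s ++ t) z = tp s z + tp t z.
Proof. by rewrite /tp big_cat. Qed.
Definition tpscale (c : C) (s : seq (C * int)) := [seq (c * x.1, x.2) | x <- s].
Lemma tp_scale c s z : tp (tpscale c s) z = c * tp s z.
Proof. by rewrite /tp big_map mulr_sumr; apply: eq_bigr => x _; rewrite mulrA. Qed.
Definition tpmul (s t : seq (C * int)) := [seq (x.1 * y.1, x.2 + y.2) | x <- s, y <- t].
Lemma tp_mul s t (x : R) : tp (tpmul s t) (circ x) = tp s (circ x) * tp t (circ x).
Proof.
rewrite /tp big_allpairs_dep mulr_suml; apply: eq_bigr => a _.
by rewrite mulr_sumr; apply: eq_bigr => b _ /=; rewrite -circXD mulrACA.
Qed.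
Definition tpconj (s : seq (C * int)) := [seq ((x.1^*)%C, - x.2) | x <- s].
Lemma tp_conj s (x : R) : tp (tpconj s) (circ x) = ((tp s (circ x))^*)%C.
Proof.
rewrite /tp big_map rmorph_sum; apply: eq_bigr => a _ /=.
by rewrite rmorphM /= conj_circX.
Qed.
Lemma tp_mon (c : C) k z : tp [:: (c, k)] z = c * z ^ k.
Proof. by rewrite tp_cons tp_nil addr0. Qed.
Lemma measC_tp s : measC (tp s).
Proof.
by apply: measC_sum => x; apply: measC_scale; exact: measC_mon.
Qed.
Definition tpbound (s : seq (C * int)) : R := \sum_(x <- s) absC x.1.
Lemma ab_tp s x : ab (tp s) x <= tpbound s.
Proof.
apply: (le_trans (absC_sum _ _ _)); apply: ler_sum => a _.
by rewrite absCM absC_circX mulr1.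
Qed.
Lemma inLp_tp p s : 0 <= p -> Lp p (tp s).
Proof.
by move=> p0; apply: (@inLp_bdd _ _ _ (tpbound s)) => //; [exact: measC_tp|move=> x _; exact: ab_tp].
Qed.
Lemma inL1_mon k : Lp 1 (fun z : C => z ^ k).
Proof.
apply: (@inLp_bdd _ _ _ 1) => //; first exact: measC_mon.
by move=> x _; rewrite /ab absC_circX.
Qed.
Lemma fourier_monomial (c : C) k n : fourier (fun z => c * z ^ k) n = if n == k then c else 0.
Proof.
rewrite fourier_scale; last exact: inL1_mon.
rewrite fourierE (@eq_cint _ (fun z => z ^ (k - n))); last by move=> x _; rewrite circXD.
rewrite cint_mon subr_eq0 eq_sym; case: eqP => _; last by rewrite !mulr0.
by rewrite c2piK mulr1.
Qed.
Definition tpcoef (s : seq (C * int)) n : C := \sum_(x <- s | x.2 == n) x.1.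
Lemma fourier_tp s n : fourier (tp s) n = tpcoef s n.
Proof.
rewrite /tpcoef; elim: s => [|x s IH].
  rewrite big_nil fourierE (@eq_cint _ (fun=> 0)) ?cint0 ?mulr0// => y _.
  by rewrite tp_nil mul0r.
rewrite (@eq_fourier _ (fun z => x.1 * z ^ x.2 + tp s z)); last by move=> y; rewrite tp_cons.
rewrite fourier_add; last exact: inLp_tp.
  rewrite fourier_monomial IH big_cons eq_sym; case: ifP => // _; exact: add0r.
by apply: inLp_scale => //; exact: inL1_mon.
Qed.
Lemma fourier0 n : fourier (fun=> 0 : C) n = 0.
Proof. by rewrite fourierE (@eq_cint _ (fun=> 0)) ?cint0 ?mulr0// => x _; rewrite mul0r. Qed.
Lemma inL1_pn p f : 1 < p -> Lp p f -> Lp 1 f.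
Proof. by move=> p1 /(inLp_L1 p1)[]. Qed.


End Fourier.
(** * Density of trigonometric polynomials *)

Section Density.
Variable R : realType.
Local Notation C := R[i].
Local Notation D := (@I02pi R).
Local Notation T := (measurableTypeR R).
Implicit Types (f g h : C -> C) (F G phi w : R -> R) (z : C) (p q : R).
Hint Resolve mD : core.

Definition rtp phi := exists s : seq (C * int), forall x, tp s (circ x) = Complex (phi x) 0.

Lemma rtp_cst (c : R) : rtp (fun=> c).
Proof. by exists [:: (Complex c 0, 0)] => x; rewrite tp_mon expr0z mulr1. Qed.
Lemma rtp_add F G : rtp F -> rtp G -> rtp (fun x => F x + G x).
Proof.
move=> [s hs] [t ht]; exists (s ++ t) => x; rewrite tp_cat hs ht.
by apply: eqCplx => /=; rewrite ?addr0.
Qed.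
Lemma rtp_mul F G : rtp F -> rtp G -> rtp (fun x => F x * G x).
Proof.
move=> [s hs] [t ht]; exists (tpmul s t) => x; rewrite tp_mul hs ht.
by apply: eqCplx => /=; rewrite ?mulr0 ?mul0r ?subr0 ?addr0.
Qed.
Lemma rtp_sub F G : rtp F -> rtp G -> rtp (fun x => F x - G x).
Proof.
move=> hF hG; have := rtp_add hF (rtp_mul (rtp_cst (-1)) hG).
by under eq_fun do rewrite mulN1r.
Qed.
Lemma rtp_exp F n : rtp F -> rtp (fun x => F x ^+ n).
Proof.
move=> hF; elim: n => [|n IH]; first by under eq_fun do rewrite expr0; exact: rtp_cst.
by under eq_fun do rewrite exprS; exact: rtp_mul.
Qed.
Lemma rtp_sum (I : Type) (s : seq I) (F : I -> R -> R) : (forall i, rtp (F i)) ->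
  rtp (fun x => \sum_(i <- s) F i x).
Proof.
move=> h; elim: s => [|i s IH].
  by under eq_fun do rewrite big_nil; exact: rtp_cst.
by under eq_fun do rewrite big_cons; exact: rtp_add.
Qed.
Lemma rtp_cos (a : R) : rtp (fun x => cos (x - a)).
Proof.
exists [:: (Complex (cos a / 2) (- (sin a / 2)), 1); (Complex (cos a / 2) (sin a / 2), -1)] => x.
rewrite tp_cons tp_mon /= expr1z exprN1 circ_conj cosB.
by apply: eqCplx => /=; field.
Qed.
Lemma rtp_m F : rtp F -> mfun F.
Proof.
move=> [s hs]; have [h _] := measC_tp s.
rewrite (_ : F = reF (tp s))//.
by apply/funext => x; rewrite /reF hs.
Qed.

(** The switching device of elementary Stone-Weierstrass proofs: [(1 - y^N)^(2^N)] tends to 1 for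
    [y < 1/2] and to 0 for [y > 1/2]. Below the threshold a Bernoulli estimate bounds it from below
    by [1 - (2y)^N]. *)
Lemma step_up (y : R) : 0 <= y -> y < 2^-1 ->
  (fun N => (1 - y ^+ N) ^+ (2 ^ N)) @ \oo --> (1 : R).
Proof.
move=> y0 y1; have cv : (fun N => 1 - (2 * y) ^+ N) @ \oo --> (1 : R).
  rewrite -[X in _ --> X]subr0; apply: cvgB; first exact: cvg_cst.
  by apply: cvg_expr; rewrite ger0_norm; lra.
apply: (squeeze_cvgr _ cv (@cvg_cst _ _ _ _ _)).
apply: nearW => N.
have yN0 : 0 <= y ^+ N by rewrite exprn_ge0.
have yN1 : y ^+ N <= 1 by rewrite exprn_ile1//; lra.
apply/andP; split; last by rewrite exprn_ile1//; lra.
rewrite exprMn -natrX.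
elim: (2 ^ N)%N => [|k IH]; first by rewrite mul0r subr0 expr0.
rewrite exprS -[k.+1]addn1 natrD.
apply: le_trans (ler_wpM2l _ IH); last by lra.
have : 0 <= k%:R * (y ^+ N) ^+ 2 by rewrite mulr_ge0// sqr_ge0.
lra.
Qed.

Lemma bernoulli (t : R) k : -1 <= t -> 1 + k%:R * t <= (1 + t) ^+ k.
Proof.
move=> t1; elim: k => [|k IH]; first by rewrite mul0r addr0 expr0.
rewrite exprS -[k.+1]addn1 natrD.
apply: le_trans (ler_wpM2l _ IH); last by lra.
have : 0 <= k%:R * t ^+ 2 by rewrite mulr_ge0// sqr_ge0.
lra.
Qed.

(** The product with [(1 + y^N)^(2^N)] is at most 1, and this factor is at least [(2y)^N] by
    Bernoulli, so the quantity is at most [(2y)^(-N)]. *)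
Lemma step_down (y : R) : 2^-1 < y -> y <= 1 ->
  (fun N => (1 - y ^+ N) ^+ (2 ^ N)) @ \oo --> (0 : R).
Proof.
move=> y1 y2; have y0 : 0 < y by lra.
have cv : (fun N => ((2 * y)^-1) ^+ N) @ \oo --> (0 : R).
  apply: cvg_expr; rewrite ger0_norm ?invr_ge0 ?mulr_ge0 ?(ltW y0)//.
  by rewrite invf_lt1; lra.
apply: (squeeze_cvgr _ (@cvg_cst _ _ _ _ _) cv).
apply: nearW => N.
have yN0 : 0 <= y ^+ N by rewrite exprn_ge0// ltW.
have yN1 : y ^+ N <= 1 by rewrite exprn_ile1// ltW.
apply/andP; split; first by rewrite exprn_ge0//; lra.
rewrite exprVn -[leRHS]mul1r ler_pdivlMr; last by rewrite exprn_gt0//; lra.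
apply: (@le_trans _ _ ((1 - y ^+ N) ^+ (2 ^ N) * (1 + y ^+ N) ^+ (2 ^ N))).
  rewrite ler_wpM2l ?exprn_ge0//; first by lra.
  apply: le_trans (bernoulli _ _); last by lra.
  by rewrite exprMn natrX lerDr.
by rewrite -exprMn exprn_ile1//; nra.
Qed.

Lemma cos_arc_in (a x : R) : 0 < a < pi -> 0 < x < a *+ 2 -> cos a < cos (x - a).
Proof.
move=> /andP[a0 ap] /andP[x0 x2]; rewrite mulr2n in x2.
have e : cos (x - a) = cos `|x - a|.
  by case: (ger0P (x - a)) => // _; rewrite cosN.
have l : `|x - a| < a by rewrite ltr_norml; lra.
rewrite e ltr_cos// in_itv /= ?normr_ge0 ?(ltW a0) ?(ltW ap)//=.
by apply: ltW; exact: lt_trans l ap.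
Qed.

Lemma cos_arc_out (a x : R) : 0 < a < pi -> a *+ 2 < x < pi *+ 2 -> cos (x - a) < cos a.
Proof.
move=> /andP[a0 ap] /andP[x0 x2]; rewrite !mulr2n in x0 x2.
have [h|h] := leP (x - a) pi.
  by rewrite ltr_cos ?in_itv /= ?(ltW a0) ?(ltW ap) ?h ?andbT//; lra.
have -> : cos (x - a) = cos (pi *+ 2 - (x - a)).
  by rewrite [in RHS]addrC cosD2pi cosN.
rewrite ltr_cos ?in_itv /= ?(ltW a0) ?(ltW ap)//; rewrite mulr2n; [|apply/andP; split]; lra.
Qed.

Lemma cvg_dist0 (u : nat -> R) (l : R) : u @ \oo --> l -> (fun n => `|u n - l|) @ \oo --> (0 : R).
Proof.
move=> h; apply/norm_cvg0P; rewrite -(subrr l); apply: cvgB => //; exact: cvg_cst.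
Qed.

Lemma sum_le1 (K : nat) (u : nat -> R) : (forall k, u k <= 1) -> \sum_(k < K) u k <= K%:R.
Proof.
move=> h; elim: K => [|K IH]; first by rewrite big_ord0.
by rewrite big_ord_recr /= -natr1; apply: lerD.
Qed.

(** * Approximation in weighted [L^1] *)

Section weighted.
Variable w : R -> R.
Hypotheses (iw : Lint w) (w0 : forall x, 0 <= w x).

Let ind (E : set R) (x : R) : R := \1_E x.

Lemma ind01 E x : 0 <= ind E x <= 1.
Proof. by rewrite /ind indicE; case: (x \in E) => /=; rewrite ?lexx ler01. Qed.

Lemma mind (E : set T) : measurable E -> mfun (ind E).
Proof. by move=> mE; apply: measurable_funTS; exact: measurable_indic. Qed.

Lemma Lint_w F (M : R) : mfun F -> (forall x, `|F x| <= M) -> Lint (fun x => F x * w x).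
Proof.
move=> mF hM; apply: (@Lint_le _ _ (fun x => M * w x)).
- by apply: measurable_funM => //; exact: Lint_m.
- exact: Lint_scale.
- by move=> x _; rewrite normrM (ger0_norm (w0 x)) ler_wpM2r.
Qed.

(** These sets form a sigma-algebra containing all rays, hence comprise all measurable sets. The
    weight [w] stays arbitrary because density is needed later for the weights 1, [|f|], [1 + |g|],
    [1 + |e|^p] and [1 + |g| + |e|^p]. *)
Definition appr (E : set T) := measurable E /\ forall e : R, 0 < e ->
  exists phi, [/\ rtp phi, (forall x, 0 <= phi x <= 1) &
    rint (fun x => `|phi x - ind E x| * w x) < e].

Lemma iappr phi E : measurable (E : set T) -> mfun phi -> (forall x, 0 <= phi x <= 1) ->
  Lint (fun x => `|phi x - ind E x| * w x).
Proof.
move=> mE mp h; apply: (@Lint_w _ 1).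
  by apply: measurableT_comp => //; apply: measurable_funB => //; exact: mind.
move=> x; rewrite normr_id ler_norml.
by have := h x; have := ind01 E x; lra.
Qed.

Lemma appr0 : appr set0.
Proof.
split => // e e0; exists (fun=> 0); split; [exact: rtp_cst|by move=> x; rewrite lexx ler01|].
rewrite (@eq_int _ _ (fun=> 0)); first by rewrite int_cst mul0r.
by move=> x _; rewrite /ind indicE in_set0 subrr normr0 mul0r.
Qed.

Lemma apprC E : appr E -> appr (~` E).
Proof.
move=> [mE hE]; split; first exact: measurableC.
move=> e /hE[phi [h1 h2 h3]]; exists (fun x => 1 - phi x); split.
- by apply: rtp_sub => //; exact: rtp_cst.
- by move=> x; have := h2 x; lra.
- apply: le_lt_trans h3; rewrite le_eqVlt; apply/orP; left; apply/eqP.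
  apply: eq_int => x _; congr (_ * _).
  have -> : ind (~` E) x = 1 - ind E x.
    rewrite /ind !indicE in_setC; case: (x \in E) => /=; lra.
  by rewrite -normrN; congr (`|_|); lra.
Qed.

Lemma apprU (E F : set T) : appr E -> appr F -> appr (E `|` F).
Proof.
move=> [mE hE] [mF hF]; split; first exact: measurableU.
move=> e e0; have e2 : 0 < e / 2 by lra.
have [phi [p1 p2 p3]] := hE _ e2; have [psi [s1 s2 s3]] := hF _ e2.
exists (fun x => 1 - (1 - phi x) * (1 - psi x)); split.
- by apply: rtp_sub; [exact: rtp_cst|apply: rtp_mul; apply: rtp_sub => //; exact: rtp_cst].
- by move=> x; have := p2 x; have := s2 x; nra.
- have i1 := iappr mE (rtp_m p1) p2; have i2 := iappr mF (rtp_m s1) s2.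
  have : rint (fun x => `|phi x - ind E x| * w x + `|psi x - ind F x| * w x) < e.
    by rewrite int_add//; lra.
  apply: le_lt_trans; apply: int_le.
  + apply: iappr; first exact: measurableU.
      by apply: rtp_m; apply: rtp_sub; [exact: rtp_cst|apply: rtp_mul; apply: rtp_sub => //; exact: rtp_cst].
    by move=> x; have := p2 x; have := s2 x; nra.
  + exact: Lint_add.
  move=> x _; rewrite -mulrDl ler_wpM2r//.
  have -> : ind (E `|` F) x = 1 - (1 - ind E x) * (1 - ind F x).
    by rewrite /ind !indicE in_setU; case: (x \in E); case: (x \in F) => /=; lra.
  have := p2 x; have := s2 x; have := ind01 E x; have := ind01 F x.
  move: (ind E x) (ind F x) (phi x) (psi x) => u v s t hv hu ht hs.
  have -> : 1 - (1 - s) * (1 - t) - (1 - (1 - u) * (1 - v)) =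
    (s - u) * (1 - v) + (1 - s) * (t - v) by ring.
  apply: (le_trans (ler_normD _ _)); rewrite !normrM; apply: lerD.
    by rewrite ler_piMr// ger0_norm; lra.
  by rewrite ler_piMl// ger0_norm; lra.
Qed.

Lemma appr_bigcup (E : nat -> set T) : (forall n, appr (E n)) -> appr (\bigcup_n E n).
Proof.
move=> hE; pose G n := \big[setU/set0]_(i < n) E i.
have hG n : appr (G n).
  rewrite /G; elim: n => [|n IH]; first by rewrite big_ord0; exact: appr0.
  by rewrite big_ord_recr /=; exact: apprU.
have mU : measurable (\bigcup_n E n) by apply: bigcupT_measurable => n; have [] := hE n.
split => // e e0; have e2 : 0 < e / 2 by lra.
pose H n x := `|ind (G n) x - ind (\bigcup_n E n) x| * w x.
have iH n : Lint (H n) by apply: iappr => //; [exact: mind (hG n).1|exact: ind01].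
have [||_ cv] := @rint_dominated_cvg R H (fun=> 0) w (fun n => Lint_m (iH n)) (measurable_cst _) iw.
- apply: aeD_all => x _ n; rewrite /H normrM normr_id (ger0_norm (w0 x)).
  rewrite ler_piMl// ler_norml.
  by have := ind01 (G n) x; have := ind01 (\bigcup_n E n) x; lra.
- apply: aeD_all => x _; have [xU|xU] := pselect ((\bigcup_n E n) x).
    have [k _ Ek] := xU.
    apply: cvg_near_cst; exists k.+1 => // n /= kn; rewrite /H /ind !indicE.
    rewrite !mem_set//; first by rewrite subrr normr0 mul0r.
    by rewrite /G -bigcup_mkord; exists k.
  apply: cvg_near_cst; apply: nearW => n; rewrite /H /ind !indicE.
  rewrite !memNset//; first by rewrite subrr normr0 mul0r.
  by rewrite /G -bigcup_mkord => -[k _ Ek]; apply: xU; exists k.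
have c0 : rint (fun _ : R => 0) < e / 2 by rewrite int_cst mul0r.
have [N _ hN] := cvgr_lt _ cv _ c0.
have {}hN : rint (H N) < e / 2 by apply: hN => /=.
have [phi [p1 p2 p3]] := (hG N).2 _ e2; exists phi; split => //.
have i1 := iappr (hG N).1 (rtp_m p1) p2.
have : rint (fun x => `|phi x - ind (G N) x| * w x + H N x) < e by rewrite int_add//; lra.
apply: le_lt_trans; apply: int_le; [apply: iappr => //; exact: rtp_m p1|exact: Lint_add|].
move=> x _; rewrite -mulrDl ler_wpM2r//.
by apply: le_trans (ler_normD _ _); rewrite addrA subrK.
Qed.

Lemma appr_null (E F : set T) : measurable F -> (forall x, D x -> x <> 0 -> x <> pi *+ 2 -> E x <-> F x) ->
  appr E -> appr F.
Proof.
move=> mF h [mE hE]; split => // e /hE[phi [p1 p2 p3]]; exists phi; split => //.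
rewrite (_ : rint _ = rint (fun x => `|phi x - ind E x| * w x))//.
apply: int_aeq; [exact: Lint_m (iappr mF (rtp_m p1) p2)|exact: Lint_m (iappr mE (rtp_m p1) p2)|].
exists ([set (0 : R)] `|` [set (pi *+ 2 : R)]); split.
- by apply: measurableU; exact: measurable_set1.
- apply: countable_lebesgue_measure0; apply: finite_set_countable.
  by rewrite finite_setU; split; exact: finite_set1.
move=> x /= hx; apply: contrapT => hn; apply: hx => Dx.
have hEF : E x <-> F x by apply: h => // e0; apply: hn; [left|right].
by congr (`|_ - _| * _); rewrite /ind !indicE; congr ((nat_of_bool _)%:R); apply/idP/idP => /set_mem /hEF /mem_set.
Qed.

Lemma appr_arc (a : R) : 0 < a < pi -> appr (`]-oo, (a *+ 2)] : set T).
Proof.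
move=> ha; have /andP[a0 ap] := ha.
have mE : measurable (`]-oo, (a *+ 2)] : set T) by exact: measurable_itv.
split => // e e0.
(* [y] is below [1/2] on the arc from 0 to [2a] and above [1/2] on the rest; the division by 4 keeps
   it in [[0, 1]]. It is a trigonometric polynomial, so the switching device stays one. *)
pose y x := 2^-1 - (cos (x - a) - cos a) / 4.
pose phi N x := (1 - y x ^+ N) ^+ (2 ^ N).
have y01 x : 0 <= y x <= 1.
  by rewrite /y; have := cos_le1 (x - a); have := cos_geN1 (x - a); have := cos_le1 a; have := cos_geN1 a; lra.
have rphi N : rtp (phi N).
  apply/rtp_exp/rtp_sub; first exact: rtp_cst.
  apply/rtp_exp/rtp_sub; first exact: rtp_cst.
  under eq_fun do rewrite mulrC; apply: rtp_mul; first exact: rtp_cst.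
  by apply: rtp_sub; [exact: rtp_cos|exact: rtp_cst].
have phi01 N x : 0 <= phi N x <= 1.
  have /andP[y0 y1] := y01 x.
  have yN0 : 0 <= y x ^+ N by rewrite exprn_ge0.
  have yN1 : y x ^+ N <= 1 by rewrite exprn_ile1.
  by rewrite /phi exprn_ge0 ?exprn_ile1//; lra.
pose H N x := `|phi N x - ind `]-oo, (a *+ 2)] x| * w x.
have iH n : Lint (H n) by apply: iappr => //; exact: rtp_m.
have [||_ cv] := @rint_dominated_cvg R H (fun=> 0) w (fun n => Lint_m (iH n)) (measurable_cst _) iw.
- apply: aeD_all => x _ n; rewrite /H normrM normr_id (ger0_norm (w0 x)).
  by rewrite ler_piMl// ler_norml; have := ind01 `]-oo, (a *+ 2)] x; have := phi01 n x; lra.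
- pose N3 : set T := [set (0 : R)] `|` [set (pi *+ 2 : R)] `|` [set (a *+ 2)].
  exists N3; split.
  + by apply: measurableU; [apply: measurableU|]; exact: measurable_set1.
  + apply: countable_lebesgue_measure0; apply: finite_set_countable.
    by rewrite !finite_setU; split; [split|]; exact: finite_set1.
  move=> x /= hx; apply: contrapT => hn; apply: hx => Dx.
  have x0 : x <> 0 by move=> h; apply: hn; left; left.
  have x2 : x <> pi *+ 2 by move=> h; apply: hn; left; right.
  have xa : x <> a *+ 2 by move=> h; apply: hn; right.
  have {Dx} /andP[Dx1 Dx2] : 0 < x < pi *+ 2.
    move: Dx; rewrite /I02pi /= in_itv /= => /andP[h1 h2].
    by rewrite !lt_neqAle h1 h2 !andbT eq_sym; apply/andP; split; apply/eqP.
  suff hc : phi N x @[N --> \oo] --> (ind `]-oo, (a *+ 2)] x).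
    rewrite -(mul0r (w x)) /H; apply: cvgMl.
    exact: cvg_dist0.
  have /andP[y0 y1] := y01 x.
  have [xl|xg] := ltP x (a *+ 2).
    rewrite /ind indicE mem_set; last by rewrite /= in_itv /= ltW.
    apply: step_up => //; have := @cos_arc_in a x ha; rewrite Dx1 xl => /(_ isT).
    rewrite /y; lra.
  have {xg} xg : a *+ 2 < x by rewrite lt_neqAle xg andbT eq_sym; exact/eqP.
  rewrite /ind indicE memNset; last by rewrite /= in_itv /=; apply/negP; rewrite -ltNge.
  apply: step_down => //; have := @cos_arc_out a x ha; rewrite Dx2 xg => /(_ isT).
  rewrite /y; lra.
have c0 : rint (fun _ : R => 0) < e by rewrite int_cst mul0r.
have [N _ hN] := cvgr_lt _ cv _ c0.
by exists (phi N); split => //; apply: hN => /=.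
Qed.

Lemma appr_ray (b : R) : appr (`]-oo, b] : set T).
Proof.
have mE : measurable (`]-oo, b] : set T) by exact: measurable_itv.
have [b0|b0] := leP b 0.
  apply: appr_null mE _ appr0 => x; rewrite /I02pi /= !in_itv /= => /andP[x0 _] /eqP xn _.
  split => // xb; exfalso; have : x = 0 by apply: le_anti; rewrite (le_trans xb b0) x0.
  exact/eqP.
have [b2|b2] := leP (pi *+ 2) b.
  apply: appr_null mE _ (apprC appr0) => x; rewrite /I02pi /= !in_itv /= => /andP[_ x2] _ _.
  by split => [_|_ []]; exact: le_trans x2 b2.
have -> : b = (b / 2) *+ 2 by rewrite mulr2n -splitr.
by apply: appr_arc; rewrite mulr2n in b2; lra.
Qed.

Lemma appr_meas (E : set T) : measurable E -> appr E.
Proof.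
have sA : sigma_algebra setT appr.
  split; first exact: appr0.
  - by move=> A hA; rewrite setTD; exact: apprC.
  - exact: appr_bigcup.
have oc : (@ocitv R) `<=` appr.
  move=> _ [[a b] _ <-] /=.
  have -> : `]a, b]%classic = ~` (~` `]-oo, b] `|` `]-oo, a]) :> set R.
    rewrite setCU setCK; apply/seteqP; split => x /=; rewrite !in_itv /=.
      by move=> /andP[h1 h2]; split => //; apply/negP; rewrite -ltNge.
    by move=> [-> /negP]; rewrite -ltNge => ->.
  by apply/apprC/apprU; [apply/apprC|]; exact: appr_ray.
by apply: smallest_sub.
Qed.


(** The sum counts the thresholds [1, ..., K] that do not exceed [y]: it is the integer part of [y],
    capped at [K]. *)
Lemma layer_cake K (y : R) : 0 <= y ->
  (K%:R <= y -> \sum_(k < K) (if (k.+1)%:R <= y then 1 else 0 : R) = K%:R) /\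
  (y <= K%:R -> y - 1 <= \sum_(k < K) (if (k.+1)%:R <= y then 1 else 0 : R) <= y).
Proof.
move=> y0; elim: K => [|K [IH1 IH2]].
  by rewrite big_ord0; split => // h; apply/andP; split; lra.
have e : (K.+1)%:R = K%:R + 1 :> R by rewrite -natr1.
rewrite big_ord_recr /= e; split => h.
  by rewrite h IH1//; lra.
have [h1|h1] := leP (K%:R + 1) y.
  by rewrite IH1; lra.
rewrite addr0; have [h2|h2] := leP K%:R y; first by rewrite IH1//; lra.
by apply: IH2; exact: ltW.
Qed.

Lemma dens_pos F (M : R) : 0 < M -> mfun F -> (forall x, 0 <= F x <= M) ->
  forall e : R, 0 < e -> exists phi, [/\ rtp phi, (forall x, 0 <= phi x <= M) &
    rint (fun x => `|phi x - F x| * w x) < e].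
Proof.
move=> M0 mF hF e e0.
have iw0 : 0 <= rint w by apply: int_ge0.
(* There are [K] levels of height [M / K]: the discretisation costs less than [e / 2] after
   integration against [w], and the approximations of the [K] level sets, each within [e / (2 M)],
   cost the other half. *)
pose K := (Num.truncn (2 * M * rint w / e)).+1.
have K0 : 0 < K%:R :> R by rewrite ltr0n.
have hK : M / K%:R * rint w < e / 2.
  have : 2 * M * rint w / e < K%:R by exact: truncnS_gt.
  rewrite ltr_pdivrMr// => h.
  by rewrite mulrAC ltr_pdivrMr//; lra.
pose E (k : nat) : set T := D `&` [set x | (k.+1)%:R <= K%:R / M * F x].
have mE k : measurable (E k).
  have mG : mfun (fun x => K%:R / M * F x) by apply: measurable_funM => //.
  have := mG (@mD R) `[(k.+1)%:R, +oo[%classic (measurable_itv _).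
  congr measurable; apply/seteqP; split => x; rewrite /E /= in_itv /= andbT//.
have d0 : 0 < e / (2 * M) by rewrite divr_gt0// mulr_gt0.
pose phi k := projT1 (cid ((appr_meas (mE k)).2 _ d0)).
have hphi k : [/\ rtp (phi k), (forall x, 0 <= phi k x <= 1) &
    rint (fun x => `|phi k x - ind (E k) x| * w x) < e / (2 * M)].
  by rewrite /phi; case: (cid _).
have MK : 0 < M / K%:R by rewrite divr_gt0.
pose Phi x := \sum_(k < K) M / K%:R * phi k x.
have rPhi : rtp Phi.
  apply: (@rtp_sum 'I_K (index_enum 'I_K) (fun k x => M / K%:R * phi k x)) => k.
  by apply: rtp_mul; [exact: rtp_cst|have [] := hphi k].
exists Phi; split => // [x|].
  rewrite /Phi -mulr_sumr; apply/andP; split.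
    by rewrite mulr_ge0 ?(ltW MK)//; apply: sumr_ge0 => k _; have [_ /(_ x)/andP[]] := hphi k.
  rewrite -mulrA ler_piMr ?(ltW M0)// ler_pdivrMl// mulr1.
  by apply: (sum_le1 K (u := fun k => phi k x)) => k; have [_ /(_ x)/andP[]] := hphi k.
have iE k : Lint (fun x => `|phi k x - ind (E k) x| * w x).
  by have [r1 r2 _] := hphi k; apply: iappr => //; exact: rtp_m.
have hsum : rint (fun x => \sum_(k < K) (`|phi k x - ind (E k) x| * w x)) <= K%:R * (e / (2 * M)) /\
  Lint (fun x => \sum_(k < K) (`|phi k x - ind (E k) x| * w x)).
  elim: (K) => [|k [IH1 IH2]].
    under [fun x => \sum_(_ < 0) _]eq_fun do rewrite big_ord0.
    by rewrite int_cst mul0r mul0r; split => //; exact: Lint_cst.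
  under [fun x => \sum_(_ < _.+1) _]eq_fun do rewrite big_ord_recr /=.
  split; last exact: Lint_add.
  rewrite int_add// -natr1 mulrDl mul1r; apply: lerD => //.
  by have [_ _ /ltW] := hphi k.
have [h1 h2] := hsum.
pose S x := \sum_(k < K) (`|phi k x - ind (E k) x| * w x).
have : rint (fun x => M / K%:R * S x + M / K%:R * w x) < e.
  rewrite int_add; [|exact: Lint_scale|exact: Lint_scale].
  rewrite !int_scale//.
  have : M / K%:R * rint S <= M / K%:R * (K%:R * (e / (2 * M))) by rewrite ler_wpM2l// ltW.
  have -> : M / K%:R * (K%:R * (e / (2 * M))) = e / 2.
    by field; rewrite !gt_eqF.
  lra.
apply: le_lt_trans; apply: int_le.
- apply: (@Lint_w _ (2 * M)).
    by apply: measurableT_comp => //; apply: measurable_funB => //; exact: rtp_m.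
  move=> x; rewrite normr_id; apply: (le_trans (ler_normB _ _)).
  have hP : 0 <= Phi x <= M.
    rewrite /Phi -mulr_sumr; apply/andP; split.
      by rewrite mulr_ge0 ?(ltW MK)//; apply: sumr_ge0 => k _; have [_ /(_ x)/andP[]] := hphi k.
    rewrite -mulrA ler_piMr ?(ltW M0)// ler_pdivrMl// mulr1.
    by apply: (sum_le1 K (u := fun k => phi k x)) => k; have [_ /(_ x)/andP[]] := hphi k.
  have /andP[a1 a2] := hP; have /andP[b1 b2] := hF x; rewrite !ger0_norm//; lra.
- by apply: Lint_add; exact: Lint_scale.
move=> x Dx; rewrite /S -mulr_suml mulrA -mulrDl ler_wpM2r//.
set L := \sum_(k < K) ind (E k) x.
have hL : K%:R / M * F x - 1 <= L <= K%:R / M * F x.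
  have y0 : 0 <= K%:R / M * F x.
    by rewrite mulr_ge0 ?divr_ge0 ?(ltW M0)//; have /andP[] := hF x.
  have [_ h] := layer_cake K y0.
  have -> : L = \sum_(k < K) (if (k.+1)%:R <= K%:R / M * F x then 1 else 0 : R).
    apply: eq_bigr => k _; rewrite /ind indicE /E.
    by case: ifPn => hk; [rewrite mem_set|rewrite memNset//= => -[_]; exact/negP].
  apply: h; rewrite mulrAC ler_pdivrMr// ler_wpM2l//.
  by have /andP[] := hF x.
have -> : Phi x - F x = M / K%:R * (\sum_(k < K) (phi k x - ind (E k) x)) +
    (M / K%:R * L - F x).
  by rewrite sumrB mulrBr /Phi -mulr_sumr /L; lra.
apply: (le_trans (ler_normD _ _)); apply: lerD.
  rewrite normrM (ger0_norm (ltW MK)) ler_wpM2l ?(ltW MK)//.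
  exact: ler_norm_sum.
have e1 : F x = M / K%:R * (K%:R / M * F x) by field; rewrite !gt_eqF.
rewrite [X in _ - X]e1 -mulrBr normrM (ger0_norm (ltW MK)) ler_piMr ?(ltW MK)//.
by rewrite ler_norml; lra.
Qed.

(** Positive and negative parts of real and imaginary part are approximated within their own bounds,
    which yields the uniform bound [4 M]. Boundedness of the approximants is what later converts
    [L^1] smallness into [L^p] smallness. *)
Lemma dens_bdd f (M : R) : 0 < M -> measC f -> (forall x, ab f x <= M) ->
  forall e : R, 0 < e -> exists s, (forall x, ab (tp s) x <= 4 * M) /\
    rint (fun x => ab (fun z => tp s z - f z) x * w x) < e.
Proof.
move=> M0 [mr mi] hf e e0; have e4 : 0 < e / 4 by lra.
have mp F : mfun F -> mfun (fun x => Num.max (F x) 0).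
  by move=> mF; apply: measurable_maxr => //; exact: measurable_cst.
have mq F : mfun F -> mfun (fun x => Num.max (- F x) 0).
  by move=> mF; apply: mp; exact: (@measurable_funN _ T).
have b1 F : (forall x, `|F x| <= M) -> forall x, 0 <= Num.max (F x) 0 <= M.
  move=> h x; have := h x; rewrite ler_norml => /andP[h1 h2].
  by rewrite le_max lexx orbT ge_max h2 (ltW M0).
have b2 F : (forall x, `|F x| <= M) -> forall x, 0 <= Num.max (- F x) 0 <= M.
  by move=> h; apply: b1 => x; rewrite normrN.
have hr x : `|reF f x| <= M by apply: le_trans (hf x); exact: absC_Re.
have hi x : `|imF f x| <= M by apply: le_trans (hf x); exact: absC_Im.
have [p1 [[s1 t1] q1 r1]] := dens_pos M0 (mp _ mr) (b1 _ hr) e4.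
have [p2 [[s2 t2] q2 r2]] := dens_pos M0 (mq _ mr) (b2 _ hr) e4.
have [p3 [[s3 t3] q3 r3]] := dens_pos M0 (mp _ mi) (b1 _ hi) e4.
have [p4 [[s4 t4] q4 r4]] := dens_pos M0 (mq _ mi) (b2 _ hi) e4.
have pe F x : F x = Num.max (F x) 0 - Num.max (- F x) 0 :> R.
  have [h|h] := leP (F x) 0; first by rewrite max_l; lra.
  by rewrite max_r; lra.
pose s := s1 ++ tpscale (-1) s2 ++ tpscale (Complex 0 1) s3 ++ tpscale (Complex 0 (-1)) s4.
have es x : tp s (circ x) = Complex (p1 x - p2 x) (p3 x - p4 x).
  rewrite !tp_cat !tp_scale t1 t2 t3 t4; apply: eqCplx => /=; lra.
have bd x : ab (tp s) x <= 4 * M.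
  rewrite /ab es; apply: (le_trans (absC_le _)) => /=.
  apply: (le_trans (lerD (ler_normB _ _) (ler_normB _ _))).
  by have := q1 x; have := q2 x; have := q3 x; have := q4 x => h4 h3 h2 h1; rewrite !ger0_norm; lra.
exists s; split => //.
have ii F G : mfun F -> rtp G -> (forall x, 0 <= F x <= M) -> (forall x, 0 <= G x <= M) ->
    Lint (fun x => `|G x - F x| * w x).
  move=> mF rG hF hG; apply: (@Lint_w _ M).
    by apply: measurableT_comp => //; apply: measurable_funB => //; exact: rtp_m.
  by move=> x; rewrite normr_id ler_norml; have := hF x; have := hG x; lra.
have i1 := ii _ _ (mp _ mr) (ex_intro _ s1 t1) (b1 _ hr) q1.
have i2 := ii _ _ (mq _ mr) (ex_intro _ s2 t2) (b2 _ hr) q2.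
have i3 := ii _ _ (mp _ mi) (ex_intro _ s3 t3) (b1 _ hi) q3.
have i4 := ii _ _ (mq _ mi) (ex_intro _ s4 t4) (b2 _ hi) q4.
have : rint (fun x => (`|p1 x - Num.max (reF f x) 0| * w x + `|p2 x - Num.max (- reF f x) 0| * w x)
  + (`|p3 x - Num.max (imF f x) 0| * w x + `|p4 x - Num.max (- imF f x) 0| * w x)) < e.
  rewrite int_add; [|exact: Lint_add|exact: Lint_add].
  by rewrite !int_add//; lra.
apply: le_lt_trans; apply: int_le.
- apply: (@Lint_w _ (5 * M)); first by apply: mab; apply: measC_sub; [exact: measC_tp|].
  move=> x; rewrite ab_norm /ab; apply: (le_trans (absCD _ _)).
  by rewrite absCN; have := bd x; have := hf x; rewrite /ab; lra.
- by apply: Lint_add; exact: Lint_add.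
move=> x _; rewrite -!mulrDl ler_wpM2r//.
rewrite /ab es; apply: (le_trans (absC_le _)).
have -> : complex.Re (Complex (p1 x - p2 x) (p3 x - p4 x) - f (circ x)) =
  p1 x - p2 x - reF f x by rewrite /reF; case: (f _).
have -> : complex.Im (Complex (p1 x - p2 x) (p3 x - p4 x) - f (circ x)) =
  p3 x - p4 x - imF f x by rewrite /imF; case: (f _).
rewrite [in X in _ - X](pe (reF f)) [X in _ + `|_ - X|](pe (imF f)).
apply: lerD.
  rewrite (_ : _ - _ - _ = (p1 x - Num.max (reF f x) 0) - (p2 x - Num.max (- reF f x) 0)); last by ring.
  exact: ler_normB.
rewrite (_ : _ - _ - _ = (p3 x - Num.max (imF f x) 0) - (p4 x - Num.max (- imF f x) 0)); last by ring.
exact: ler_normB.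
Qed.

End weighted.

End Density.
#[global] Opaque tp.

(** * Uniqueness of Fourier coefficients and density in [L^p] *)

Section DensityConsequences.
Variable R : realType.
Local Notation C := R[i].
Local Notation D := (@I02pi R).
Local Notation T := (measurableTypeR R).
Implicit Types (f g h : C -> C) (F G phi w : R -> R) (z : C) (p q : R).
Hint Resolve mD : core.

Lemma measC_real (F : C -> R) : mfun (fun x => F (circ x)) -> measC (fun z => Complex (F z) 0).
Proof. by move=> mF; split => //; exact: measurable_cst. Qed.

Lemma mfun_if (E : R -> bool) F G : measurable (D `&` [set x | E x] : set T) ->
  mfun F -> mfun G -> mfun (fun x => if E x then F x else G x).
Proof.
move=> mb mF mG.
have mfb : measurable_fun (D : set T) E.
  by apply: (measurable_fun_bool true); rewrite setIC in mb *; move: mb; congr measurable; apply/seteqP; split => x [].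
apply: measurable_fun_if => //.
  by apply: measurable_funS mF => // x [].
by apply: measurable_funS mG => // x [].
Qed.

Lemma measC_if (b : C -> bool) f g : measurable (D `&` [set x | b (circ x)] : set T) ->
  measC f -> measC g -> measC (fun z => if b z then f z else g z).
Proof.
move=> mb [rf jf] [rg jg].
have gen F G := @mfun_if (fun x => b (circ x)) F G mb.
split.
  rewrite (_ : reF _ = fun x => if b (circ x) then reF f x else reF g x); first exact: gen.
  by apply/funext => x; rewrite /reF; case: ifP.
rewrite (_ : imF _ = fun x => if b (circ x) then imF f x else imF g x); first exact: gen.
by apply/funext => x; rewrite /imF; case: ifP.
Qed.

Lemma mset_le F (M : R) : mfun F -> measurable (D `&` [set x | F x <= M] : set T).
Proof.
move=> mF; have := mF (@mD R) `]-oo, M]%classic (measurable_itv _).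
by congr measurable; apply/seteqP; split => x; rewrite /= in_itv /=.
Qed.
Lemma mset_ge F (M : R) : mfun F -> measurable (D `&` [set x | M <= F x] : set T).
Proof.
move=> mF; have := mF (@mD R) `[M, +oo[%classic (measurable_itv _).
by congr measurable; apply/seteqP; split => x; rewrite /= in_itv /= andbT.
Qed.

Lemma cint_tp_mul s f : Lp 1 f ->
  @c2pi R * cint (fun z => f z * tp s z) = \sum_(x <- s) x.1 * fourier f (- x.2).
Proof.
move=> hf; elim: s => [|x s IH].
  rewrite big_nil (@eq_cint _ _ (fun=> 0)) ?cint0 ?mulr0// => y _.
  by rewrite tp_nil mulr0.
rewrite big_cons -IH fourierE opprK mulrCA -mulrDr -(cint_scale x.1 (inLp_mon x.2 hf)).
have h1 : Lp 1 (fun z => x.1 * (f z * z ^ x.2)).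
  by apply: inLp_scale => //; exact: inLp_mon.
have h2 : Lp 1 (fun z => f z * tp s z).
  have [|h _] := @inLp_Linf R 1 f (tp s) (tpbound s) ltr01 (measC_tp s) _ hf.
    by apply: aeD_all => y _; exact: ab_tp.
  by move: h; under eq_fun do rewrite mulrC.
rewrite -(cint_add h1 h2); congr (_ * _); apply: eq_cint => y _.
by rewrite tp_cons mulrDr mulrCA.
Qed.

Lemma c2pi_neq0 : @c2pi R != 0.
Proof. by apply/eqP => h; have := @c2piK R; rewrite h mul0r => /eqP; rewrite eq_sym oner_eq0. Qed.

(** [int |f| = int r f] for [r = conj f / |f|], which is 0 where [f] vanishes. Trigonometric
    polynomials, against which [f] integrates to 0, approximate [r] in [L^1(|f|)]. *)
Lemma L1_unique f : Lp 1 f -> (forall n, fourier f n = 0) -> aeq f (fun=> 0).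
Proof.
move=> hf h0; have /inL1P[mf iab] := hf.
pose r z := (f z)^*%C / Complex (absC (f z)) 0.
have mr : measC r.
  apply: measC_mul; first exact: measC_conj.
  by apply: measC_inv; apply: measC_real; exact: mab.
have rf x : r (circ x) * f (circ x) = Complex (ab f x) 0.
  rewrite /r /ab; have [->|fn] := eqVneq (f (circ x)) 0; first by rewrite mulr0 absC0.
  rewrite mulrAC [_^*%C * _]mulrC mul_conjC.
  have a0 := absC_gt0 fn; have a1 : Complex (absC (f (circ x))) 0 != 0 :> C.
    by rewrite eq_complex /= eqxx andbT gt_eqF.
  apply: (mulIf a1); rewrite divfK//; apply: eqCplx; rewrite ?cReM ?cImM /= ?expr2; ring.
have rb x : ab r x <= 1.
  rewrite /r /ab absCM absCV absC_conj absC_real ger0_norm; last exact: absC_ge0.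
  have [->|fn] := eqVneq (f (circ x)) 0; first by rewrite absC0 mul0r.
  by rewrite mulfV// gt_eqF// absC_gt0.
have z0 : rint (ab f) = 0.
  apply/eqP; rewrite eq_le int_ge0// ?andbT//.
  apply/ler_addgt0Pr => e e0; rewrite add0r.
  have e2 : 0 < e / 2 by lra.
  have [s [bs hs]] := dens_bdd iab (ab_ge0 f) ltr01 mr rb e2.
  have hrf : Lp 1 (fun z => r z * f z).
    have [|//] := @inLp_Linf R 1 f r 1 ltr01 mr _ hf.
    by apply: aeD_all => y _; exact: rb.
  have hsf : Lp 1 (fun z => f z * tp s z).
    have [|h _] := @inLp_Linf R 1 f (tp s) (tpbound s) ltr01 (measC_tp s) _ hf.
      by apply: aeD_all => y _; exact: ab_tp.
    by move: h; under eq_fun do rewrite mulrC.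
  have cs0 : cint (fun z => f z * tp s z) = 0.
    apply: (mulfI c2pi_neq0); rewrite mulr0 cint_tp_mul//.
    by apply: big1_seq => x _; rewrite h0 mulr0.
  have hd := inLp_sub (lexx 1) hsf hrf.
  have e1 : cint (fun z => f z * tp s z - r z * f z) = - Complex (rint (ab f)) 0.
    have -> : Complex (rint (ab f)) 0 = cint (fun z => r z * f z).
      rewrite cintE; congr Complex.
        by apply: eq_int => x _; rewrite /reF rf.
      by rewrite -[LHS](mul0r (pi *+ 2)) -int_cst; apply: eq_int => x _; rewrite /imF rf.
    have hn : Lp 1 (fun z => -1 * (r z * f z)) by apply: inLp_scale.
    rewrite -mulN1r -(cint_scale (-1) hrf) -[RHS]add0r -cs0 -(cint_add hsf hn).
    by apply: eq_cint => x _; rewrite mulN1r.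
  have := cint_abs hd; rewrite e1 absCN absC_real ger0_norm; last exact: int_ge0.
  move=> h; apply: (le_trans h).
  have -> : rint (ab (fun z => f z * tp s z - r z * f z)) =
    rint (fun x => ab (fun z => tp s z - r z) x * ab f x).
    apply: eq_int => x _; rewrite /ab -absCM; congr absC; ring.
  lra.
apply: (aeD1 (int_eq0 iab _ z0)) => // x _; exact: absC_eq0.
Qed.

Lemma fourier_inj f g : Lp 1 f -> Lp 1 g -> (forall n, fourier f n = fourier g n) -> aeq f g.
Proof.
move=> hf hg h.
have h1 : aeq (fun z => f z - g z) (fun=> 0).
  apply: L1_unique => [|n]; first exact: inLp_sub.
  by rewrite fourier_sub// h subrr.
by apply: (aeD1 h1) => x _ /eqP; rewrite subr_eq0 => /eqP.
Qed.

Lemma normLp_lt p f (e : R) : 0 < p -> 0 < e -> rint (fun x => ab f x `^ p) < pi *+ 2 * e `^ p ->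
  normLp p f < e.
Proof.
move=> p0 e0; rewrite (normLpK f p0) ltr_pM2l ?pi2_gt0// => h.
rewrite ltNge; apply/negP => h2; move: h; rewrite ltNge => /negP; apply.
by apply: ge0_ler_powR; rewrite ?nnegrE ?normLp_ge0 ?(ltW e0) ?(ltW p0).
Qed.

Lemma normLp_cvg0 p (u : nat -> C -> C) : 0 < p ->
  (fun n => rint (fun x => ab (u n) x `^ p)) @ \oo --> (0 : R) ->
  forall e, 0 < e -> exists N, forall n, (N <= n)%N -> normLp p (u n) < e.
Proof.
move=> p0 cv e e0; have h : 0 < pi *+ 2 * e `^ p by rewrite mulr_gt0 ?pi2_gt0 ?powR_gt0.
have [N _ hN] := cvgr_lt _ cv _ h.
by exists N => n Nn; apply: normLp_lt => //; exact: hN.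
Qed.

Lemma powR_le_lin p (x M : R) : 1 <= p -> 0 <= x <= M -> x `^ p <= M `^ (p - 1) * x.
Proof.
move=> p1 /andP[x0 xM]; have [->|xn] := eqVneq x 0.
  by rewrite powR0 ?mulr0// gt_eqF// (lt_le_trans ltr01 p1).
have -> : x `^ p = x `^ (p - 1) * x.
  rewrite -[X in _ * X](powRr1 x0) -powRD ?subrK//.
  by apply/implyP => _.
rewrite ler_wpM2r// ge0_ler_powR ?nnegrE ?subr_ge0//.
exact: le_trans xM.
Qed.

Definition truncate f (N : R) : C -> C := fun z => if absC (f z) <= N then f z else 0.
Lemma measC_trunc f N : measC f -> measC (truncate f N).
Proof.
move=> mf; apply: measC_if => //; last exact: measC_cst.
by apply: mset_le; exact: mab.
Qed.
Lemma ab_trunc f N x : 0 <= N -> ab (truncate f N) x <= N.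
Proof. by move=> N0; rewrite /ab /truncate; case: ifP => // _; rewrite absC0. Qed.

Lemma trunc_cvg p f : 0 < p -> Lp p f ->
  (fun n => rint (fun x => ab (fun z => f z - truncate f n%:R z) x `^ p)) @ \oo --> (0 : R).
Proof.
move=> p0 /inLpP[mf hf].
have hle n x : ab (fun z => f z - truncate f n%:R z) x `^ p <= ab f x `^ p.
  apply: ge0_ler_powR; rewrite ?nnegrE ?(ltW p0) ?ab_ge0//.
  by rewrite /ab /truncate; case: ifP => _; [rewrite subrr absC0; exact: absC_ge0|rewrite subr0].
have mm n : mfun (fun x => ab (fun z => f z - truncate f n%:R z) x `^ p).
  by apply: mabp; apply: measC_sub => //; exact: measC_trunc.
have [||_] := rint_dominated_cvg mm (measurable_cst (0 : R)) hf.
- by apply: aeD_all => x _ n; rewrite ger0_norm ?powR_ge0.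
- apply: aeD_all => x _; apply: cvg_near_cst.
  exists (Num.truncn (ab f x)).+1 => // n /= hn.
  rewrite /ab /truncate ifT ?subrr ?absC0 ?powR0 ?gt_eqF//.
  apply: le_trans (ltW (truncnS_gt _)) _; by rewrite ler_nat.
by rewrite int_cst mul0r.
Qed.

(** After truncation the function and its approximant are bounded by [M] and [4 M], so their
    difference [u] satisfies [|u|^p <= (5 M)^(p - 1) |u|] and [L^1] density suffices. *)
Lemma dens_Lp p f : 1 <= p -> Lp p f -> forall e : R, 0 < e ->
  exists s, normLp p (fun z => f z - tp s z) < e.
Proof.
move=> p1 hf e e0; have p0 : 0 < p by exact: lt_le_trans p1.
have mf := inLp_m hf.
have e2 : 0 < e / 2 by lra.
have [N hN] := normLp_cvg0 p0 (trunc_cvg p0 hf) e2.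
have {hN} hN := hN N.+1 (leqnSn _).
set g := truncate f _ in hN; pose M : R := N.+1%:R.
have M0 : 0 < M by rewrite ltr0n.
have mg : measC g by exact: measC_trunc.
have bg x : ab g x <= M by apply: ab_trunc; exact: ltW.
have hg : Lp p g by apply: (@inLp_bdd _ _ _ M) => //; exact: ltW.
have d0 : 0 < pi *+ 2 * (e / 2) `^ p / (5 * M) `^ (p - 1).
  by rewrite divr_gt0// ?mulr_gt0 ?pi2_gt0 ?powR_gt0// mulr_gt0.
have i1 : Lint (fun _ : R => 1) by exact: Lint_cst.
have [s [bs hs]] := dens_bdd i1 (fun=> ler01) M0 mg bg d0.
exists s.
have hsp : Lp p (tp s) by apply: inLp_tp; exact: ltW.
have hd : normLp p (fun z => tp s z - g z) < e / 2.
  apply: normLp_lt => //.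
  have iab : Lint (ab (fun z => tp s z - g z)).
    have /inL1P[] // : Lp 1 (fun z => tp s z - g z).
    apply: inLp_sub => //; first exact: inLp_tp.
    by apply: (@inLp_bdd _ _ _ M).
  apply: (@le_lt_trans _ _ ((5 * M) `^ (p - 1) * rint (ab (fun z => tp s z - g z)))).
    rewrite -int_scale//; apply: int_le.
    - by have /inLpP[] := inLp_sub p1 hsp hg.
    - exact: Lint_scale.
    move=> x _; apply: powR_le_lin => //; rewrite ab_ge0 /=.
    apply: (le_trans (absCD _ _)); rewrite absCN.
    by have := bs x; have := bg x; rewrite /ab; lra.
  rewrite mulrC -ltr_pdivlMr ?powR_gt0 ?mulr_gt0//.
  rewrite (_ : ab (fun z => tp s z - g z) = (fun x => ab (fun z => tp s z - g z) x * 1))//.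
  by apply/funext => x; rewrite mulr1.
have -> : normLp p (fun z => f z - tp s z) = normLp p (fun z => (f z - g z) - (tp s z - g z)).
  by congr normLp; apply/funext => z; ring.
apply: (le_lt_trans (normLp_sub p1 (inLp_sub p1 hf hg) (inLp_sub p1 hsp hg))).
by rewrite [X in _ < X]splitr; exact: (ltrD hN hd).
Qed.

End DensityConsequences.
(** * The M. Riesz inequality *)

Section RieszInequality.
Variable R : realType.
Local Notation C := R[i].
Implicit Types (f g h : C -> C) (F G phi w : R -> R) (z : C) (p q : R).
Implicit Types (s t : seq (C * int)).
Hint Resolve mD : core.

Lemma lim_ge_seq (u : nat -> R) (l c : R) : u @ \oo --> l -> (forall n, c <= u n) -> c <= l.
Proof.
move=> h hc; rewrite -(cvg_lim (@Rhausdorff R) h); apply: limr_ge; first exact: cvgP h.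
exact: nearW.
Qed.

Definition tpP s := [seq x <- s | 0 <= x.2].

Lemma tpP_cat s t : tpP (s ++ t) = tpP s ++ tpP t.
Proof. by rewrite /tpP filter_cat. Qed.
Lemma tpP_scale (c : C) s : tpP (tpscale c s) = tpscale c (tpP s).
Proof. by rewrite /tpP /tpscale filter_map. Qed.
Lemma tpcoef_tpP s n : tpcoef (tpP s) n = if 0 <= n then tpcoef s n else 0.
Proof.
rewrite /tpcoef /tpP big_filter_cond; case: ifP => hn.
  by apply: eq_bigl => x; case: eqP => [->|]; rewrite ?hn ?andbF.
by rewrite big1// => x /andP[h /eqP e]; rewrite e hn in h.
Qed.

Definition analytic s := all (fun x : C * int => 0 <= x.2) s.

Lemma tpcoef0_mul s t : analytic s -> analytic t ->
  tpcoef (tpmul s t) 0 = tpcoef s 0 * tpcoef t 0.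
Proof.
move=> /allP hs /allP ht; rewrite /tpcoef big_mkcond /= big_allpairs_dep /=.
rewrite [X in _ = X * _]big_mkcond mulr_suml; apply: eq_big_seq => x xs.
case: (eqVneq x.2 0) => hx; last first.
  rewrite mul0r big1_seq// => y /andP[_ yt]; rewrite ifN//.
  by rewrite paddr_eq0; [rewrite (negPf hx)|exact: hs|exact: ht].
rewrite [in RHS]big_mkcond mulr_sumr; apply: eq_big_seq => y yt /=.
by rewrite hx add0r; case: ifP => _; rewrite ?mulr0.
Qed.
Lemma analytic_mul s t : analytic s -> analytic t -> analytic (tpmul s t).
Proof.
move=> /allP hs /allP ht; apply/allP => _ /allpairsP[[x y] /= [xs yt ->]] /=.
by apply: addr_ge0; [exact: hs|exact: ht].
Qed.
Lemma tpcoef_cat s t n : tpcoef (s ++ t) n = tpcoef s n + tpcoef t n.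
Proof. by rewrite /tpcoef big_cat. Qed.
Lemma tpcoef_scale (c : C) s n : tpcoef (tpscale c s) n = c * tpcoef s n.
Proof. by rewrite /tpcoef big_map /= mulr_sumr. Qed.
Lemma analytic_cat s t : analytic s -> analytic t -> analytic (s ++ t).
Proof. by rewrite /analytic all_cat => -> ->. Qed.
Lemma analytic_scale (c : C) s : analytic s -> analytic (tpscale c s).
Proof. by rewrite /analytic /tpscale all_map. Qed.

Definition tppow s n := iter n (tpmul s) [:: (1, 0)].
Lemma tp_pow s n (x : R) : tp (tppow s n) (circ x) = tp s (circ x) ^+ n.
Proof.
elim: n => [|n IH]; first by rewrite tp_mon expr0z mulr1 expr0.
by rewrite /= tp_mul IH exprS.
Qed.
Lemma analytic_pow s n : analytic s -> analytic (tppow s n).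
Proof. by move=> h; elim: n => //= n IH; exact: analytic_mul. Qed.
Lemma tpcoef_pow s n : analytic s -> tpcoef (tppow s n) 0 = tpcoef s 0 ^+ n.
Proof.
move=> h; elim: n => [|n IH].
  by rewrite /tpcoef big_cons big_nil /= expr0 addr0.
by rewrite /= tpcoef0_mul ?analytic_pow// IH exprS.
Qed.

Lemma geom_rest (x : C) n : x != 1 -> (1 - x)^-1 - \sum_(k < n) x ^+ k = x ^+ n / (1 - x).
Proof.
move=> x1; have h : 1 - x != 0 by rewrite subr_eq0 eq_sym.
have -> : \sum_(k < n) x ^+ k = (1 - x ^+ n) / (1 - x).
  apply: (mulIf h); rewrite divfK//.
  have := subrX1 x n; rewrite -opprB => /(congr1 (fun y => - y)); rewrite opprK => ->.
  by rewrite -mulNr opprB mulrC.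
by rewrite mulrBl mul1r opprB addrC subrK.
Qed.

Lemma quot_bound (a B y rho d u : R) n : 0 <= a <= B -> 0 <= y <= rho -> 0 < u <= d ->
  a ^+ 2 * y ^+ n / d <= B ^+ 2 / u * rho ^+ n.
Proof.
move=> /andP[a0 aB] /andP[y0 yr] /andP[u0 ud].
rewrite [leRHS]mulrAC; have d0 : 0 < d by exact: lt_le_trans ud.
apply: ler_pM; last by rewrite lef_pV2.
- by rewrite mulr_ge0// exprn_ge0.
- by rewrite invr_ge0 ltW.
apply: ler_pM; rewrite ?exprn_ge0//; apply: lerXn2r; rewrite ?nnegrE//.
  exact: le_trans aB.
exact: le_trans yr.
Qed.

(** The mean value property of [F^2 / (F + u)]. With [X = 1 - (F + u) / M] one has [|X| <= rho < 1]
    on the circle, so [1 / (F + u)] is a uniform limit of geometric sums in [X]; these are analytic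
    polynomials, on which the zeroth coefficient is multiplicative. *)
Lemma fourier_analytic_quot s (u : R) : analytic s -> 0 < u ->
  (forall x, 0 <= complex.Re (tp s (circ x))) ->
  complex.Im (tpcoef s 0) = 0 -> 0 <= complex.Re (tpcoef s 0) ->
  fourier (fun z => tp s z ^+ 2 / (tp s z + Complex u 0)) 0 =
    tpcoef s 0 ^+ 2 / (tpcoef s 0 + Complex u 0).
Proof.
move=> an u0 re0 im0 m0; set m := tpcoef s 0; set U := Complex u 0.
pose B := tpbound s + absC m.
have B0 : 0 <= B by rewrite addr_ge0 ?absC_ge0//; apply: sumr_ge0 => x _; exact: absC_ge0.
have bF x : absC (tp s (circ x)) <= B.
  by apply: (le_trans (ab_tp s x)); rewrite lerDl absC_ge0.
have bounded_mfun : absC m <= B by rewrite lerDr; apply: sumr_ge0 => x _; exact: absC_ge0.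
(* [|M - (w + u)|^2 = M^2 - 2 M Re (w + u) + |w + u|^2] is at most [M^2 - u M] as soon as
   [(B + u)^2 <= u M]; equality is chosen, and [rho^2 = 1 - u / M]. *)
pose M := (B + u) ^+ 2 / u; have M0 : 0 < M by rewrite divr_gt0// exprn_gt0// ltr_wpDl.
pose rho := Num.sqrt (1 - u / M).
have uM : u / M <= 1.
  rewrite /M invf_div mulrA -expr2 ler_pdivrMr ?exprn_gt0 ?ltr_wpDl// mul1r.
  by apply: lerXn2r; rewrite ?nnegrE; lra.
have rho1 : rho < 1.
  by rewrite -sqrtr1 ltr_sqrt// ltrBlDr ltrDl divr_gt0.
have rho0 : 0 <= rho by exact: sqrtr_ge0.
pose MC : C := Complex M 0.
have MC0 : MC != 0 by rewrite eq_complex /= eqxx andbT gt_eqF.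
have key (w : C) : absC w <= B -> 0 <= complex.Re w ->
    [/\ w + U != 0, u <= absC (w + U) & absC (1 - (w + U) / MC) <= rho].
  move=> wB w0.
  have h1 : u <= absC (w + U).
    apply: le_trans (absC_Re _); rewrite cReD /= ger0_norm; lra.
  have h0 : w + U != 0.
    by apply/eqP => h; rewrite h absC0 in h1; lra.
  split => //; rewrite absCE ler_wsqrtr//.
  have -> : (w + U) / MC = Complex ((complex.Re w + u) / M) (complex.Im w / M).
    by apply: (mulIf MC0); rewrite divfK//; apply: eqCplx; rewrite ?cReM ?cImM ?cReD ?cImD /=; field; rewrite gt_eqF.
  have a2 : complex.Re w ^+ 2 + complex.Im w ^+ 2 <= B ^+ 2.
    by rewrite -absC_sqr ler_sqr ?nnegrE ?absC_ge0.
  have rB : complex.Re w <= B by apply: le_trans wB; apply: le_trans (ler_norm _) (absC_Re _).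
  rewrite cReD cImD /=.
  have -> : (1 - (complex.Re w + u) / M) ^+ 2 + (0 - complex.Im w / M) ^+ 2 =
     1 - (2 * (complex.Re w + u) * M - (complex.Re w ^+ 2 + complex.Im w ^+ 2 + 2 * u * complex.Re w + u ^+ 2)) / M ^+ 2.
    by field; rewrite gt_eqF.
  rewrite lerD2l lerN2 ler_pdivlMr ?exprn_gt0// expr2 mulrA divfK ?gt_eqF//.
  have -> : 2 * (complex.Re w + u) * M = 2 * complex.Re w * M + u * M + u * M by ring.
  have e : u * M = (B + u) ^+ 2 by rewrite /M mulrC divfK// gt_eqF.
  rewrite e; have : 0 <= 2 * complex.Re w * M.
    by apply: mulr_ge0; [exact: mulr_ge0|exact: ltW].
  have : 2 * u * complex.Re w <= 2 * u * B by apply: ler_wpM2l => //; lra.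
  rewrite sqrrD; lra.
pose X := [:: ((1 : C), (0 : int))] ++ tpscale (- MC^-1) (s ++ [:: (U, (0 : int))]).
have X0 x : tp X (circ x) = 1 - (tp s (circ x) + U) / MC.
  by rewrite tp_cat tp_scale tp_cat !tp_mon !expr0z !mulr1 mulNr mulrC.
have aX : analytic X by apply: analytic_cat => //; apply: analytic_scale; apply: analytic_cat.
have cX : tpcoef X 0 = 1 - (m + U) / MC.
  rewrite tpcoef_cat tpcoef_scale tpcoef_cat /tpcoef !big_cons !big_nil /= !addr0.
  by rewrite mulNr mulrC.
have alg (w : C) n : w + U != 0 ->
    w ^+ 2 / (w + U) - w ^+ 2 / MC * (\sum_(k < n) (1 - (w + U) / MC) ^+ k) =
    w ^+ 2 * (1 - (w + U) / MC) ^+ n / (w + U).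
  move=> wU; set y := 1 - (w + U) / MC.
  have y1 : y != 1.
    by rewrite /y -subr_eq0 addrAC subrr add0r oppr_eq0 mulf_neq0// invr_eq0.
  have ey : (1 - y)^-1 = MC / (w + U) by rewrite /y opprB addrC subrK invf_div.
  have h : \sum_(k < n) y ^+ k = MC / (w + U) - y ^+ n * (MC / (w + U)).
    by have := geom_rest n y1; rewrite ey => <-; ring.
  have -> : (w + U)^-1 = MC^-1 * (MC / (w + U)) by rewrite mulrA mulVf// mul1r.
  by rewrite h; ring.
have [m1 m2 m3] := key m bounded_mfun m0.
pose Q z := tp s z ^+ 2 / (tp s z + U).
have mF : measC (tp s) by exact: measC_tp.
have mtU : measC (fun z => (tp s z + U)^-1).
  by apply: measC_inv; apply: measC_add => //; exact: measC_cst.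
have iQ : Lp 1 Q.
  apply: (@inLp_bdd _ _ _ (B ^+ 2 / u)) => //.
    by apply: measC_mul => //; under eq_fun do rewrite expr2; exact: measC_mul.
  move=> x _; have [h1 h2 h3] := key _ (bF x) (re0 x).
  rewrite /ab absCM absCX absCV; apply: ler_pM.
  - by rewrite exprn_ge0// absC_ge0.
  - by rewrite invr_ge0 absC_ge0.
  - by rewrite ler_sqr ?nnegrE ?absC_ge0.
  - by rewrite lef_pV2 ?posrE// (lt_le_trans u0).
pose K := 2 * (B ^+ 2 / u) * (pi *+ 2) + B ^+ 2 / u.
have bound n : absC (fourier Q 0 - m ^+ 2 / (m + U)) <= K * rho ^+ n.
  pose S := tpmul (tpscale MC^-1 (tpmul s s)) (flatten [seq tppow X k | k <- index_iota 0 n]).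
  have tS x : tp S (circ x) = tp s (circ x) ^+ 2 / MC * \sum_(k < n) (1 - (tp s (circ x) + U) / MC) ^+ k.
    rewrite tp_mul tp_scale tp_mul -expr2 [MC^-1 * _]mulrC; congr (_ * _).
    rewrite -(big_mkord xpredT (fun k => (1 - (tp s (circ x) + U) / MC) ^+ k)).
    elim: (index_iota 0 n) => [|k l IH]; first by rewrite big_nil tp_nil.
    by rewrite big_cons /= tp_cat IH tp_pow X0.
  have aF : analytic (flatten [seq tppow X k | k <- index_iota 0 n]).
    elim: (index_iota 0 n) => [|k l IH] //=.
    by apply: analytic_cat => //; exact: analytic_pow.
  have cS : tpcoef S 0 = m ^+ 2 / MC * \sum_(k < n) (1 - (m + U) / MC) ^+ k.
    rewrite tpcoef0_mul//; last by apply: analytic_scale; exact: analytic_mul.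
    rewrite tpcoef_scale tpcoef0_mul// -expr2 [MC^-1 * _]mulrC; congr (_ * _).
    rewrite -(big_mkord xpredT (fun k => (1 - (m + U) / MC) ^+ k)).
    elim: (index_iota 0 n) => [|k l IH]; first by rewrite big_nil /tpcoef big_nil.
    by rewrite big_cons /= tpcoef_cat IH tpcoef_pow// cX.
  have iS : Lp 1 (tp S) by exact: inLp_tp.
  have h1 : absC (fourier (fun z => Q z - tp S z) 0) <= pi *+ 2 * (B ^+ 2 / u * rho ^+ n).
    have iD := inLp_sub (lexx 1) iQ iS.
    apply: (le_trans (fourier_abs 0 iD)); rewrite mulrC -int_cst.
    apply: int_le => //; [by have /inL1P[] := iD|exact: Lint_cst|move=> x _].
    have [k1 k2 k3] := key _ (bF x) (re0 x).
    rewrite /ab /Q tS alg// !absCM absCV !absCX.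
    by apply: quot_bound; rewrite ?absC_ge0 ?bF ?k3 ?u0 ?k2.
  have h2 : absC (m ^+ 2 / (m + U) - tpcoef S 0) <= B ^+ 2 / u * rho ^+ n.
    rewrite cS alg// !absCM absCV !absCX.
    by apply: quot_bound; rewrite ?absC_ge0 ?bounded_mfun ?m3 ?u0 ?m2.
  rewrite fourier_sub// fourier_tp in h1.
  have -> : fourier Q 0 - m ^+ 2 / (m + U) = (fourier Q 0 - tpcoef S 0) - (m ^+ 2 / (m + U) - tpcoef S 0) by ring.
  apply: (le_trans (absCD _ _)); rewrite absCN /K.
  have : 0 <= pi *+ 2 * (B ^+ 2 / u * rho ^+ n).
    by rewrite !mulr_ge0 ?exprn_ge0 ?invr_ge0 ?(ltW u0) ?(ltW (pi2_gt0 R)).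
  have -> : (2 * (B ^+ 2 / u) * (pi *+ 2) + B ^+ 2 / u) * rho ^+ n =
    2 * (pi *+ 2 * (B ^+ 2 / u * rho ^+ n)) + B ^+ 2 / u * rho ^+ n by ring.
  lra.
apply/eqP; rewrite -subr_eq0; apply/eqP; apply: absC_eq0; apply/eqP.
rewrite eq_le absC_ge0 andbT.
have cv : (fun n => K * rho ^+ n) @ \oo --> (0 : R).
  rewrite -(mulr0 K); apply: cvgMr; apply: cvg_expr.
  by rewrite ger0_norm.
by apply: (lim_ge_seq cv) => n; exact: bound.
Qed.

End RieszInequality.

(** * A uniform bound for dyadic sums *)

Section DyadicSum.
Variable R : realType.
Implicit Types a b v : R.

Lemma powR_neg_le (x y b : R) : 0 < x -> x <= y -> 0 <= b -> y `^ (- b) <= x `^ (- b).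
Proof.
move=> x0 xy b0; have y0 : 0 < y by exact: lt_le_trans xy.
rewrite !powRN lef_pV2 ?posrE ?powR_gt0//.
by apply: ge0_ler_powR; rewrite ?nnegrE ?(ltW x0) ?(ltW y0).
Qed.

(** Up to a constant, each summand is dominated by the increment from [w] to [2 w] of a bounded
    increasing function: [min (w, 1)^a] if [w <= 1/2], and [- max (w, 1/2)^(-b)] if [w > 1/2]. The
    sum telescopes to a bound independent of [v] and [N]. *)
Lemma dyadic_sum a b : 0 < a -> 0 < b -> exists2 K : R, 0 <= K &
  forall v N, 0 < v ->
  \sum_(k < N) Num.min ((v * 2 ^+ k) `^ a) ((v * 2 ^+ k) `^ (- b)) <= K.
Proof.
move=> a0 b0.
have A0 : 0 < (2 : R) `^ a - 1.
  have : (1 : R) `^ a < 2 `^ a by apply: gt0_ltr_powR; rewrite ?nnegrE//; lra.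
  by rewrite powR1 subr_gt0.
have B0 : 0 < 1 - (2 : R) `^ (- b).
  rewrite subr_gt0 powRN invf_lt1 ?powR_gt0//.
  have : (1 : R) `^ b < 2 `^ b by apply: gt0_ltr_powR; rewrite ?nnegrE//; lra.
  by rewrite powR1.
pose p1 v := (Num.min v 1) `^ a.
pose p2 v := - (Num.max v 2^-1) `^ (- b).
exists (((2 : R) `^ a - 1)^-1 + 2^-1 `^ (- b) / (1 - (2 : R) `^ (- b))).
  by rewrite addr_ge0 ?mulr_ge0 ?invr_ge0 ?powR_ge0 ?(ltW A0) ?(ltW B0).
move=> v N v0; pose w k := v * 2 ^+ k.
have w0 k : 0 < w k by rewrite mulr_gt0// exprn_gt0.
have wS k : w k.+1 = 2 * w k by rewrite /w exprS mulrCA.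
have h1 k : 0 <= p1 (w k.+1) - p1 (w k).
  rewrite subr_ge0 /p1 wS; have := w0 k => wk.
  have wk2 : w k <= 2 * w k by lra.
  apply: ge0_ler_powR; rewrite ?nnegrE ?le_min ?ler01 ?andbT; [exact: ltW|exact: ltW| |].
    by rewrite mulr_ge0// ltW.
  by rewrite !ge_min lexx orbT wk2.
have m0 k : 0 < Num.max (w k) 2^-1 by rewrite lt_max w0.
have h2 k : 0 <= p2 (w k.+1) - p2 (w k).
  rewrite subr_ge0 /p2 lerN2; apply: powR_neg_le => //; last exact: ltW.
  rewrite wS ge_max !le_max lexx orbT andbT; apply/orP; left.
  by have := w0 k; lra.
have st k : Num.min (w k `^ a) (w k `^ (- b)) <=
    (p1 (w k.+1) - p1 (w k)) / ((2 : R) `^ a - 1) + (p2 (w k.+1) - p2 (w k)) / (1 - (2 : R) `^ (- b)).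
  have [hk|hk] := leP (w k) 2^-1.
    apply: (@le_trans _ _ (w k `^ a)); first by rewrite ge_min lexx.
    rewrite -[leLHS]addr0; apply: lerD; last by rewrite divr_ge0// ltW.
    rewrite /p1 wS !min_l; [|lra|lra].
    by rewrite powRM ?(ltW (w0 k))// -[X in _ - X]mul1r -mulrBl mulrAC mulfV ?mul1r// gt_eqF.
  apply: (@le_trans _ _ (w k `^ (- b))); first by rewrite ge_min lexx orbT.
  rewrite -[leLHS]add0r; apply: lerD; first by rewrite divr_ge0// ltW.
  rewrite /p2 wS !max_l; [|lra|lra].
  rewrite powRM ?(ltW (w0 k))// opprK addrC -[X in X - _]mul1r -mulrBl mulrAC mulfV ?mul1r//.
  by rewrite gt_eqF.
have : \sum_(k < N) Num.min (w k `^ a) (w k `^ (- b)) <=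
  (p1 (w N) - p1 (w 0%N)) / ((2 : R) `^ a - 1) + (p2 (w N) - p2 (w 0%N)) / (1 - (2 : R) `^ (- b)).
  elim: N => [|N IH]; first by rewrite big_ord0 !subrr !mul0r addr0.
  rewrite big_ord_recr /=; apply: (le_trans (lerD IH (st N))).
  by rewrite le_eqVlt; apply/orP; left; apply/eqP; ring.
move=> h; apply: (le_trans h); apply: lerD.
  rewrite -[leRHS]mul1r; apply: ler_wpM2r; first by rewrite invr_ge0 ltW.
  have g0 : 0 <= p1 (w 0%N) by exact: powR_ge0.
  have g1 : p1 (w N) <= 1.
    apply: (@le_trans _ _ (1 `^ a)); last by rewrite powR1.
    apply: ge0_ler_powR; rewrite ?nnegrE ?(ltW a0)//.
      by rewrite le_min (ltW (w0 N)) ler01.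
    by rewrite ge_min lexx orbT.
  lra.
apply: ler_wpM2r; first by rewrite invr_ge0 ltW.
have g0 : p2 (w N) <= 0 by rewrite oppr_le0 powR_ge0.
have g1 : - p2 (w 0%N) <= 2^-1 `^ (- b).
  by rewrite /p2 opprK; apply: powR_neg_le; rewrite ?invr_gt0 ?(ltW b0)// le_max lexx orbT.
lra.
Qed.

Lemma frac_le_min v a : 0 < v -> 0 < a < 2 -> v `^ a / (1 + v ^+ 2) <= Num.min (v `^ a) (v `^ (- (2 - a))).
Proof.
move=> v0 /andP[a0 a2]; have d0 : 0 < 1 + v ^+ 2 by rewrite ltr_wpDr// sqr_ge0.
rewrite le_min; apply/andP; split; rewrite ler_pdivrMr//.
  by rewrite ler_peMr ?powR_ge0// lerDl sqr_ge0.
have -> : v `^ a = v `^ (- (2 - a)) * v ^+ 2.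
  rewrite -powR_mulrn ?(ltW v0)// -powRD; last by apply/implyP => _; rewrite gt_eqF.
  by congr (_ `^ _); lra.
by rewrite ler_wpM2l ?powR_ge0// lerDr.
Qed.

End DyadicSum.

(** * Analytic polynomials with positive real part, [1 < p < 2] *)

Section RieszPositive.
Variable R : realType.
Local Notation C := R[i].
Implicit Types (f g h : C -> C) (F G phi w : R -> R) (z : C) (p q : R).
Implicit Types (s t : seq (C * int)).
Hint Resolve mD : core.

Definition bounded_mfun F := mfun F /\ exists M, forall x, `|F x| <= M.
Lemma bm_add F G : bounded_mfun F -> bounded_mfun G -> bounded_mfun (fun x => F x + G x).
Proof.
move=> [mF [M hM]] [mG [N hN]]; split; first exact: measurable_funD.
by exists (M + N) => x; apply: (le_trans (ler_normD _ _)); exact: lerD.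
Qed.
Lemma bm_mul F G : bounded_mfun F -> bounded_mfun G -> bounded_mfun (fun x => F x * G x).
Proof.
move=> [mF [M hM]] [mG [N hN]]; split; first exact: measurable_funM.
by exists (M * N) => x; rewrite normrM; apply: ler_pM.
Qed.
Lemma bm_cst c : bounded_mfun (fun=> c).
Proof. by split; [exact: measurable_cst|exists `|c|]. Qed.
Lemma bm_sum (I : Type) (l : seq I) (F : I -> R -> R) : (forall i, bounded_mfun (F i)) ->
  bounded_mfun (fun x => \sum_(i <- l) F i x).
Proof.
move=> h; elim: l => [|i l IH].
  by under eq_fun do rewrite big_nil; exact: bm_cst.
by under eq_fun do rewrite big_cons; exact: bm_add.
Qed.
Lemma bm_Lint F : bounded_mfun F -> Lint F.
Proof. by move=> [mF [M hM]]; apply: (@Lint_bdd _ _ M). Qed.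
Lemma rint_sum (I : Type) (l : seq I) (F : I -> R -> R) : (forall i, bounded_mfun (F i)) ->
  rint (fun x => \sum_(i <- l) F i x) = \sum_(i <- l) rint (F i).
Proof.
move=> h; elim: l => [|i l IH].
  by rewrite big_nil; under eq_fun do rewrite big_nil; rewrite int_cst mul0r.
rewrite big_cons -IH; under eq_fun do rewrite big_cons.
by rewrite int_add//; apply: bm_Lint => //; exact: bm_sum.
Qed.

Lemma powR_root (x y p q c : R) : 0 <= x -> 0 < q -> p / q = c -> y `^ p = x `^ q -> x = y `^ c.
Proof.
move=> x0 q0 <- h; rewrite powRrM h -powRrM (mulfV (lt0r_neq0 q0)) powRr1//.
Qed.

(* The real part of the mean value property for [F^2 / (F + u)], [F = tp s]. *)
Lemma riesz_pos_step s (u : R) : analytic s -> 0 < u ->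
  (forall x, 0 <= reF (tp s) x) ->
  complex.Im (tpcoef s 0) = 0 -> 0 <= complex.Re (tpcoef s 0) ->
  rint (fun x => imF (tp s) x ^+ 2 * u / ab (fun z => tp s z + Complex u 0) x ^+ 2) <=
  rint (fun x => (reF (tp s) x * ab (tp s) x ^+ 2 + reF (tp s) x ^+ 2 * u) /
    ab (fun z => tp s z + Complex u 0) x ^+ 2).
Proof.
move=> an u0 re0 im0 m0; have e := fourier_analytic_quot an u0 re0 im0 m0.
set d := fun x => ab (fun z => tp s z + Complex u 0) x ^+ 2.
have ud x : u ^+ 2 <= d x.
  rewrite /d; apply: lerXn2r; [by rewrite nnegrE ltW|by rewrite nnegrE ab_ge0|].
  by apply: le_trans (absC_Re _); rewrite cReD /= ger0_norm; have := re0 x; rewrite /reF; lra.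
have d0 x : 0 < d x by apply: lt_le_trans (ud x); rewrite exprn_gt0.
have [mr mi] := measC_tp s.
have br : bounded_mfun (reF (tp s)).
  by split => //; exists (tpbound s) => x; apply: (le_trans (absC_Re _)); exact: ab_tp.
have bi : bounded_mfun (imF (tp s)).
  by split => //; exists (tpbound s) => x; apply: (le_trans (absC_Im _)); exact: ab_tp.
have ba : bounded_mfun (ab (tp s)).
  split; first by apply: mab; exact: measC_tp.
  by exists (tpbound s) => x; rewrite ab_norm; exact: ab_tp.
have bd : bounded_mfun (fun x => (d x)^-1).
  split.
    apply: mfunV; apply: measurable_funX; apply: mab; apply: measC_add; [exact: measC_tp|exact: measC_cst].
  exists (u ^+ 2)^-1 => x; rewrite ger0_norm ?invr_ge0 ?(ltW (d0 x))//.
  by rewrite lef_pV2 ?posrE; [exact: ud|exact: d0|exact: exprn_gt0].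
have b2 F : bounded_mfun F -> bounded_mfun (fun x => F x ^+ 2).
  by move=> h; under eq_fun do rewrite expr2; exact: bm_mul.
have bu : bounded_mfun (fun=> u) by exact: bm_cst.
rewrite -subr_ge0 -int_sub; last 2 first.
- by apply/bm_Lint/bm_mul => //; apply: bm_add; apply: bm_mul => //; exact: b2.
- by apply/bm_Lint/bm_mul => //; apply: bm_mul => //; exact: b2.
have := congr1 (@complex.Re _) e; rewrite fourierE cReM cintE /= mul0r subr0.
set I := rint _; set J := rint _.
(* [Re (F^2 / (F + u)) = (Re F |F|^2 + u ((Re F)^2 - (Im F)^2)) / |F + u|^2]; its mean is
   [m^2 / (m + u) >= 0], where [m >= 0] is the zeroth coefficient of [F]. *)
have -> : I = J.
  rewrite /I /J.
  apply: eq_int => x _.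
  rewrite /reF /imF expr0z mulr1.
  have := absC_sqr (tp s (circ x)); have := absC_sqr (tp s (circ x) + Complex u 0).
  rewrite /d /ab; have := d0 x; rewrite /d /ab.
  case: (tp s (circ x)) => a b /= dd e1 e2.
  rewrite e1 in dd *; rewrite e2 /=.
  by rewrite !addr0 in dd *; field; rewrite gt_eqF.
move=> hJ; have : 0 <= (pi *+ 2)^-1 * J.
  rewrite hJ; move: im0 m0; case: (tpcoef s 0) => a b /= -> a0.
  rewrite !(mul0r, mulr0, addr0, subr0, oppr0, expr0n) /=.
  have au : 0 <= a + u by rewrite addr_ge0// ltW.
  apply: mulr_ge0; first exact: mulr_ge0.
  by apply: divr_ge0 => //; exact: sqr_ge0.
by rewrite pmulr_rge0// invr_gt0 pi2_gt0.
Qed.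

(* Summing [riesz_pos_step] over dyadic [u] with weight [u^(p-1)] replaces
   [u^p / |F + u|^2] by [|F|^(p-2)] up to constants. *)
Lemma riesz_positive p : 1 < p < 2 -> exists2 K : R, 0 <= K & forall s (e : R), analytic s -> 0 < e ->
  (forall x, e <= reF (tp s) x) ->
  complex.Im (tpcoef s 0) = 0 -> 0 <= complex.Re (tpcoef s 0) ->
  normLp p (tp s) <= K * normLp p (fun z => Complex (complex.Re (tp s z)) 0).
Proof.
move=> /andP[p1 p2].
have [|K1 K10 hK1] := @dyadic_sum R p (2 - p) (lt_trans ltr01 p1); first by lra.
have [||K2 K20 hK2] := @dyadic_sum R (p - 1) (2 - (p - 1)); [lra|lra|].
pose K := 1 + 9 * (K1 + K2); exists K; first by rewrite /K; lra.
move=> s e an e0 re0 im0 m0.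
have p0 : 0 < p by lra.
set X := reF (tp s); set Y := imF (tp s); set r := ab (tp s).
have X0 x : 0 < X x by apply: lt_le_trans (re0 x).
have rX x : X x <= r x by apply: le_trans (absC_Re _); exact: ler_norm.
have r0 x : 0 < r x by apply: lt_le_trans (rX x).
have er x : e <= r x by apply: le_trans (rX x).
have rXY x : r x ^+ 2 = X x ^+ 2 + Y x ^+ 2 by exact: absC_sqr.
pose q x := r x `^ (p - 2).
have q0 x : 0 < q x by rewrite powR_gt0.
pose u (k : nat) := e * 2 ^+ k.
have u0 k : 0 < u k by rewrite mulr_gt0// exprn_gt0.
pose B := tpbound s.
have rB x : r x <= B by exact: ab_tp.
(* Since [e <= |F| <= B] on the circle, the finitely many scales from [e] up to [B] suffice. *)
have [N hN] : exists N, B <= u N.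
  exists (Num.truncn (B / e)).+1.
  have : B / e < (Num.truncn (B / e)).+1%:R by exact: truncnS_gt.
  move=> h; rewrite /u -ler_pdivrMl// mulrC; apply: (le_trans (ltW h)).
  by rewrite -natrX ler_nat; exact: ltnW (ltn_expl _ _).
pose d k x := ab (fun z => tp s z + Complex (u k) 0) x ^+ 2.
have dE k x : d k x = (X x + u k) ^+ 2 + Y x ^+ 2.
  by rewrite /d /ab absC_sqr cReD cImD /= addr0.
have dlow k x : r x ^+ 2 + u k ^+ 2 <= d k x.
  rewrite dE rXY; have := mulr_ge0 (ltW (X0 x)) (ltW (u0 k)); lra.
have dup k x : d k x <= (r x + u k) ^+ 2.
  rewrite dE; have := rXY x; have := ler_wpM2r (ltW (u0 k)) (rX x); lra.
have dl0 k x : 0 < r x ^+ 2 + u k ^+ 2 by rewrite addr_gt0 ?exprn_gt0.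
have d0 k x : 0 < d k x by exact: lt_le_trans (dlow k x).
have pwq x : r x `^ p = q x * r x ^+ 2.
  rewrite /q -powR_mulrn ?(ltW (r0 x))// -powRD ?subrK//.
  by apply/implyP => _; rewrite gt_eqF.
have pwq1 x : r x `^ (p - 1) = q x * r x.
  rewrite /q -[X in _ * X]powRr1 ?(ltW (r0 x))// -powRD; last by apply/implyP => _; rewrite gt_eqF.
  by congr (_ `^ _); lra.
have vsc k x a : u k `^ a = (u k / r x) `^ a * r x `^ a.
  by rewrite -powRM ?divfK ?gt_eqF// ?divr_ge0 ?(ltW (u0 _)) ?(ltW (r0 _)).
have ve k x : u k / r x = e / r x * 2 ^+ k by rewrite /u mulrAC.
have v0 x : 0 < e / r x by rewrite divr_gt0.
have vk0 k x : 0 < u k / r x by rewrite divr_gt0.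
have S1up x : \sum_(k < N.+1) u k `^ p / d k x <= q x * K1.
  apply: (@le_trans _ _ (q x * \sum_(k < N.+1) Num.min ((e / r x * 2 ^+ k) `^ p) ((e / r x * 2 ^+ k) `^ (- (2 - p))))).
    rewrite mulr_sumr; apply: ler_sum => k _.
    apply: (@le_trans _ _ (u k `^ p / (r x ^+ 2 + u k ^+ 2))).
      by rewrite ler_wpM2l ?powR_ge0// lef_pV2 ?posrE.
    rewrite -ve; apply: le_trans (ler_wpM2l (ltW (q0 x)) (frac_le_min (vk0 k x) _)); last by lra.
    rewrite (vsc k x) pwq le_eqVlt; apply/orP; left; apply/eqP.
    field; rewrite !gt_eqF//; by rewrite ?addr_gt0 ?exprn_gt0 ?divr_gt0.
  by rewrite ler_wpM2l ?(ltW (q0 x))//; apply: hK1.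
have S2up x : r x ^+ 2 * \sum_(k < N.+1) u k `^ (p - 1) / d k x <= q x * r x * K2.
  apply: (@le_trans _ _ (q x * r x * \sum_(k < N.+1) Num.min ((e / r x * 2 ^+ k) `^ (p - 1)) ((e / r x * 2 ^+ k) `^ (- (2 - (p - 1)))))).
    rewrite !mulr_sumr; apply: ler_sum => k _.
    apply: (@le_trans _ _ (r x ^+ 2 * (u k `^ (p - 1) / (r x ^+ 2 + u k ^+ 2)))).
      by rewrite ler_wpM2l ?sqr_ge0// ler_wpM2l ?powR_ge0// lef_pV2 ?posrE.
    have qr0 : 0 <= q x * r x by rewrite mulr_ge0// ltW.
    rewrite -ve; apply: le_trans (ler_wpM2l qr0 (frac_le_min (vk0 k x) _)); last by lra.
    rewrite (vsc k x) pwq1 le_eqVlt; apply/orP; left; apply/eqP.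
    field; rewrite !gt_eqF//; by rewrite ?addr_gt0 ?exprn_gt0 ?divr_gt0.
  by rewrite ler_wpM2l ?mulr_ge0 ?(ltW (q0 x)) ?(ltW (r0 x))//; apply: hK2.
(* A single term suffices: the least [k] with [|F| <= u k] has [u k <= 2 |F|], hence
   [|F + u k|^2 <= 9 |F|^2]. This is the origin of the 9. *)
have S1low x : q x / 9 <= \sum_(k < N.+1) u k `^ p / d k x.
  have ex : exists k, r x <= u k by exists N; exact: le_trans (rB x) hN.
  pose k := ex_minn ex.
  have [rk kmin] : r x <= u k /\ forall j, r x <= u j -> (k <= j)%N.
    by rewrite /k; case: ex_minnP.
  have kN : (k < N.+1)%N by rewrite ltnS; apply: kmin; exact: le_trans (rB x) hN.
  have uk2 : u k <= 2 * r x.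
    case: (k) kmin => [|j] kmin; first by rewrite /u expr0 mulr1; have := er x; have := r0 x; lra.
    have : ~~ (r x <= u j) by apply/negP => /kmin; rewrite ltnn.
    by rewrite -ltNge /u exprS mulrCA; lra.
  rewrite (bigD1 (Ordinal kN)) //= -[leLHS]addr0; apply: lerD; last first.
    by apply: sumr_ge0 => j _; rewrite divr_ge0 ?powR_ge0// ltW.
  rewrite ler_pdivlMr// ; apply: (@le_trans _ _ (q x / 9 * (3 * r x) ^+ 2)).
    rewrite ler_wpM2l ?divr_ge0 ?(ltW (q0 x))//; apply: (le_trans (dup k x)).
    by apply: lerXn2r; rewrite ?nnegrE; have := u0 k; have := r0 x; lra.
  have -> : q x / 9 * (3 * r x) ^+ 2 = r x `^ p by rewrite pwq; field.
  by apply: ge0_ler_powR; rewrite ?nnegrE ?(ltW (r0 x)) ?(ltW (u0 k)) ?(ltW p0).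
have [mr mi] := measC_tp s.
have bX : bounded_mfun X.
  by split => //; exists (tpbound s) => x; apply: (le_trans (absC_Re _)); exact: ab_tp.
have bY : bounded_mfun Y.
  by split => //; exists (tpbound s) => x; apply: (le_trans (absC_Im _)); exact: ab_tp.
have br : bounded_mfun r.
  split; first by apply: mab; exact: measC_tp.
  by exists (tpbound s) => x; rewrite ab_norm; exact: ab_tp.
have bq : bounded_mfun q.
  split; first by apply: mabp; exact: measC_tp.
  exists (e `^ (p - 2)) => x; rewrite ger0_norm ?(ltW (q0 x))//.
  rewrite /q (_ : p - 2 = - (2 - p)); last by rewrite opprB.
  by apply: powR_neg_le; [exact: e0|exact: er|rewrite subr_ge0 ltW].
have bd k : bounded_mfun (fun x => (d k x)^-1).
  split.
    apply: mfunV; apply: measurable_funX; apply: mab; apply: measC_add; [exact: measC_tp|exact: measC_cst].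
  exists (u k ^+ 2)^-1 => x; rewrite ger0_norm ?invr_ge0 ?(ltW (d0 k x))//.
  rewrite lef_pV2 ?posrE; [|exact: d0|exact: exprn_gt0].
  by apply: le_trans (dlow k x); rewrite lerDr sqr_ge0.
have b2 F : bounded_mfun F -> bounded_mfun (fun x => F x ^+ 2).
  by move=> h; under eq_fun do rewrite expr2; exact: bm_mul.
pose A k x := Y x ^+ 2 * (u k `^ p / d k x).
pose Bf k x := X x * r x ^+ 2 * (u k `^ (p - 1) / d k x) + X x ^+ 2 * (u k `^ p / d k x).
have bA k : bounded_mfun (A k).
  by apply: bm_mul; [exact: b2|apply: bm_mul; [exact: bm_cst|exact: bd]].
have bBf k : bounded_mfun (Bf k).
  apply: bm_add; apply: bm_mul.
  - by apply: bm_mul => //; exact: b2.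
  - by apply: bm_mul; [exact: bm_cst|exact: bd].
  - exact: b2.
  - by apply: bm_mul; [exact: bm_cst|exact: bd].
have AB k : rint (A k) <= rint (Bf k).
  have upk : u k `^ p = u k `^ (p - 1) * u k.
    rewrite -[X in _ * X]powRr1 ?(ltW (u0 k))// -powRD ?subrK//.
    by apply/implyP => _; rewrite gt_eqF.
  have h := riesz_pos_step an (u0 k) (fun x => ltW (X0 x)) im0 m0.
  have h' := ler_wpM2l (powR_ge0 (u k) (p - 1)) h.
  rewrite -!int_scale in h'; last 2 first.
  - apply/bm_Lint/bm_mul; last exact: bd.
    by apply: bm_add; apply: bm_mul => //; [exact: b2|exact: b2|exact: bm_cst].
  - by apply/bm_Lint/bm_mul; [apply: bm_mul; [exact: b2|exact: bm_cst]|exact: bd].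
  apply: le_trans (le_trans _ h') _.
    rewrite le_eqVlt; apply/orP; left; apply/eqP; apply: eq_int => x _.
    by rewrite /A upk /d; ring.
  rewrite le_eqVlt; apply/orP; left; apply/eqP; apply: eq_int => x _.
  by rewrite /Bf upk /d /X /r; ring.
have bXqr : bounded_mfun (fun x => X x * (q x * r x)) by apply: bm_mul => //; exact: bm_mul.
have main1 : rint (fun x => Y x ^+ 2 * q x / 9) <= (K1 + K2) * rint (fun x => X x * (q x * r x)).
  apply: (@le_trans _ _ (rint (fun x => \sum_(k <- index_enum 'I_N.+1) A k x))).
    apply: int_le.
    - by apply/bm_Lint/bm_mul; [apply: bm_mul => //; exact: b2|exact: bm_cst].
    - by apply/bm_Lint/bm_sum.
    by move=> x _; rewrite -mulrA -mulr_sumr ler_wpM2l ?sqr_ge0.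
  apply: (@le_trans _ _ (rint (fun x => \sum_(k <- index_enum 'I_N.+1) Bf k x))).
    by rewrite !rint_sum//; apply: ler_sum.
  rewrite -int_scale; last exact: bm_Lint.
  apply: int_le.
  - by apply/bm_Lint/bm_sum.
  - by apply/bm_Lint/bm_mul => //; exact: bm_cst.
  move=> x _; rewrite /Bf big_split /= -!mulr_sumr mulrDl addrC; apply: lerD.
    apply: (@le_trans _ _ (X x ^+ 2 * (q x * K1))); first by rewrite ler_wpM2l ?sqr_ge0.
    have : X x * (q x * K1) * X x <= X x * (q x * K1) * r x.
      by rewrite ler_wpM2l// !mulr_ge0// ?(ltW (X0 x)) ?(ltW (q0 x)).
    by rewrite expr2; lra.
  rewrite -mulrA; apply: (@le_trans _ _ (X x * (q x * r x * K2))); last by lra.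
  by rewrite ler_wpM2l ?(ltW (X0 x)).
(* [|F|^p = |F|^(p-2) (X^2 + Y^2)]: the [X] part is at most [X |F|^(p-1)] because [X <= |F|], and
   the [Y] part is [main1]. *)
have main2 : rint (fun x => r x `^ p) <= K * rint (fun x => X x * r x `^ (p - 1)).
  have -> : rint (fun x => r x `^ p) = rint (fun x => X x ^+ 2 * q x + 9 * (Y x ^+ 2 * q x / 9)).
    by apply: eq_int => x _; rewrite pwq rXY; field.
  have -> : rint (fun x => X x * r x `^ (p - 1)) = rint (fun x => X x * (q x * r x)).
    by apply: eq_int => x _; rewrite pwq1.
  rewrite int_add; last 2 first.
  - by apply/bm_Lint/bm_mul => //; exact: b2.
  - by apply/bm_Lint/bm_mul; [exact: bm_cst|apply: bm_mul; [apply: bm_mul => //; exact: b2|exact: bm_cst]].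
  rewrite int_scale; last by apply/bm_Lint/bm_mul; [apply: bm_mul => //; exact: b2|exact: bm_cst].
  have : rint (fun x => X x ^+ 2 * q x) <= rint (fun x => X x * (q x * r x)).
    apply: int_le; [by apply/bm_Lint/bm_mul => //; exact: b2|exact: bm_Lint|move=> x _].
    have : X x * q x * X x <= X x * q x * r x by rewrite ler_wpM2l// mulr_ge0// ltW.
    by rewrite expr2; lra.
  by rewrite /K; lra.
have [c1 cc _] := conj_exp p1; set p' := conjexp p in c1 cc.
have p'0 : 0 < p' by lra.
pose fr z := Complex (absC (tp s z) `^ (p - 1)) 0 : C.
pose fX z := Complex (complex.Re (tp s z)) 0 : C.
have pp' : (p - 1) * p' = p by rewrite /p' /conjexp; field; rewrite subr_eq0 gt_eqF.
have abfr x : ab fr x = r x `^ (p - 1) by rewrite /ab absC_real ger0_norm// powR_ge0.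
have abfX x : ab fX x = X x by rewrite /ab absC_real ger0_norm; [|exact: ltW (X0 x)].
have LX : Lp p fX.
  apply: (@inLp_bdd _ _ _ B) => //; [exact: ltW|by apply: measC_real|].
  by move=> x _; rewrite abfX (le_trans (rX x)).
have e1 : rint (fun x => ab fr x `^ p') = rint (fun x => r x `^ p).
  by apply: eq_int => x _; rewrite abfr -powRrM pp'.
have Ls : Lp p (tp s) by apply: inLp_tp; exact: ltW.
have Lr : Lp p' fr.
  apply/inLpP; split.
    by apply: measC_real; apply: (@mabp _ (tp s)); exact: measC_tp.
  move/inLpP: Ls => [_]; apply: eq_Lint => x _.
  by rewrite abfr -powRrM pp'.
have [_ hh] := hoelderC p0 p'0 cc LX Lr.
have e2 : rint (ab (fun z => fX z * fr z)) = rint (fun x => X x * r x `^ (p - 1)).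
  by apply: eq_int => x _; rewrite /ab absCM -!/(ab _ _) abfX abfr.
rewrite e2 in hh.
set n1 := normLp p (tp s); set n2 := normLp p fX in hh *.
have n10 : 0 <= n1 by exact: normLp_ge0.
have n20 : 0 <= n2 by exact: normLp_ge0.
have K0 : 0 <= K := addr_ge0 ler01 (mulr_ge0 (ler0n _ 9) (addr_ge0 K10 K20)).
have e3 : normLp p' fr = n1 `^ (p - 1).
  have a1 := normLpK fr p'0; have a2 := normLpK (tp s) p0.
  have a4 : pi *+ 2 * n1 `^ p = pi *+ 2 * normLp p' fr `^ p' := etrans (esym a2) (etrans (esym e1) a1).
  have a3 := mulfI (lt0r_neq0 (pi2_gt0 R)) a4.
  have e5 : p / p' = p - 1 by rewrite -[X in X / _]pp' (mulfK (lt0r_neq0 p'0)).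
  exact: (powR_root (normLp_ge0 _ _) p'0 e5 a3).
(* Hoelder bounds the integral of [X |F|^(p-1)] by the norm of [X] times the norm of [F] to the
   power [p - 1]; the latter factor is then cancelled. *)
have main3 : n1 `^ p <= K * n2 * n1 `^ (p - 1).
  have h1 : pi *+ 2 * n1 `^ p <= pi *+ 2 * (K * n2 * n1 `^ (p - 1)).
    rewrite /n1 -(normLpK (tp s) p0); apply: (le_trans main2).
    apply: (le_trans (ler_wpM2l K0 hh)); rewrite e3.
    by rewrite le_eqVlt; apply/orP; left; apply/eqP; ring.
  by rewrite ler_pM2l ?pi2_gt0 in h1.
have [z0|zn] := eqVneq n1 0; first by rewrite z0; exact: mulr_ge0.
have n1p : 0 < n1 by rewrite lt_neqAle eq_sym zn n10.
have e4 : n1 `^ p = n1 * n1 `^ (p - 1).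
  rewrite -[X in X * _](powRr1 n10) -powRD; last by rewrite zn implybT.
  by congr (_ `^ _); rewrite addrC subrK.
rewrite e4 ler_pM2r in main3; [exact: main3|exact: powR_gt0].
Qed.

End RieszPositive.

(** * From positive real part to nonnegative trigonometric polynomials *)

Section RieszTheorem.
Variable R : realType.
Local Notation C := R[i].
Implicit Types (f g h : C -> C) (F G phi w : R -> R) (z : C) (p q : R).
Implicit Types (s t : seq (C * int)).
Hint Resolve mD : core.

(* Conjugating the terms of negative exponent keeps the real part on the circle. *)
Definition analytic_completion s := [seq (if 0 <= x.2 then x.1 else (x.1^*)%C, `|x.2|) | x <- s].

Lemma anl_analytic s : analytic (analytic_completion s).
Proof. by rewrite /analytic all_map; apply/allP => x _ /=. Qed.

Lemma Re_anl s x : reF (tp (analytic_completion s)) x = reF (tp s) x.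
Proof.
rewrite /reF; elim: s => [|a s IH]; first by rewrite !tp_nil.
rewrite /= !tp_cons !cReD IH; congr (_ + _); case: a => a k /=.
have [k0|k0] := leP 0 k; first by rewrite ger0_norm.
by rewrite ltr0_norm// -conj_circX -conjM cReC.
Qed.

Lemma tpcoef_cons x s (n : int) : tpcoef (x :: s) n = (if x.2 == n then x.1 else 0) + tpcoef s n.
Proof. by rewrite /tpcoef big_cons; case: ifP => // _; rewrite add0r. Qed.

Lemma tpcoef_anl0 s : tpcoef (analytic_completion s) 0 = tpcoef s 0.
Proof.
elim: s => [|[a k] s IH]; first by rewrite /tpcoef !big_nil.
rewrite /= !tpcoef_cons IH /= normr_eq0; congr (_ + _).
by case: eqP => // ->.
Qed.

Lemma tpcoef_anl s (n : int) : tpcoef (analytic_completion s) n =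
  if n == 0 then tpcoef s 0 else if 0 < n then tpcoef s n + ((tpcoef s (- n))^*)%C else 0.
Proof.
case: eqP => [->|/eqP n0]; first exact: tpcoef_anl0.
case: ifP => n1; last first.
  rewrite /tpcoef big1_seq// => y /andP[/eqP e /mapP[x _ ey]].
  have : 0 <= n by rewrite -e ey normr_ge0.
  by rewrite le_eqVlt eq_sym (negPf n0) n1.
elim: s => [|[a k] s IH]; first by rewrite /tpcoef !big_nil conjc0 addr0.
rewrite /= !tpcoef_cons IH /= conjD; have [k0|k0] := leP 0 k.
  rewrite ger0_norm// (_ : (k == - n) = false) ?conjc0 ?add0r ?addrA//.
  by apply/eqP => e; rewrite e oppr_ge0 leNgt n1 in k0.
rewrite ltr0_norm// (_ : (k == n) = false) ?add0r; last first.
  by apply/eqP => e; rewrite e ltNge ltW in k0.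
rewrite eqr_oppLR; case: ifP => _; rewrite ?conjc0 ?add0r//; exact: addrCA.
Qed.

Lemma half_double (c : C) : 2^-1 * (c + c) = c.
Proof. by field. Qed.

Lemma real_coef s : (forall x, imF (tp s) x = 0) -> forall n, tpcoef s (- n) = ((tpcoef s n)^*)%C.
Proof.
move=> h n; rewrite -!fourier_tp -{2}(opprK n) -fourier_conj; last exact: inLp_tp.
apply: eq_fourier => x; rewrite /fconj; have := h x; rewrite /imF.
by case: (tp s _) => a b /= ->; rewrite oppr0.
Qed.

Lemma tpP_anl s : (forall x, imF (tp s) x = 0) ->
  aeq (tp (tpP s)) (fun z => 2^-1 * (tp (analytic_completion s) z + tpcoef s 0)).
Proof.
move=> h; have hc := real_coef h.
have h1 : Lp 1 (fun z => tp (analytic_completion s) z + tpcoef s 0).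
  by apply: inLp_add => //; [exact: inLp_tp|exact: inLp_cst].
apply: fourier_inj => [||n]; [exact: inLp_tp|exact: inLp_scale|].
rewrite fourier_scale// fourier_add//; [|exact: inLp_tp|exact: inLp_cst].
rewrite !fourier_tp tpcoef_tpP tpcoef_anl.
rewrite (@eq_fourier _ _ (fun z => tpcoef s 0 * z ^ (0 : int))); last by move=> x; rewrite expr0z mulr1.
rewrite fourier_monomial; case: (eqVneq n 0) => [->|n0].
  by rewrite lexx half_double.
rewrite addr0 le_eqVlt eq_sym (negPf n0) /=; case: ifP => n1; last by rewrite mulr0.
by rewrite hc conjcK half_double.
Qed.

Lemma real_coef0 s : (forall x, imF (tp s) x = 0) -> (forall x, 0 <= reF (tp s) x) ->
  complex.Im (tpcoef s 0) = 0 /\ 0 <= complex.Re (tpcoef s 0).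
Proof.
move=> h h0; rewrite -fourier_tp fourierE cintE.
have e1 : rint (reF (fun z => tp s z * z ^ (- 0))) = rint (reF (tp s)).
  by apply: eq_int => x _; rewrite /reF expr0z mulr1.
have e2 : rint (imF (fun z => tp s z * z ^ (- 0))) = 0.
  rewrite -[RHS](mul0r (pi *+ 2)) -int_cst; apply: eq_int => x _.
  by have := h x; rewrite /imF expr0z mulr1.
rewrite e1 e2 cImM cReM /= !mulr0 mul0r addr0 subr0; split => //.
by rewrite mulr_ge0 ?invr_ge0 ?(ltW (pi2_gt0 R))//; exact: int_ge0.
Qed.

(** [P s] is half of the analytic completion plus half of the mean, and [riesz_positive] bounds the
    completion by its real part [s]. That bound asks for a positive lower bound of the real part, so
    a constant [e] is added and then sent to 0; the mean accounts for the summand [2 pi]. *)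
Lemma riesz_tp_pos p : 1 < p < 2 -> exists2 K : R, 0 <= K & forall s,
  (forall x, imF (tp s) x = 0) -> (forall x, 0 <= reF (tp s) x) ->
  normLp p (tp (tpP s)) <= K * normLp p (tp s).
Proof.
move=> hp; have [K K0 hK] := riesz_positive hp.
have /andP[p1 p2] := hp; have p1' := ltW p1.
have p0 : 0 < p by lra.
exists (K + pi *+ 2); first by rewrite addr_ge0// ltW// pi2_gt0.
move=> s him hre; set N := normLp p (tp s).
have N0 : 0 <= N by exact: normLp_ge0.
have [i0 r0] := real_coef0 him hre.
have Ls : Lp p (tp s) by apply: inLp_tp; exact: ltW.
have La : Lp p (tp (analytic_completion s)) by apply: inLp_tp; exact: ltW.
have bnd : normLp p (tp (analytic_completion s)) <= K * N.
  apply/ler_addgt0Pr => d d0.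
  pose e := d / (K + 1); have K1 : 0 < K + 1 by rewrite ltr_wpDl.
  have e0 : 0 < e by exact: divr_gt0.
  pose s' := (Complex e 0, 0 : int) :: analytic_completion s.
  have ts' z : tp s' z = Complex e 0 + tp (analytic_completion s) z by rewrite tp_cons /= expr0z mulr1.
  have := hK s' e; rewrite {1}/analytic /= -/(analytic _) anl_analytic => /(_ isT e0) h.
  have {}h : normLp p (tp s') <= K * normLp p (fun z => Complex (complex.Re (tp s' z)) 0).
    apply: h.
    - by move=> x; rewrite /reF ts' cReD /= lerDl -/(reF _ _) Re_anl.
    - by rewrite tpcoef_cons /= cImD tpcoef_anl0 i0 addr0.
    - by rewrite tpcoef_cons /= cReD tpcoef_anl0 addr_ge0// ltW.
  have Le : Lp p (fun=> Complex e 0 : C) by apply: inLp_cst; exact: ltW.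
  have ne : normLp p (fun=> Complex e 0 : C) = e.
    by rewrite absC_const// absC_real ger0_norm// ltW.
  have h2 : normLp p (fun z => Complex (complex.Re (tp s' z)) 0 : C) <= e + N.
    rewrite -ne; apply: le_trans (normLp_add p1' Le Ls).
    rewrite le_eqVlt; apply/orP; left; apply/eqP; apply: normLp_ab => x.
    rewrite /ab; congr absC; apply: eqCplx; rewrite ?cReD ?cImD /= ?add0r.
      by rewrite ts' cReD /=; congr (_ + _); exact: Re_anl.
    by rewrite -/(imF _ _) him.
  have Ls' : Lp p (tp s') by apply: inLp_tp; exact: ltW.
  have h3 : normLp p (tp (analytic_completion s)) <= normLp p (tp s') + e.
    rewrite -[X in _ + X]ne; apply: le_trans (normLp_sub p1' Ls' Le).
    rewrite le_eqVlt; apply/orP; left; apply/eqP; apply: normLp_ab => x.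
    by rewrite /ab ts' [X in absC (X - _)]addrC addrK.
  apply: (le_trans h3); apply: (le_trans (lerD h (lexx e))).
  apply: (le_trans (lerD (ler_wpM2l K0 h2) (lexx e))).
  have ed : e * (K + 1) = d by rewrite /e divfK// (lt0r_neq0 K1).
  by rewrite -ed (mulrDr K) (mulrDr e) mulr1 (mulrC e K) -addrA addrCA.
have L1 : Lp p (fun z => tp (analytic_completion s) z + tpcoef s 0).
  by apply: inLp_add => //; apply: inLp_cst; exact: ltW.
rewrite (normLp_aeq p _ _ (tpP_anl him)); last 2 first.
- exact: measC_tp.
- by apply: measC_scale; exact: inLp_m L1.
rewrite (normLp_scale _ p0 L1) absCV.
have -> : absC (2 : C) = 2.
  have -> : (2 : C) = Complex 2 0 by apply: eqCplx => /=; rewrite ?addr0.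
  by rewrite absC_real ger0_norm.
have Lc : Lp p (fun=> tpcoef s 0) by apply: inLp_cst; exact: ltW.
have h4 := normLp_add p1' La Lc; rewrite absC_const// in h4.
have h5 : absC (tpcoef s 0) <= pi *+ 2 * N by rewrite -fourier_tp; exact: fourier_norm.
have h6 := normLp_ge0 p (fun z => tp (analytic_completion s) z + tpcoef s 0).
set A := normLp p (fun z => tp (analytic_completion s) z + tpcoef s 0) in h4 h6 *.
rewrite mulrDl; lra.
Qed.

Lemma normLp_le_rint p f g : 0 < p ->
  rint (fun x => ab f x `^ p) <= rint (fun x => ab g x `^ p) -> normLp p f <= normLp p g.
Proof.
move=> p0 h.
have i0 u : 0 <= rint (fun x => ab u x `^ p) by apply: int_ge0 => x _; exact: powR_ge0.
have hm := ge0_ler_powR (ltW (eq_ind_r is_true p0 (invr_gt0 p))) (i0 f) (i0 g) h.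
rewrite (normLp_split p f) (normLp_split p g); apply: ler_wpM2l hm; exact: powR_ge0.
Qed.

Lemma tp_split s z : tp s z = tp (tpP s) z + tp [seq x <- s | x.2 < 0] z.
Proof.
elim: s => [|[a k] l IH] /=; first by rewrite !tp_nil addr0.
rewrite tp_cons IH /=; have [k0|k0] := leP 0 k; rewrite tp_cons /=.
  by rewrite addrA.
by rewrite addrCA.
Qed.

Lemma cross_coef s t : tpcoef (tpmul (tpP s) (tpconj [seq x <- t | x.2 < 0])) 0 = 0.
Proof.
rewrite /tpcoef big1_seq// => y /andP[/eqP y0 /allpairsP[[a b] /= [ha /mapP[c hc eb] e]]].
exfalso; move: y0; rewrite e eb /= => /eqP; apply/negP.
move: ha hc; rewrite !mem_filter => /andP[a0 _] /andP[c0 _].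
by rewrite gt_eqF// ltr_wpDl// oppr_gt0.
Qed.

Lemma cint_tp0 s : tpcoef s 0 = 0 -> cint (tp s) = 0.
Proof.
move=> h; apply: (mulfI (c2pi_neq0 R)); rewrite mulr0 -h -fourier_tp fourierE.
by congr (_ * _); apply: eq_cint => x _; rewrite expr0z mulr1.
Qed.

Lemma cross_int s t : cint (fun z => tp (tpP s) z * (tp [seq x <- t | x.2 < 0] z)^*%C) = 0.
Proof.
rewrite -(cint_tp0 (cross_coef s t)); apply: eq_cint => x _.
by rewrite tp_mul tp_conj.
Qed.

Lemma parseval_tpP s : normLp 2 (tp (tpP s)) <= normLp 2 (tp s).
Proof.
apply: (normLp_le_rint (ltr0Sn R 1)).
have e2 f x : ab f x `^ 2 = ab f x ^+ 2 by rewrite powR_mulrn.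
set N := [seq x <- s | x.2 < 0].
have L2 t : Lint (fun x => ab (tp t) x `^ 2).
  by have /inLpP[] : Lp 2 (tp t) by apply: inLp_tp.
have Lc : Lp 1 (fun z => tp (tpP s) z * (tp N z)^*%C).
  have : Lp 1 (tp (tpmul (tpP s) (tpconj N))) by exact: inLp_tp.
  apply: inLp_aeq; last by apply: aeq_eq => x; rewrite tp_mul tp_conj.
  by apply: measC_mul; [exact: measC_tp|apply: measC_conj; exact: measC_tp].
have -> : rint (fun x => ab (tp s) x `^ 2) =
   rint (fun x => (ab (tp (tpP s)) x `^ 2 + ab (tp N) x `^ 2) +
     2 * reF (fun z => tp (tpP s) z * (tp N z)^*%C) x).
  apply: eq_int => x _; rewrite !e2 /ab /reF !absC_sqr tp_split -/N cReM cReC cImC cReD cImD.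
  ring.
rewrite int_add; [|exact: Lint_add|apply: Lint_scale; exact: inL1_re].
rewrite int_scale; last exact: inL1_re.
have -> : rint (reF (fun z => tp (tpP s) z * (tp N z)^*%C)) = 0.
  by have := cross_int s s; rewrite cintE => -[].
rewrite mulr0 addr0 int_add// lerDl; apply: int_ge0 => x _; exact: powR_ge0.
Qed.

(** For every level [l > 0], [r^p <= l^(p-2) r^2 + l^p]; with [l] above the [L^2] norm both terms
    integrate to at most [2 pi l^p]. Taking [l] strictly above that norm keeps it positive when the
    norm is 0. *)
Lemma normLp_le2 p f : 1 < p < 2 -> Lp 2 f -> Lp p f /\ normLp p f <= 2 * normLp 2 f.
Proof.
move=> /andP[p1 p2] /inLpP[mf hf]; have p0 : 0 < p by lra.
have pt (l r : R) : 0 < l -> 0 <= r -> r `^ p <= l `^ (p - 2) * r `^ 2 + l `^ p.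
  move=> l0 r0; have [h|h] := leP r l.
    apply: (@le_trans _ _ (l `^ p)); last by rewrite lerDr mulr_ge0 ?powR_ge0.
    by apply: ge0_ler_powR; rewrite ?nnegrE ?(ltW p0) ?(ltW l0).
  have rp : 0 < r by exact: lt_trans h.
  apply: (@le_trans _ _ (l `^ (p - 2) * r `^ 2)); last by rewrite lerDl powR_ge0.
  have -> : r `^ p = r `^ (p - 2) * r `^ 2.
    rewrite -powRD; last by apply/implyP => _; rewrite gt_eqF.
    by rewrite subrK.
  rewrite ler_wpM2r ?powR_ge0// -(opprB 2 p).
  by apply: powR_neg_le; rewrite ?(ltW h)// subr_ge0 ltW.
have Lpf : Lint (fun x => ab f x `^ p).
  apply: (@Lint_le _ _ (fun x => 1 `^ (p - 2) * ab f x `^ 2 + 1 `^ p)).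
  - exact: mabp.
  - by apply: Lint_add; [exact: Lint_scale|exact: Lint_cst].
  - by move=> x _; rewrite ger0_norm ?powR_ge0//; apply: pt.
split; first by apply/inLpP.
set N := normLp 2 f; have N0 : 0 <= N by exact: normLp_ge0.
have hl (l : R) : N < l -> normLp p f <= 2 * l.
  move=> lN; have l0 : 0 < l by exact: le_lt_trans lN.
  have h1 : rint (fun x => ab f x `^ p) <= l `^ (p - 2) * (pi *+ 2 * N `^ 2) + l `^ p * (pi *+ 2).
    rewrite -(normLpK f) // -int_cst -int_scale// -int_add; [|exact: Lint_scale|exact: Lint_cst].
    apply: int_le => //; first by apply: Lint_add; [exact: Lint_scale|exact: Lint_cst].
    by move=> x _; exact: pt.
  rewrite leNgt; apply/negP => h2.
  have h3 : (2 * l) `^ p < normLp p f `^ p.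
    by apply: gt0_ltr_powR; rewrite ?nnegrE ?normLp_ge0 ?mulr_ge0 ?(ltW l0).
  have h4 : pi *+ 2 * (2 * l) `^ p < pi *+ 2 * normLp p f `^ p by rewrite ltr_pM2l ?pi2_gt0.
  rewrite -normLpK// in h4.
  have h5 : l `^ (p - 2) * (pi *+ 2 * N `^ 2) <= pi *+ 2 * l `^ p.
    rewrite mulrCA ler_wpM2l ?(ltW (pi2_gt0 R))//.
    have -> : l `^ p = l `^ (p - 2) * l `^ 2.
      rewrite -powRD; last by apply/implyP => _; rewrite gt_eqF.
      by rewrite subrK.
    apply: ler_wpM2l; first exact: powR_ge0.
    exact: (ge0_ler_powR (ltW (ltr0Sn R 1)) N0 (ltW l0) (ltW lN)).
  have h6 : 2 * l `^ p <= (2 * l) `^ p.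
    rewrite powRM ?(ltW l0)// ler_wpM2r ?powR_ge0//.
    rewrite -{1}(powRr1 (ltW (ltr0Sn R 1))); apply: ler_powR; last exact: ltW.
    by rewrite ler1n.
  have h7 : pi *+ 2 * (2 * l `^ p) <= pi *+ 2 * (2 * l) `^ p by rewrite ler_wpM2l// ltW// pi2_gt0.
  move: (lt_le_trans h4 h1); apply/negP; rewrite -leNgt.
  apply: (le_trans (lerD h5 (lexx _))); apply: le_trans h7.
  by rewrite le_eqVlt; apply/orP; left; apply/eqP; ring.
apply/ler_addgt0Pr => e e0.
apply: (le_trans (hl (N + e / 2) _)); last by lra.
by rewrite ltrDl; lra.
Qed.

Lemma dens_pos2 F (M : R) : 0 < M -> mfun F -> (forall x, 0 <= F x <= M) ->
  forall e : R, 0 < e -> exists s, [/\ (forall x, imF (tp s) x = 0), (forall x, 0 <= reF (tp s) x) &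
    forall f, measC f -> (forall x, ab f x = `|reF (tp s) x - F x|) -> normLp 2 f < e].
Proof.
move=> M0 mF hF e e0.
have d0 : 0 < pi *+ 2 * e `^ 2 / M by rewrite divr_gt0// mulr_gt0 ?pi2_gt0 ?powR_gt0.
have [phi [[s hs] h1 h2]] := dens_pos (@Lint_cst R 1) (fun=> ler01) M0 mF hF d0.
have re x : reF (tp s) x = phi x by rewrite /reF hs.
exists s; split; [by move=> x; rewrite /imF hs|by move=> x; rewrite re; have /andP[] := h1 x|].
move=> f mf hf; apply: normLp_lt => //.
have bf x : ab f x <= M.
  by rewrite hf re ler_norml; have := h1 x; have := hF x; lra.
have iab : Lint (ab f).
  by have /inL1P[] : Lp 1 f by apply: (@inLp_bdd _ _ _ M).
apply: (@le_lt_trans _ _ (M * rint (ab f))).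
  rewrite -int_scale//; apply: int_le.
  - by have /inLpP[] : Lp 2 f by apply: (@inLp_bdd _ _ _ M).
  - exact: Lint_scale.
  move=> x _; rewrite powR_mulrn; last exact: ab_ge0.
  by rewrite expr2; apply: ler_wpM2r; [exact: ab_ge0|exact: bf].
rewrite mulrC -ltr_pdivlMr//; apply: le_lt_trans h2.
by rewrite le_eqVlt; apply/orP; left; apply/eqP; apply: eq_int => x _; rewrite hf re mulr1.
Qed.

End RieszTheorem.

(** * A weighted converse of Hoelder's inequality *)

Section ConverseHoelder.
Variable R : realType.
Local Notation C := R[i].
Local Notation D := (@I02pi R).
Local Notation T := (measurableTypeR R).
Implicit Types (f h : C -> C) (F G phi w : R -> R) (z : C).
Implicit Types (s t : seq (C * int)).
Hint Resolve mD ab_ge0 absC_ge0 : core.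
Variables (p : R) (g e : C -> C) (A : R).
Hypotheses (p1 : 1 < p) (hg : Lp 1 g) (he : Lp p e) (A0 : 0 <= A).
Hypothesis hA : forall s, absC (cint (fun z => g z * tp s z)) <= pi *+ 2 * A * normLp p (fun z => e z * tp s z).
Local Notation q := (conjexp p).

Let k z := g z / e z.
Let b (N : nat) z := (absC (k z) <= N%:R) && ((N.+1%:R)^-1 <= absC (e z)).
(** The extremal function of Hoelder's inequality for [k = g / e]: where [e] is not 0,
    [g h0 = |k|^q = |e h0|^p]. The cutoff [b N] makes it bounded, hence replaceable by the
    trigonometric polynomials of [hA]. Where [e] vanishes, [k] is 0 by convention. *)
Let h0 z := (k z)^*%C * Complex (absC (k z) `^ (q - 2)) 0 / e z.
Let h (N : nat) z := if b N z then h0 z else 0.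
Let F (N : nat) (x : R) := if b N (circ x) then ab k x `^ q else 0.

Let p0 : 0 < p. Proof. exact: lt_trans p1. Qed.
Let q1 : 1 < q. Proof. by have [] := conj_exp p1. Qed.
Let q0 : 0 < q. Proof. exact: lt_trans q1. Qed.
Let mg : measC g. Proof. exact: inLp_m hg. Qed.
Let me : measC e. Proof. exact: inLp_m he. Qed.
Let mk : measC k. Proof. by apply: measC_mul; [|exact: measC_inv]. Qed.

Lemma conjexp_mul : (q - 1) * p = q.
Proof.
have p2 : p - 1 != 0 by rewrite lt0r_neq0// subr_gt0.
by rewrite /conjexp; field.
Qed.

Lemma powR_pred (y r : R) : 1 < r -> 0 <= y -> y * y `^ (r - 2) = y `^ (r - 1).
Proof.
move=> r1; rewrite le_eqVlt => /predU1P[<-|y0].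
  by rewrite mul0r powR0// lt0r_neq0// subr_gt0.
rewrite -{1}(powRr1 (ltW y0)) -powRD; last by apply/implyP => _; rewrite lt0r_neq0.
by congr (_ `^ _); ring.
Qed.

Let ab_h0 x : ab h0 x = ab k x `^ (q - 1) / ab e x.
Proof.
have hk := powR_pred q1 (ab_ge0 k x).
by rewrite /ab /h0 absCM absCM absC_conj absC_real ger0_norm ?powR_ge0// absCV -hk.
Qed.

Let mset_b N : measurable (D `&` [set x | b N (circ x)] : set T).
Proof.
have := measurableI _ _ (mset_le N%:R (mab mk)) (mset_ge (N.+1%:R)^-1 (mab me)).
congr measurable; apply/seteqP; split => x /=.
  by move=> [[Dx h1] [_ h2]]; split => //; rewrite /b h1.
by move=> [Dx /andP[h1 h2]].
Qed.

Let mh N : measC (h N).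
Proof.
apply: measC_if => //; last exact: measC_cst.
apply: measC_mul; last exact: measC_inv.
apply: measC_mul; first exact: measC_conj.
by apply: (@measC_real _ (fun z => absC (k z) `^ (q - 2))); exact: mabp.
Qed.

Let M N : R := N%:R `^ (q - 1) * N.+1%:R + 1.
Let M0 N : 0 < M N. Proof. by rewrite ltr_wpDl// mulr_ge0 ?powR_ge0. Qed.
Let bh N x : ab (h N) x <= M N.
Proof.
rewrite /ab /h; case: ifP => [/andP[h1 h2]|_]; last by rewrite absC0 ltW.
rewrite -[absC _]/(ab h0 x) ab_h0; apply: (@le_trans _ _ (N%:R `^ (q - 1) * N.+1%:R)); last by rewrite lerDl.
apply: ler_pM; rewrite ?powR_ge0 ?invr_ge0 ?ab_ge0//.
  apply: ge0_ler_powR; rewrite ?nnegrE ?ab_ge0 ?subr_ge0 ?(ltW q1)//.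
by rewrite -[leRHS]invrK lef_pV2// posrE ?invr_gt0// (lt_le_trans _ h2)// invr_gt0.
Qed.

Lemma mul_div_cancel (u v w1 w2 : C) : v != 0 -> u * v * (w1 * w2 / v) = u * w1 * w2.
Proof. by move=> v0; field. Qed.

Let gh N x : g (circ x) * h N (circ x) = Complex (F N x) 0.
Proof.
rewrite /h /F; case: ifP => [/andP[h1 h2]|_]; last by rewrite mulr0.
have e0 : e (circ x) != 0.
  apply/eqP => e0; move: h2; rewrite e0 absC0 leNgt invr_gt0 ltr0n //.
have -> : g (circ x) * h0 (circ x) = (k (circ x) * (k (circ x))^*%C) * Complex (ab k x `^ (q - 2)) 0.
  have gk : g (circ x) = k (circ x) * e (circ x) by rewrite /k divfK.
  by rewrite gk /h0 mul_div_cancel.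
rewrite mul_conjC; apply: eqCplx; rewrite /= !mulr0 ?mul0r ?subr0 ?addr0//.
rewrite expr2 -mulrA (powR_pred q1 (ab_ge0 _ _)).
have [k0|kn] := eqVneq (ab k x) 0.
  by rewrite -/(ab k x) k0 mul0r powR0// lt0r_neq0.
rewrite -/(ab k x) -[X in X * _](powRr1 (ab_ge0 k x)) -powRD; last by apply/implyP => _; exact: kn.
by congr (_ `^ _); ring.
Qed.

Let eh N x : ab (fun z => e z * h N z) x `^ p = F N x.
Proof.
rewrite /ab /h /F; case: ifP => [/andP[h1 h2]|_]; last by rewrite mulr0 absC0 powR0 ?lt0r_neq0.
rewrite absCM -[absC (h0 _)]/(ab h0 x) ab_h0 mulrCA mulfV ?mulr1 ?lt0r_neq0//.
  by rewrite -powRrM conjexp_mul.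
by apply: lt_le_trans h2; rewrite invr_gt0.
Qed.

Let LehN N : Lp p (fun z => e z * h N z).
Proof.
have [] := @inLp_Linf _ p e (h N) (M N) p0 (mh N) _ he; first by apply: aeD_all => x _; exact: bh.
by move=> h1 _; under eq_fun do rewrite mulrC.
Qed.

Let LF N : Lint (F N).
Proof. by have /inLpP[_] := LehN N; under eq_fun do rewrite eh. Qed.

Let F0 N x : 0 <= F N x. Proof. by rewrite /F; case: ifP => // _; exact: powR_ge0. Qed.

Lemma le_lin_eps (X Y c : R) : 0 <= c -> (forall d, 0 < d -> X <= Y + c * d) -> X <= Y.
Proof.
move=> c0 H; apply/ler_addgt0Pr => d d0; have c1 : 0 < c + 1 by rewrite ltr_wpDl.
apply: (le_trans (H (d / (c + 1)) (divr_gt0 d0 c1))); rewrite lerD2l mulrCA ger_pMr//.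
by rewrite ler_pdivrMr// mul1r lerDl.
Qed.

Let Fbound N : rint (F N) <= pi *+ 2 * A * normLp p (fun z => e z * h N z).
Proof.
have pp := ltW (pi2_gt0 R).
apply: (@le_lin_eps _ _ (pi *+ 2 * A + 2)).
  by apply: addr_ge0 => //; apply: mulr_ge0.
move=> d d0.
(* One weight controls both replacement errors: the integral of [|g u|] and, because [u] is bounded,
   that of [|e u|^p]. *)
pose w x := 1 + (ab g x + ab e x `^ p).
have /inL1P[_ ig] := hg; have /inLpP[_ ie] := he.
have iw : Lint w by apply: Lint_add; [exact: Lint_cst|exact: Lint_add].
have w0 x : 0 <= w x by rewrite /w !addr_ge0 ?ab_ge0 ?powR_ge0.
pose m := Num.min d (pi *+ 2 * d `^ p / (5 * M N) `^ (p - 1)).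
have M5 : 0 < 5 * M N by exact: mulr_gt0.
have m0 : 0 < m.
  rewrite lt_min d0 divr_gt0 ?powR_gt0//; apply: mulr_gt0; [exact: pi2_gt0|exact: powR_gt0].
have [s [bs hs]] := dens_bdd iw w0 (M0 N) (mh N) (bh N) m0.
pose u z := tp s z - h N z.
have mu_ : measC u by apply: measC_sub => //; exact: measC_tp.
have bu x : ab u x <= 5 * M N.
  apply: (le_trans (absCD _ _)); rewrite absCN.
  by have := bs x; have := bh N x; rewrite /ab; lra.
have iuw : Lint (fun x => ab u x * w x).
  apply: (@Lint_le _ _ (fun x => 5 * M N * w x)); last 1 first.
  - move=> x _; rewrite ger0_norm; last by apply: mulr_ge0; [exact: ab_ge0|exact: w0].
    by apply: ler_wpM2r; [exact: w0|exact: bu].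
  - by apply: (@measurable_funM _ T) => //; [exact: mab|exact: Lint_m iw].
  exact: Lint_scale.
have [Leu _] : Lp p (fun z => u z * e z) /\ normLp p (fun z => u z * e z) <= `|5 * M N| * normLp p e.
  by apply: (inLp_Linf p0 mu_ _ he); apply: aeD_all.
have neu : normLp p (fun z => u z * e z) <= d.
  apply/ltW/normLp_lt => //.
  apply: (@le_lt_trans _ _ ((5 * M N) `^ (p - 1) * rint (fun x => ab u x * w x))).
    rewrite -int_scale//; apply: int_le; [by have /inLpP[] := Leu|exact: Lint_scale|].
    move=> x _; rewrite /ab absCM powRM// mulrA; apply: ler_pM; rewrite ?powR_ge0//.
      by apply: powR_le_lin; [exact: ltW|rewrite absC_ge0; exact: bu].
    by rewrite /w addrA; exact: (ler_wpDl (addr_ge0 ler01 (ab_ge0 g x)) (lexx _)).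
  rewrite mulrC -ltr_pdivlMr ?powR_gt0//; apply: (lt_le_trans hs).
  by rewrite /m ge_min lexx orbT.
have Leh := LehN N.
have Lgu : Lp 1 (fun z => g z * u z).
  have [] := @inLp_Linf _ 1 g u (5 * M N) ltr01 mu_ _ hg; first by apply: aeD_all.
  by move=> h1 _; under eq_fun do rewrite mulrC.
have Lgs : Lp 1 (fun z => g z * tp s z).
  have [] := @inLp_Linf _ 1 g (tp s) (4 * M N) ltr01 (measC_tp s) _ hg; first by apply: aeD_all.
  by move=> h1 _; under eq_fun do rewrite mulrC.
have -> : rint (F N) = absC (cint (fun z => g z * tp s z - g z * u z)).
  rewrite (@eq_cint _ _ (fun z => g z * h N z)); last by move=> x _; rewrite /u; ring.
  rewrite cintE.
  have -> : rint (reF (fun z => g z * h N z)) = rint (F N) by apply: eq_int => x _; rewrite /reF gh.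
  have -> : rint (imF (fun z => g z * h N z)) = 0.
    by rewrite -[RHS](mul0r (pi *+ 2)) -int_cst; apply: eq_int => x _; rewrite /imF gh.
  by rewrite absC_real ger0_norm//; exact: int_ge0.
have -> : cint (fun z => g z * tp s z - g z * u z) =
    cint (fun z => g z * tp s z) + - cint (fun z => g z * u z).
  rewrite -mulN1r -cint_scale// -cint_add//; last exact: inLp_scale.
  by apply: eq_cint => x _; rewrite mulN1r.
apply: (le_trans (absCD _ _)); rewrite absCN.
have gu : absC (cint (fun z => g z * u z)) <= 2 * d.
  apply: (le_trans (cint_abs Lgu)); apply: ler_wpM2l => //.
  apply: (@le_trans _ _ (rint (fun x => ab u x * w x))); last first.
    by apply: ltW; apply: (lt_le_trans hs); rewrite /m ge_min lexx.
  apply: int_le => //; first by have /inL1P[] := Lgu.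
  move=> x _; rewrite /ab absCM mulrC; apply: ler_wpM2l; first exact: absC_ge0.
  by rewrite /w addrCA lerDl addr_ge0// powR_ge0.
have es : normLp p (fun z => e z * tp s z) <= normLp p (fun z => e z * h N z) + d.
  have -> : normLp p (fun z => e z * tp s z) = normLp p (fun z => e z * h N z + u z * e z).
    by congr normLp; apply/funext => z; rewrite /u; ring.
  by apply: (le_trans (normLp_add (ltW p1) Leh Leu)); rewrite lerD2l.
apply: (le_trans (lerD (hA s) gu)).
apply: (le_trans (lerD (ler_wpM2l _ es) (lexx _))); first exact: mulr_ge0.
by rewrite le_eqVlt; apply/orP; left; apply/eqP; ring.
Qed.

Lemma pq_inv : p^-1 + q^-1 = 1. Proof. by have [] := conj_exp p1. Qed.

(** For the norm [Y] of [e h], [Fbound] reads [Y^p <= A Y]; dividing by [Y] and raising to the power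
    [q] gives [Y^p <= A^q], since [(p - 1) q = p]. *)
Let Fbound2 N : rint (F N) <= pi *+ 2 * A `^ q.
Proof.
have pp := pi2_gt0 R.
pose Y := normLp p (fun z => e z * h N z).
have Y0 : 0 <= Y by exact: normLp_ge0.
have eY : rint (F N) = pi *+ 2 * Y `^ p.
  by rewrite -normLpK//; congr rint; apply/funext => x; rewrite eh.
have := Fbound N; rewrite -/Y eY -mulrA !ler_pM2l// => h1.
have [->|Yn] := eqVneq Y 0; first by rewrite powR0 ?lt0r_neq0 ?powR_ge0.
have Yp : 0 < Y by rewrite lt0r Yn.
have h2 : Y `^ (p - 1) <= A.
  rewrite -(ler_pM2r Yp); apply: le_trans h1; rewrite le_eqVlt; apply/orP; left; apply/eqP.
  rewrite -{2}(powRr1 Y0) -powRD; first by congr (_ `^ _); ring.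
  by apply/implyP.
have h3 := ge0_ler_powR (ltW q0) (powR_ge0 Y (p - 1)) A0 h2.
apply: le_trans h3; rewrite -powRrM le_eqVlt; apply/orP; left; apply/eqP; congr (_ `^ _).
have p2 : p - 1 != 0 by rewrite lt0r_neq0// subr_gt0.
by rewrite /conjexp; field.
Qed.

(** Monotone convergence as the cutoff is removed. It stands in for the dual of [L^p] three times:
    for the projection bound at [p > 2] ([e = 1]), for [1 / e] in [L^q] ([g = 1]), and for the lower
    bound of the dual Toeplitz operator ([e = 1]). *)
Lemma converse_hoelder : Lp q (fun z => g z / e z) /\ normLp q (fun z => g z / e z) <= A.
Proof.
have [||||||Lk hk] := @rint_monotone_cvg _ F (fun x => ab k x `^ q) (pi *+ 2 * A `^ q).
- exact: LF.
- exact: mabp.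
- by move=> N x _; exact: F0.
- move=> x _; apply/nondecreasing_seqP => N; rewrite /F; case: ifP => [/andP[h1 h2]|_]; last exact: F0.
  rewrite ifT//; apply/andP; split; first by rewrite (le_trans h1)// ler_nat.
  by apply: le_trans h2; rewrite lef_pV2 ?posrE// ler_nat.
- apply: aeD_all => x _; apply: cvg_near_cst.
  have [k0|kn] := eqVneq (ab k x) 0.
    by exists 0%N => // N _ /=; rewrite /F k0 powR0 ?lt0r_neq0//; case: ifP.
  have e0 : 0 < ab e x.
    apply: absC_gt0; apply/eqP => e0; move/eqP: kn; apply.
    by rewrite /ab /k e0 invr0 mulr0 absC0.
  exists (Num.truncn (ab k x) + Num.truncn (ab e x)^-1).+1 => // N /= hN.
  rewrite /F ifT//; apply/andP; split.
    apply: (le_trans (ltW (truncnS_gt _))); rewrite ler_nat; apply: leq_trans hN.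
    by rewrite ltnS leq_addr.
  rewrite -[leRHS]invrK lef_pV2 ?posrE ?invr_gt0//.
  apply: (le_trans (ltW (truncnS_gt _))); rewrite ler_nat ltnS; apply: leq_trans (ltnW hN).
  by rewrite leq_addl.
- exact: Fbound2.
have Lqk : Lp q k by apply/inLpP.
split => //; rewrite (normLpK k q0) ler_pM2l ?pi2_gt0// in hk.
rewrite leNgt; apply/negP => h1.
have := gt0_ltr_powR q0 A0 (normLp_ge0 q k) h1.
by rewrite ltNge hk.
Qed.

End ConverseHoelder.

(** * Boundedness of the projection on trigonometric polynomials *)

Section RieszProjectionBound.
Variable R : realType.
Local Notation C := R[i].
Local Notation T := (measurableTypeR R).
Implicit Types (f g h : C -> C) (F G : R -> R) (z : C) (p q K : R).
Implicit Types (s t : seq (C * int)).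
Hint Resolve mD ab_ge0 absC_ge0 : core.

Lemma normLp_tpD p s t : 1 <= p ->
  normLp p (tp (s ++ t)) <= normLp p (tp s) + normLp p (tp t).
Proof.
move=> p1; have p0 := ltW (lt_le_trans ltr01 p1).
have -> : tp (s ++ t) = (fun z => tp s z + tp t z) by apply/funext => z; rewrite tp_cat.
by apply: normLp_add => //; exact: inLp_tp.
Qed.
Lemma normLp_tpZ p (c : C) s : 0 < p -> normLp p (tp (tpscale c s)) = absC c * normLp p (tp s).
Proof.
move=> p0; have -> : tp (tpscale c s) = (fun z => c * tp s z) by apply/funext => z; rewrite tp_scale.
exact: (normLp_scale c p0 (inLp_tp s (ltW p0))).
Qed.

Definition tpsum (c : nat -> C) (S : nat -> seq (C * int)) (n : nat) :=
  flatten [seq tpscale (c i) (S i) | i <- iota 0 n].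

Lemma tp_sum c S n z : tp (tpsum c S n) z = \sum_(i < n) c i * tp (S i) z.
Proof.
elim: n => [|n IH]; first by rewrite big_ord0 /tpsum /= tp_nil.
by rewrite big_ord_recr /= -IH /tpsum -addn1 iotaD map_cat flatten_cat tp_cat /= cats0 tp_scale.
Qed.

Lemma tpP_sum c S n : tpP (tpsum c S n) = tpsum c (fun i => tpP (S i)) n.
Proof.
elim: n => [//|n IH]; rewrite /tpsum -addn1 !iotaD !map_cat !flatten_cat tpP_cat IH /= !cats0.
by rewrite tpP_scale.
Qed.

Lemma normLp_tpsum p c S n : 1 <= p ->
  normLp p (tp (tpsum c S n)) <= \sum_(i < n) absC (c i) * normLp p (tp (S i)).
Proof.
move=> p1; have p0 := lt_le_trans ltr01 p1.
elim: n => [|n IH].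
  rewrite big_ord0 (_ : tp _ = fun=> 0) ?normLp0//; apply/funext => z.
  by rewrite tp_sum big_ord0.
rewrite big_ord_recr /= /tpsum -addn1 iotaD map_cat flatten_cat /= cats0.
by apply: (le_trans (normLp_tpD _ _ p1)); rewrite normLp_tpZ// lerD2r.
Qed.

Definition unit4 (i : nat) : C :=
  nth 0 [:: 1; -1; Complex 0 1; Complex 0 (-1)] i.
Definition part4 f (i : nat) (z : C) : R :=
  nth 0 [:: Num.max (complex.Re (f z)) 0; Num.max (- complex.Re (f z)) 0;
            Num.max (complex.Im (f z)) 0; Num.max (- complex.Im (f z)) 0] i.

Lemma max_parts (x : R) : Num.max x 0 - Num.max (- x) 0 = x.
Proof. by case: (leP x 0) => h; [rewrite max_l ?oppr_ge0//|rewrite max_r ?oppr_le0 ?ltW//]; ring. Qed.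

Lemma sum_part4 f z : f z = \sum_(i < 4) unit4 i * Complex (part4 f i z) 0.
Proof.
rewrite !big_ord_recl big_ord0 /unit4 /part4 /=.
by apply: eqCplx => /=; rewrite -[LHS]max_parts; ring.
Qed.

Lemma part4_ge0 f i z : 0 <= part4 f i z.
Proof.
by case: i => [|[|[|[|i]]]]; rewrite /part4 /= ?le_max ?lexx ?orbT// nth_nil.
Qed.

Lemma part4_le f i z : part4 f i z <= absC (f z).
Proof.
have := absC_Re (f z); have := absC_Im (f z); rewrite !ler_norml => /andP[h1 h2] /andP[h3 h4].
case: i => [|[|[|[|i]]]]; rewrite /part4 /= ?ge_max ?absC_ge0 ?andbT// ?nth_nil ?absC_ge0//.
  by rewrite lerNl.
by rewrite lerNl.
Qed.

Lemma part4_m f i : measC f -> mfun (fun x => part4 f i (circ x)).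
Proof.
move=> [mr mi]; have mz : mfun (fun=> 0 : R) by exact: measurable_cst.
have mo F : mfun F -> mfun (fun x => - F x) 
    by move=> mF; under eq_fun do rewrite -sub0r; exact: (@measurable_funB _ T).
case: i => [|[|[|[|i]]]]; rewrite /part4 /=.
- exact: (@measurable_maxr _ T).
- by apply: (@measurable_maxr _ T) => //; exact: mo.
- exact: (@measurable_maxr _ T).
- by apply: (@measurable_maxr _ T) => //; exact: mo.
- by under eq_fun do rewrite nth_nil.
Qed.

Lemma absC_unit4 (i : 'I_4) : absC (unit4 i) = 1.
Proof.
have e (x : R) : x ^+ 2 = 1 -> absC (Complex 0 x) = 1.
  by move=> hx; rewrite absCE /= hx expr0n add0r sqrtr1.
case: i => [[|[|[|[|i]]]] hi] //.
- exact: absC1.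
- by rewrite -[LHS]/(absC (-1 : C)) absCN absC1.
- by rewrite -[LHS]/(absC (Complex 0 1)) e ?expr1n.
- by rewrite -[LHS]/(absC (Complex 0 (-1))) e ?sqrrN ?expr1n.
Qed.

(** The four nonnegative parts of [s] need not be trigonometric polynomials, so each is replaced by
    a nonnegative one within [d] in [L^2]. The remainder [eta] is handled by orthogonality in [L^2],
    which embeds into [L^p] for [p < 2]; this is why the approximation is made in [L^2]. *)
Lemma riesz_tp_lt2 p : 1 < p < 2 -> exists2 K, 0 <= K & forall s,
  normLp p (tp (tpP s)) <= K * normLp p (tp s).
Proof.
move=> hp; have [K K0 hK] := riesz_tp_pos hp; have /andP[p1 p2] := hp.
have p1' := ltW p1; have p0 : 0 < p by exact: lt_trans p1.
exists (4 * K); first exact: mulr_ge0.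
move=> s; set N := normLp p (tp s); have N0 : 0 <= N by exact: normLp_ge0.
pose B := tpbound s + 1.
have Bs x : ab (tp s) x <= B by apply: (le_trans (ab_tp s x)); rewrite lerDl.
have B0 : 0 < B by rewrite ltr_wpDl// (le_trans (ab_ge0 _ _) (ab_tp s 0)).
(* The four parts contribute [2 K d] each, and the remainder of [L^2] norm [4 d] contributes [8 d]
   through the embedding constant 2. *)
apply: (@le_lin_eps _ _ _ (8 * K + 8)); first by rewrite addr_ge0 ?mulr_ge0.
move=> d d0.
have hb i x : 0 <= part4 (tp s) i (circ x) <= B.
  by rewrite part4_ge0 (le_trans (part4_le _ _ _) (Bs x)).
have mp i : mfun (fun x => part4 (tp s) i (circ x)) by apply: part4_m; exact: measC_tp.
pose FC i z : C := Complex (part4 (tp s) i z) 0.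
have mFC i : measC (FC i) by exact: measC_real.
have LFC (r : R) i : 0 <= r -> Lp r (FC i).
  move=> r0; apply: (@inLp_bdd _ _ _ B) => // x _.
  by rewrite /ab absC_real ger0_norm ?part4_ge0//; have /andP[] := hb i x.
have nFC i : normLp p (FC i) <= N.
  apply: normLp_le_rint => //; apply: int_le.
  - by have /inLpP[] := LFC p i (ltW p0).
  - by have /inLpP[] : Lp p (tp s) by exact: inLp_tp (ltW p0).
  move=> x _; apply: ge0_ler_powR; rewrite ?nnegrE ?(ltW p0) ?ab_ge0//.
  by rewrite /ab absC_real ger0_norm ?part4_ge0// part4_le.
have ch i : exists si, [/\ (forall x, imF (tp si) x = 0), (forall x, 0 <= reF (tp si) x) &
    normLp 2 (fun z => tp si z - FC i z) < d].
  have [si [h1 h2 h3]] := dens_pos2 B0 (mp i) (hb i) d0.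
  exists si; split => //; apply: h3; first by apply: measC_sub => //; exact: measC_tp.
  move=> x; rewrite /ab /FC -absC_real; congr absC; apply: eqCplx.
    by rewrite cReD.
  by rewrite cImD /= oppr0 addr0; exact: h1.
have [si hsi] := boolp.choice ch.
pose st := tpsum unit4 si 4.
pose eta := s ++ tpscale (-1) st.
have neta : normLp 2 (tp eta) <= 4 * d.
  have -> : tp eta = fun z => \sum_(i <- iota 0 4) - unit4 i * (tp (si i) z - FC i z).
    apply/funext => z; rewrite tp_cat tp_scale tp_sum (sum_part4 (tp s) z) -/(index_iota 0 4) big_mkord mulr_sumr -big_split /=.
    by apply: eq_bigr => i _; rewrite /FC; ring.
  have h2 : 1 <= (2 : R) by rewrite ler1n.
  have h20 : 0 < (2 : R) by [].
  have Lt i : Lp 2 (fun z => tp (si i) z - FC i z) 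
    by apply: (inLp_sub h2); [exact: inLp_tp (ler0n R 2)|exact: (LFC 2 _ (ler0n R 2))].
  have : forall l, (forall i, i \in l -> (i < 4)%N) ->
     Lp 2 (fun z => \sum_(i <- l) - unit4 i * (tp (si i) z - FC i z)) /\
     normLp 2 (fun z => \sum_(i <- l) - unit4 i * (tp (si i) z - FC i z)) <= (size l)%:R * d.
    elim=> [|i l IH] hl.
      under eq_fun do rewrite big_nil.
      by split; [exact: inLp0|rewrite normLp0// mul0r].
    under eq_fun do rewrite big_cons.
    have [] := IH; first by move=> j jl; apply: hl; rewrite inE jl orbT.
    move=> L1 n1; have Li : Lp 2 (fun z => - unit4 i * (tp (si i) z - FC i z)) by exact: inLp_scale.
    split; first exact: inLp_add.
    apply: (le_trans (normLp_add h2 Li L1)).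
    rewrite normLp_scale// absCN.
    have hi : (i < 4)%N by apply: hl; rewrite inE eqxx.
    rewrite (absC_unit4 (Ordinal hi)) mul1r -[(size (i :: l))%:R]natr1 (mulrDl (size l)%:R) mul1r [leRHS]addrC; apply: lerD n1.
    by have [_ _ /ltW] := hsi i.
  by move=> /(_ (iota 0 4))[]// i; rewrite mem_iota.
have ePs : tp (tpP s) = tp (tpP st ++ tpP eta).
  apply/funext => z; rewrite /eta tpP_cat !tp_cat tpP_scale tp_scale; ring.
rewrite ePs; apply: (le_trans (normLp_tpD _ _ p1')).
have h1 : normLp p (tp (tpP eta)) <= 2 * (4 * d).
  have [_ h1] := normLp_le2 hp (@inLp_tp R 2 (tpP eta) (ler0n R 2)).
  exact: (le_trans h1 (ler_wpM2l (ler0n R 2) (le_trans (parseval_tpP eta) neta))).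
have h2 : normLp p (tp (tpP st)) <= 4 * (K * (N + 2 * d)).
  rewrite tpP_sum; apply: (le_trans (normLp_tpsum _ _ _ p1')).
  rewrite (_ : 4 * _ = \sum_(i < 4) K * (N + 2 * d)); last by rewrite sumr_const card_ord mulr_natl.
  apply: ler_sum => i _; rewrite absC_unit4 mul1r /=.
  have [him hre hn] := hsi i.
  apply: (le_trans (hK _ him hre)); apply: ler_wpM2l => //.
  have Li : Lp p (tp (si i)) by exact: inLp_tp (ltW p0).
  have Lf := LFC p i (ltW p0).
  have -> : tp (si i) = fun z => FC i z + (tp (si i) z - FC i z) by apply/funext => z; ring.
  apply: (le_trans (normLp_add p1' Lf (inLp_sub p1' Li Lf))); apply: lerD => //.
  have L2d : Lp 2 (fun z => tp (si i) z - FC i z).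
    by apply: inLp_sub; [rewrite ler1n|exact: inLp_tp (ler0n R 2)|exact: (LFC 2 _ (ler0n R 2))].
  have [_ h4] := normLp_le2 hp L2d; exact: (le_trans h4 (ler_wpM2l (ler0n R 2) (ltW hn))).
apply: (le_trans (lerD h2 h1)); rewrite le_eqVlt; apply/orP; left; apply/eqP; ring.
Qed.

Lemma cross_int2 s t :
  cint (fun z => tp (tpP s) z * (tp t z)^*%C) = cint (fun z => tp s z * (tp (tpP t) z)^*%C).
Proof.
have Lm u v : Lp 1 (fun z => tp u z * (tp v z)^*%C).
  have : Lp 1 (tp (tpmul u (tpconj v))) by exact: inLp_tp.
  apply: inLp_aeq; last by apply: aeq_eq => x; rewrite tp_mul tp_conj.
  by apply: measC_mul; [exact: measC_tp|apply: measC_conj; exact: measC_tp].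
transitivity (cint (fun z => tp (tpP s) z * (tp (tpP t) z)^*%C)).
  rewrite (@eq_cint _ _ (fun z => tp (tpP s) z * (tp (tpP t) z)^*%C +
    tp (tpP s) z * (tp [seq x <- t | x.2 < 0] z)^*%C)); last first.
    by move=> x _; rewrite (tp_split t) conjD mulrDr.
  by rewrite cint_add// cross_int addr0.
rewrite (@eq_cint _ (fun z => tp s z * (tp (tpP t) z)^*%C) (fun z => tp (tpP s) z * (tp (tpP t) z)^*%C +
    tp [seq x <- s | x.2 < 0] z * (tp (tpP t) z)^*%C)); last first.
  by move=> x _; rewrite (tp_split s) mulrDl.
rewrite cint_add// (_ : cint (fun z => tp [seq x <- s | x.2 < 0] z * _) = 0) ?addr0//.
rewrite -[LHS]conjcK -cint_conj// -[RHS]conjc0 -(cross_int t s); congr (_^*%C).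
by apply: eq_cint => x _; rewrite /fconj conjM conjcK mulrC.
Qed.

Lemma cross_alg (a b c d : R) : 2 * (a * b * (c * d)) = a * (2 * c * b) * d.
Proof. by ring. Qed.

(** [P] is symmetric for the pairing, so the bound at [q < 2] transfers to [p > 2] through
    [converse_hoelder], with a factor 2 from [cint_abs]; [p = 2] is orthogonality. *)
Lemma riesz_tp p : 1 < p -> exists2 K, 0 <= K & forall s,
  normLp p (tp (tpP s)) <= K * normLp p (tp s).
Proof.
move=> p1; have [p2|p2|->] := ltgtP p 2; first by apply: riesz_tp_lt2; rewrite p1.
  have [q1 pq qq] := conj_exp p1; set q := conjexp p in q1 pq qq *.
  have q2 : q < 2.
    by rewrite /q /conjexp ltr_pdivrMr ?subr_gt0//; lra.
  have [K K0 hK] : exists2 K, 0 <= K & forall s, normLp q (tp (tpP s)) <= K * normLp q (tp s).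
    by apply: riesz_tp_lt2; rewrite q1 q2.
  exists (2 * K); first exact: mulr_ge0.
  move=> s; have q0 : 0 < q by exact: lt_trans q1.
  have p0 : 0 < p by exact: lt_trans p1.
  have N0 : 0 <= normLp p (tp s) by exact: normLp_ge0.
  have [] := @converse_hoelder _ q (tp (tpP s)) (fun=> 1) (2 * K * normLp p (tp s)) q1.
  - exact: inLp_tp.
  - exact: inLp_cst (ltW q0).
  - by rewrite !mulr_ge0.
  - move=> t; under [X in normLp q X]eq_fun do rewrite mul1r.
    have -> : cint (fun z => tp (tpP s) z * tp t z) =
        cint (fun z => tp s z * (tp (tpP (tpconj t)) z)^*%C).
      rewrite -cross_int2; apply: eq_cint => x _; rewrite tp_conj conjcK//.
    have Ls : Lp p (tp s) by exact: inLp_tp (ltW p0).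
    have Lt : Lp q (fconj (tp (tpP (tpconj t)))) by apply: inLp_conj; exact: inLp_tp (ltW q0).
    have [L1 h1] := hoelderC p0 q0 pq Ls Lt.
    apply: (le_trans (cint_abs L1)).
    have e1 : normLp q (fconj (tp (tpP (tpconj t)))) = normLp q (tp (tpP (tpconj t))).
      by apply: normLp_ab => x; rewrite ab_conj.
    rewrite e1 in h1.
    have h2 := hK (tpconj t).
    have e2 : normLp q (tp (tpconj t)) = normLp q (tp t).
      by apply: normLp_ab => x; rewrite /ab tp_conj absC_conj.
    rewrite e2 in h2.
    have pp := ltW (pi2_gt0 R).
    have h3 := ler_wpM2l (mulr_ge0 pp N0) h2.
    apply: (le_trans (ler_wpM2l (ler0n R 2) (le_trans h1 h3))).
    by rewrite cross_alg; exact: lexx.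
  rewrite -/(conjexp q) qq => _; under eq_fun do rewrite divr1.
  by [].
by exists 1 => // s; rewrite mul1r; exact: parseval_tpP.
Qed.

End RieszProjectionBound.
(** * Completeness and the Riesz projection *)

Section LpComplete.
Variable R : realType.
Local Notation C := R[i].
Local Notation D := (@I02pi R).
Local Notation T := (measurableTypeR R).
Implicit Types (f g h : C -> C) (F G : R -> R) (z : C) (p q K : R).
Implicit Types (s t : seq (C * int)).
Hint Resolve mD ab_ge0 absC_ge0 : core.

Lemma half_gt0 n : 0 < (2^-1 : R) ^+ n.
Proof. by rewrite exprn_gt0// invr_gt0. Qed.

Lemma half_cvg0 (c : R) : (fun n => c * 2^-1 ^+ n) @ \oo --> (0 : R).
Proof.
rewrite -[X in _ --> X](mulr0 c); apply: cvgM; first exact: cvg_cst.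
by apply: cvg_expr; rewrite ger0_norm ?invf_lt1 ?ltr1n.
Qed.

Lemma le_half_eps (x y c : R) : (forall n, x <= y + c * 2^-1 ^+ n) -> x <= y.
Proof.
move=> H; have h : (fun n => y + c * 2^-1 ^+ n) @ \oo --> y.
  by rewrite -[X in _ --> X](addr0 y); apply: cvgD; [exact: cvg_cst|exact: half_cvg0].
exact: lim_ge_seq h H.
Qed.

Lemma half_small (c e : R) : 0 < e -> exists n, c * 2^-1 ^+ n < e.
Proof.
move=> e0; apply/not_existsP => H.
have : e <= 0 by apply: (lim_ge_seq (half_cvg0 c)) => n; rewrite leNgt; exact/negP/H.
by rewrite leNgt e0.
Qed.

Lemma geo_sum (c : R) n m : 0 <= c -> \sum_(n <= k < m) c * 2^-1 ^+ k <= 2 * c * 2^-1 ^+ n.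
Proof.
move=> c0; have h0 k : 0 <= c * 2^-1 ^+ k by rewrite mulr_ge0// ltW// half_gt0.
have [nm|mn] := leqP n m; last by rewrite big_geq ?(ltnW mn)// -mulrA mulr_ge0.
have : \sum_(n <= k < m) c * 2^-1 ^+ k = 2 * c * 2^-1 ^+ n - 2 * c * 2^-1 ^+ m.
  rewrite -(subnK nm); elim: (m - n)%N => [|i IH]; first by rewrite add0n big_geq// subrr.
  by rewrite addSn big_nat_recr ?leq_addl//= IH exprS; field.
by move=> ->; rewrite gerBl -mulrA mulr_ge0.
Qed.

Lemma mfun_lim (E : R -> bool) (F_ : nat -> R -> R) : (forall n, mfun (F_ n)) ->
  measurable (D `&` [set x | E x] : set T) -> (forall x, E x -> cvgn (F_^~ x)) ->
  mfun (fun x => if E x then limn (F_^~ x) else 0).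
Proof.
move=> mF mE cF.
have mG n : mfun (fun x => if E x then F_ n x else 0).
  by apply: mfun_if => //; exact: measurable_cst.
apply: (measurable_fun_cvg mG) => x _; case: ifP => Ex; last exact: cvg_cst.
exact: cF.
Qed.

Lemma powR_incr_cvg (v : nat -> R) (l p : R) : 0 < p -> (forall n, 0 <= v n) -> nondecreasing_seq v ->
  v @ \oo --> l -> (fun n => v n `^ p) @ \oo --> l `^ p.
Proof.
move=> p0 v0 iv cv.
have lv n : v n <= l by rewrite -(cvg_lim (@Rhausdorff R) cv); apply: nondecreasing_cvgn_le => //; exact: cvgP cv.
have [l0|ln] := eqVneq l 0.
  by apply: cvg_near_cst; apply: nearW => n; have -> : v n = l by apply/eqP; rewrite eq_le lv l0 v0.
have lp : 0 < l by rewrite lt0r ln (le_trans (v0 0%N) (lv 0%N)).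
apply: (@continuous_cvg _ _ _ _ _ _ (fun y : R => y `^ p)) cv.
apply/differentiable_continuous/derivable1_diffP; apply: derivable_powR.
by rewrite in_itv /= lp.
Qed.

Section Series.
Variables (p c : R) (u : nat -> C -> C).
Hypotheses (p1 : 1 < p) (c0 : 0 <= c) (hu : forall k, Lp p (u k)).
Hypothesis nu : forall k, normLp p (u k) <= c * 2^-1 ^+ k.

Let p0 : 0 < p. Proof. exact: lt_trans p1. Qed.
Let G n m x := \sum_(n <= k < m) ab (u k) x.
Let mu_ k : measC (u k). Proof. exact: inLp_m (hu k). Qed.

Let mG n m : mfun (G n m).
Proof.
rewrite /G; elim: m => [|m IH]; first by under eq_fun do rewrite big_geq//; exact: measurable_cst.
have [nm|mn] := leqP n m; last by under eq_fun do rewrite big_geq//; exact: measurable_cst.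
by under eq_fun do rewrite big_nat_recr//=; apply: (@measurable_funD _ T) => //; exact: mab.
Qed.

Let G_ge0 n m x : 0 <= G n m x. Proof. by apply: sumr_ge0 => k _; exact: ab_ge0. Qed.

Let G_mono n x : nondecreasing_seq (G n ^~ x).
Proof.
apply/nondecreasing_seqP => m; rewrite /G.
have [nm|mn] := leqP n m; first by rewrite big_nat_recr//= lerDl ab_ge0.
by rewrite !big_geq// ltnW.
Qed.

Let Gc n m z : C := Complex (\sum_(n <= k < m) absC (u k z)) 0.
Let ab_Gc n m x : ab (Gc n m) x = G n m x.
Proof. by rewrite /ab absC_real ger0_norm//; apply: sumr_ge0 => k _; exact: absC_ge0. Qed.

Let hGc n m : Lp p (Gc n m) /\ normLp p (Gc n m) <= 2 * c * 2^-1 ^+ n.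
Proof.
suff [h1 h2] : Lp p (Gc n m) /\ normLp p (Gc n m) <= \sum_(n <= k < m) c * 2^-1 ^+ k.
  by split => //; apply: (le_trans h2); exact: geo_sum.
have e0 : (m <= n)%N -> Gc n m = fun=> 0.
  by move=> mn; apply/funext => z; rewrite /Gc big_geq.
elim: m e0 => [|m IH] e0; first by rewrite e0// normLp0// big_geq//; split => //; exact: inLp0.
have [nm|mn] := leqP n m; last by rewrite e0// normLp0// big_geq//; split => //; exact: inLp0.
have [|L1 n1] := IH; first by move=> mn; apply/funext => z; rewrite /Gc big_geq.
pose v z : C := Complex (absC (u m z)) 0.
have abv x : ab v x = ab (u m) x by rewrite /ab absC_real ger0_norm ?absC_ge0.
have Lv : Lp p v.
  by apply: inLp_ab (hu m); [apply: measC_real; exact: mab|].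
have -> : Gc n m.+1 = fun z => Gc n m z + v z.
  by apply/funext => z; apply: eqCplx; rewrite /= ?addr0// big_nat_recr.
split; first exact: (inLp_add (ltW p1)).
rewrite big_nat_recr//=; apply: (le_trans (normLp_add (ltW p1) L1 Lv)).
by apply: lerD => //; rewrite (normLp_ab _ abv).
Qed.

(** The bound is quantified over the naturals so that the set is a countable union of countable
    intersections, hence measurable. *)
Let fin z : bool := `[< exists M : nat, forall m, \sum_(0 <= k < m) absC (u k z) <= M%:R >].

Let mfin : measurable (D `&` [set x | fin (circ x)] : set T).
Proof.
have -> : (D `&` [set x | fin (circ x)] : set T) =
   \bigcup_M \bigcap_m (D `&` [set x | G 0 m x <= M%:R]).
  apply/seteqP; split => x /=.
    by move=> [Dx /asboolP[M hM]]; exists M => // m _; split => //; exact: hM.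
  move=> [M _ hM]; split; first by have [] := hM 0%N I.
  by apply/asboolP; exists M => m; have [] := hM m I.
by apply: bigcup_measurable => M _; apply: bigcap_measurable => [|m _]; [by []|exact: mset_le].
Qed.

Let G_fin n m x : G n m x <= G 0 m x.
Proof.
have [nm|mn] := leqP n m; last by rewrite {1}/G big_geq ?(ltnW mn) ?G_ge0.
by rewrite /G (big_cat_nat (leq0n n) nm) /= lerDr; exact: G_ge0.
Qed.

Let cvgG n x : fin (circ x) -> cvgn (G n ^~ x).
Proof.
move=> /asboolP[M hM]; apply: nondecreasing_is_cvgn; [exact: G_mono|exists M%:R => _ [m _ <-]].
exact: le_trans (G_fin n m x) (hM m).
Qed.

(** Off [fin] the partial sums exceed every [N], so monotone convergence of [min (G, N)] bounds [N]
    times the measure of the complement by [B], for every [N]. *)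
Let fin_ae : aeD (fun x => fin (circ x)).
Proof.
pose B := 2 * c * (pi *+ 2).
have B0 : 0 <= B by rewrite !mulr_ge0// ltW// pi2_gt0.
have iG m : Lint (G 0 m) /\ rint (G 0 m) <= B.
  have [L1 n1] := hGc 0 m; have [/inL1P[_ h1] h2] := inLp_L1 p1 L1.
  rewrite (funext (ab_Gc 0 m)) in h1 h2; split => //; apply: (le_trans h2).
  by rewrite mulrC ler_wpM2r ?(ltW (pi2_gt0 R))//; apply: (le_trans n1); rewrite expr0 mulr1.
pose ind x : R := if fin (circ x) then 0 else 1.
have mind : mfun ind.
  by apply: mfun_if; [exact: mfin|exact: measurable_cst|exact: measurable_cst].
have iind : Lint ind.
  by apply: (@Lint_bdd _ _ 1) => // x _; rewrite /ind; case: ifP; rewrite ?normr0 ?normr1.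
have hN (N : nat) : N%:R * rint ind <= B.
  pose psi m x := Num.min (G 0 m x) N%:R.
  have mpsi m : mfun (psi m) 
    by apply: (@measurable_minr _ T); [exact: mG|exact: (measurable_cst (N%:R : R))].
  have bpsi m x : 0 <= psi m x <= N%:R by rewrite le_min G_ge0 ler0n ge_min lexx orbT.
  have ndp x : nondecreasing_seq (psi ^~ x).
    move=> i j ij; rewrite /psi le_min !ge_min lexx orbT andbT.
    by rewrite (G_mono 0 x ij).
  have cp x : cvgn (psi ^~ x).
    apply: nondecreasing_is_cvgn => //; exists N%:R => _ [m _ <-].
    by have /andP[] := bpsi m x.
  have ip m : Lint (psi m).
    by apply: (@Lint_bdd _ _ N%:R) => // x _; have /andP[h1 h2] := bpsi m x; rewrite ger0_norm.
  have mlim : mfun (fun x => limn (psi ^~ x)).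
    by apply: (measurable_fun_cvg mpsi) => x _; exact: cp.
  have [||||Ll hl] := @rint_monotone_cvg _ psi (fun x => limn (psi ^~ x)) B ip mlim.
  - by move=> n x _; have /andP[] := bpsi n x.
  - by move=> x _; exact: ndp.
  - by apply: aeD_all => x _; exact: cp.
  - move=> m; have [i1 i2] := iG m; apply: le_trans i2; apply: int_le => // x _.
    by rewrite /psi ge_min lexx.
  apply: le_trans hl; rewrite -int_scale//; apply: int_le => //; first exact: Lint_scale.
  move=> x _; rewrite /ind; case: ifP => h.
    by rewrite mulr0; apply: (lim_ge_seq (cp x)) => m; have /andP[] := bpsi m x.
  rewrite mulr1.
  have [m hm] : exists m, N%:R < G 0 m x.
    apply/not_existsP => H; move/negP: h; apply; apply/asboolP; exists N => m.
    by rewrite leNgt; exact/negP/H.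
  have : (fun k => psi (k + m)%N x) @ \oo --> limn (psi ^~ x) by rewrite (cvg_shiftn m (psi ^~ x)); exact: cp.
  move=> /lim_ge_seq; apply => k.
  apply: (@le_trans _ _ (psi m x)); last by apply: ndp; exact: leq_addl.
  by rewrite /psi le_min lexx (ltW hm).
have ind0 : rint ind = 0.
  apply/eqP; rewrite eq_le; apply/andP; split; last first.
    by apply: int_ge0 => x _; rewrite /ind; case: ifP.
  rewrite leNgt; apply/negP => i0.
  have := hN (Num.truncn (B / rint ind)).+1; apply/negP; rewrite -ltNge -ltr_pdivrMr//.
  exact: truncnS_gt.
apply: (aeD1 (int_eq0 iind _ ind0)); first by move=> x _; rewrite /ind; case: ifP.
by move=> x _; rewrite /ind; case: ifP => // _ /eqP; rewrite oner_eq0.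
Qed.

Let S n z := \sum_(0 <= k < n) u k z.
Let f z : C := if fin z then
  Complex (limn (fun n => complex.Re (S n z))) (limn (fun n => complex.Im (S n z))) else 0.

Let mS n : measC (S n).
Proof. by apply: measC_sum. Qed.

Let cvg_part (a : C -> R) x : (forall z w, a (z + w) = a z + a w) -> a 0 = 0 ->
  (forall z, `|a z| <= absC z) -> fin (circ x) -> cvgn (fun n => a (S n (circ x))).
Proof.
move=> aD a0 aN hx.
have -> : (fun n => a (S n (circ x))) = series (fun k => a (u k (circ x))).
  apply/funext => n; rewrite /S /series /=; exact: (big_morph a aD a0).
apply: normed_cvg; have h0 : cvgn (series (fun k => ab (u k) x)) := @cvgG 0%N x hx.
by apply: series_le_cvg h0 => k /=; [exact: normr_ge0|exact: ab_ge0|exact: aN].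
Qed.

Let cvgRe x : fin (circ x) -> cvgn (fun n => complex.Re (S n (circ x))).
Proof. by apply: cvg_part => //; [exact: cReD|exact: absC_Re]. Qed.
Let cvgIm x : fin (circ x) -> cvgn (fun n => complex.Im (S n (circ x))).
Proof. by apply: cvg_part => //; [exact: cImD|exact: absC_Im]. Qed.

Let mf : measC f.
Proof.
split.
  have -> : reF f = fun x => if fin (circ x) then limn (fun n => reF (S n) x) else 0.
    by apply/funext => x; rewrite /reF /f; case: ifP.
  by apply: (mfun_lim _ mfin cvgRe) => n; have [] := mS n.
have -> : imF f = fun x => if fin (circ x) then limn (fun n => imF (S n) x) else 0.
  by apply/funext => x; rewrite /imF /f; case: ifP.
by apply: (mfun_lim _ mfin cvgIm) => n; have [] := mS n.
Qed.

Let Kt n x := if fin (circ x) then limn (G n ^~ x) else 0.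

Let f_tail n x : fin (circ x) -> ab (fun z => f z - S n z) x <= Kt n x.
Proof.
move=> hx; rewrite /Kt hx.
have hG m : G n m x <= limn (G n ^~ x) by exact: (nondecreasing_cvgn_le (G_mono n x) (@cvgG n x hx)).
have hd m : (n <= m)%N -> absC (S m (circ x) - S n (circ x)) <= limn (G n ^~ x).
  move=> nm; apply: le_trans (hG m); rewrite /S (big_cat_nat (leq0n n) nm) /= addrAC subrr add0r.
  exact: absC_sum.
rewrite /ab /f hx; set l := Complex _ _.
have hs m : (n <= m)%N -> absC (l - S n (circ x)) <= absC (l - S m (circ x)) + limn (G n ^~ x).
  move=> nm; rewrite (_ : l - S n (circ x) = (l - S m (circ x)) + (S m (circ x) - S n (circ x))); last by ring.
  by apply: (le_trans (absCD _ _)); rewrite lerD2l hd.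
have c1 : (fun m => `|complex.Re l - complex.Re (S m (circ x))| + `|complex.Im l - complex.Im (S m (circ x))| + limn (G n ^~ x)) @ \oo
   --> limn (G n ^~ x).
  rewrite -[X in _ --> X]add0r; apply: cvgD; last exact: cvg_cst.
  rewrite -[X in _ --> X]addr0; apply: cvgD; under eq_fun do rewrite distrC; apply: cvg_dist0.
    exact: cvgRe.
  exact: cvgIm.
pose w m := `|complex.Re l - complex.Re (S m (circ x))| + `|complex.Im l - complex.Im (S m (circ x))| + limn (G n ^~ x).
have c2 : (fun k => w (k + n)%N) @ \oo --> limn (G n ^~ x) by rewrite (cvg_shiftn n w).
apply: (lim_ge_seq c2) => k; rewrite /w /=; apply: (le_trans (hs _ (leq_addl k n))); rewrite lerD2r.
by apply: (le_trans (absC_le _)); rewrite !cReD !cImD; case: (S (k + n) (circ x)).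
Qed.

(** Riesz-Fischer in series form: the pointwise sum on [fin], completed by 0, is the limit, and the
    tails are estimated by monotone convergence of their [p]-th powers. The geometric rate is the
    form in which the later iterations use completeness. *)
Lemma Lp_complete : exists2 f, Lp p f & forall n,
  normLp p (fun z => f z - \sum_(0 <= k < n) u k z) <= 2 * c * 2^-1 ^+ n.
Proof.
have key n : Lp p (fun z => f z - S n z) /\ normLp p (fun z => f z - S n z) <= 2 * c * 2^-1 ^+ n.
  set B := 2 * c * 2^-1 ^+ n.
  have B0 : 0 <= B by rewrite !mulr_ge0// ltW// half_gt0.
  have mK : mfun (Kt n) by apply: mfun_lim => // x; exact: cvgG.
  have K0 x : 0 <= Kt n x.
    by rewrite /Kt; case: ifP => // hx; apply: (lim_ge_seq (@cvgG n x hx)).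
  have md : measC (fun z => f z - S n z) by exact: measC_sub.
  have [||||||LK hK] := @rint_monotone_cvg _ (fun m x => G n m x `^ p) (fun x => Kt n x `^ p) (pi *+ 2 * B `^ p).
  - move=> m; have [/inLpP[_ h] _] := hGc n m.
    by rewrite (eq_fun (fun x => congr1 (fun y => y `^ p) (ab_Gc n m x))) in h.
  - by have := mpow p mK; under eq_fun do rewrite ger0_norm//.
  - by move=> m x _; exact: powR_ge0.
  - move=> x _ i j ij; apply: ge0_ler_powR; rewrite ?nnegrE ?(ltW p0)//.
    exact: (G_mono n x ij).
  - apply: (aeD1 fin_ae) => x _ hx; rewrite /Kt hx.
    by apply: powR_incr_cvg => //; exact: cvgG.
  - move=> m; have [_ h] := hGc n m.
    have -> : rint (fun x => G n m x `^ p) = pi *+ 2 * normLp p (Gc n m) `^ p.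
      rewrite -(normLpK (Gc n m) p0); by congr rint; apply/funext => x; rewrite ab_Gc.
    apply: ler_wpM2l; first exact: ltW (pi2_gt0 R).
    by apply: ge0_ler_powR; rewrite ?nnegrE ?(ltW p0) ?normLp_ge0.
  have le1 : aeD (fun x => ab (fun z => f z - S n z) x `^ p <= Kt n x `^ p).
    apply: (aeD1 fin_ae) => x _ hx; apply: ge0_ler_powR; rewrite ?nnegrE ?(ltW p0) ?ab_ge0//.
    exact: f_tail.
  have Ld : Lint (fun x => ab (fun z => f z - S n z) x `^ p).
    apply: Lint_aele LK _; first exact: mabp.
    by apply: (aeD1 le1) => x _ h; rewrite ger0_norm// powR_ge0.
  split; first by apply/inLpP.
  have := le_trans (int_aele Ld LK le1) hK; rewrite normLpK// ler_pM2l ?pi2_gt0// => h.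
  rewrite leNgt; apply/negP => h1.
  by have := gt0_ltr_powR p0 B0 (normLp_ge0 p (fun z => f z - S n z)) h1; rewrite ltNge h.
exists f; last by move=> n; have [] := key n.
have [h _] := key 0%N; apply: (inLp_aeq _ _ h) => //; apply: aeq_eq => x.
by rewrite /S big_geq// subr0.
Qed.
End Series.

End LpComplete.

(** * The Riesz projection on [L^p] *)

Section LpProjection.
Variable R : realType.
Local Notation C := R[i].
Implicit Types (f g h : C -> C) (p q K : R) (s : seq (C * int)).

Lemma fourier_half_eq f (l : C) (n : int) (B p : R) (w : nat -> C -> C) : 1 < p ->
  Lp p f -> (forall k, Lp p (w k)) -> (forall k, normLp p (fun z => f z - w k z) <= B * 2^-1 ^+ k) ->
  (forall e : R, 0 < e -> exists N, forall k, (N <= k)%N -> absC (fourier (w k) n - l) < e) -> fourier f n = l.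
Proof.
move=> p1 hf hw hn hl; apply/eqP; rewrite -subr_eq0; apply/eqP/absC_eq0/eqP.
rewrite eq_le absC_ge0 andbT; apply/ler_addgt0Pr => e e0; rewrite add0r.
have e2 : 0 < e / 2 by rewrite divr_gt0.
have [m hm] := half_small (pi *+ 2 * B) e2.
have [N hN] := hl _ e2; pose k := maxn m N.
have -> : fourier f n - l = (fourier f n - fourier (w k) n) + (fourier (w k) n - l) by ring.
apply: (le_trans (absCD _ _)); rewrite [leRHS]splitr; apply: lerD; last first.
  by apply/ltW/hN; rewrite leq_maxr.
rewrite -fourier_sub; [|exact: inL1_pn p1 _|exact: inL1_pn p1 _].
apply: (le_trans (fourier_norm n p1 (inLp_sub (ltW p1) hf (hw k)))); apply/ltW.
apply: le_lt_trans hm; rewrite -mulrA; apply: ler_wpM2l; first exact: ltW (pi2_gt0 R).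
apply: (le_trans (hn k)); apply: ler_wpM2l.
  have := le_trans (normLp_ge0 p _) (hn 0%N); by rewrite expr0 mulr1.
by apply: ler_wiXn2l; rewrite ?invr_ge0 ?invf_le1 ?ler1n ?leq_maxl.
Qed.

(** Polynomial approximants of rate [2^-k] are projected, and the projections are summed as a
    telescoping series; norm convergence determines the Fourier coefficients of the limit. *)
Lemma riesz_Lp p : 1 < p -> exists2 K, 0 <= K & forall f, Lp p f ->
  exists g, [/\ Lp p g, (forall n, fourier g n = if 0 <= n then fourier f n else 0) &
    normLp p g <= K * normLp p f].
Proof.
move=> p1; have [K K0 hK] := riesz_tp p1; exists K => // f hf.
have p1' := ltW p1; have p0 : 0 < p by exact: lt_trans p1.
have ch k : exists s, normLp p (fun z => f z - tp s z) <= 2^-1 ^+ k.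
  by have [s /ltW hs] := dens_Lp p1' hf (half_gt0 R k); exists s.
have [S hS] := boolp.choice ch.
have Lt s : Lp p (tp s) by exact: inLp_tp (ltW p0).
pose u k : C -> C := if k is k'.+1 then fun z => tp (tpP (S k)) z - tp (tpP (S k')) z
   else tp (tpP (S 0%N)).
have su k z : \sum_(0 <= i < k.+1) u i z = tp (tpP (S k)) z.
  elim: k => [|k IH]; first by rewrite big_nat1.
  by rewrite big_nat_recr//= IH; ring.
have nS k : normLp p (tp (tpP (S k))) <= K * (normLp p f + 2^-1 ^+ k).
  apply: (le_trans (hK _)); apply: ler_wpM2l => //.
  have -> : tp (S k) = fun z => f z - (f z - tp (S k) z) by apply/funext => z; ring.
  by apply: (le_trans (normLp_sub p1' hf (inLp_sub p1' hf (Lt _)))); rewrite lerD2l.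
pose c := K * (normLp p f + 4).
have c0 : 0 <= c by rewrite mulr_ge0// addr_ge0// normLp_ge0.
have Lu k : Lp p (u k) by case: k => [|k]; [exact: Lt|apply: inLp_sub => //; exact: Lt].
have nu k : normLp p (u k) <= c * 2^-1 ^+ k.
  case: k => [|k].
    rewrite expr0 mulr1; apply: (le_trans (nS 0%N)); apply: ler_wpM2l => //.
    by rewrite expr0 lerD2l ler1n.
  have -> : u k.+1 = tp (tpP (S k.+1 ++ tpscale (-1) (S k))).
    by apply/funext => z; rewrite tpP_cat tp_cat tpP_scale tp_scale mulN1r.
  apply: (le_trans (hK _)); rewrite /c -mulrA; apply: ler_wpM2l => //.
  have -> : tp (S k.+1 ++ tpscale (-1) (S k)) = fun z => (f z - tp (S k) z) - (f z - tp (S k.+1) z).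
    by apply/funext => z; rewrite tp_cat tp_scale; ring.
  apply: (le_trans (normLp_sub p1' (inLp_sub p1' hf (Lt _)) (inLp_sub p1' hf (Lt _)))).
  apply: (le_trans (lerD (hS k) (hS k.+1))); rewrite mulrDl.
  have h1 : 0 <= normLp p f * 2^-1 ^+ k.+1 by rewrite mulr_ge0 ?normLp_ge0// ltW// half_gt0.
  apply: (@le_trans _ _ (4 * 2^-1 ^+ k.+1)); last by rewrite lerDr.
  have := half_gt0 R k; rewrite exprS; move: (_ ^+ k) => y y0; lra.
have [g Lg hg] := Lp_complete p1 c0 Lu nu.
have hg2 k : normLp p (fun z => g z - tp (tpP (S k)) z) <= c * 2^-1 ^+ k.
  have := hg k.+1; under [X in normLp p X]eq_fun do rewrite su.
  have -> : 2 * c * 2^-1 ^+ k.+1 = c * 2^-1 ^+ k by rewrite exprS; field.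
  by [].
exists g; split => //.
  move=> n; apply: (fourier_half_eq p1 Lg (fun k => Lt (tpP (S k))) hg2) => e e0.
  have [N hN] := half_small (pi *+ 2) e0; exists N => k Nk.
  rewrite fourier_tp tpcoef_tpP -fourier_tp; case: ifP => _; last by rewrite subrr absC0.
  rewrite -fourier_sub; [|exact: inL1_pn p1 _|exact: inL1_pn p1 _].
  apply: (le_lt_trans (fourier_norm n p1 (inLp_sub p1' (Lt _) hf))).
  apply: le_lt_trans hN; apply: ler_wpM2l; first exact: ltW (pi2_gt0 R).
  rewrite normLp_distC; apply: (le_trans (hS k)).
  by apply: ler_wiXn2l; rewrite ?invr_ge0 ?invf_le1 ?ler1n.
apply: (@le_half_eps _ _ _ (c + K)) => k.
have -> : g = fun z => tp (tpP (S k)) z + (g z - tp (tpP (S k)) z) by apply/funext => z; ring.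
apply: (le_trans (normLp_add p1' (Lt _) (inLp_sub p1' Lg (Lt _)))).
apply: (le_trans (lerD (nS k) (hg2 k))).
by rewrite le_eqVlt; apply/orP; left; apply/eqP; ring.
Qed.

End LpProjection.
(** * The F. and M. Riesz uniqueness theorem *)

Section FMRiesz.
Variable R : realType.
Local Notation C := R[i].
Local Notation D := (@I02pi R).
Local Notation T := (measurableTypeR R).
Implicit Types (f g h : C -> C) (F G : R -> R) (z : C) (p q K : R).
Implicit Types (s t : seq (C * int)).
Hint Resolve mD : core.

Lemma fourier_mul_analytic g t : Lp 1 g -> (forall n : int, n < 0 -> fourier g n = 0) -> analytic t ->
  fourier (fun z => g z * tp t z) 0 = tpcoef t 0 * fourier g 0.
Proof.
move=> Lg g0 ht; rewrite fourierE (@eq_cint _ _ (fun z => g z * tp t z)); last first.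
  by move=> x _; rewrite expr0z mulr1.
rewrite cint_tp_mul// /tpcoef mulr_suml [RHS]big_mkcond /=; apply: eq_big_seq => x xt.
have /allP/(_ x xt) := ht; rewrite le_eqVlt => /predU1P[<-|x0]; first by rewrite eqxx oppr0.
by rewrite g0 ?oppr_lt0// mulr0 gt_eqF.
Qed.

Lemma natC (n : nat) : (n%:R : C) = Complex n%:R 0.
Proof.
elim: n => [//|n IH]; rewrite -natr1 IH; apply: eqCplx; rewrite /= ?addr0//.
by rewrite natr1.
Qed.

(** [(1 + w/M)^M] is the polynomial substitute for [exp w]: it is analytic when [w] is an analytic
    polynomial and, by [1 + x <= exp x] applied to [|1 + w/M|^2], its modulus exceeds that of
    [exp w] by at most the factor [exp (|w|^2 / M)]. *)
Lemma absC_exp_le (w : C) (M : nat) : (0 < M)%N ->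
  absC (1 + Complex M%:R^-1 0 * w) ^+ M <= expR (complex.Re w + absC w ^+ 2 / M%:R).
Proof.
move=> M0; have MR : 0 < (M%:R : R) by rewrite ltr0n.
set y := complex.Re w / M%:R + (absC w / M%:R) ^+ 2.
have h1 : absC (1 + Complex M%:R^-1 0 * w) <= expR y.
  rewrite -(ler_pXn2r (ltn0Sn 1)) ?nnegrE ?absC_ge0 ?expR_ge0//.
  rewrite -expRM_natl absC_sqr cReD cImD cReM cImM /=.
  apply: le_trans (expR_ge1Dx _); rewrite /y exprMn absC_sqr.
  have r0 := sqr_ge0 (complex.Re w); have i0 := sqr_ge0 (complex.Im w).
  have v0 := sqr_ge0 (M%:R^-1 : R).
  have v1 := mulr_ge0 r0 v0; have v2 := mulr_ge0 i0 v0.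
  rewrite -subr_ge0; set rhs := (X in 0 <= X).
  have -> : rhs = complex.Re w ^+ 2 * M%:R^-1 ^+ 2 + complex.Im w ^+ 2 * M%:R^-1 ^+ 2.
    by rewrite /rhs; ring.
  exact: addr_ge0.
apply: (@le_trans _ _ (expR y ^+ M)); first by apply: lerXn2r; rewrite ?nnegrE ?absC_ge0 ?expR_ge0.
rewrite -expRM_natl ler_expR /y mulrDr mulrCA mulfV ?lt0r_neq0// mulr1 lerD2l.
by rewrite le_eqVlt; apply/orP; left; apply/eqP; field; exact: lt0r_neq0.
Qed.

Lemma expR_le_lin (y L : R) : 0 <= y <= L -> expR y <= 1 + y * expR L.
Proof.
move=> /andP[y0 yL]; have := expR_ge1Dx (- y); rewrite expRN => h.
have e0 := expR_gt0 y.
have h2 : expR y * (1 - y) <= 1 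
  by rewrite -[leRHS](mulfV (lt0r_neq0 e0)) ler_pM2l.
have h3 : y * expR y <= y * expR L by rewrite ler_wpM2l// ler_expR.
have : expR y * (1 - y) = expR y - y * expR y by ring.
lra.
Qed.

Section Step.
Variables (g : C -> C) (E : R -> bool).
Hypotheses (Lg : Lp 1 g) (g0 : forall n : int, n < 0 -> fourier g n = 0).
Hypotheses (mE : measurable (D `&` [set x | E x] : set T)).
Hypothesis gE : aeD (fun x => E x -> g (circ x) = 0).
Let ind x : R := if E x then 1 else 0.
Let m := rint ind.

Lemma ind_m : mfun ind.
Proof. by apply: mfun_if; [exact: mE|exact: measurable_cst|exact: measurable_cst]. Qed.
Lemma ind_01 x : 0 <= ind x <= 1.
Proof. by rewrite /ind; case: ifP; rewrite lexx ler01. Qed.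
Lemma ind_int : Lint ind.
Proof.
by apply: (@Lint_bdd _ _ 1); [exact: ind_m|move=> x _; have /andP[h1 h2] := ind_01 x; rewrite ger0_norm].
Qed.

(* Testing [g] against the exponential of an analytic polynomial whose real part
   is close to [L (ind - mean)] keeps the zeroth coefficient, while [L -> oo]
   makes the weight small off [E]. *)
Lemma vanishing_set_bound (L : nat) : 0 < m ->
  absC (fourier g 0) * expR (L%:R * (m / (pi *+ 4))) <= expR 1 * (rint (ab g) + 1).
Proof.
move=> m0; have pp := pi2_gt0 R; have /inL1P[_ ig] := Lg.
(* The first bound makes the integral of [phi] at least half that of the indicator, whence
   [m / (4 pi)]; the second keeps the approximation error, multiplied by [L exp L], at most 1. *)
pose e := Num.min (m / 2) ((L.+1%:R * expR L%:R)^-1).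
have e0 : 0 < e by rewrite lt_min divr_gt0//= invr_gt0 mulr_gt0 ?expR_gt0.
have w0 x : 0 <= 1 + ab g x by rewrite addr_ge0// ab_ge0.
have iw : Lint (fun x => 1 + ab g x) by apply: Lint_add => //; exact: Lint_cst.
have [phi [hphi b01 hap]] := dens_pos iw w0 ltr01 ind_m ind_01 e0.
have mphi := rtp_m hphi.
have iphi : Lint phi.
  by apply: (@Lint_bdd _ _ 1) => // x _; have /andP[h1 h2] := b01 x; rewrite ger0_norm.
have iabs : Lint (fun x => `|phi x - ind x| * (1 + ab g x)).
  apply: (@Lint_le _ _ (fun x => 1 * (1 + ab g x))); last 2 first.
  - exact: Lint_scale.
  - move=> x _; rewrite ger0_norm ?mulr_ge0//; apply: ler_wpM2r => //.
    by rewrite ler_norml; have /andP[? ?] := b01 x; have /andP[? ?] := ind_01 x; lra.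
  apply: (@measurable_funM _ T); last exact: Lint_m iw.
  by have := mpow 1 (Lint_m (Lint_sub iphi ind_int)); under eq_fun do rewrite powRr1//.
have [s1 hs1] := hphi.
pose mu' := rint phi / (pi *+ 2).
have c1 : tpcoef s1 0 = Complex mu' 0.
  rewrite -fourier_tp fourierE cintE.
  have -> : rint (reF (fun z => tp s1 z * z ^ (- 0))) = rint phi.
    by apply: eq_int => x _; rewrite /reF expr0z mulr1 hs1.
  have -> : rint (imF (fun z => tp s1 z * z ^ (- 0))) = 0.
    by rewrite -[RHS](mul0r (pi *+ 2)) -int_cst; apply: eq_int => x _; rewrite /imF expr0z mulr1 hs1.
  by apply: eqCplx; rewrite /= ?mulr0 ?mul0r ?subr0 ?addr0// mulrC.
pose s := s1 ++ [:: (- Complex mu' 0, 0 : int)].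
have s0 : tpcoef s 0 = 0 by rewrite tpcoef_cat c1 /tpcoef big_cons big_nil /= addr0 subrr.
have res x : reF (tp s) x = phi x - mu'.
  by rewrite /reF tp_cat hs1 tp_mon expr0z mulr1.
pose B := tpbound (analytic_completion s); pose w z := L%:R * tp (analytic_completion s) z.
(* [M > (L B)^2 >= |w|^2], so that passing from the exponential to a polynomial costs only the
   factor [exp 1]. *)
pose M := (Num.truncn ((L%:R * B) ^+ 2)).+1.
have MR : 0 < (M%:R : R) by rewrite ltr0n.
pose t0 := [:: (1 : C, 0 : int)] ++ tpscale (Complex M%:R^-1 0) (tpscale L%:R (analytic_completion s)).
have at0 : analytic t0 by rewrite /t0 analytic_cat//; do 2 apply: analytic_scale; exact: anl_analytic.
have ht0 z : tp t0 z = 1 + Complex M%:R^-1 0 * w z by rewrite tp_cat tp_mon expr0z mulr1 !tp_scale.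
have ct0 : tpcoef t0 0 = 1.
  by rewrite tpcoef_cat !tpcoef_scale tpcoef_anl0 s0 !mulr0 addr0 /tpcoef big_cons big_nil /= addr0.
have bw x : absC (tp t0 (circ x)) ^+ M <= expR 1 * expR (L%:R * (phi x - mu')).
  rewrite ht0; apply: (le_trans (absC_exp_le _ (ltn0Sn _))); rewrite -expRD ler_expR addrC.
  apply: lerD.
    rewrite ler_pdivrMr// mul1r; apply: ltW; apply: le_lt_trans (truncnS_gt _).
    rewrite /w absCM; have -> : absC (L%:R : C) = L%:R.
      by rewrite natC absC_real ger0_norm.
    apply: lerXn2r; rewrite ?nnegrE ?mulr_ge0 ?absC_ge0//.
      exact: le_trans (ab_ge0 _ _) (ab_tp (analytic_completion s) x).
    by rewrite ler_wpM2l//; exact: ab_tp.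
  have -> : complex.Re (w (circ x)) = L%:R * reF (tp (analytic_completion s)) x.
    by rewrite /w natC cReM /= mul0r subr0.
  by rewrite Re_anl res.
have Lgt : Lp 1 (fun z => g z * tp (tppow t0 M) z).
  have [] := @inLp_Linf _ 1 g (tp (tppow t0 M)) (tpbound (tppow t0 M)) ltr01 (measC_tp _) _ Lg.
    by apply: aeD_all => x _; exact: ab_tp.
  by move=> h1 _; under eq_fun do rewrite mulrC.
have key : absC (fourier g 0) <= expR 1 * expR (- (L%:R * mu')) * (rint (ab g) + 1).
  have := fourier_mul_analytic Lg g0 (analytic_pow M at0).
  rewrite tpcoef_pow// ct0 expr1n mul1r => <-.
  apply: (le_trans (fourier_abs _ Lgt)).
  have -> : rint (ab g) + 1 = rint (ab g) + L%:R * expR L%:R * (L%:R * expR L%:R)^-1 + (1 - L%:R * expR L%:R * (L%:R * expR L%:R)^-1) by ring.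
  set c := expR 1 * expR (- (L%:R * mu')); have c0 : 0 <= c by rewrite mulr_ge0// expR_ge0.
  apply: (@le_trans _ _ (c * (rint (ab g) + L%:R * expR L%:R * rint (fun x => `|phi x - ind x| * (1 + ab g x))))).
    rewrite -int_scale// -int_add//; last exact: Lint_scale.
    rewrite -int_scale; last by apply: Lint_add => //; exact: Lint_scale.
    apply: int_aele; [by have /inL1P[] := Lgt|by apply: Lint_scale; apply: Lint_add => //; exact: Lint_scale|].
    apply: (aeD1 gE) => x _ hx.
    rewrite /ab absCM tp_pow absCX -/(ab g x) mulrC.
    apply: (@le_trans _ _ (expR 1 * expR (L%:R * (phi x - mu')) * ab g x)).
      by rewrite ler_wpM2r ?ab_ge0.
    have -> : expR 1 * expR (L%:R * (phi x - mu')) * ab g x = c * (expR (L%:R * phi x) * ab g x).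
      by rewrite mulrBr expRD /c; ring.
    apply: ler_wpM2l => //.
    have /andP[p0 p1] := b01 x.
    have hy : 0 <= L%:R * phi x <= L%:R by rewrite mulr_ge0//= ler_piMr.
    apply: (@le_trans _ _ ((1 + L%:R * phi x * expR L%:R) * ab g x)).
      by rewrite ler_wpM2r ?ab_ge0//; exact: expR_le_lin.
    rewrite mulrDl mul1r lerD2l.
    have -> : L%:R * phi x * expR L%:R * ab g x = L%:R * expR L%:R * (phi x * ab g x) by ring.
    apply: ler_wpM2l.
      by rewrite mulr_ge0 ?expR_ge0.
    move: hx; rewrite /ind; case: ifP => _ hx.
      by rewrite /ab hx// absC0 mulr0 mulr_ge0// addr0.
    by rewrite subr0 ger0_norm// ler_wpM2l// lerDr.
  apply: ler_wpM2l => //; rewrite -addrA lerD2l addrCA subrr addr0.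
  apply: (@le_trans _ _ (L.+1%:R * expR L%:R * e)).
    apply: ler_pM; rewrite ?mulr_ge0 ?expR_ge0//; last exact: ltW.
      by apply: int_ge0 => x _; rewrite mulr_ge0.
    by rewrite ler_wpM2r ?expR_ge0// ler_nat.
  rewrite mulrC -ler_pdivlMr ?mulr_gt0 ?expR_gt0// div1r /e ge_min lexx orbT//.
have mmu : m / (pi *+ 4) <= mu'.
  have : m - rint phi <= m / 2.
    rewrite -int_sub//; last exact: ind_int.
    apply: (@le_trans _ _ (rint (fun x => `|phi x - ind x| * (1 + ab g x)))).
      apply: int_le => //; first by apply: Lint_sub => //; exact: ind_int.
      move=> x _; apply: (@le_trans _ _ `|phi x - ind x|); first by rewrite distrC ler_norm.
      by rewrite ler_peMr// lerDl ab_ge0.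
    by apply: (le_trans (ltW hap)); rewrite /e ge_min lexx.
  rewrite /mu' (_ : pi *+ 4 = 2 * (pi *+ 2)); last by ring.
  rewrite invfM mulrA ler_pM2r ?invr_gt0//; move: (rint phi) m => r0 m1 h; lra.
have h2 : expR (L%:R * (m / (pi *+ 4))) <= expR (L%:R * mu') by rewrite ler_expR ler_wpM2l.
apply: (le_trans (ler_wpM2l (absC_ge0 _) h2)).
apply: (le_trans (ler_wpM2r (expR_ge0 _) key)).
rewrite mulrAC -[X in X * _]mulrA -expRD addNr expR0 mulr1//.
Qed.

Lemma vanishing_set_coef0 : 0 < m -> fourier g 0 = 0.
Proof.
move=> m0; apply: absC_eq0; apply/eqP; rewrite eq_le absC_ge0 andbT leNgt; apply/negP => A0.
pose dl := m / (pi *+ 4).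
have dl0 : 0 < dl by rewrite divr_gt0// pmulrn_lgt0// pi_gt0.
set A := absC _ in A0.
pose L := (Num.truncn (expR 1 * (rint (ab g) + 1) / (A * dl))).+1.
have := vanishing_set_bound L m0; apply/negP; rewrite -ltNge -/A -/dl.
apply: (@lt_le_trans _ _ (A * (L%:R * dl))).
  by rewrite mulrCA -ltr_pdivrMr; [rewrite /L; exact: truncnS_gt|exact: mulr_gt0].
rewrite ler_pM2l//; apply: le_trans (expR_ge1Dx _); by rewrite lerDr.
Qed.
End Step.

(** Once the coefficients below [k] vanish, [h t^(-k)] is again analytic and vanishes on [E], so its
    zeroth coefficient, which is the [k]-th one of [h], is 0 by [vanishing_set_coef0]. *)
Lemma fm_riesz_uniqueness h (E : R -> bool) : Lp 1 h -> (forall n : int, n < 0 -> fourier h n = 0) ->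
  measurable (D `&` [set x | E x] : set T) -> aeD (fun x => E x -> h (circ x) = 0) ->
  ~ aeD (fun x => ~~ E x) -> aeq h (fun=> 0).
Proof.
move=> Lh h0 mE hE nE; apply: L1_unique => // n.
have [n0|n0] := ltP n 0; first exact: h0.
rewrite -(gez0_abs n0); elim/ltn_ind: `|n|%N => k IH.
pose g z := h z * z ^ (- k%:Z).
have fg j : fourier g j = fourier h (j + k%:Z) by rewrite fourier_mon opprK.
rewrite -[k%:Z]add0r -fg.
apply: (@vanishing_set_coef0 g E) => //.
- exact: inLp_mon.
- move=> j j0; rewrite fg; have [jk|jk] := ltP (j + k%:Z) 0; first exact: h0.
  by rewrite -(gez0_abs jk); apply: IH; rewrite -ltz_nat gez0_abs// gtrDr.
- by apply: (aeD1 hE) => x _ hx Ex; rewrite /g hx// mul0r.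
rewrite lt_neqAle; apply/andP; split; last by apply: int_ge0 => x _; case: ifP.
apply/eqP => e; apply: nE.
apply: (aeD1 (int_eq0 (ind_int mE) _ (esym e))); first by move=> x _; case: ifP.
by move=> x _; case: ifP => // _ /eqP; rewrite oner_eq0.
Qed.

End FMRiesz.
(** * Hardy spaces and the open mapping theorem *)

Section OpenMapping.
Variable R : realType.
Local Notation C := R[i].
Implicit Types (f g h x y : C -> C) (z : C) (K : R).

Definition Hs (p : R) f := Lp p f /\ forall n : int, n < 0 -> fourier f n = 0.

Lemma HsE (p : R) f : inHp p f <-> Hs p f.
Proof. by rewrite /inHp /Hs LpE. Qed.

Variable p : R.
Hypothesis p1 : 1 < p.
Let p1' : 1 <= p. Proof. exact: ltW. Qed.
Let p0 : 0 < p. Proof. exact: lt_trans p1. Qed.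
Local Notation N := (normLp p).

Lemma Hs_Lp f : Hs p f -> Lp p f. Proof. by case. Qed.
Lemma Hs_L1 f : Hs p f -> Lp 1 f. Proof. by move=> /Hs_Lp; exact: inL1_pn. Qed.
Lemma Hs_m f : Hs p f -> measC f. Proof. by move=> /Hs_Lp; exact: inLp_m. Qed.
Lemma Hs0 : Hs p (fun=> 0).
Proof. by split; [exact: inLp0|move=> n _; exact: fourier0]. Qed.
Lemma Hs_scale (c : C) f : Hs p f -> Hs p (fun z => c * f z).
Proof.
move=> hf; split; first by apply: inLp_scale => //; exact: Hs_Lp.
by move=> n n0; rewrite fourier_scale; [rewrite hf.2// mulr0|exact: Hs_L1].
Qed.
Lemma Hs_add f g : Hs p f -> Hs p g -> Hs p (fun z => f z + g z).
Proof.
move=> hf hg; split; first by apply: inLp_add => //; exact: Hs_Lp.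
by move=> n n0; rewrite fourier_add; [rewrite hf.2// hg.2// addr0|exact: Hs_L1|exact: Hs_L1].
Qed.
Lemma Hs_opp f : Hs p f -> Hs p (fun z => - f z).
Proof. by move=> /(Hs_scale (-1)); under eq_fun do rewrite mulN1r. Qed.
Lemma Hs_sub f g : Hs p f -> Hs p g -> Hs p (fun z => f z - g z).
Proof. by move=> hf /Hs_opp; exact: Hs_add. Qed.
Lemma Hs_mon f (k : nat) : Hs p f -> Hs p (fun z => f z * z ^ k%:Z).
Proof.
move=> [L h]; split; first exact: inLp_mon.
by move=> n n0; rewrite fourier_mon h// subr_lt0 (lt_le_trans n0).
Qed.
Lemma Hs_sum (I : Type) (s : seq I) (F : I -> C -> C) : (forall i, Hs p (F i)) ->
  Hs p (fun z => \sum_(i <- s) F i z).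
Proof.
move=> h; elim: s => [|i s IH]; first by under eq_fun do rewrite big_nil; exact: Hs0.
by under eq_fun do rewrite big_cons; exact: Hs_add.
Qed.

Lemma Hs_complete (c : R) (u : nat -> C -> C) : 0 <= c -> (forall k, Hs p (u k)) ->
  (forall k, N (u k) <= c * 2^-1 ^+ k) -> exists2 f, Hs p f &
  forall n, N (fun z => f z - \sum_(0 <= k < n) u k z) <= 2 * c * 2^-1 ^+ n.
Proof.
move=> c0 hu nu; have [f Lf hf] := Lp_complete p1 c0 (fun k => Hs_Lp (hu k)) nu.
exists f => //; split => // n n0.
have hS k : Hs p (fun z => \sum_(0 <= i < k) u i z) by exact: Hs_sum.
apply: (fourier_half_eq p1 Lf (fun k => Hs_Lp (hS k)) hf) => e e0.
by exists 0%N => k _; rewrite (hS k).2// subrr absC0.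
Qed.


Variable A : (C -> C) -> C -> C.
Hypothesis Ablo : isBLOp p A.

Lemma blo_Hs f : Hs p f -> Hs p (A f).
Proof. by move=> /HsE hf; apply/HsE; case: Ablo => + _; apply. Qed.
Lemma blo_lin f g (l : C) : Hs p f -> Hs p g ->
  aeq (A (fun z => f z + l * g z)) (fun z => A f z + l * A g z).
Proof. by move=> /HsE hf /HsE hg; case: Ablo => _ [+ _]; apply. Qed.
Lemma blo_bound : exists2 M : R, 0 <= M & forall f, Hs p f -> N (A f) <= M * N f.
Proof.
case: Ablo => _ [_ [M hM]]; exists `|M|; first exact: normr_ge0.
move=> f /HsE hf; apply: (le_trans (hM f hf)).
by rewrite ler_wpM2r ?normLp_ge0// ler_norm.
Qed.
Lemma blo_aeq f g : Hs p f -> Hs p g -> aeq f g -> aeq (A f) (A g).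
Proof.
move=> hf hg h.
have e : aeq (fun z => A f z + -1 * A g z) (fun=> 0).
  apply: aeq_trans (aeq_sym (blo_lin (-1) hf hg)) _.
  have hd : Hs p (fun z => f z + -1 * g z) by apply: Hs_add => //; exact: Hs_scale.
  have [M M0 hM] := blo_bound.
  apply: normLp_eq0 (Hs_Lp (blo_Hs hd)) _ => //; apply/eqP; rewrite eq_le normLp_ge0 andbT.
  apply: (le_trans (hM _ hd)); rewrite (normLp_aeq0 p0 (Hs_m hd)) ?mulr0//.
  by apply: (aeD1 h) => t _ ->; rewrite mulN1r subrr.
by apply: (aeD1 e) => t _ /eqP; rewrite mulN1r subr_eq0 => /eqP.
Qed.
Lemma blo_sub f g : Hs p f -> Hs p g -> aeq (A (fun z => f z - g z)) (fun z => A f z - A g z).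
Proof.
move=> hf hg; have := blo_lin (-1) hf hg.
by under eq_fun do rewrite mulN1r; under [X in aeq _ X]eq_fun do rewrite mulN1r.
Qed.
Lemma blo_0 : aeq (A (fun=> 0)) (fun=> 0).
Proof.
have := blo_sub Hs0 Hs0; under eq_fun do rewrite subr0; move/aeq_trans; apply.
by apply: aeq_eq => x; rewrite subrr.
Qed.
Lemma blo_scale (l : C) f : Hs p f -> aeq (A (fun z => l * f z)) (fun z => l * A f z).
Proof.
move=> hf; have := blo_lin l Hs0 hf; under eq_fun do rewrite add0r.
by move=> h; apply: (aeD2 h blo_0) => x _ -> ->; rewrite add0r.
Qed.
Lemma blo_add f g : Hs p f -> Hs p g -> aeq (A (fun z => f z + g z)) (fun z => A f z + A g z).
Proof.
move=> hf hg; have := blo_lin 1 hf hg.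
by under eq_fun do rewrite mul1r; under [X in aeq _ X]eq_fun do rewrite mul1r.
Qed.

Hypothesis Aonto : forall h, Hs p h -> exists2 f, Hs p f & aeq (A f) h.

Let Im (m : nat) h := exists f, [/\ Hs p f, aeq (A f) h & N f <= m%:R].

(** Baire's argument by hand. If no [Im m] were dense in a ball, there would be shrinking balls each
    of which stays away from the next [Im m]; halving the radii and moving the centres by at most a
    quarter of them, the centres converge to a point outside every [Im m], against surjectivity. *)
Lemma baire_step : exists m y0 (r : R), [/\ Hs p y0, 0 < r & forall y, Hs p y -> N (fun z => y z - y0 z) < r ->
  forall e : R, 0 < e -> exists a, [/\ Hs p a, Im m a & N (fun z => y z - a z) < e]].
Proof.
apply: contrapT => nH.
have ch (s : nat * ((C -> C) * R)) : exists s' : (C -> C) * R,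
    Hs p s.2.1 -> 0 < s.2.2 -> [/\ Hs p s'.1, 0 < s'.2, s'.2 <= s.2.2 / 2,
      N (fun z => s'.1 z - s.2.1 z) <= s.2.2 / 4 &
      forall a, Hs p a -> Im s.1 a -> s'.2 < N (fun z => s'.1 z - a z)].
  case: s => m [y r] /=; have [[hy r0]|nh] := pselect (Hs p y /\ 0 < r); last first.
    by exists (y, r) => h1 h2; case: nh.
  have r4 : 0 < r / 4 by rewrite divr_gt0.
  apply: contrapT => nh; apply: nH; exists m, y, (r / 4); split => // y' hy' hd e e0.
  apply: contrapT => na; apply: nh.
  exists (y', Num.min (e / 2) (r / 2)) => _ _ /=; split => //.
  - by rewrite lt_min !divr_gt0.
  - by rewrite ge_min lexx orbT.
  - exact: ltW.
  move=> a ha ia; apply: (@le_lt_trans _ _ (e / 2)); first by rewrite ge_min lexx.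
  rewrite ltNge; apply/negP => h1; apply: na; exists a; split => //.
  by apply: (le_lt_trans h1); rewrite ltr_pdivrMr// mulr_natr mulr2n ltrDl.
have [nx hnx] := boolp.choice ch.
pose st := fix st n : (C -> C) * R := if n is n'.+1 then nx (n', st n') else ((fun=> 0), 1).
have hst n : Hs p (st n).1 /\ 0 < (st n).2.
  elim: n => [|n [h1 h2]]; first by split; [exact: Hs0|exact: ltr01].
  by have [] := hnx (n, st n) h1 h2.
have prop n : [/\ (st n.+1).2 <= (st n).2 / 2, N (fun z => (st n.+1).1 z - (st n).1 z) <= (st n).2 / 4 &
      forall a, Hs p a -> Im n a -> (st n.+1).2 < N (fun z => (st n.+1).1 z - a z)].
  by have [h1 h2] := hst n; have [] := hnx (n, st n) h1 h2.
have rdec n k : (st (n + k)%N).2 <= (st n).2 * 2^-1 ^+ k.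
  elim: k => [|k IH]; first by rewrite addn0 expr0 mulr1.
  have [h _ _] := prop (n + k)%N; rewrite addnS; apply: (le_trans h).
  by rewrite exprSr mulrA ler_pM2r ?invr_gt0.
have r2 n : (st n).2 <= 2^-1 ^+ n by have := rdec 0%N n; rewrite /= mul1r.
pose u k z := (st k.+1).1 z - (st k).1 z.
have hu k : Hs p (u k) by apply: Hs_sub; [exact: (hst k.+1).1|exact: (hst k).1].
have nu k : N (u k) <= 4^-1 * 2^-1 ^+ k.
  have [_ h _] := prop k; apply: (le_trans h).
  by rewrite mulrC ler_pM2l ?invr_gt0//; exact: r2.
have c0 : 0 <= (4^-1 : R) by rewrite invr_ge0.
have [y hy ny] := Hs_complete c0 hu nu.
have su n z : \sum_(0 <= k < n) u k z = (st n).1 z.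
  elim: n => [|n IH]; first by rewrite big_geq.
  by rewrite big_nat_recr//= IH /u; ring.
have dk n k : N (fun z => (st (n + k)%N).1 z - (st n).1 z) <= (st n).2 / 2.
  suff : N (fun z => (st (n + k)%N).1 z - (st n).1 z) <= (st n).2 / 2 * (1 - 2^-1 ^+ k).
    move/le_trans; apply; apply: ler_piMr; first exact: ltW (divr_gt0 (hst n).2 (ltr0Sn R 1)).
    by rewrite gerBl ltW// half_gt0.
  elim: k => [|k IH].
    rewrite addn0 expr0 subrr mulr0 (normLp_aeq0 p0)//; last by apply: aeq_eq => t; rewrite subrr.
    by apply: Hs_m; apply: Hs_sub; exact: (hst n).1.
  have -> : (fun z => (st (n + k.+1)%N).1 z - (st n).1 z) = fun z => ((st (n + k).+1).1 z - (st (n + k)%N).1 z) + ((st (n + k)%N).1 z - (st n).1 z).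
    by apply/funext => z; rewrite addnS; ring.
  have [_ h _] := prop (n + k)%N.
  apply: (le_trans (normLp_add p1' (Hs_Lp (hu _)) (Hs_Lp (Hs_sub (hst _).1 (hst _).1)))).
  apply: (le_trans (lerD h IH)).
  apply: (@le_trans _ _ ((st n).2 * 2^-1 ^+ k / 4 + (st n).2 / 2 * (1 - 2^-1 ^+ k))).
    by rewrite lerD2r ler_pM2r ?invr_gt0//; exact: rdec.
  by rewrite exprS le_eqVlt; apply/orP; left; apply/eqP; field.
have yk n : N (fun z => y z - (st n).1 z) <= (st n).2 / 2.
  apply: (@le_half_eps _ _ _ (2 * 4^-1)) => k.
  have -> : (fun z => y z - (st n).1 z) = fun z => (y z - \sum_(0 <= i < n + k) u i z) + ((st (n + k)%N).1 z - (st n).1 z).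
    by apply/funext => z; rewrite su; ring.
  have hd : Hs p (fun z => y z - \sum_(0 <= i < n + k) u i z) by apply: Hs_sub => //; exact: Hs_sum.
  apply: (le_trans (normLp_add p1' (Hs_Lp hd) (Hs_Lp (Hs_sub (hst _).1 (hst _).1)))).
  rewrite addrC; apply: lerD; first exact: dk.
  apply: (le_trans (ny _)); apply: ler_wpM2l; first by rewrite mulr_ge0.
  by apply: ler_wiXn2l; rewrite ?invr_ge0 ?invf_le1 ?ler1n ?leq_addl.
have [f hf ef] := Aonto hy.
pose m := (Num.truncn (N f)).+1.
have [_ _ h] := prop m.
have := h y hy; rewrite normLp_distC => /(_ _)/lt_geF-/(_ _)/negP; apply.
  by exists f; split => //; apply: ltW; exact: truncnS_gt.
apply: (le_trans (yk m.+1)); rewrite ler_pdivrMr// ler_peMr ?ler1n//.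
by apply: ltW; exact: (hst m.+1).2.
Qed.

Lemma halfS (a : R) n : a * 2^-1 ^+ n.+1 = a * 2^-1 ^+ n / 2.
Proof. by rewrite exprSr mulrA. Qed.

(** Approximating [y0 + l y] and [y0] from [Im m] and subtracting approximates [l y]. With
    [l = r / (2 N y)] the two errors [r / 8] become [N y / 2] after division by [l], and the two
    preimages of norm at most [m] give [2 m / l = (4 m / r) N y]. *)
Lemma half_solve : exists2 M : R, 0 <= M & forall y, Hs p y ->
  exists x, [/\ Hs p x, N x <= M * N y & N (fun z => y z - A x z) <= N y / 2].
Proof.
have [m [y0 [r [hy0 r0 H]]]] := baire_step.
exists (4 * m%:R / r); first by rewrite divr_ge0// ?ltW// mulr_ge0.
move=> y hy; have [yz|yn] := eqVneq (N y) 0.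
  exists (fun=> 0); split; [exact: Hs0|by rewrite normLp0// yz mulr0|].
  have h0 := normLp_aeq0 p0 (Hs_m (blo_Hs Hs0)) blo_0.
  apply: (le_trans (normLp_sub p1' (Hs_Lp hy) (Hs_Lp (blo_Hs Hs0)))).
  by rewrite yz h0 mul0r addr0.
have y1 : 0 < N y by rewrite lt0r yn normLp_ge0.
pose l := r / (2 * N y); have l0 : 0 < l by rewrite divr_gt0// mulr_gt0.
have lN : l * N y = r / 2 by rewrite /l; field.
have r8 : 0 < r / 8 by rewrite divr_gt0.
have al : absC (Complex l 0) = l by rewrite absC_real gtr0_norm.
have hly := Hs_scale (Complex l 0) hy.
have [|a1 [ha1 [f1 [hf1 e1 n1]] d1]] := H _ (Hs_add hy0 hly) _ _ r8.
  have -> : (fun z => y0 z + Complex l 0 * y z - y0 z) = fun z => Complex l 0 * y z.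
    by apply/funext => z; ring.
  by rewrite (normLp_scale _ p0 (Hs_Lp hy)) al lN ltr_pdivrMr// mulr_natr mulr2n ltrDl.
have [|a2 [ha2 [f2 [hf2 e2 n2]] d2]] := H _ hy0 _ _ r8.
  rewrite (normLp_aeq0 p0)//; last by apply: aeq_eq => t; rewrite subrr.
  by apply: Hs_m; exact: Hs_sub.
pose k : C := Complex l^-1 0.
have ak : absC k = l^-1 by rewrite absC_real gtr0_norm ?invr_gt0.
have kl : k * Complex l 0 = 1.
  by apply: eqCplx; rewrite /= ?mulr0 ?mul0r ?addr0 ?subr0// mulVf// lt0r_neq0.
have hx : Hs p (fun z => k * (f1 z - f2 z)) by apply: Hs_scale; exact: Hs_sub.
exists (fun z => k * (f1 z - f2 z)); split => //.
  rewrite (normLp_scale k p0 (Hs_Lp (Hs_sub hf1 hf2))).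
  rewrite ak; apply: (@le_trans _ _ (l^-1 * (m%:R + m%:R))).
    rewrite ler_pM2l ?invr_gt0//; apply: (le_trans (normLp_sub p1' (Hs_Lp hf1) (Hs_Lp hf2))).
    exact: (lerD n1 n2).
  rewrite le_eqVlt; apply/orP; left; apply/eqP; rewrite /l; field.
  by rewrite yn lt0r_neq0.
have eA : aeq (A (fun z => k * (f1 z - f2 z))) (fun z => k * (a1 z - a2 z)).
  apply: aeq_trans (blo_scale _ (Hs_sub hf1 hf2)) _.
  apply: (aeD3 (blo_sub hf1 hf2) e1 e2) => t _ -> -> ->; by [].
have -> : N (fun z => y z - A (fun z0 => k * (f1 z0 - f2 z0)) z) =
   N (fun z => k * ((y0 z + Complex l 0 * y z - a1 z) - (y0 z - a2 z))).
  apply: normLp_aeq.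
  - by apply: Hs_m; apply: Hs_sub => //; exact: blo_Hs.
  - by apply: Hs_m; apply/Hs_scale/Hs_sub; apply: Hs_sub => //; exact: Hs_add.
  apply: (aeD1 eA) => t _ ->; rewrite -[y _ in LHS]mul1r -kl; ring.
have hd1 : Hs p (fun z => y0 z + Complex l 0 * y z - a1 z) by apply: Hs_sub => //; exact: Hs_add.
have hd2 := Hs_sub hy0 ha2.
rewrite (normLp_scale k p0 (Hs_Lp (Hs_sub hd1 hd2))).
rewrite ak; apply: (@le_trans _ _ (l^-1 * (r / 8 + r / 8))).
  rewrite ler_pM2l ?invr_gt0//; apply: (le_trans (normLp_sub p1' (Hs_Lp hd1) (Hs_Lp hd2))).
  exact: (lerD (ltW d1) (ltW d2)).
rewrite le_eqVlt; apply/orP; left; apply/eqP; rewrite /l; field.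
by rewrite yn lt0r_neq0.
Qed.

(** Each application of [half_solve] halves the remainder, so the corrections form a geometric
    series, whose sum doubles the constant. *)
Lemma open_mapping : exists2 M : R, 0 <= M & forall h, Hs p h ->
  exists f, [/\ Hs p f, aeq (A f) h & N f <= M * N h].
Proof.
have [M M0 H] := half_solve; have [MA MA0 hA] := blo_bound.
exists (2 * M); first exact: mulr_ge0.
move=> h hh.
have ch y : exists x, Hs p y -> [/\ Hs p x, N x <= M * N y & N (fun z => y z - A x z) <= N y / 2].
  have [hy|nh] := pselect (Hs p y); last by exists y.
  by have [x hx] := H y hy; exists x.
have [X hX] := boolp.choice ch.
have [y [y0 yS]] : exists y : nat -> C -> C, y 0%N = h /\
    forall n, y n.+1 = fun z => y n z - A (X (y n)) z.
  by exists (fix y n := if n is n'.+1 then (fun z => y n' z - A (X (y n')) z) else h).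
have hy n : Hs p (y n).
  elim: n => [|n IH]; first by rewrite y0.
  by rewrite yS; have [h1 _ _] := hX _ IH; apply: Hs_sub => //; exact: blo_Hs.
have ny n : N (y n) <= N h * 2^-1 ^+ n.
  elim: n => [|n IH]; first by rewrite expr0 mulr1 y0.
  have [_ _ h2] := hX _ (hy n); rewrite yS; apply: (le_trans h2).
  rewrite [leRHS](halfS (N h) n); exact: (ler_wpM2r (eq_ind_r is_true (ler0n R 2) (invr_ge0 2)) IH).
have nx n : N (X (y n)) <= M * N h * 2^-1 ^+ n.
  have [_ h2 _] := hX _ (hy n); apply: (le_trans h2).
  by rewrite -mulrA ler_wpM2l.
have hx n : Hs p (X (y n)) by have [] := hX _ (hy n).
have c0 : 0 <= M * N h by rewrite mulr_ge0// normLp_ge0.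
have [f hf nf] := Hs_complete c0 hx nx.
have hS n : Hs p (fun z => \sum_(0 <= k < n) X (y k) z) by exact: Hs_sum.
have AS n : aeq (A (fun z => \sum_(0 <= k < n) X (y k) z)) (fun z => h z - y n z).
  elim: n => [|n IH].
    have -> : (fun z => \sum_(0 <= k < 0) X (y k) z) = fun=> 0 by apply/funext => z; rewrite big_geq.
    by apply: (aeD1 blo_0) => t _ ->; rewrite y0 subrr.
  have -> : (fun z => \sum_(0 <= k < n.+1) X (y k) z) = fun z => \sum_(0 <= k < n) X (y k) z + X (y n) z.
    by apply/funext => z; rewrite big_nat_recr.
  apply: aeq_trans (blo_add (hS n) (hx n)) _.
  by apply: (aeD1 IH) => t _ -> /=; rewrite yS; ring.
exists f; split => //; last first.
  have := nf 0%N; rewrite expr0 mulr1 mulrA.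
  by under [X in N X]eq_fun do rewrite big_geq// subr0.
have e0 : aeq (fun z => A f z - h z) (fun=> 0).
  have hd : Hs p (fun z => A f z - h z) by apply: Hs_sub => //; exact: blo_Hs.
  apply: normLp_eq0 (Hs_Lp hd) _ => //; apply/eqP; rewrite eq_le normLp_ge0 andbT.
  apply: (@le_half_eps _ _ _ (MA * (2 * (M * N h)) + N h)) => n; rewrite add0r.
  pose Sn z := \sum_(0 <= k < n) X (y k) z.
  have -> : N (fun z => A f z - h z) = N (fun z => A (fun w => f w - Sn w) z - y n z).
    apply: normLp_aeq; [exact: Hs_m| |].
      by apply: Hs_m; apply: Hs_sub => //; apply: blo_Hs; exact: Hs_sub (hS n).
    by apply: (aeD2 (blo_sub hf (hS n)) (AS n)) => t _ -> ->; ring.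
  have hfS := Hs_sub hf (hS n).
  apply: (le_trans (normLp_sub p1' (Hs_Lp (blo_Hs hfS)) (Hs_Lp (hy n)))).
  rewrite mulrDl; apply: lerD (ny n); apply: (le_trans (hA _ hfS)).
  by rewrite -[leRHS]mulrA; apply: ler_wpM2l => //; exact: nf.
by apply: (aeD1 e0) => t _ /eqP; rewrite subr_eq0 => /eqP.
Qed.

End OpenMapping.
(** * Toeplitz and Hankel operators *)

Section RieszOperators.
Variable R : realType.
Local Notation C := R[i].
Implicit Types (a b f g h y : C -> C) (z : C) (p q K : R).
Implicit Types (s t : seq (C * int)).

Definition Linf f := measC f /\ exists M : R, aeD (fun x => ab f x <= M).
Definition Qs (p : R) f := Lp p f /\ forall n : int, 0 <= n -> fourier f n = 0.
Definition pair f g : C := cint (fun z => f z * fconj g z).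

Lemma Linf_Lp g : Linf g -> exists2 M : R, 0 <= M & forall p f, 0 < p -> Lp p f ->
  Lp p (fun z => g z * f z) /\ normLp p (fun z => g z * f z) <= M * normLp p f.
Proof.
move=> [mg [M hM]]; exists `|M|; first exact: normr_ge0.
by move=> p f p0 hf; exact: inLp_Linf.
Qed.
Lemma Linf_mulLp p g f : 0 < p -> Linf g -> Lp p f -> Lp p (fun z => g z * f z).
Proof. by move=> p0 /Linf_Lp[M _ h] hf; have [] := h p f p0 hf. Qed.
Lemma Linf_mul f g : Linf f -> Linf g -> Linf (fun z => f z * g z).
Proof.
move=> [mf [M hM]] [mg [K hK]]; split; first exact: measC_mul.
exists (`|M| * `|K|); apply: (aeD2 hM hK) => x _ h1 h2; rewrite /ab absCM.
apply: ler_pM; rewrite ?absC_ge0//; first exact: le_trans h1 (ler_norm _).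
exact: le_trans h2 (ler_norm _).
Qed.
Lemma Linf_ab f g : measC g -> aeD (fun x => ab g x = ab f x) -> Linf f -> Linf g.
Proof.
by move=> mg h [mf [M hM]]; split => //; exists M; apply: (aeD2 h hM) => x _ ->.
Qed.
Lemma Linf_tilde f : Linf f -> Linf (tilde f).
Proof.
move=> [mf [M hM]]; split; first exact: measC_tilde.
by exists M; apply: (aeD1 (aeD_rfl hM)) => x _ /=; rewrite ab_tilde.
Qed.
Lemma Linf_conj f : Linf f -> Linf (fconj f).
Proof.
move=> hf; apply: (Linf_ab _ _ hf); first by apply: measC_conj; case: hf.
by apply: aeD_all => x _; rewrite ab_conj.
Qed.
Lemma Linf_mon f (k : int) : Linf f -> Linf (fun z => f z * z ^ k).
Proof.
move=> hf; apply: (Linf_ab _ _ hf); first by apply: measC_mul; [case: hf|exact: measC_mon].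
by apply: aeD_all => x _; rewrite ab_mon.
Qed.

Section Fixed.
Variable p : R.
Hypothesis p1 : 1 < p.
Let p1' : 1 <= p. Proof. exact: ltW. Qed.
Let p0 : 0 < p. Proof. exact: lt_trans p1. Qed.
Local Notation N := (normLp p).

Lemma Qs_Lp f : Qs p f -> Lp p f. Proof. by case. Qed.
Lemma Qs_L1 f : Qs p f -> Lp 1 f. Proof. by move=> /Qs_Lp; exact: inL1_pn. Qed.
Lemma Qs_aeq f g : measC g -> aeq f g -> Qs p f -> Qs p g.
Proof.
move=> mg h [L h0]; split; first exact: inLp_aeq L.
by move=> n n0; rewrite -(fourier_aeq n (inLp_m L) mg h) h0.
Qed.
Lemma Qs_scale (c : C) f : Qs p f -> Qs p (fun z => c * f z).
Proof.
move=> hf; split; first by apply: inLp_scale => //; exact: Qs_Lp.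
by move=> n n0; rewrite fourier_scale; [rewrite hf.2// mulr0|exact: Qs_L1].
Qed.
Lemma Qs_add f g : Qs p f -> Qs p g -> Qs p (fun z => f z + g z).
Proof.
move=> hf hg; split; first by apply: inLp_add => //; exact: Qs_Lp.
by move=> n n0; rewrite fourier_add; [rewrite hf.2// hg.2// addr0|exact: Qs_L1|exact: Qs_L1].
Qed.
Lemma Qs_sub f g : Qs p f -> Qs p g -> Qs p (fun z => f z - g z).
Proof.
move=> hf /(Qs_scale (-1)) hg; have := Qs_add hf hg.
by under eq_fun do rewrite mulN1r.
Qed.
Lemma QsP f h : Lp p f -> Lp p h ->
  Qs p (fun z => f z - h z) <-> forall n : int, 0 <= n -> fourier f n = fourier h n.
Proof.
move=> hf hh; have f1 := inL1_pn p1 hf; have h1 := inL1_pn p1 hh; split=> [[_ h0] n n0|h0].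
  by apply/eqP; rewrite -subr_eq0 -fourier_sub// h0.
split; first exact: inLp_sub.
by move=> n n0; rewrite fourier_sub// h0// subrr.
Qed.
Lemma HsQs_eq0 f : Hs p f -> Qs p f -> aeq f (fun=> 0).
Proof.
move=> [Lf h1] [_ h2]; apply: L1_unique; first exact: inL1_pn Lf.
by move=> n; have [n0|n0] := ltP n 0; [exact: h1|exact: h2].
Qed.
Lemma Hs_eq_pos f g : Hs p f -> Hs p g -> (forall n : int, 0 <= n -> fourier f n = fourier g n) -> aeq f g.
Proof.
move=> hf hg h; apply: fourier_inj; [exact: Hs_L1 hf|exact: Hs_L1 hg|].
by move=> n; have [n0|n0] := ltP n 0; [rewrite hf.2// hg.2|exact: h].
Qed.

Lemma rieszP_bound : exists2 K : R, 0 <= K & forall f, Lp p f ->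
  [/\ Hs p (rieszP f), (forall n : int, 0 <= n -> fourier (rieszP f) n = fourier f n) &
      N (rieszP f) <= K * N f].
Proof.
have [K K0 hK] := riesz_Lp p1; exists K => // f hf; have [g [Lg fg ng]] := hK f hf.
have Lg1 : inLp 1 g by apply/LpE; exact: (inL1_pn p1 Lg).
have [L1 fr] : IsRiesz f (rieszP f) by apply: epsilon_spec; exists g.
move/LpE: L1 => L1.
have e : aeq g (rieszP f) by apply: fourier_inj => // [|n]; [exact: (inL1_pn p1 Lg)|rewrite fg fr].
split.
- split; first exact: inLp_aeq (inLp_m L1) e Lg.
  by move=> n n0; rewrite fr leNgt n0.
- by move=> n n0; rewrite fr n0.
by rewrite -(normLp_aeq p (inLp_m Lg) (inLp_m L1) e).
Qed.
Lemma Hs_rieszP f : Lp p f -> Hs p (rieszP f).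
Proof. by have [K _ h] := rieszP_bound => /h[]. Qed.
Lemma fourier_rieszP f (n : int) : Lp p f -> 0 <= n -> fourier (rieszP f) n = fourier f n.
Proof. by have [K _ h] := rieszP_bound => /h[_ + _]; apply. Qed.

Lemma Qs_rieszQ f : Lp p f -> Qs p (rieszQ f).
Proof.
move=> hf; apply/QsP => //; first exact: Hs_Lp (Hs_rieszP hf).
by move=> n n0; rewrite fourier_rieszP.
Qed.

Lemma Hs_tp s : analytic s -> Hs p (tp s).
Proof.
move=> hs; split; first exact: inLp_tp (ltW p0).
move=> n n0; rewrite fourier_tp /tpcoef big1_seq// => x /andP[/eqP e xs].
by have /allP/(_ x xs) := hs; rewrite e leNgt n0.
Qed.

Lemma dens_Hs g : Hs p g -> forall e : R, 0 < e -> exists s, analytic s /\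
  N (fun z => g z - tp s z) < e.
Proof.
move=> hg e e0; have [K K0 hK] := rieszP_bound.
have K1 : 0 < K + 1 by rewrite ltr_wpDl.
have [s hs] := dens_Lp p1' (Hs_Lp hg) (divr_gt0 e0 K1); exists (tpP s).
have as_ : analytic (tpP s) by rewrite /analytic all_filter; apply/allP => x _; exact: implybb.
split => //.
have Ls : Lp p (tp s) by exact: inLp_tp (ltW p0).
have Ld := inLp_sub p1' (Hs_Lp hg) Ls.
have [h1 h2 h3] := hK _ Ld.
have hd := Hs_sub p1 hg (Hs_tp as_).
have -> : N (fun z => g z - tp (tpP s) z) = N (rieszP (fun z => g z - tp s z)).
  apply: normLp_aeq; [exact: Hs_m hd|exact: Hs_m h1|].
  apply: Hs_eq_pos => // n n0; rewrite h2// !fourier_sub ?fourier_tp ?tpcoef_tpP ?n0//;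
    by [exact: Hs_L1 hg|exact: inLp_tp].
apply: (le_lt_trans h3); apply: (@le_lt_trans _ _ ((K + 1) * N (fun z => g z - tp s z))).
  by rewrite ler_wpM2r ?normLp_ge0// lerDl.
by rewrite mulrC -ltr_pdivlMr.
Qed.

Lemma pair_L1 f g : Lp p f -> Lp (conjexp p) g -> Lp 1 (fun z => f z * fconj g z) /\
  absC (pair f g) <= 2 * (pi *+ 2 * N f * normLp (conjexp p) g).
Proof.
move=> hf hg; have [q1 pq _] := conj_exp p1; have q0 : 0 < conjexp p by exact: lt_trans q1.
have [h1 h2] := hoelderC p0 q0 pq hf (inLp_conj hg); split => //.
have <- : normLp (conjexp p) (fconj g) = normLp (conjexp p) g by apply: normLp_ab => x; rewrite ab_conj.
exact: (le_trans (cint_abs h1) (ler_wpM2l (ler0n R 2) h2)).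
Qed.

Lemma conj_tp s x : fconj (tp s) (circ x) = tp (tpconj s) (circ x).
Proof. by rewrite tp_conj. Qed.

Lemma pair_tp f s : Lp 1 f -> c2pi R * pair f (tp s) = \sum_(x <- s) (x.1^*)%C * fourier f x.2.
Proof.
move=> hf; rewrite /pair (@eq_cint _ _ (fun z => f z * tp (tpconj s) z)); last first.
  by move=> x _; rewrite conj_tp.
by rewrite cint_tp_mul// big_map; apply: eq_bigr => x _ /=; rewrite opprK.
Qed.

End Fixed.

(** * Duality pairing and the flip [J] *)

Section Pairing.
Variable p : R.
Hypothesis p1 : 1 < p.
Let p1' : 1 <= p. Proof. exact: ltW. Qed.
Let p0 : 0 < p. Proof. exact: lt_trans p1. Qed.
Local Notation q := (conjexp p).
Let q1 : 1 < q. Proof. by have [] := conj_exp p1. Qed.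

Lemma pair_subr f g h : Lp p f -> Lp q g -> Lp q h ->
  pair f (fun z => g z - h z) = pair f g - pair f h.
Proof.
move=> hf hg hh; have [L1 _] := pair_L1 p1 hf hg; have [L2 _] := pair_L1 p1 hf hh.
rewrite /pair -mulN1r -(cint_scale (-1) L2) -cint_add//; last exact: inLp_scale.
apply: eq_cint => x _; rewrite /fconj rmorphB /=; ring.
Qed.
Lemma pair_subl f g h : Lp p f -> Lp p g -> Lp q h ->
  pair (fun z => f z - g z) h = pair f h - pair g h.
Proof.
move=> hf hg hh; have [L1 _] := pair_L1 p1 hf hh; have [L2 _] := pair_L1 p1 hg hh.
rewrite /pair -mulN1r -(cint_scale (-1) L2) -cint_add//; last exact: inLp_scale.
apply: eq_cint => x _; ring.
Qed.
Lemma pair_addl f g h : Lp p f -> Lp p g -> Lp q h ->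
  pair (fun z => f z + g z) h = pair f h + pair g h.
Proof.
move=> hf hg hh; have [L1 _] := pair_L1 p1 hf hh; have [L2 _] := pair_L1 p1 hg hh.
by rewrite /pair -cint_add//; apply: eq_cint => x _; ring.
Qed.
Lemma pair_conj f g : Lp p f -> Lp q g -> pair g f = ((pair f g)^*)%C.
Proof.
move=> hf hg; have [L1 _] := pair_L1 p1 hf hg.
by rewrite /pair -cint_conj//; apply: eq_cint => x _; rewrite /fconj conjM conjcK mulrC.
Qed.

Lemma pair_Qs y g : Qs p y -> Hs q g -> pair y g = 0.
Proof.
move=> hy hg.
apply: absC_eq0; apply/eqP; rewrite eq_le absC_ge0 andbT.
set c := 2 * (pi *+ 2 * normLp p y).
have c0 : 0 <= c by rewrite !mulr_ge0 ?normLp_ge0// ltW// pi2_gt0.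
apply: (@le_lin_eps _ _ _ c c0) => d d0; rewrite add0r.
have [s [as_ hs]] := dens_Hs q1 hg d0.
have hps : pair y (tp s) = 0.
  apply: (mulfI (c2pi_neq0 R)); rewrite mulr0 pair_tp; last exact: (Qs_L1 p1 hy).
  rewrite big1_seq// => x /andP[_ xs]; rewrite hy.2 ?mulr0//.
  exact: (allP as_ x xs).
have Lts : Lp q (tp s) by apply: inLp_tp; apply: ltW; exact: lt_trans q1.
rewrite -[pair y g]subr0 -hps -pair_subr; [|exact: Qs_Lp hy|exact: Hs_Lp hg|by []].
have [_] := pair_L1 p1 (Qs_Lp hy) (inLp_sub (ltW q1) (Hs_Lp hg) Lts).
move/le_trans; apply; rewrite mulrA -/c; apply: ler_wpM2l c0 _ _ _; exact: ltW.
Qed.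

Lemma pair_mon f (n : int) : Lp p f -> c2pi R * pair f (fun z => z ^ n) = fourier f n.
Proof.
move=> hf; rewrite fourierE; congr (_ * _); apply: eq_cint => x _.
by rewrite /fconj conj_circX.
Qed.

Lemma pair_eq0 f : Hs p f -> (forall g, Hs q g -> pair f g = 0) -> aeq f (fun=> 0).
Proof.
move=> hf h; apply: (HsQs_eq0 p1 hf); split; first exact: Hs_Lp hf.
move=> n n0; rewrite -pair_mon; last exact: Hs_Lp hf.
rewrite h ?mulr0//; have hs : analytic [:: (1 : C, n)] by rewrite /analytic /= n0.
by have := Hs_tp q1 hs; rewrite (_ : tp _ = fun z => z ^ n)//; apply/funext => z; rewrite tp_mon mul1r.
Qed.

Lemma flipJE f x : flipJ f (circ x) = (fun z => tilde f z * z ^ (-1 : int)) (circ x).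
Proof. by rewrite /flipJ /tilde mulrC. Qed.
Lemma fourier_flipJ f (n : int) : Lp 1 f -> fourier (flipJ f) n = fourier f (- n - 1).
Proof.
move=> hf; rewrite (eq_fourier _ (flipJE f)) fourier_mon opprK fourier_tilde// opprD; by [].
Qed.
Lemma ab_flipJ f x : ab (flipJ f) x = ab (tilde f) x.
Proof. by rewrite /ab /flipJ absCM absCV absC_circ invr1 mul1r. Qed.
Lemma measC_flipJ f : measC f -> measC (flipJ f).
Proof.
move=> mf; apply: measC_mul; last exact: measC_tilde.
by have := @measC_mon R (-1); rewrite /measC /reF /imF.
Qed.
Lemma flipJ_Lp f : Lp p f -> Lp p (flipJ f) /\ normLp p (flipJ f) = normLp p f.
Proof.
move=> hf; split; last by rewrite (normLp_ab _ (ab_flipJ f)) normLp_tilde.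
by apply: (inLp_ab _ (ab_flipJ f) (inLp_tilde hf)); apply: measC_flipJ; exact: inLp_m hf.
Qed.
Lemma flipJ_aeq f g : aeq f g -> aeq (flipJ f) (flipJ g).
Proof. by move=> /aeq_tilde h; apply: (aeD1 h) => x _; rewrite /flipJ /tilde => ->. Qed.
Lemma flipJK f x : flipJ (flipJ f) (circ x) = f (circ x).
Proof. by rewrite /flipJ invrK mulrA mulVf ?circ_neq0// mul1r. Qed.
Lemma Qs_flipJ f : Hs p f -> Qs p (flipJ f).
Proof.
move=> hf; split; first by have [] := flipJ_Lp (Hs_Lp hf).
move=> n n0; rewrite fourier_flipJ; last exact: (Hs_L1 p1 hf).
by rewrite hf.2// ltrBlDr add0r (le_lt_trans (_ : - n <= 0))// oppr_le0.
Qed.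
Lemma Hs_flipJ f : Qs p f -> Hs p (flipJ f).
Proof.
move=> hf; split; first by have [] := flipJ_Lp (Qs_Lp hf).
move=> n n0; rewrite fourier_flipJ; last exact: (Qs_L1 p1 hf).
by rewrite hf.2// lerBrDr add0r -gtz0_ge1 oppr_gt0.
Qed.
End Pairing.

Section ProjectedOperators.
Variable p : R.
Hypothesis p1 : 1 < p.
Let p1' : 1 <= p. Proof. exact: ltW. Qed.
Let p0 : 0 < p. Proof. exact: lt_trans p1. Qed.
Local Notation N := (normLp p).
Variables (O B : (C -> C) -> C -> C).
Hypothesis BL : forall f, Hs p f -> Lp p (B f).
Hypothesis OH : forall f, Hs p f -> Hs p (O f).
Hypothesis OB : forall f, Hs p f -> forall n : int, 0 <= n -> fourier (O f) n = fourier (B f) n.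

(** For an operator [O = P B], the equation [O f = h] in the Hardy space says that [B f - h] has
    only negative coefficients. In this form [rieszP] disappears and symbols can be manipulated
    pointwise. *)
Lemma proj_eq f h : Hs p f -> Hs p h -> aeq (O f) h <-> Qs p (fun z => B f z - h z).
Proof.
move=> hf hh; rewrite QsP//; [|exact: BL|exact: Hs_Lp hh]; split=> [e n n0|e].
  rewrite -OB//; apply: fourier_aeq e; [exact: Hs_m (OH hf)|exact: Hs_m hh].
by apply: (Hs_eq_pos p1 (OH hf) hh) => n n0; rewrite OB// e.
Qed.

Lemma proj_blo : (forall f g (l : C) z, B (fun w => f w + l * g w) z = B f z + l * B g z) ->
  (exists2 M : R, 0 <= M & forall f, Hs p f -> N (B f) <= M * N f) -> isBLOp p O.
Proof.
move=> Blin [M M0 hM]; split; first by move=> f /HsE hf; apply/HsE; exact: OH.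
split.
  move=> f g l /HsE hf /HsE hg; have hfg := Hs_add p1 hf (Hs_scale p1 l hg).
  apply/proj_eq => //; first by apply: Hs_add => //; [exact: OH|apply: Hs_scale => //; exact: OH].
  have hd k : Hs p k -> Qs p (fun z => B k z - O k z).
    by move=> hk; apply/proj_eq; [|exact: OH|exact: aeq_refl].
  have -> : (fun z => B (fun w => f w + l * g w) z - (O f z + l * O g z)) =
     (fun z => (B f z - O f z) + l * (B g z - O g z)) by apply/funext => z; rewrite Blin; ring.
  by apply: Qs_add => //; [exact: hd|apply: Qs_scale => //; exact: hd].
have [K K0 hK] := rieszP_bound p1.
exists (K * M) => f /HsE hf; have [h1 h2 h3] := hK _ (BL hf).
have -> : N (O f) = N (rieszP (B f)).
  apply: normLp_aeq; [exact: Hs_m (OH hf)|exact: Hs_m h1|].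
  by apply: (Hs_eq_pos p1 (OH hf) h1) => n n0; rewrite OB// h2.
by rewrite -mulrA; exact: (le_trans h3 (ler_wpM2l K0 (hM _ hf))).
Qed.
End ProjectedOperators.

Section ToeplitzHankel.
Variable p : R.
Hypothesis p1 : 1 < p.
Let p1' : 1 <= p. Proof. exact: ltW. Qed.
Let p0 : 0 < p. Proof. exact: lt_trans p1. Qed.
Local Notation N := (normLp p).
Variables (a b : C -> C).
Hypotheses (La : Linf a) (Lb : Linf b).

Lemma aLp f : Lp p f -> Lp p (fun z => a z * f z). Proof. exact: Linf_mulLp. Qed.
Lemma Toep_Hs f : Hs p f -> Hs p (Toep a f).
Proof. by move=> hf; apply: Hs_rieszP => //; apply: aLp; exact: Hs_Lp. Qed.
Lemma ToepP f h : Hs p f -> Hs p h -> aeq (Toep a f) h <-> Qs p (fun z => a z * f z - h z).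
Proof.
apply: (proj_eq p1 (O := Toep a) (B := fun f z => a z * f z)).
- by move=> g hg; apply: aLp; exact: Hs_Lp.
- exact: Toep_Hs.
- by move=> g hg n n0; rewrite (fourier_rieszP p1)//; apply: aLp; exact: Hs_Lp.
Qed.
Lemma Toep_blo : isBLOp p (Toep a).
Proof.
apply: (proj_blo p1 (O := Toep a) (B := fun f z => a z * f z)).
- by move=> g hg; apply: aLp; exact: Hs_Lp.
- exact: Toep_Hs.
- by move=> g hg n n0; rewrite (fourier_rieszP p1)//; apply: aLp; exact: Hs_Lp.
- by move=> f g l z; ring.
by have [M M0 hM] := Linf_Lp La; exists M => // f hf; have [] := hM p f p0 (Hs_Lp hf).
Qed.

Let B f z := a z * f z + b z * flipJ f z.
Let bJ f : Hs p f -> Lp p (fun z => b z * flipJ f z).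
Proof. by move=> hf; apply: Linf_mulLp => //; have [] := flipJ_Lp (Hs_Lp hf). Qed.
Let BLp f : Hs p f -> Lp p (B f).
Proof. by move=> hf; apply: inLp_add => //; [apply: aLp; exact: Hs_Lp|exact: bJ]. Qed.
(** [J f] has only negative coefficients, so [Q J f = J f] and the Hankel part is the projection of
    [b J f]. *)
Let bQ f : Hs p f -> aeq (fun z => b z * rieszQ (flipJ f) z) (fun z => b z * flipJ f z).
Proof.
move=> hf; have Lj : Lp p (flipJ f) by have [] := flipJ_Lp (Hs_Lp hf).
have h1 := Hs_rieszP p1 Lj.
have : aeq (rieszP (flipJ f)) (fun=> 0).
  apply: (HsQs_eq0 p1 h1); split; first exact: Hs_Lp h1.
  by move=> n n0; rewrite (fourier_rieszP p1)// (Qs_flipJ p1 hf).2.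
by move=> h; apply: (aeD1 h) => x _ e; rewrite /rieszQ e subr0.
Qed.
Let bQLp f : Hs p f -> Lp p (fun z => b z * rieszQ (flipJ f) z).
Proof.
move=> hf; apply: inLp_aeq (aeq_sym (bQ hf)) (bJ hf); apply: measC_mul; first by case: Lb.
by have Lj : Lp p (flipJ f) by [have [] := flipJ_Lp (Hs_Lp hf)]; exact: inLp_m (Qs_Lp (Qs_rieszQ p1 Lj)).
Qed.
Lemma TH_Hs f : Hs p f -> Hs p (TH a b f).
Proof. by move=> hf; apply: Hs_add => //; [exact: Toep_Hs|apply: Hs_rieszP => //; exact: bQLp]. Qed.
Let TH_fourier f : Hs p f -> forall n : int, 0 <= n -> fourier (TH a b f) n = fourier (B f) n.
Proof.
move=> hf n n0; have h1 := Toep_Hs hf; have h2 := Hs_rieszP p1 (bQLp hf).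
rewrite fourier_add; [|exact: (Hs_L1 p1 h1)|exact: (Hs_L1 p1 h2)].
rewrite (fourier_add n (inL1_pn p1 (aLp (Hs_Lp hf))) (inL1_pn p1 (bJ hf))).
rewrite /Toep /Hank !(fourier_rieszP p1)//; [|exact: bQLp|by apply: aLp; exact: Hs_Lp].
congr (_ + _); apply: fourier_aeq (bQ hf); [exact: inLp_m (bQLp hf)|exact: inLp_m (bJ hf)].
Qed.
Lemma THP f h : Hs p f -> Hs p h -> aeq (TH a b f) h <-> Qs p (fun z => a z * f z + b z * flipJ f z - h z).
Proof. exact: (proj_eq p1 BLp TH_Hs TH_fourier). Qed.
Lemma TH_blo : isBLOp p (TH a b).
Proof.
apply: (proj_blo p1 BLp TH_Hs TH_fourier); first by move=> f g l z; rewrite /B /flipJ; ring.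
have [M M0 hM] := Linf_Lp La; have [K K0 hK] := Linf_Lp Lb.
exists (M + K); first exact: addr_ge0.
move=> f hf; have [L1 n1] := hM p f p0 (Hs_Lp hf).
have [Lj nj] := flipJ_Lp (Hs_Lp hf); have [L2 n2] := hK p _ p0 Lj.
apply: (le_trans (normLp_add p1' L1 L2)); rewrite mulrDl -[X in _ + K * X]nj; exact: (lerD n1 n2).
Qed.
End ToeplitzHankel.
End RieszOperators.

(** * Symbols vanishing on a set, and default values of the projection *)

Section NonIntegrable.
Variable R : realType.
Local Notation C := R[i].
Local Notation mu := (@lebesgue_measure R).
Local Notation D := (@I02pi R).
Local Notation T := (measurableTypeR R).
Implicit Types (f g h : C -> C) (F G : R -> R) (z : C).
Hint Resolve mD : core.

Lemma countable_subsingleton (A : set R) : (forall x y, A x -> A y -> x = y) -> countable A.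
Proof.
move=> h; have [[x Ax]|nA] := pselect (exists x, A x).
  by apply: sub_countable (countable1 x); apply: subset_card_le => y Ay; exact: h.
rewrite (_ : A = set0); first exact: countable0.
by apply/seteqP; split => // x Ax; apply: nA; exists x.
Qed.

Lemma uncountable_real (A : set R) : countable A -> exists x, ~ A x.
Proof.
move=> cA; apply: contrapT => h; have hA : A = setT.
  by apply/seteqP; split => // x _; apply: contrapT => nA; apply: h; exists x.
have := @lebesgue_measure_itv R `[0, 1]; rewrite /= lte_fin ltr01 oppr0 adde0.
rewrite countable_lebesgue_measure0; last by apply: sub_countable cA; apply: subset_card_le; rewrite hA.
by move=> /eqP; rewrite eqe eq_sym oner_eq0.
Qed.

(* Off countably many [be], all Fourier integrals of [(1 + i be) g] diverge and take the junk value 0. *)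
Lemma nonint_multiple g : measC g -> ~ Lp 1 g ->
  exists be : R, forall n, fourier (fun z => Complex 1 be * g z) n = 0.
Proof.
move=> mg ng; pose gn n z := g z * z ^ (- n).
have mgn n : measC (gn n) by apply: measC_mul => //; exact: measC_mon.
have ngn n : ~ (Lint (reF (gn n)) /\ Lint (imF (gn n))).
  move=> [h1 h2]; apply: ng; apply: (inLp_ab mg _ (inL1_reim h1 h2)) => x.
  by rewrite ab_mon.
pose F (n : int) (i : bool) (be : R) x := if i then reF (gn n) x - be * imF (gn n) x
  else imF (gn n) x + be * reF (gn n) x.
have bad n i : countable [set be | Lint (F n i be)].
  apply: countable_subsingleton => x y /= hx hy; apply: contrapT => /eqP xy.
  have c0 : y - x != 0 by rewrite subr_eq0 eq_sym.
  apply: (ngn n); case: i hx hy => hx hy.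
    have hI : Lint (imF (gn n)).
      have := Lint_scale (y - x)^-1 (Lint_sub hx hy); apply: eq_Lint => t _.
      by rewrite /F; field.
    split => //; have := Lint_add hx (Lint_scale x hI); apply: eq_Lint => t _.
    by rewrite /F; ring.
  have hI : Lint (reF (gn n)).
    have := Lint_scale (y - x)^-1 (Lint_sub hy hx); apply: eq_Lint => t _.
    by rewrite /F; field.
  split => //; have := Lint_sub hx (Lint_scale x hI); apply: eq_Lint => t _.
  by rewrite /F; ring.
have [be hbe] := uncountable_real (@bigcup_countable _ _ [set: int * bool]
  (fun ni => [set be | Lint (F ni.1 ni.2 be)]) (countableP _) (fun ni _ => bad ni.1 ni.2)).
exists be => n; rewrite fourierE cintE.
have hn i : rint (F n i be) = 0.
  apply: rint_nonint; last by move=> h; apply: hbe; exists (n, i).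
  have [mr mi] := mgn n; case: i.
    by apply: (@measurable_funB _ T) => //; apply: (@measurable_funM _ T) => //; exact: measurable_cst.
  by apply: (@measurable_funD _ T) => //; apply: (@measurable_funM _ T) => //; exact: measurable_cst.
have -> : rint (reF (fun z => Complex 1 be * g z * z ^ (- n))) = rint (F n true be).
  by apply: eq_int => x _; rewrite /reF -mulrA cReM /= mul1r.
have -> : rint (imF (fun z => Complex 1 be * g z * z ^ (- n))) = rint (F n false be).
  by apply: eq_int => x _; rewrite /imF -mulrA cImM /= mul1r.
by rewrite !hn mulr0.
Qed.

(** Shifting the projection of [g t] down by one leaves a single unwanted entry, at exponent -1,
    which is subtracted. Contraposition carries the non-existence of a projection over to all
    shifts. *)
Lemma riesz_unsat_shift g : measC g -> (exists h, IsRiesz (fun z => g z * z) h) -> exists h, IsRiesz g h.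
Proof.
move=> mg [h [/LpE Lh fh]].
have fs n : fourier (fun z => g z * z) n = fourier g (n - 1).
  by rewrite -fourier_mon; apply: eq_fourier => x; rewrite expr1z.
pose k z := h z * z ^ (-1 : int) - fourier g (-1) * z ^ (-1 : int).
have Lm : Lp 1 (fun z : C => fourier g (-1) * z ^ (-1 : int)) by apply: inLp_scale => //; exact: inL1_mon.
have Lhm := inLp_mon (-1) Lh.
exists k; split; first by apply/LpE; exact: inLp_sub.
move=> n; rewrite fourier_sub// fourier_mon opprK fh fs addrK fourier_monomial.
have [->|n1] := eqVneq n (-1); first by rewrite addNr lexx subrr.
rewrite subr0 -[0 <= n](_ : 0 <= n + 1 = _)//.
have [h0|h0] := leP 0 n; first by rewrite addr_ge0.
apply/negbTE; rewrite -ltNge; move: h0; rewrite -lezD1 le_eqVlt addr_eq0 (negPf n1).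
by [].
Qed.

Lemma fourier_sum (I : Type) (s : seq I) (F : I -> C -> C) n : (forall i, Lp 1 (F i)) ->
  fourier (fun z => \sum_(i <- s) F i z) n = \sum_(i <- s) fourier (F i) n.
Proof.
move=> hF; elim: s => [|i s IH].
  by rewrite big_nil; under eq_fun do rewrite big_nil; exact: fourier0.
rewrite big_cons -IH -fourier_add//; last first.
  elim: s {IH} => [|j s IH]; first by under eq_fun do rewrite big_nil; exact: inLp0.
  by under eq_fun do rewrite big_cons; exact: inLp_add.
by apply: eq_fourier => x; rewrite big_cons.
Qed.

Lemma Hs_first_coef (p : R) f : 1 < p -> Hs p f -> ~ aeq f (fun=> 0) ->
  exists n : nat, fourier f n != 0 /\ forall m : int, m < n%:Z -> fourier f m = 0.
Proof.
move=> p1 hf nf; have ex : exists n : nat, fourier f n != 0.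
  apply: contrapT => h; apply: nf; apply: L1_unique; first exact: (Hs_L1 p1 hf).
  move=> n; have [n0|n0] := ltP n 0; first exact: hf.2.
  apply/eqP/negPn/negP => hn; apply: h; exists `|n|%N; by rewrite gez0_abs.
case: (ex_minnP ex) => n hn mn; exists n; split => // m mn'.
have [m0|m0] := ltP m 0; first exact: hf.2.
apply/eqP/negPn/negP => hm; have := mn `|m|%N; rewrite gez0_abs// => /(_ hm).
by rewrite leqNgt -ltz_nat gez0_abs// mn'.
Qed.

Lemma shift_indep (p : R) f m (c : 'I_m -> C) : 1 < p -> Hs p f -> ~ aeq f (fun=> 0) ->
  aeq (fun z => \sum_(j < m) c j * (f z * z ^ j%:Z)) (fun=> 0) -> forall j, c j = 0.
Proof.
move=> p1 hf nf h0 j; apply/eqP/negPn/negP => cj.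
have [n [hn mn]] := Hs_first_coef p1 hf nf.
case: (arg_minnP (P := fun i => c i != 0) (fun i : 'I_m => i : nat) cj) => i ci hi.
have LF k : Lp 1 (fun z => c k * (f z * z ^ k%:Z)).
  by apply: inLp_scale => //; apply: inLp_mon; exact: (Hs_L1 p1 hf).
have : fourier (fun z => \sum_(k < m) c k * (f z * z ^ k%:Z)) (n%:Z + i%:Z) = 0.
  apply: etrans (fourier0 R (n%:Z + i%:Z)); apply: (fourier_aeq _ _ (measC_cst 0) h0).
  by apply: measC_sum => k; exact: (inLp_m (LF k)).
rewrite fourier_sum// (bigD1 i)//= big1 ?addr0 => [|k ki].
  rewrite fourier_scale; last by apply: inLp_mon; exact: (Hs_L1 p1 hf).
  by rewrite fourier_mon addrK => /eqP; rewrite mulf_eq0 (negPf ci) (negPf hn).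
rewrite fourier_scale; last by apply: inLp_mon; exact: (Hs_L1 p1 hf).
have [->|ck] := eqVneq (c k) 0; first by rewrite mul0r.
rewrite fourier_mon mn ?mulr0//; have := hi k ck.
rewrite leq_eqVlt => /orP[/eqP e|ik]; first by rewrite (val_inj e) eqxx in ki.
by rewrite ltrBlDr ltrD2l ltz_nat.
Qed.

Lemma lin_dep k (L : 'M[C]_(k.+1, k)) : exists c : 'I_k.+1 -> C,
  (exists j, c j != 0) /\ forall i, \sum_j c j * L j i = 0.
Proof.
have : kermx L != 0.
  by rewrite -mxrank_eq0 mxrank_ker -lt0n subn_gt0 ltnS; exact: rank_leq_col.
case/rowV0Pn => v /sub_kermxP hv v0; exists (fun j => v 0 j); split.
  by have /rV0Pn[j hj] := v0; exists j.
by move=> i; have /(congr1 (fun M : 'rV_k => M 0 i)) := hv; rewrite !mxE.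
Qed.

Lemma aeD_ord m (P : 'I_m -> R -> Prop) : (forall j, aeD (P j)) -> aeD (fun x => forall j, P j x).
Proof.
move=> h; have h2 (i : nat) : aeD (fun x => if insub i is Some j then P j x else True).
  by case: insubP => [j _ _|_]; [exact: h|exact: aeD_all].
apply: (aeD1 (aeD_nat h2)) => x _ hx j; have := hx j; case: insubP => [k _ e|].
  by rewrite (val_inj e).
by rewrite ltn_ord.
Qed.

(** The [k + 1] functions [f t^j] are linearly independent and do not fit into a kernel of dimension
    [k]. The multiples [al] are there because for non-integrable products only special multiples
    fall into the kernel. *)
Lemma kerDim_shifts (p : R) A k f : 1 < p -> kerDim p A k -> Hs p f -> ~ aeq f (fun=> 0) ->
  ~ forall j : nat, (j <= k)%N -> exists2 al : C, al != 0 & aeq (A (fun z => al * (f z * z ^ j%:Z))) (fun=> 0).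
Proof.
move=> p1 [e [he [_ span]]] hf nf ch.
have ch2 (j : 'I_k.+1) : exists x : C * ('I_k -> C), x.1 != 0 /\
    aeq (fun z => x.1 * (f z * z ^ j%:Z)) (lincomb x.2 e).
  have [al al0 h] := ch j (ltn_ord j); have [|lam hl] := span _ _ h; last by exists (al, lam).
  by apply/HsE; apply: Hs_scale => //; exact: Hs_mon.
have [x hx] := boolp.choice ch2.
have [c [[j0 cj0] hc]] := lin_dep (\matrix_(j < k.+1, i < k) (x j).2 i).
have hz : aeq (fun z => \sum_(j < k.+1) (c j * (x j).1) * (f z * z ^ j%:Z)) (fun=> 0).
  have all_ : aeD (fun t => forall j : 'I_k.+1, (x j).1 * (f (circ t) * circ t ^ j%:Z) = lincomb (x j).2 e (circ t)).
    by apply: aeD_ord => j; exact: (hx j).2.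
  apply: (aeD1 all_) => t _ ht.
  under eq_bigr do rewrite -mulrA ht /lincomb mulr_sumr.
  rewrite exchange_big big1// => i _.
  under eq_bigr do rewrite mulrA; rewrite -mulr_suml.
  by have := hc i; under eq_bigr do rewrite mxE; move=> ->; rewrite mul0r.
have := shift_indep p1 hf nf hz j0; move/eqP; rewrite mulf_eq0 (negPf cj0) /=.
by apply/negP; exact: (hx j0).1.
Qed.

(** [d] is merely measurable, so [T(d)] may rest on default values. Take [f] in the kernel, not 0.
    If [d f] is not integrable, suitable multiples of all shifts [f t^j] have vanishing Fourier
    integrals. If [d f] has no projection, neither have its shifts, and [epsilon] returns the same
    function for all of them. Otherwise [d f] is antianalytic and vanishes on [E], hence is 0. In
    each case the shifts of [f] yield too many kernel elements. *)
Lemma fredholm_pos_nonvanish (p : R) d (k : int) (E : R -> bool) : 1 < p -> measC d ->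
  FredholmIndex p (Toep d) k -> 0 < k ->
  measurable (D `&` [set x | E x] : set T) -> aeD (fun x => E x -> d (circ x) = 0) ->
  aeD (fun x => ~~ E x).
Proof.
move=> p1 md [k1 [m [hker [_ [_ ek]]]]] k0 mE dE; apply: contrapT => nE.
have k1_gt0 : (0 < k1)%N by rewrite -ltz_nat (lt_le_trans k0)// ek gerBl.
have [e [he [ind _]]] := hker; pose i0 := Ordinal k1_gt0.
have [/HsE hf kf] := he i0; set f := e i0 in hf kf.
have nf : ~ aeq f (fun=> 0).
  move=> f0; pose lam i : C := if i == i0 then 1 else 0.
  have /(_ i0) : forall i, lam i = 0.
    apply: ind; apply: aeq_trans f0; apply: aeq_eq => x; rewrite /lincomb (bigD1 i0)//= big1 /lam.
      by rewrite eqxx mul1r addr0.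
    by move=> i /negPf ->; rewrite mul0r.
  by rewrite /lam eqxx => /eqP; rewrite oner_eq0.
pose g j z := d z * (f z * z ^ j%:Z).
have mg j : measC (g j).
  by apply: (measC_mul md); exact: (Hs_m (Hs_mon j hf)).
have riesz0 (G : C -> C) : (forall n : int, 0 <= n -> fourier G n = 0) -> aeq (rieszP G) (fun=> 0).
  move=> hG; have [/LpE h1 h2] : IsRiesz G (rieszP G).
    apply: epsilon_spec; exists (fun=> 0); split; first by apply/LpE; exact: inLp0.
    by move=> n; rewrite fourier0; case: ifP => // /hG.
  apply: L1_unique => // n; rewrite h2; case: ifP => // n0; exact: hG.
apply: (kerDim_shifts p1 hker hf nf) => j _.
have [L1|nL1] := pselect (Lp 1 (g 0%N)); last first.
  have nLj : ~ Lp 1 (g j).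
    move=> h; apply: nL1; apply: (inLp_ab (mg 0%N) _ h) => x.
    by rewrite /ab /g !absCM !absC_circX.
  have [be hbe] := nonint_multiple (mg j) nLj; exists (Complex 1 be).
    by apply/eqP => /(congr1 (@complex.Re R)) /= /eqP; rewrite oner_eq0.
  have -> : Toep d (fun z => Complex 1 be * (f z * z ^ j%:Z)) = rieszP (fun z => Complex 1 be * g j z).
    by rewrite /Toep; congr rieszP; apply/funext => z; rewrite mulrCA.
  by apply: riesz0 => n _; exact: hbe.
exists 1; first exact: oner_neq0.
have -> : Toep d (fun z => 1 * (f z * z ^ j%:Z)) = rieszP (g j).
  by rewrite /Toep; congr rieszP; apply/funext => z; rewrite mul1r.
have kf0 : aeq (rieszP (g 0%N)) (fun=> 0).
  by move: kf; rewrite /Toep (_ : (fun z => d z * f z) = g 0%N)//; apply/funext => z; rewrite /g expr0z mulr1.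
have [sat|unsat] := pselect (exists h, IsRiesz (g 0%N) h); last first.
  suff -> : rieszP (g j) = rieszP (g 0%N) by [].
  have unsatj i : ~ exists h, IsRiesz (g i) h.
    elim: i => [//|i IH] h; apply: IH; apply: riesz_unsat_shift => //.
    suff <- : g i.+1 = (fun z => g i z * z) by [].
    by apply/funext => z; rewrite /g -addn1 -exprnP exprD expr1 !mulrA -exprnP.
  rewrite /rieszP; congr (epsilon _ _); apply/funext => h; apply/propext; split => H.
    by case: (unsatj j); exists h.
  by case: unsat; exists h.
have [/LpE h1 h2] : IsRiesz (g 0%N) (rieszP (g 0%N)) by apply: epsilon_spec.
have g0 n : 0 <= n -> fourier (g 0%N) n = 0.
  move=> n0; have := h2 n; rewrite n0 => <-; rewrite -(fourier0 R n).
  by apply: fourier_aeq kf0; [exact: inLp_m h1|exact: measC_cst].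
have gz : aeq (fconj (g 0%N)) (fun=> 0).
  apply: (@fm_riesz_uniqueness R _ E) => //; first exact: inLp_conj.
    by move=> n n0; rewrite fourier_conj// g0 ?conjc0// oppr_ge0 ltW.
  by apply: (aeD1 dE) => x _ h Ex; rewrite /fconj /g h// mul0r conjc0.
apply: riesz0 => n _; rewrite -(fourier0 R n); apply: fourier_aeq => //; first exact: measC_cst.
apply: (aeD1 gz) => x _ /(congr1 (fun w => (w^*)%C)); rewrite /fconj conjcK conjc0 /g expr0z mulr1 => h.
by rewrite mulrA h mul0r.
Qed.

End NonIntegrable.

(** * Bounded symbols with bounded inverse *)

Section Symbols.
Variable R : realType.
Local Notation C := R[i].
Local Notation D := (@I02pi R).
Local Notation T := (measurableTypeR R).
Implicit Types (a b f g h : C -> C) (z : C).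
Hint Resolve mD : core.

(** Nonvanishing is a separate clause because [0^-1 = 0] makes the other two compatible with
    zeros. *)
Definition GL g := [/\ Linf g, Linf (fun z => (g z)^-1) & aeD (fun x => g (circ x) != 0)].

Lemma Linf_aeq f g : measC g -> aeq f g -> Linf f -> Linf g.
Proof. by move=> mg h; apply: Linf_ab => //; apply: (aeD1 h) => x _; rewrite /ab => ->. Qed.
Lemma GL_mul f g : GL f -> GL g -> GL (fun z => f z * g z).
Proof.
move=> [h1 h2 h3] [k1 k2 k3]; split; first exact: Linf_mul.
  by under eq_fun do rewrite invfM; exact: Linf_mul.
by apply: (aeD2 h3 k3) => x _ *; exact: mulf_neq0.
Qed.
Lemma GL_inv f : GL f -> GL (fun z => (f z)^-1).
Proof.
move=> [h1 h2 h3]; split => //; first by under eq_fun do rewrite invrK.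
by apply: (aeD1 h3) => x _; rewrite invr_eq0.
Qed.
Lemma GL_tilde f : GL f -> GL (tilde f).
Proof.
move=> [h1 h2 h3]; split; [exact: Linf_tilde|exact: (Linf_tilde h2)|].
by apply: (aeD1 (aeD_rfl h3)) => x _ /=; rewrite circ_rfl.
Qed.
Lemma GL_conj f : GL f -> GL (fconj f).
Proof.
move=> [h1 h2 h3]; split; first exact: Linf_conj.
  have -> : (fun z => (fconj f z)^-1) = fconj (fun z => (f z)^-1).
    apply/funext => z; apply: eqCplx; rewrite /fconj ?cReC ?cImC ?cReV ?cImV ?cReC ?cImC sqrrN//.
    by rewrite mulNr opprK.
  exact: Linf_conj.
by apply: (aeD1 h3) => x _; rewrite /fconj conjc_eq0.
Qed.
Lemma GL_mon f (k : int) : GL f -> GL (fun z => f z * z ^ k).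
Proof.
move=> [h1 h2 h3]; split; first exact: Linf_mon.
  apply: (Linf_aeq _ _ (Linf_mon (- k) h2)).
    apply: measC_inv; apply: measC_mul; [by case: h1|exact: measC_mon].
  by apply: aeq_eq => x; rewrite invfM invr_expz.
by apply: (aeD1 h3) => x _ h; rewrite mulf_neq0// expfz_neq0// circ_neq0.
Qed.

Definition Sym g := GL g /\ aeq (fun z => g z * tilde g z) (fun=> 1).

Lemma sym_mon g (k : int) : Sym g -> Sym (fun z => g z * z ^ k).
Proof.
move=> [h1 h2]; split; first exact: GL_mon.
apply: (aeD1 h2) => x _ e; rewrite /tilde mulrACA -/(tilde g _) e mul1r.
by rewrite circVX circXD subrr expr0z.
Qed.

Lemma matching_GL a b (k : int) (p : R) : 1 < p -> 0 < k -> matching a b ->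
  FredholmIndex p (Toep (subd a b)) k -> [/\ GL a, GL b, Sym (subc a b) & Sym (subd a b)].
Proof.
move=> p1 k0 [[/eq_aeD_Linf La /eq_aeD_Linf Lia] [/eq_aeD_Linf Lb hab]] hd.
have ma : measC a by case: La.
have mb : measC b by case: Lb.
have md : measC (subd a b) by apply: measC_mul => //; apply: measC_inv; exact: measC_tilde.
have a0 : aeD (fun x => a (circ x) != 0).
  have := fredholm_pos_nonvanish (E := fun x => a (circ x) == 0) p1 md hd k0; apply.
    have -> : (D `&` [set x | a (circ x) == 0] : set T) = D `&` [set x | ab a x <= 0].
      apply/seteqP; split => x [Dx /= b0]; split => //=; first by rewrite /ab (eqP b0) absC0.
      by apply/eqP/absC_eq0/eqP; rewrite eq_le b0 absC_ge0.
    by apply: mset_le; exact: mab.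
  by apply: aeD_all => x _ /eqP; rewrite /subd => ->; rewrite mul0r.
have Ga : GL a by [].
have [Lta Ltia ta0] := GL_tilde Ga.
have b0 : aeD (fun x => b (circ x) != 0).
  apply: (aeD3 a0 ta0 hab) => x _ h1 h2 e; apply/eqP => hb; move: e; rewrite hb mul0r => /eqP.
  by rewrite mulf_eq0 (negPf h1) (negPf h2).
(* By the matching condition [1 / b = \tilde b / (a \tilde a)], which is bounded. *)
have Gb : GL b.
  split => //; apply: (Linf_aeq _ _ (Linf_mul (Linf_tilde Lb) (Linf_mul Lia Ltia))); first exact: measC_inv.
  apply: (aeD3 b0 a0 (aeD2 ta0 hab (fun x _ => @conj _ _))) => x _ h1 h2 [h3 /= e].
  have -> : tilde b (circ x) = a (circ x) * tilde a (circ x) / b (circ x) by rewrite e mulrC mulKf.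
  by field; rewrite h1 h2 h3.
have [_ _ tb0] := GL_tilde Gb.
split => //.
  split; first exact: GL_mul (GL_inv Gb).
  apply: (aeD3 b0 tb0 hab) => x _ h1 h2; rewrite /subc /tilde => e.
  by rewrite mulrACA e -invfM mulfV// mulf_neq0.
split; first exact: GL_mul (GL_inv (GL_tilde Gb)).
apply: (aeD3 b0 tb0 hab) => x _ h1 h2; rewrite /subd /tilde invrK => e.
by rewrite mulrACA e -invfM [X in _ / X]mulrC mulfV// mulf_neq0.
Qed.

End Symbols.

(** * Coburn's lemma and the index *)

Section Coburn.
Variable R : realType.
Local Notation C := R[i].
Implicit Types (f g h v : C -> C) (z : C) (s : seq (C * int)).
Variable p : R.
Hypothesis p1 : 1 < p.
Let p1' : 1 <= p. Proof. exact: ltW. Qed.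
Let p0 : 0 < p. Proof. exact: lt_trans p1. Qed.
Local Notation N := (normLp p).

Definition Rg (A : (C -> C) -> C -> C) h := exists2 f, Hs p f & aeq (A f) h.
Definition inj (A : (C -> C) -> C -> C) := forall f, Hs p f -> aeq (A f) (fun=> 0) -> aeq f (fun=> 0).
Definition onto (A : (C -> C) -> C -> C) := forall h, Hs p h -> Rg A h.

Section Range.
Variable A : (C -> C) -> C -> C.
Hypothesis Ablo : isBLOp p A.
Lemma Rg_aeq h k : aeq h k -> Rg A h -> Rg A k.
Proof. by move=> e [f hf hA]; exists f => //; exact: aeq_trans e. Qed.
Lemma Rg_lin h k (l : C) : Rg A h -> Rg A k -> Rg A (fun z => h z + l * k z).
Proof.
move=> [f hf h1] [g hg h2]; exists (fun z => f z + l * g z).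
  by apply: Hs_add => //; exact: Hs_scale.
apply: aeq_trans (blo_lin Ablo l hf hg) _.
by apply: (aeD2 h1 h2) => x _ -> ->.
Qed.
Lemma Rg_0 : Rg A (fun=> 0).
Proof. by exists (fun=> 0); [exact: Hs0|exact: (blo_0 p1 Ablo)]. Qed.
Lemma Rg_scale h (l : C) : Rg A h -> Rg A (fun z => l * h z).
Proof. by move=> hk; have := Rg_lin l Rg_0 hk; under eq_fun do rewrite add0r. Qed.
Lemma Rg_add h k : Rg A h -> Rg A k -> Rg A (fun z => h z + k z).
Proof. by move=> h1 h2; have := Rg_lin 1 h1 h2; under eq_fun do rewrite mul1r. Qed.
Lemma Rg_sum (I : Type) (r : seq I) (F : I -> C -> C) : (forall i, Rg A (F i)) ->
  Rg A (fun z => \sum_(i <- r) F i z).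
Proof.
move=> h; elim: r => [|i r IH]; first by under eq_fun do rewrite big_nil; exact: Rg_0.
by under eq_fun do rewrite big_cons; exact: Rg_add.
Qed.
Lemma Rg_tp s : (forall n : nat, Rg A (fun z => z ^ n%:Z)) -> analytic s -> Rg A (tp s).
Proof.
move=> hA; elim: s => [|[c k] s IH] /=.
  by move=> _; apply: (Rg_aeq _ Rg_0); apply: aeq_eq => x; rewrite tp_nil.
move=> /andP[k0 /IH hs]; apply: (Rg_aeq _ (Rg_lin c hs (hA `|k|%N))).
by apply: aeq_eq => x; rewrite tp_cons /= gez0_abs// addrC.
Qed.
End Range.

Lemma ToepC g f h : Linf g -> Hs p f -> Hs p h ->
  aeq (Toep g f) h <-> forall n : int, 0 <= n -> fourier (fun z => g z * f z) n = fourier h n.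
Proof.
move=> Lg hf hh; rewrite (ToepP p1 Lg hf hh) (QsP p1 _ (Hs_Lp hh))//.
by apply: Linf_mulLp => //; exact: Hs_Lp.
Qed.

Lemma Toep0 g f : Linf g -> Hs p f ->
  aeq (Toep g f) (fun=> 0) <-> Qs p (fun z => g z * f z).
Proof.
move=> Lg hf; rewrite (ToepP p1 Lg hf (Hs0 p1)).
by under eq_fun do rewrite subr0.
Qed.

Lemma Hs_zn (n : nat) : Hs p (fun z => z ^ n%:Z).
Proof.
have := Hs_tp p1 (s := [:: (1, n%:Z)]) isT; rewrite (_ : tp _ = fun z => z ^ n%:Z)//.
by apply/funext => z; rewrite tp_mon mul1r.
Qed.

Lemma Qs_mon f (k : nat) : Qs p f -> Qs p (fun z => f z * z ^ (- k%:Z)).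
Proof.
move=> [L h]; split; first exact: inLp_mon.
by move=> n n0; rewrite fourier_mon opprK h// addr_ge0.
Qed.

Lemma Hs_div f (m : nat) : Hs p f -> (forall j, (j < m)%N -> fourier f j%:Z = 0) ->
  Hs p (fun z => f z * z ^ (- m%:Z)).
Proof.
move=> [L h] h0; split; first exact: inLp_mon.
move=> n n0; rewrite fourier_mon opprK; have [nm|nm] := ltP (n + m%:Z) 0; first exact: h.
by rewrite -(gez0_abs nm) h0// -ltz_nat gez0_abs// gtrDr.
Qed.

Lemma fourier_poly m (c : 'I_m -> C) (n : int) :
  fourier (fun z => \sum_(j < m) c j * z ^ j%:Z) n =
  if (0 <= n) =P true is ReflectT _ then (if insub `|n|%N is Some j then c j else 0) else 0.
Proof.
rewrite fourier_sum => [|i]; last by apply: inLp_scale => //; exact: inL1_mon.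
under eq_bigr do rewrite fourier_monomial.
case: eqP => [n0|nn].
  case: insubP => [j jm ej|nm].
    rewrite (bigD1 j)//= big1 ?addr0 => [|i ij].
      by rewrite ej gez0_abs// eqxx.
    by case: eqP => // e; case/eqP: ij; apply: val_inj; rewrite /= ej e absz_nat.
  rewrite big1// => i _; case: eqP => // e; case/negP: nm; rewrite e absz_nat//.
rewrite big1// => i _; case: eqP => // e; by case: nn; rewrite e.
Qed.

(** A form of Coburn's lemma that avoids the adjoint. For [f] in the kernel, [g f] is antianalytic;
    let [-(r + 1)] be its highest exponent with nonzero coefficient. Then [T(g)] maps
    [f t^(r + 1 + n)] to a polynomial of degree [n] with nonzero leading coefficient, and induction
    on [n] puts every [t^n] in the range. *)
Lemma coburn_poly g f : GL g -> Hs p f -> ~ aeq f (fun=> 0) -> aeq (Toep g f) (fun=> 0) ->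
  forall n : nat, Rg (Toep g) (fun z => z ^ n%:Z).
Proof.
move=> [Lg Lig g0] hf nf /(Toep0 Lg hf) hQ.
have nz : ~ aeq (flipJ (fun z => g z * f z)) (fun=> 0).
  move=> h; apply: nf; have := flipJ_aeq h => h2.
  apply: (aeD2 g0 h2) => x _ gx; rewrite flipJK /flipJ mulr0 => /eqP.
  by rewrite mulf_eq0 (negPf gx) /= => /eqP.
have [r [hr mr]] := Hs_first_coef p1 (Hs_flipJ p1 hQ) nz.
have L1 := Qs_L1 p1 hQ.
pose co (k : int) := fourier (fun z => g z * f z) k.
have er (k : nat) : fourier (flipJ (fun z => g z * f z)) k%:Z = co (- k%:Z - 1) by rewrite fourier_flipJ.
have co0 k : - (r.+1)%:Z < k -> co k = 0.
  move=> hk; rewrite /co; have [k0|k0] := leP 0 k; first exact: hQ.2.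
  have ek : k = - (`|k|.-1)%:Z - 1 :> int.
    have : (0 < `|k|)%N by rewrite absz_gt0 lt_eqF.
    case: `|k|%N (ltz0_abs k0) => [//|m] e _ /=; rewrite -opprD addrC -PoszD add1n e opprK//.
  rewrite ek -/(co _) -er mr//.
  have : (0 < `|k|)%N by rewrite absz_gt0 lt_eqF.
  have ek2 : k = - (`|k|%N : int) by rewrite ltz0_abs// opprK.
  by move: hk; rewrite {1}ek2 ltrN2 !ltz_nat; case: `|k|%N.
have cor : co (- (r.+1)%:Z) != 0.
  by move: hr; rewrite er (_ : - r%:Z - 1 = - (r.+1)%:Z)// -opprD addrC -PoszD add1n.
elim/ltn_ind => n IH.
have hF := Hs_mon (r.+1 + n) hf.
pose c (j : 'I_n.+1) := co (j%:Z - (r.+1 + n)%:Z).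
have hS : Hs p (fun z => \sum_(j < n.+1) c j * z ^ j%:Z).
  by apply: Hs_sum => // j; apply: Hs_scale => //; exact: Hs_zn.
have hT : aeq (Toep g (fun z => f z * z ^ (r.+1 + n)%:Z)) (fun z => \sum_(j < n.+1) c j * z ^ j%:Z).
  apply/ToepC => // k k0.
  rewrite (@eq_fourier _ _ (fun z => g z * f z * z ^ (r.+1 + n)%:Z)); last by move=> x; rewrite mulrA.
  rewrite fourier_mon fourier_poly -/(co _); case: eqP => // _.
  case: insubP => [j jm ej|]; first by rewrite /c ej gez0_abs.
  rewrite -leqNgt => nk; apply: co0; rewrite -[X in _ < X - _](gez0_abs k0) PoszD opprD addrCA ltrDl.
  by rewrite subr_gt0 ltz_nat.
have hR : Rg (Toep g) (fun z => \sum_(j < n.+1) c j * z ^ j%:Z) by exists (fun z => f z * z ^ (r.+1 + n)%:Z).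
have hl : Rg (Toep g) (fun z => \sum_(j < n) (c (widen_ord (leqnSn n) j)) * z ^ j%:Z).
  by apply: (Rg_sum (Toep_blo p1 Lg)) => j; apply: (Rg_scale (Toep_blo p1 Lg)); exact: IH.
have cn : c ord_max = co (- (r.+1)%:Z) by rewrite /c /= PoszD opprD addrCA subrr addr0.
have := Rg_scale (Toep_blo p1 Lg) (co (- (r.+1)%:Z))^-1 (Rg_lin (Toep_blo p1 Lg) (-1) hR hl).
apply: Rg_aeq; apply: aeq_eq => x.
by rewrite big_ord_recr /= cn mulN1r addrAC subrr add0r mulKf.
Qed.

Lemma dense_approx (A : (C -> C) -> C -> C) : isBLOp p A -> (forall n : nat, Rg A (fun z => z ^ n%:Z)) ->
  forall h, Hs p h -> forall k, exists f, Hs p f /\ N (fun z => A f z - h z) <= 2^-1 ^+ k.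
Proof.
move=> Ablo hA h hh k.
have [s [as_ /ltW hs]] := dens_Hs p1 hh (half_gt0 R k).
have [f hf ef] := Rg_tp Ablo hA as_; exists f; split; first exact: hf.
rewrite normLp_distC.
suff -> : N (fun z => h z - A f z) = N (fun z => h z - tp s z) by [].
apply: normLp_aeq.
- by apply: (@Hs_m _ p); apply: Hs_sub => //; exact: (blo_Hs Ablo hf).
- by apply: (@Hs_m _ p); apply: Hs_sub => //; exact: (Hs_tp p1 as_).
by apply: (aeD1 ef) => x _ ->.
Qed.

Lemma closed_dense_onto (A : (C -> C) -> C -> C) : isBLOp p A -> closedRange p A ->
  (forall n : nat, Rg A (fun z => z ^ n%:Z)) -> onto A.
Proof.
move=> Ablo cl hA h hh.
have [F hF] := boolp.choice (dense_approx Ablo hA hh).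
have [|||f [/HsE hf e]] := cl F h.
- by move=> k; apply/HsE; have [] := hF k.
- exact/HsE.
- apply: (@squeeze_cvgr _ _ _ _ (fun=> 0) (fun k => 1 * 2^-1 ^+ k)).
  + by apply: nearW => k; rewrite normLp_ge0 mul1r; have [] := hF k.
  + exact: cvg_cst.
  + exact: half_cvg0.
by exists f.
Qed.

Lemma coburn g : GL g -> closedRange p (Toep g) -> ~ inj (Toep g) -> onto (Toep g).
Proof.
move=> Gg cl ni; have [Lg _ _] := Gg.
have [f [hf kf nf]] : exists f, [/\ Hs p f, aeq (Toep g f) (fun=> 0) & ~ aeq f (fun=> 0)] by
  apply: contrapT => h; apply: ni => f hf kf; apply: contrapT => nf; apply: h; exists f.
by apply: (closed_dense_onto (Toep_blo p1 Lg) cl); exact: (coburn_poly Gg hf nf kf).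
Qed.


Lemma cokerDim_onto A m : isBLOp p A -> cokerDim p A m -> onto A -> m = 0%N.
Proof.
move=> Ablo [u [hu [_ ind]]] hA; case: m u hu ind => [//|m] u hu ind; exfalso.
have /HsE h0 := hu ord0; have [f hf ef] := hA _ h0.
pose lam (i : 'I_m.+1) : C := if i == ord0 then -1 else 0.
have /(_ ord0) : forall i, lam i = 0.
  apply: (ind f); first exact/HsE.
  apply: (aeD1 ef) => x _ ->; rewrite /lincomb (bigD1 ord0)//= big1 /lam => [|i /negPf ->].
    by rewrite eqxx mulN1r addr0 subrr.
  by rewrite mul0r.
by rewrite /lam eqxx => /eqP; rewrite oppr_eq0 oner_eq0.
Qed.

Lemma kerDim_basis_neq0 (k : nat) (e : 'I_k -> C -> C) :
  (forall lam, aeq (lincomb lam e) (fun _ => 0) -> forall i, lam i = 0) -> forall i, ~ aeq (e i) (fun=> 0).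
Proof.
move=> ind i h; pose lam j : C := if j == i then 1 else 0.
have /(_ i) : forall j, lam j = 0.
  apply: ind; apply: aeq_trans h; apply: aeq_eq => x; rewrite /lincomb (bigD1 i)//= big1 /lam.
    by rewrite eqxx mul1r addr0.
  by move=> j /negPf ->; rewrite mul0r.
by rewrite /lam eqxx => /eqP; rewrite oner_eq0.
Qed.

Lemma kerDim_inj A k : kerDim p A k -> inj A -> k = 0%N.
Proof.
move=> [e [he [ind _]]] hi; case: k e he ind => [//|k] e he ind; exfalso.
have [/HsE h1 h2] := he ord0; exact: (kerDim_basis_neq0 ind (hi _ h1 h2)).
Qed.

Lemma Hs_lincomb k (lam : 'I_k -> C) (e : 'I_k -> C -> C) : (forall i, Hs p (e i)) -> Hs p (lincomb lam e).
Proof. by move=> h; apply: Hs_sum => // i; exact: Hs_scale. Qed.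

Lemma blo_lincomb A k (lam : 'I_k -> C) (e : 'I_k -> C -> C) : isBLOp p A -> (forall i, Hs p (e i)) ->
  aeq (A (lincomb lam e)) (lincomb lam (fun i => A (e i))).
Proof.
move=> Ablo he; rewrite /lincomb; elim: (index_enum _) => [|i s IH].
  under eq_fun do rewrite big_nil; under [X in aeq _ X]eq_fun do rewrite big_nil.
  exact: (blo_0 p1 Ablo).
under eq_fun do rewrite big_cons; under [X in aeq _ X]eq_fun do rewrite big_cons.
have hs : Hs p (fun z => \sum_(j <- s) lam j * e j z) by apply: Hs_sum => // j; exact: Hs_scale.
apply: aeq_trans (blo_add Ablo (Hs_scale p1 (lam i) (he i)) hs) _.
by apply: (aeD2 (blo_scale p1 Ablo (lam i) (he i)) IH) => x _ -> ->.
Qed.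

Lemma mulmx_unit_solve m (E : 'M[C]_m) : (forall c : 'I_m -> C, (forall i, \sum_j c j * E j i = 0) -> forall j, c j = 0) ->
  E \in unitmx.
Proof.
move=> h; rewrite -row_free_unit -kermx_eq0; apply/eqP/row_matrixP => i; rewrite row0.
have /sub_kermxP hk : (row i (kermx E) <= kermx E)%MS by exact: row_sub.
apply/rowP => j; rewrite [RHS]mxE; apply: (h (fun j => row i (kermx E) 0 j)) => l.
by have /(congr1 (fun M : 'rV_m => M 0 l)) := hk; rewrite !mxE.
Qed.

(** * Positive index: bijectivity of [T(d t^n)] *)

Section PositiveIndex.
Variables (d : C -> C) (n : nat).
Hypotheses (Gd : GL d) (n0 : (0 < n)%N) (Fd : FredholmIndex p (Toep d) n%:Z).
Let Ld : Linf d. Proof. by case: Gd. Qed.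
Let G z := d z * z ^ n%:Z.
Let LG : Linf G. Proof. exact: Linf_mon. Qed.

Lemma pos_index_onto : onto (Toep d) /\ kerDim p (Toep d) n.
Proof.
have [k [m [hk [hm [cl e]]]]] := Fd.
have ho : onto (Toep d).
  apply: coburn => // hi; have k0 := kerDim_inj hk hi.
  have : 0 < n%:Z by []. move: e; rewrite k0 sub0r => ->; rewrite oppr_gt0 ltz_nat ltn0; by [].
split => //; have m0 := cokerDim_onto (Toep_blo p1 Ld) hm ho.
by move: e; rewrite m0 subr0 => -[->].
Qed.

(** For a nonzero [f] in the kernel of [T(d t^n)], the [n + 1] functions [f t^j] with [j <= n] would
    all lie in the kernel of [T(d)], which has dimension [n]. This [n] is later instantiated with
    twice the [n] of the theorem. *)
Lemma pos_shift_inj : inj (Toep G).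
Proof.
move=> f hf /(Toep0 LG hf) hQ; apply: contrapT => nf.
have [_ hk] := pos_index_onto.
apply: (kerDim_shifts p1 hk hf nf) => j jn; exists 1; first exact: oner_neq0.
have hj := Hs_mon j hf.
have -> : (fun z => 1 * (f z * z ^ j%:Z)) = fun z => f z * z ^ j%:Z by apply/funext => z; rewrite mul1r.
apply/(Toep0 Ld hj).
apply: (Qs_aeq _ _ (Qs_mon (n - j) hQ)).
  by apply: measC_mul; [case: Ld|exact: (Hs_m hj)].
apply: aeq_eq => x; rewrite /G; rewrite -[LHS]mulrA mulrAC -!mulrA; congr (_ * _).
congr (_ * _); rewrite circXD; congr (_ ^ _).
by rewrite -subzn// opprB subrK.
Qed.

(** A preimage under [T(d)] that is divisible by [t^n] gives one under [T(d t^n)]. Divisibility is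
    achieved by subtracting kernel elements of [T(d)]: the matrix [E] of their first [n]
    coefficients is invertible, since a nonzero kernel element with all of these 0 would contradict
    [pos_shift_inj]. *)
Lemma pos_shift_onto : onto (Toep G).
Proof.
have [ho [e [he [ind span]]]] := pos_index_onto => h hh.
have hE i : Hs p (e i) by have [/HsE] := he i.
have [F hF eF] := ho h hh.
have shift_ker f : Hs p f -> (forall j, (j < n)%N -> fourier f j%:Z = 0) ->
   aeq (Toep G (fun z => f z * z ^ (- n%:Z))) (Toep d f).
  move=> hf h0; have hd := Hs_div hf h0; apply/ToepC => //; first exact: Toep_Hs.
  move=> k k0; rewrite /Toep (fourier_rieszP p1)//; last by apply: Linf_mulLp => //; exact: Hs_Lp.
  apply: eq_fourier => x; rewrite /G mulrACA -[RHS]mulr1; congr (_ * _).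
  by rewrite circXD subrr expr0z.
pose E : 'M[C]_n := \matrix_(i < n, j < n) fourier (e i) j%:Z.
have fl (c : 'I_n -> C) k : fourier (lincomb c e) k = \sum_i c i * fourier (e i) k.
  rewrite /lincomb fourier_sum => [|i]; last by apply: inLp_scale => //; exact: (Hs_L1 p1 (hE i)).
  by apply: eq_bigr => i _; rewrite fourier_scale//; exact: (Hs_L1 p1 (hE i)).
have uE : E \in unitmx.
  apply: mulmx_unit_solve => c hc.
  have hl := Hs_lincomb c hE.
  have h0 j : (j < n)%N -> fourier (lincomb c e) j%:Z = 0.
    by move=> jn; rewrite fl; have := hc (Ordinal jn); under eq_bigr do rewrite mxE.
  apply: ind; have hd := Hs_div hl h0.
  have : aeq (fun z => lincomb c e z * z ^ (- n%:Z)) (fun=> 0).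
    apply: pos_shift_inj => //; apply: aeq_trans (shift_ker _ hl h0) _.
    apply: aeq_trans (blo_lincomb c (Toep_blo p1 Ld) hE) _.
    apply: (aeD1 (aeD_ord (fun i => (he i).2))) => x _ hx; rewrite /lincomb big1// => i _.
    by rewrite hx mulr0.
  move=> hz; apply: (aeD1 hz) => x _ /eqP; rewrite mulf_eq0 => /orP[/eqP//|].
  by rewrite expfz_eq0 (negPf (circ_neq0 x)) andbF.
pose v : 'rV[C]_n := (\row_j fourier F j%:Z) *m invmx E.
pose c i := v 0 i.
have hl := Hs_lincomb c hE; have hF' := Hs_sub p1 hF hl.
have h0 j : (j < n)%N -> fourier (fun z => F z - lincomb c e z) j%:Z = 0.
  move=> jn; rewrite fourier_sub; [|exact: (Hs_L1 p1 hF)|exact: (Hs_L1 p1 hl)].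
  rewrite fl; have : v *m E = \row_j fourier F j%:Z by rewrite mulmxKV.
  move/(congr1 (fun M : 'rV_n => M 0 (Ordinal jn))); rewrite !mxE /= => <-.
  by apply/eqP; rewrite subr_eq0; apply/eqP; apply: eq_bigr => i _; rewrite [E i _]mxE.
exists (fun z => (F z - lincomb c e z) * z ^ (- n%:Z)); first exact: Hs_div.
apply: aeq_trans (shift_ker _ hF' h0) _.
apply: aeq_trans (blo_sub (Toep_blo p1 Ld) hF hl) _.
apply: (aeD3 eF (blo_lincomb c (Toep_blo p1 Ld) hE) (aeD_ord (fun i => (he i).2))) => x _ -> -> hx.
by rewrite /lincomb big1 ?subr0// => i _; rewrite hx mulr0.
Qed.
End PositiveIndex.

(** * Negative index: bijectivity of [T(c t^(-n))] *)

Section NegativeIndex.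
Variables (c : C -> C) (n : nat).
Hypotheses (Gc : GL c) (n0 : (0 < n)%N) (Fc : FredholmIndex p (Toep c) (- n%:Z)).
Let Lc : Linf c. Proof. by case: Gc. Qed.
Let S z := c z * z ^ (- n%:Z).
Let GS : GL S. Proof. exact: GL_mon. Qed.
Let LS : Linf S. Proof. by case: GS. Qed.

Lemma neg_index_inj : inj (Toep c) /\ cokerDim p (Toep c) n.
Proof.
have [k [m [hk [hm [cl e]]]]] := Fc.
have hi : inj (Toep c).
  apply: contrapT => ni; have ho := coburn Gc cl ni.
  have m0 := cokerDim_onto (Toep_blo p1 Lc) hm ho.
  move: e; rewrite m0 subr0 => e; have : - n%:Z >= 0 by rewrite e.
  by rewrite oppr_ge0 lez_nat leqNgt n0.
split => //; have k0 := kerDim_inj hk hi.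
by move: e; rewrite k0 sub0r => /eqP; rewrite eqr_opp => /eqP[->].
Qed.

Let Smul f : Hs p f -> aeq (Toep S (fun z => f z * z ^ n%:Z)) (Toep c f).
Proof.
move=> hf; have hm := Hs_mon n hf; apply/ToepC => //; first exact: Toep_Hs.
move=> k k0; rewrite /Toep (fourier_rieszP p1)//; last by apply: Linf_mulLp => //; exact: Hs_Lp.
apply: eq_fourier => x; rewrite /S mulrACA -[RHS]mulr1; congr (_ * _).
by rewrite circXD addNr expr0z.
Qed.

Let Sblo := Toep_blo p1 LS.
Let Cblo := Toep_blo p1 Lc.

Lemma Rg_c_S h : Rg (Toep c) h -> Rg (Toep S) h.
Proof.
move=> [f hf ef]; exists (fun z => f z * z ^ n%:Z); first exact: Hs_mon.
exact: aeq_trans (Smul hf) ef.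
Qed.

(** A closed subspace plus a line is closed: if [v] is not in [M], its distance [dl] to [M] is
    positive and controls the scalars of an approximating sequence, which therefore converge. *)
Lemma closed_addspan (M : (C -> C) -> Prop) v : Hs p v -> (forall h, M h -> Hs p h) ->
  (forall h k (l : C), M h -> M k -> M (fun z => h z + l * k z)) -> M (fun=> 0) ->
  (forall h, Hs p h -> (forall e : R, 0 < e -> exists2 m, M m & N (fun z => h z - m z) < e) -> M h) ->
  forall h, Hs p h -> (forall e : R, 0 < e -> exists2 m, (exists l : C, M (fun z => m z - l * v z)) & N (fun z => h z - m z) < e) ->
  exists l : C, M (fun z => h z - l * v z).
Proof.
move=> hv MH Mlin M0 Mcl h hh happ.
have Mscale (l : C) k : M k -> M (fun z => l * k z).
  by move=> hk; have := Mlin _ _ l M0 hk; under eq_fun do rewrite add0r.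
have mH m l : M (fun z => m z - l * v z) -> Hs p m.
  move=> /MH hm; have := Hs_add p1 hm (Hs_scale p1 l hv).
  by under eq_fun do rewrite subrK.
have [Mv|nMv] := pselect (M v).
  exists 0; apply: Mcl; first by apply: Hs_sub => //; exact: Hs_scale.
  move=> e e0; have [m [l hl] hm] := happ e e0; exists m.
    by have := Mlin _ _ l hl Mv; under eq_fun do rewrite subrK.
  by under [X in N X]eq_fun do rewrite mul0r subr0.
have [dl dl0 hdl] : exists2 dl : R, 0 < dl & forall m, M m -> dl <= N (fun z => v z - m z).
  apply: contrapT => H; apply: nMv; apply: (Mcl v hv) => e e0.
  apply: contrapT => H2; apply: H; exists e => // m hm; rewrite leNgt; apply/negP => lt.
  by apply: H2; exists m.
have ch k : exists ml : (C -> C) * C, M (fun z => ml.1 z - ml.2 * v z) /\ N (fun z => h z - ml.1 z) <= 2^-1 ^+ k.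
  by have [m [l hl] /ltW hm] := happ _ (half_gt0 R k); exists (m, l).
have [x hx] := boolp.choice ch.
have hm k : Hs p (x k).1 by have [h1 _] := hx k; exact: mH h1.
have dist k j : absC ((x k).2 - (x j).2) * dl <= 2^-1 ^+ k + 2^-1 ^+ j.
  set mu := _ - _; have [mu0|mun] := eqVneq mu 0.
    by rewrite mu0 absC0 mul0r addr_ge0// ltW// half_gt0.
  have amu : 0 < absC mu by exact: absC_gt0.
  have [h1 n1] := hx k; have [h2 n2] := hx j.
  have hM := Mscale (- mu^-1) _ (Mlin _ _ (-1) h1 h2).
  have := hdl _ hM.
  have -> : (fun z => v z - - mu^-1 * ((x k).1 z - (x k).2 * v z + -1 * ((x j).1 z - (x j).2 * v z))) =
      (fun z => mu^-1 * ((h z - (x j).1 z) - (h z - (x k).1 z))).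
    apply/funext => z; have -> : (x k).2 = mu + (x j).2 by rewrite subrK.
    by field.
  have L1 := Hs_Lp (Hs_sub p1 hh (hm j)); have L2 := Hs_Lp (Hs_sub p1 hh (hm k)).
  rewrite (normLp_scale _ p0 (inLp_sub p1' L1 L2)) absCV mulrC ler_pdivlMr// mulrC => h3.
  apply: (le_trans h3); apply: (le_trans (normLp_sub p1' L1 L2)); rewrite addrC; exact: lerD.
(* The scalars are viewed as constant functions, so that completeness of [H^p] yields their limit as
   a zeroth coefficient. *)
pose u k : C -> C := if k is k'.+1 then fun=> (x k).2 - (x k').2 else fun=> (x 0%N).2.
have su k z : \sum_(0 <= i < k.+1) u i z = (x k).2.
  elim: k => [|k IH]; first by rewrite big_nat1.
  by rewrite big_nat_recr//= IH addrC subrK.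
have hcst (a : C) : Hs p (fun=> a).
  by have := Hs_scale p1 a (Hs_zn 0); under eq_fun do rewrite expr0z mulr1.
have hu k : Hs p (u k) by case: k => [|k]; exact: hcst.
pose B := absC (x 0%N).2 + 3 / dl.
have B0 : 0 <= B by rewrite addr_ge0 ?absC_ge0// divr_ge0// ltW.
have nu k : N (u k) <= B * 2^-1 ^+ k.
  case: k => [|k]; rewrite /u absC_const//; first by rewrite expr0 mulr1 lerDl divr_ge0// ltW.
  apply: (@le_trans _ _ (3 / dl * 2^-1 ^+ k.+1)); last first.
    by apply: ler_wpM2r; [exact: ltW (half_gt0 _ _)|rewrite lerDr absC_ge0].
  rewrite mulrAC ler_pdivlMr//; apply: (le_trans (dist _ _)).
  by rewrite exprS le_eqVlt; apply/orP; left; apply/eqP; field.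
have [f hf nf] := Hs_complete p1 B0 hu nu.
exists (fourier f 0); apply: Mcl; first by apply: Hs_sub => //; exact: Hs_scale.
have lim k : absC (fourier f 0 - (x k).2) <= pi *+ 2 * (2 * B * 2^-1 ^+ k).
  have := fourier_norm 0 p1 (Hs_Lp (Hs_sub p1 hf (Hs_sum p1 (index_iota 0 k.+1) hu))).
  rewrite fourier_sub; [|exact: (Hs_L1 p1 hf)|exact: (Hs_L1 p1 (Hs_sum p1 _ hu))].
  rewrite (@eq_fourier _ (fun z => \sum_(i <- index_iota 0 k.+1) u i z) (fun z => (x k).2 * z ^ (0 : int))); last first.
    by move=> t; rewrite su expr0z mulr1.
  rewrite fourier_monomial eqxx => /le_trans; apply; apply: ler_wpM2l; first exact: ltW (pi2_gt0 R).
  apply: (le_trans (nf k.+1)); rewrite halfS ler_pdivrMr// ler_peMr ?ler1n//.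
  by rewrite mulr_ge0 ?mulr_ge0// ltW// half_gt0.
move=> e e0; have [k hk] := half_small (1 + pi *+ 2 * (2 * B) * N v) e0.
exists (fun z => (x k).1 z - (x k).2 * v z); first exact: (hx k).1.
apply: le_lt_trans hk.
have -> : (fun z => h z - fourier f 0 * v z - ((x k).1 z - (x k).2 * v z)) =
   fun z => (h z - (x k).1 z) - (fourier f 0 - (x k).2) * v z by apply/funext => z; ring.
have L1 := Hs_Lp (Hs_sub p1 hh (hm k)); have L2 := Hs_Lp (Hs_scale p1 (fourier f 0 - (x k).2) hv).
apply: (le_trans (normLp_sub p1' L1 L2)); rewrite mulrDl mul1r; apply: lerD; first exact: (hx k).2.
rewrite (normLp_scale _ p0 (Hs_Lp hv)) mulrAC; apply: ler_wpM2r; first exact: normLp_ge0.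
by rewrite -mulrA; exact: lim.
Qed.

Lemma blo_sum_zn A m (c0 : nat -> C) : isBLOp p A ->
  aeq (A (fun z => \sum_(j < m) c0 j * z ^ j%:Z)) (fun z => \sum_(j < m) c0 j * A (fun w => w ^ j%:Z) z).
Proof.
move=> Ablo; exact: (blo_lincomb (fun j : 'I_m => c0 j) Ablo (e := fun j : 'I_m => fun z => z ^ j%:Z) (fun j => Hs_zn j)).
Qed.

Let v (j : nat) := Toep S (fun z => z ^ j%:Z).
Let hv j : Hs p (v j). Proof. exact: (Toep_Hs p1 LS (Hs_zn j)). Qed.

(** The range of [T(c)] enlarged by [v 1, ..., v r]. The index starts at 1 because in
    [neg_shift_inj] the monomial [t^0] is eliminated with the help of a kernel element. *)
Let V (r : nat) h := Hs p h /\ exists (l : nat -> C), Rg (Toep c) (fun z => h z - \sum_(1 <= j < r.+1) l j * v j z).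

Let V_lin r h k (l : C) : V r h -> V r k -> V r (fun z => h z + l * k z).
Proof.
move=> [hh [a ha]] [hk [b hb]]; split; first by apply: Hs_add => //; exact: Hs_scale.
exists (fun j => a j + l * b j); apply: (Rg_aeq _ (Rg_lin Cblo l ha hb)); apply: aeq_eq => x.
under [in RHS]eq_bigr do rewrite mulrDl -mulrA; rewrite big_split /= -mulr_sumr; ring.
Qed.

Let V_closed r h : Hs p h -> (forall e : R, 0 < e -> exists2 m, V r m & N (fun z => h z - m z) < e) -> V r h.
Proof.
elim: r h => [|r IH] h hh happ.
  split => //; exists (fun=> 0).
  have sub0 g : (fun z => g z - \sum_(1 <= j < 1) 0 * v j z) = g by apply/funext => z; rewrite big_geq// subr0.
  have sub0' g (l : nat -> C) : (fun z => g z - \sum_(1 <= j < 1) l j * v j z) = g by apply/funext => z; rewrite big_geq// subr0.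
  rewrite sub0; have [k [m [_ [_ [cl _]]]]] := Fc.
  have ch i : exists f, Hs p f /\ N (fun z => Toep c f z - h z) <= 2^-1 ^+ i.
    have [g [hg [l]]] := happ _ (half_gt0 R i); rewrite sub0' => -[f hf ef] /ltW hn.
    exists f; split; first exact: hf.
    rewrite normLp_distC.
    suff -> : N (fun z => h z - Toep c f z) = N (fun z => h z - g z) by [].
    apply: normLp_aeq.
    - by apply: (@Hs_m _ p); apply: Hs_sub => //; exact: (Toep_Hs p1 Lc hf).
    - by apply: (@Hs_m _ p); exact: Hs_sub.
    by apply: (aeD1 ef) => x _ ->.
  have [F hF] := boolp.choice ch.
  have [|||f [/HsE hf e]] := cl F h.
  - by move=> i; apply/HsE; have [] := hF i.
  - exact/HsE.
  - apply: (@squeeze_cvgr _ _ _ _ (fun=> 0) (fun i => 1 * 2^-1 ^+ i)).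
    + by apply: nearW => i; rewrite normLp_ge0 mul1r; have [] := hF i.
    + exact: cvg_cst.
    + exact: half_cvg0.
  by exists f.
have V0 : V r (fun=> 0).
  split; first exact: Hs0.
  exists (fun=> 0); apply: (Rg_aeq _ (Rg_0 Cblo)); apply: aeq_eq => x.
  by rewrite big1 ?subr0// => j _; rewrite mul0r.
have [|||l [hl [a ha]]] := @closed_addspan (V r) (v r.+1) (hv _) _ _ V0 IH h hh.
- by move=> g [].
- exact: V_lin.
- move=> e e0; have [m [hm [a ha]] hn] := happ e e0; exists m => //; exists (a r.+1); split.
    by apply: Hs_sub => //; exact: Hs_scale.
  exists a; apply: (Rg_aeq _ ha); apply: aeq_eq => x.
  by rewrite big_nat_recr//= opprD addrA addrAC.
split => //; exists (fun j => if j == r.+1 then l else a j).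
apply: (Rg_aeq _ ha); apply: aeq_eq => x.
rewrite [in RHS]big_nat_recr//= eqxx opprD addrA addrAC; congr (_ - _).
by apply: eq_big_nat => j /andP[_ jr]; rewrite ltn_eqF.
Qed.

(** A nonzero kernel element of [T(S)] can be divided by a power of [t] until its constant term is
    not 0. Subtracting multiples of it, every [T(S) g] is seen to lie in the range of [T(c)] plus
    the span of [v 1, ..., v (n - 1)]. This space is closed, and dense by [coburn_poly], so the
    cokernel of [T(c)] would have dimension at most [n - 1]. *)
Lemma neg_shift_inj : inj (Toep S).
Proof.
move=> f1 hf1 kf1; apply: contrapT => nf1.
have [m1 [hm1 mm1]] := Hs_first_coef p1 hf1 nf1.
pose f z := f1 z * z ^ (- m1%:Z).
have hf : Hs p f by apply: Hs_div => // j jm; apply: mm1; rewrite ltz_nat.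
have f0 : fourier f 0 != 0 by rewrite /f fourier_mon opprK add0r.
have kf : aeq (Toep S f) (fun=> 0).
  apply/(Toep0 LS hf); move/(Toep0 LS hf1): kf1 => /(Qs_mon m1).
  apply: Qs_aeq; first by apply: measC_mul; [case: LS|exact: (Hs_m hf)].
  by apply: aeq_eq => x; rewrite /f mulrA.
have nf : ~ aeq f (fun=> 0).
  move=> h; case/eqP: f0; rewrite (fourier_aeq _ _ _ h) ?fourier0//; [exact: (Hs_m hf)|exact: measC_cst].
have n1 : n = n.-1.+1 by rewrite prednK.
have SV g : Hs p g -> V n.-1 (Toep S g).
  move=> hg; split; first exact: Toep_Hs.
  pose be := fourier g 0 / fourier f 0.
  pose g1 z := g z - be * f z.
  have hg1 : Hs p g1 by apply: Hs_sub => //; exact: Hs_scale.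
  have fg1 : fourier g1 0 = 0.
    rewrite fourier_sub; [|exact: (Hs_L1 p1 hg)|exact: (Hs_L1 p1 (Hs_scale p1 be hf))].
    rewrite fourier_scale; last exact: (Hs_L1 p1 hf).
    by rewrite /be divfK// subrr.
  pose c0 (j : nat) := fourier g1 j%:Z.
  have hP : Hs p (fun z => \sum_(j < n) c0 j * z ^ j%:Z).
    by apply: Hs_sum => // j; apply: Hs_scale => //; exact: Hs_zn.
  pose g2 z := g1 z - \sum_(j < n) c0 j * z ^ j%:Z.
  have hg2 : Hs p g2 by exact: Hs_sub.
  have fg2 j : (j < n)%N -> fourier g2 j%:Z = 0.
    move=> jn; rewrite fourier_sub; [|exact: (Hs_L1 p1 hg1)|exact: (Hs_L1 p1 hP)].
    rewrite (fourier_poly (fun i : 'I_n => c0 i)); case: eqP => // _; case: insubP => [i _ ei|]; last by rewrite /= jn.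
    by rewrite /c0 ei /= subrr.
  have hq := Hs_div hg2 fg2.
  exists c0; exists (fun z => g2 z * z ^ (- n%:Z)) => //.
  apply: aeq_trans (aeq_sym (Smul hq)) _.
  have e1 : aeq (Toep S (fun z => g2 z * z ^ (- n%:Z) * z ^ n%:Z)) (Toep S g2).
    apply: (blo_aeq p1 Sblo) => //; first exact: Hs_mon.
    by apply: aeq_eq => x; rewrite -mulrA circXD addNr expr0z mulr1.
  apply: aeq_trans e1 _.
  have e2 := blo_sub Sblo hg1 hP; have e3 := blo_sub Sblo hg (Hs_scale p1 be hf).
  have e4 := blo_scale p1 Sblo be hf; have e5 := blo_sum_zn n c0 Sblo.
  apply: (aeD3 e2 e3 (aeD3 e4 e5 kf (fun x _ a b c => conj a (conj b c)))) => x _ h2 h3 [h4 [h5 h6]].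
  rewrite /g2 h2 h5 /g1 h3 h4 h6 mulr0 subr0; congr (_ - _).
  rewrite -(big_mkord xpredT (fun j => c0 j * Toep S (fun w => w ^ j%:Z) (circ x))) n1 big_nat_recl//= /c0 fg1 mul0r add0r.
  by rewrite big_add1.
have Vall h : Hs p h -> V n.-1 h.
  move=> hh; apply: V_closed => // e e0; have [s [as_ hs]] := dens_Hs p1 hh e0.
  exists (tp s) => //; have [g hg eg] := Rg_tp Sblo (coburn_poly GS hf nf kf) as_.
  have [_ [l hl]] := SV g hg; split; first exact: Hs_tp.
  by exists l; apply: (Rg_aeq _ hl); apply: (aeD1 eg) => x _ ->.
have [_ [u [hu [_ ind]]]] := neg_index_inj.
have hU i : Hs p (u i) by apply/HsE; exact: hu.
have [L hL] := boolp.choice (fun i => (Vall _ (hU i)).2).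
have n2 : n.-1.+1 = n by rewrite prednK.
pose u' (i : 'I_n.-1.+1) := u (cast_ord n2 i).
(* Modulo the range, [n] cokernel representatives are combinations of [n - 1] vectors, so a
   nontrivial combination of them lies in the range. *)
have [al [[i0 ai0] hal]] := lin_dep (\matrix_(i < n.-1.+1, j < n.-1) L (cast_ord n2 i) j.+1).
pose al' (i : 'I_n) := al (cast_ord (esym n2) i).
have hR i := hL (cast_ord n2 i).
have := Rg_sum Cblo (index_enum _) (fun i => Rg_scale Cblo (al i) (hR i)).
move=> [F hF eF]; have hF' := Hs_scale p1 (-1) hF.
have : forall i, al' i = 0.
  apply: (ind (fun z => -1 * F z)); first exact/HsE.
  apply: (aeD2 (blo_scale p1 Cblo (-1) hF) eF) => x _ -> ->.
  rewrite mulN1r /lincomb (reindex (cast_ord n2)) /=; last first.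
    by exists (cast_ord (esym n2)) => i _; rewrite ?cast_ordK ?cast_ordKV.
  under [X in _ + X]eq_bigr do rewrite /al' cast_ordK.
  rewrite -sumrN -big_split /= -[RHS](_ : \sum_(j < n.-1) (\sum_i al i * L (cast_ord n2 i) j.+1) * v j.+1 (circ x) = 0); last first.
    by rewrite big1// => j _; have := hal j; under eq_bigr do rewrite mxE; move=> ->; rewrite mul0r.
  under [RHS]eq_bigr do rewrite mulr_suml; rewrite [RHS]exchange_big /=; apply: eq_bigr => i _.
  rewrite mulrBr opprB subrK big_add1 big_mkord mulr_sumr; apply: eq_bigr => j _; exact: mulrA.
move=> /(_ (cast_ord n2 i0)); rewrite /al' cast_ordK => e; by rewrite e eqxx in ai0.
Qed.

(** Modulo the range of [T(c)], the vectors [T(S) t^j] with [j < n] have coordinates [L] in the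
    cokernel basis [u]. A relation among the rows of [L] would give a kernel element of [T(S)], so
    [L] is invertible and every [u i] is reached. *)
Lemma neg_shift_onto : onto (Toep S).
Proof.
move=> h hh; have [_ [u [hu [span ind]]]] := neg_index_inj.
have hU i : Hs p (u i) by apply/HsE; exact: hu.
have ch (j : 'I_n) : exists x : (C -> C) * ('I_n -> C), Hs p x.1 /\ aeq (v j) (fun z => Toep c x.1 z + lincomb x.2 u z).
  have /HsE hj := hv j; have [f [lam [/HsE hf e]]] := span _ hj; by exists (f, lam).
have [x hx] := boolp.choice ch.
pose L : 'M[C]_n := \matrix_(j, i) (x j).2 i.
have hF (al : 'I_n -> C) : Hs p (fun z => \sum_(j < n) al j * (x j).1 z).
  by apply: Hs_sum => // j; apply: Hs_scale => //; exact: (hx j).1.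
have sumv (al : 'I_n -> C) : aeD (fun t => \sum_(j < n) al j * v j (circ t) =
    Toep c (fun z => \sum_(j < n) al j * (x j).1 z) (circ t) + \sum_i (\sum_j al j * L j i) * u i (circ t)).
  have e1 := blo_lincomb al Cblo (fun j => (hx j).1).
  apply: (aeD2 e1 (aeD_ord (fun j => (hx j).2))) => t _; rewrite /lincomb => -> ht.
  under eq_bigr do rewrite ht mulrDr; rewrite big_split /=; congr (_ + _).
  under [RHS]eq_bigr do rewrite mulr_suml; rewrite [RHS]exchange_big /=; apply: eq_bigr => j _.
  by rewrite /lincomb mulr_sumr; apply: eq_bigr => i _; rewrite mxE mulrA.
have uL : L \in unitmx.
  apply: mulmx_unit_solve => al hal j.
  have hP : Hs p (fun z => \sum_(j < n) al j * z ^ j%:Z).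
    by apply: Hs_sum => // i; apply: Hs_scale => //; exact: Hs_zn.
  pose FF z := (\sum_(j < n) al j * (x j).1 z) * z ^ n%:Z.
  have hFF : Hs p FF by apply: Hs_mon.
  have hd := Hs_sub p1 hP hFF.
  have : aeq (fun z => \sum_(j < n) al j * z ^ j%:Z - FF z) (fun=> 0).
    apply: neg_shift_inj => //.
    have e1 := blo_lincomb al Sblo (e := fun j : 'I_n => fun z => z ^ j%:Z) (fun j => Hs_zn j).
    apply: (aeD3 (blo_sub Sblo hP hFF) e1 (aeD2 (sumv al) (Smul (hF al)) (fun t _ a b => conj a b))) => t _ -> e2 [e3 e4].
    rewrite /lincomb in e2; rewrite e2 e3 e4 big1 ?addr0 ?subrr// => i _; by rewrite hal mul0r.
  move=> e; have : fourier (fun z => \sum_(j < n) al j * z ^ j%:Z - FF z) j%:Z = 0.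
    by apply: etrans (fourier0 R j%:Z); apply: (fourier_aeq _ (Hs_m hd) (measC_cst 0) e).
  rewrite fourier_sub; [|exact: (Hs_L1 p1 hP)|exact: (Hs_L1 p1 hFF)].
  rewrite fourier_poly /FF fourier_mon (hF al).2 ?subr_lt0 ?ltz_nat// subr0.
  by case: eqP => // _; case: insubP => [i _ ei|]; [rewrite (val_inj ei)|rewrite /= ltn_ord].
have Rv j : Rg (Toep S) (v j) by exists (fun z => z ^ j%:Z); [exact: Hs_zn|exact: aeq_refl].
have RF al : Rg (Toep S) (Toep c (fun z => \sum_(j < n) al j * (x j).1 z)).
  by apply: Rg_c_S; exists (fun z => \sum_(j < n) al j * (x j).1 z); [exact: hF|exact: aeq_refl].
have Ru i : Rg (Toep S) (u i).
  pose al j := invmx L i j.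
  have := Rg_lin Sblo (-1) (Rg_sum Sblo (index_enum _) (fun j : 'I_n => Rg_scale Sblo (al j) (Rv j))) (RF al).
  apply: Rg_aeq; apply: (aeD1 (sumv al)) => t _ ->.
  rewrite mulN1r addrAC subrr add0r (bigD1 i)//= [X in _ + X]big1 ?addr0.
    have e1 : \sum_j al j * L j i = 1 by have : (invmx L *m L) i i = 1 by [rewrite mulVmx// mxE eqxx]; rewrite mxE.
    by rewrite e1 mul1r.
  move=> k ki; have e1 : \sum_j al j * L j k = 0.
    by have : (invmx L *m L) i k = 0 by [rewrite mulVmx// mxE eq_sym (negPf ki)]; rewrite mxE.
  by rewrite e1 mul0r.
have /HsE hh' := hh; have [f [lam [/HsE hf e]]] := span _ hh'.
apply: (Rg_aeq (aeq_sym e)); apply: (Rg_add Sblo); last first.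
  by apply: (Rg_sum Sblo) => i; apply: (Rg_scale Sblo).
by apply: Rg_c_S; exists f; [|exact: aeq_refl].
Qed.
End NegativeIndex.

End Coburn.
(** * Symbols with G * tilde G = 1 *)

Section Duality.
Variable R : realType.
Local Notation C := R[i].
Local Notation D := (@I02pi R).
Local Notation T := (measurableTypeR R).
Implicit Types (f g h v : C -> C) (z : C) (s t : seq (C * int)).
Hint Resolve mD : core.
Variable p : R.
Hypothesis p1 : 1 < p.
Let p1' : 1 <= p. Proof. exact: ltW. Qed.
Let p0 : 0 < p. Proof. exact: lt_trans p1. Qed.
Local Notation N := (normLp p).
Local Notation q := (conjexp p).
Let q1 : 1 < q. Proof. by have [] := conj_exp p1. Qed.
Let q0 : 0 < q. Proof. exact: lt_trans q1. Qed.
Let qq : conjexp q = p. Proof. by have [] := conj_exp p1. Qed.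

Lemma Lp_mul_tp (r : R) f s : 0 < r -> Lp r f -> Lp r (fun z => f z * tp s z).
Proof.
move=> r0 hf; have [] := @inLp_Linf _ r f (tp s) (tpbound s) r0 (measC_tp s) _ hf.
  by apply: aeD_all => x _; exact: ab_tp.
by move=> h1 _; under eq_fun do rewrite mulrC.
Qed.

Lemma fourier_mul_tp f s n : Lp 1 f ->
  fourier (fun z => f z * tp s z) n = \sum_(x <- s) x.1 * fourier f (n - x.2).
Proof.
move=> hf; have -> : (fun z => f z * tp s z) = fun z => \sum_(x <- s) x.1 * (f z * z ^ x.2).
  apply/funext => z; elim: s => [|x s IH]; first by rewrite tp_nil big_nil mulr0.
  by rewrite tp_cons big_cons mulrDr IH mulrCA.
have Lx (x : C * int) : Lp 1 (fun z => f z * z ^ x.2) by exact: inLp_mon.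
rewrite fourier_sum => [|x]; last exact: inLp_scale.
by apply: eq_bigr => x _; rewrite fourier_scale// fourier_mon.
Qed.

Lemma Hs_mul_tp f s : Hs p f -> analytic s -> Hs p (fun z => f z * tp s z).
Proof.
move=> hf hs; split; first by apply: Lp_mul_tp => //; exact: Hs_Lp.
move=> n n0; rewrite fourier_mul_tp; last exact: (Hs_L1 p1 hf).
rewrite big1_seq// => x /andP[_ xs]; rewrite hf.2 ?mulr0// subr_lt0.
exact: lt_le_trans n0 (allP hs x xs).
Qed.

Variable G : C -> C.
Hypotheses (SG : Sym G) (Ginj : inj p (Toep G)) (Gonto : onto p (Toep G)).
Let LG : Linf G. Proof. by case: SG => -[]. Qed.
Let G0 : aeD (fun x => G (circ x) != 0). Proof. by case: SG => -[]. Qed.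
Let Gblo := Toep_blo p1 LG.
Let H1 : Hs p (fun=> 1).
Proof. by have := Hs_zn p1 0; under eq_fun do rewrite expr0z. Qed.

Lemma tilde_Hs f (n : int) : Hs p f -> 0 < n -> fourier (tilde f) n = 0.
Proof. by move=> hf n0; rewrite fourier_tilde ?hf.2 ?oppr_lt0//; exact: (Hs_L1 p1 hf). Qed.

Section Eigen.
Variable e : C -> C.
Hypotheses (he : Hs p e) (ee : aeq (Toep G e) (fun=> 1)).
Let Le1 := Hs_L1 p1 he.

Lemma eigen : aeq (fun z => G z * e z) (fun z => fourier e 0 * tilde e z) /\ fourier e 0 ^+ 2 = 1.
Proof.
pose y z := G z * e z - 1.
have hy : Qs p y by apply/(ToepP p1 LG he H1).
have Ly := inL1_pn p1 (Qs_Lp hy).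
pose k z := 1 + tilde y z.
have fk n : fourier k n = (if n == 0 then 1 else 0) + fourier y (- n).
  rewrite fourier_add ?fourier_tilde//; [|exact: (Hs_L1 p1 H1)|exact: inLp_tilde].
  rewrite (@eq_fourier _ _ (fun z => 1 * z ^ (0 : int))) ?fourier_monomial// => x.
  by rewrite expr0z mulr1.
have hk : Hs p k.
  split; first by apply: inLp_add => //; [exact: (Hs_Lp H1)|apply: inLp_tilde; exact: Qs_Lp hy].
  by move=> n n0; rewrite fk lt_eqF// add0r hy.2// oppr_ge0 ltW.
have Gk : aeq (fun z => G z * k z) (tilde e).
  have [_ hS] := SG; apply: (aeD1 hS) => x _; rewrite /k /y /tilde => h.
  by rewrite addrC subrK mulrA h mul1r.
have hT : aeq (Toep G (fun z => k z - fourier e 0 * e z)) (fun=> 0).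
  have hd := Hs_sub p1 hk (Hs_scale p1 (fourier e 0) he).
  apply/(ToepC p1 LG hd (Hs0 p1)) => n n0; rewrite fourier0.
  have -> : fourier (fun z => G z * (k z - fourier e 0 * e z)) n =
      fourier (fun z => tilde e z - fourier e 0 * (1 + y z)) n.
    apply: fourier_aeq.
    - by apply: measC_mul; [case: LG|exact: (Hs_m hd)].
    - apply: measC_sub; first by apply: measC_tilde; exact: (Hs_m he).
      by apply: measC_scale; apply: measC_add; [exact: measC_cst|exact: (inLp_m (Qs_Lp hy))].
    by apply: (aeD1 Gk) => x _ h; rewrite mulrBr h /y; ring.
  have L1y : Lp 1 (fun z => 1 + y z) by apply: inLp_add => //; exact: (Hs_L1 p1 H1).
  rewrite fourier_sub; [|exact: inLp_tilde|exact: inLp_scale].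
  rewrite fourier_scale// fourier_add//; last exact: (Hs_L1 p1 H1).
  rewrite (@eq_fourier _ (fun=> 1) (fun z => 1 * z ^ (0 : int))); last by move=> x; rewrite expr0z mulr1.
  rewrite fourier_monomial hy.2// addr0; have [->|nn] := eqVneq n 0.
    by rewrite fourier_tilde// oppr0 mulr1 subrr.
  by rewrite mulr0 subr0 tilde_Hs// lt_neqAle eq_sym nn n0.
have hz := Ginj (Hs_sub p1 hk (Hs_scale p1 (fourier e 0) he)) hT.
split.
  apply: (aeD1 (aeD_rfl hz)) => x _ /=; rewrite circ_rfl /k /y /tilde invrK => /eqP.
  by rewrite subr_eq0 addrC subrK => /eqP.
have : fourier k 0 = fourier e 0 * fourier e 0.
  rewrite -fourier_scale//; apply: fourier_aeq.
  - exact: (Hs_m hk).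
  - by apply: measC_scale; exact: (Hs_m he).
  by apply: (aeD1 hz) => x _ /eqP; rewrite subr_eq0 => /eqP.
by rewrite fk eqxx oppr0 hy.2// addr0 expr2 => <-.
Qed.

Let sg := fourier e 0.
Let sg2 : sg ^+ 2 = 1. Proof. by have [] := eigen. Qed.
Let Ge : aeq (fun z => G z * e z) (fun z => sg * tilde e z). Proof. by have [] := eigen. Qed.
Let sg0 : sg != 0. Proof. by apply/eqP => h; move: sg2; rewrite h expr0n => /eqP; rewrite eq_sym oner_eq0. Qed.
Let asg : absC sg = 1.
Proof.
have : absC sg ^+ 2 = 1 by rewrite -absCX sg2 absC1.
by move=> /eqP; rewrite sqrp_eq1 ?absC_ge0// => /eqP.
Qed.

Lemma eigen_neq0 : aeD (fun x => e (circ x) != 0).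
Proof.
have me := Hs_m he.
apply: contrapT => nE; have : aeq e (fun=> 0).
  apply: (@fm_riesz_uniqueness R _ (fun x => e (circ x) == 0) Le1 he.2) => //.
  - have -> : (D `&` [set x | e (circ x) == 0] : set T) = D `&` [set x | ab e x <= 0].
      apply/seteqP; split => x [Dx /= b0]; split => //=; first by rewrite /ab (eqP b0) absC0.
      by apply/eqP/absC_eq0/eqP; rewrite eq_le b0 absC_ge0.
    by apply: mset_le; exact: mab.
  by apply: aeD_all => x _ /eqP.
by move=> h; move/eqP: sg0; apply; rewrite /sg (fourier_aeq 0 me (measC_cst 0) h) fourier0.
Qed.

(** [G e = sigma \tilde e] has no positive coefficients, so the terms of [s] with negative exponent
    do not survive the projection. Thus [e P e^(-1)] coincides with [T(G)^(-1) P G] on products of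
    [e] with polynomials. *)
Lemma Toep_eigen_tp s : aeq (Toep G (fun z => e z * tp (tpP s) z)) (rieszP (fun z => G z * (e z * tp s z))).
Proof.
have as_ : analytic (tpP s) by rewrite /analytic all_filter; apply/allP => x _; exact: implybb.
have h1 := Hs_mul_tp he as_.
have L2 : Lp p (fun z => G z * (e z * tp s z)).
  by apply: Linf_mulLp => //; apply: Lp_mul_tp => //; exact: Hs_Lp.
have h2 := Hs_rieszP p1 L2.
apply/(ToepC p1 LG h1 h2) => n n0; rewrite (fourier_rieszP p1)//.
have Lt := inLp_tilde Le1; have mG : measC G by case: LG.
have hh t : fourier (fun z => G z * (e z * tp t z)) n = sg * \sum_(x <- t) x.1 * fourier (tilde e) (n - x.2).
  rewrite -fourier_mul_tp// -fourier_scale; last exact: Lp_mul_tp.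
  apply: fourier_aeq.
  - by apply: measC_mul => //; apply: measC_mul; [exact: (Hs_m he)|exact: measC_tp].
  - by apply: measC_scale; apply: measC_mul; [exact: (inLp_m Lt)|exact: measC_tp].
  by apply: (aeD1 Ge) => x _ h; rewrite mulrA h mulrA.
rewrite !hh; congr (_ * _); rewrite /tpP big_filter [LHS]big_mkcond; apply: eq_bigr => x _.
by case: leP => // x0; rewrite tilde_Hs ?mulr0// subr_gt0 (lt_le_trans x0).
Qed.

Lemma mul4A (x y u w : R) : x * (y * (u * w)) = x * (y * u) * w.
Proof. by rewrite !mulrA. Qed.

(** The open mapping bound for [T(G)^(-1)], applied to [Toep_eigen_tp]. An offset [f] in [H^p] is
    allowed because [T(G)^(-1) P G f = f]; the cases [f = 0] and [f = 1] are used below. *)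
Lemma eigen_bound : exists2 K : R, 0 <= K & forall s f, Hs p f ->
  N (fun z => e z * tp (tpP s) z - f z) <= K * N (fun z => e z * tp s z - f z).
Proof.
have [M M0 hM] := open_mapping p1 Gblo Gonto.
have [K K0 hK] := rieszP_bound p1; have [L L0 hL] := Linf_Lp LG.
exists (M * (K * L)); first by rewrite !mulr_ge0.
move=> s f hf.
have as_ : analytic (tpP s) by rewrite /analytic all_filter; apply/allP => x _; exact: implybb.
have h1 := Hs_mul_tp he as_; have hd := Hs_sub p1 h1 hf.
have L2 : Lp p (fun z => e z * tp s z) by apply: Lp_mul_tp => //; exact: Hs_Lp.
have L3 := inLp_sub p1' L2 (Hs_Lp hf).
have [L4 n4] := hL p _ p0 L3.
have [h5 f5 n5] := hK _ L4.
have e5 : aeq (Toep G (fun z => e z * tp (tpP s) z - f z)) (rieszP (fun z => G z * (e z * tp s z - f z))).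
  apply: aeq_trans (blo_sub Gblo h1 hf) _.
  have hG := Hs_rieszP p1 (Linf_mulLp p0 LG L2); have hF := Toep_Hs p1 LG hf.
  have e6 : aeq (fun z => rieszP (fun w => G w * (e w * tp s w)) z - Toep G f z) (rieszP (fun z => G z * (e z * tp s z - f z))).
    apply: (Hs_eq_pos p1 (Hs_sub p1 hG hF) h5) => n n0.
    rewrite f5// fourier_sub; [|exact: (Hs_L1 p1 hG)|exact: (Hs_L1 p1 hF)].
    have LL := inL1_pn p1 (Linf_mulLp p0 LG L2); have LLf := inL1_pn p1 (Linf_mulLp p0 LG (Hs_Lp hf)).
    rewrite /Toep !(fourier_rieszP p1)//; [|exact: Linf_mulLp (Hs_Lp hf)|exact: Linf_mulLp L2].
    by rewrite -fourier_sub//; apply: eq_fourier => x; rewrite mulrBr.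
  by apply: (aeD2 (Toep_eigen_tp s) e6) => x _ -> <-.
have [f' [hf' ef' nf']] := hM _ h5.
have hz : aeq (fun z => e z * tp (tpP s) z - f z - f' z) (fun=> 0).
  apply: Ginj; first exact: Hs_sub.
  by apply: (aeD3 (blo_sub Gblo hd hf') e5 ef') => x _ -> -> ->; rewrite subrr.
have -> : N (fun z => e z * tp (tpP s) z - f z) = N f'.
  by apply: normLp_aeq; [exact: (Hs_m hd)|exact: (Hs_m hf')|apply: (aeD1 hz) => x _ /eqP; rewrite subr_eq0 => /eqP].
rewrite -mul4A; exact: (le_trans nf' (ler_wpM2l M0 (le_trans n5 (ler_wpM2l K0 n4)))).
Qed.

(** The zeroth coefficient of [e P s] is [sigma] times that of [s], so [eigen_bound] bounds the
    integral of [s] by the [L^p] norm of [e s]; this is the hypothesis of [converse_hoelder] with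
    [g = 1]. *)
Lemma inv_eigen_Lq : Lp q (fun z => (e z)^-1).
Proof.
have [K K0 hK] := eigen_bound.
have pp := pi2_gt0 R.
have [] := @converse_hoelder R p (fun=> 1) e (pi *+ 2 * K) p1 _ (Hs_Lp he) _ _.
- exact: inLp_cst.
- by rewrite mulr_ge0// ltW.
- move=> s; have as_ : analytic (tpP s) by rewrite /analytic all_filter; apply/allP => x _; exact: implybb.
  have -> : cint (fun z => 1 * tp s z) = Complex (pi *+ 2) 0 * tpcoef s 0.
    apply: (mulfI (c2pi_neq0 R)); rewrite mulrA c2piK mul1r -fourier_tp fourierE; congr (_ * _).
    by apply: eq_cint => x _; rewrite mul1r expr0z mulr1.
  rewrite absCM absC_real gtr0_norm// -mulrA; apply: ler_wpM2l; first exact: ltW.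
  have -> : absC (tpcoef s 0) = absC (fourier (fun z => e z * tp (tpP s) z) 0).
    by rewrite (fourier_mul_analytic Le1 he.2 as_) absCM asg mulr1 tpcoef_tpP.
  apply: (le_trans (fourier_norm 0 p1 (Hs_Lp (Hs_mul_tp he as_)))); rewrite -mulrA; apply: ler_wpM2l; first exact: ltW.
  have e0 t : (fun z => e z * tp t z - 0) = fun z => e z * tp t z by apply/funext => z; rewrite subr0.
  by have := hK s _ (Hs0 p1); rewrite !e0.
by under eq_fun do rewrite mul1r.
Qed.

(** [1 / e], cut off where [|e|] is small, is bounded, hence approximable by polynomials in the
    weight [1 + |e|^p]; the product of [e] with the cutoff tends to 1 by dominated convergence. *)
Lemma eigen_dens (d : R) : 0 < d -> exists s, N (fun z => e z * tp s z - 1) < d.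
Proof.
move=> d0; have me := Hs_m he; have Le := Hs_Lp he.
pose bb (n : nat) z := (n.+1%:R)^-1 <= absC (e z).
pose hh n z := if bb n z then (e z)^-1 else 0.
have mb n : measurable (D `&` [set x | bb n (circ x)] : set T) by apply: mset_ge; exact: mab.
have mh n : measC (hh n) by apply: measC_if; [exact: mb|exact: measC_inv|exact: measC_cst].
have bh n x : ab (hh n) x <= n.+1%:R.
  rewrite /ab /hh; case: ifP => [hb|_]; last by rewrite absC0.
  rewrite absCV -[leRHS]invrK lef_pV2 ?posrE ?invr_gt0//.
  by apply: lt_le_trans hb; rewrite invr_gt0.
have c1 : (fun n => rint (fun x => ab (fun z => e z * hh n z - 1) x `^ p)) @ \oo --> (0 : R).
  have [|||||_] := @rint_dominated_cvg R (fun n x => ab (fun z => e z * hh n z - 1) x `^ p) (fun=> 0) (fun=> 1).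
  - by move=> n; apply: mabp; apply: measC_sub; [exact: measC_mul|exact: measC_cst].
  - exact: measurable_cst.
  - exact: Lint_cst.
  - apply: aeD_all => x _ n; rewrite ger0_norm ?powR_ge0//.
    apply: (@le_trans _ _ (1 `^ p)); last by rewrite powR1.
    apply: ge0_ler_powR; rewrite ?nnegrE ?ab_ge0 ?(ltW p0)//.
    rewrite /ab /hh; case: ifP => [hb|_]; last by rewrite mulr0 sub0r absCN absC1.
    rewrite mulfV ?subrr ?absC0//; apply/eqP => e0; move: hb.
    by rewrite /bb e0 absC0 leNgt invr_gt0 ltr0n.
  - apply: (aeD1 eigen_neq0) => x _ e0; apply: cvg_near_cst.
    have a0 := absC_gt0 e0.
    exists (Num.truncn (absC (e (circ x)))^-1) => // n /= hn.
    rewrite /ab /hh ifT; first by rewrite mulfV// subrr absC0 powR0// (lt0r_neq0 p0).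
    rewrite /bb -[leRHS]invrK lef_pV2 ?posrE ?invr_gt0//; apply: ltW.
    by apply: (lt_le_trans (truncnS_gt _)); rewrite ler_nat.
  by rewrite int_cst mul0r.
have d2 : 0 < d / 2 by rewrite divr_gt0.
have [n0 hn0] := normLp_cvg0 p0 c1 d2; have {}hn0 := hn0 n0 (leqnn _).
set h := hh n0 in hn0; pose M : R := n0.+1%:R.
have M0 : 0 < M by rewrite ltr0n.
pose w x := 1 + ab e x `^ p.
have /inLpP[_ ie] := Le.
have iw : Lint w by apply: Lint_add => //; exact: Lint_cst.
have w0 x : 0 <= w x by rewrite addr_ge0 ?powR_ge0.
have M5 : 0 < 5 * M by exact: mulr_gt0.
have m0 : 0 < pi *+ 2 * (d / 2) `^ p / (5 * M) `^ (p - 1).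
  by rewrite divr_gt0 ?powR_gt0//; apply: mulr_gt0; [exact: pi2_gt0|exact: powR_gt0].
have [s [bs hs]] := dens_bdd iw w0 M0 (mh n0) (bh n0) m0.
pose u z := tp s z - h z.
have mu_ : measC u by apply: measC_sub; [exact: measC_tp|exact: mh].
have bu x : ab u x <= 5 * M.
  apply: (le_trans (absCD _ _)); rewrite absCN.
  apply: (le_trans (lerD (bs x) (bh n0 x))); rewrite -/M.
  by rewrite -[X in _ + X]mul1r -mulrDl ler_pM2r// -(natrD R 4 1).
have iuw : Lint (fun x => ab u x * w x).
  apply: (@Lint_le _ _ (fun x => 5 * M * w x)); last 1 first.
  - move=> x _; rewrite ger0_norm; last by apply: mulr_ge0; [exact: ab_ge0|exact: w0].
    by apply: ler_wpM2r; [exact: w0|exact: bu].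
  - by apply: (@measurable_funM _ T) => //; [exact: mab|exact: Lint_m iw].
  exact: Lint_scale.
have [Leu _] : Lp p (fun z => u z * e z) /\ N (fun z => u z * e z) <= `|5 * M| * N e.
  by apply: (inLp_Linf p0 mu_ _ Le); apply: aeD_all.
have neu : N (fun z => u z * e z) < d / 2.
  apply: normLp_lt => //.
  apply: (@le_lt_trans _ _ ((5 * M) `^ (p - 1) * rint (fun x => ab u x * w x))).
    rewrite -int_scale//; apply: int_le; [by have /inLpP[] := Leu|exact: Lint_scale|].
    move=> x _; rewrite /ab absCM powRM ?absC_ge0// mulrA; apply: ler_pM; rewrite ?powR_ge0//.
      by apply: powR_le_lin; [exact: ltW|rewrite absC_ge0; exact: bu].
    by rewrite /w lerDr.
  by rewrite mulrC -ltr_pdivlMr ?powR_gt0.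
exists s.
have Leh : Lp p (fun z => e z * h z - 1).
  apply: inLp_sub => //; last exact: (Hs_Lp H1).
  have [] := @inLp_Linf _ p e h M p0 (mh n0) _ Le; first by apply: aeD_all => x _; exact: bh.
  by move=> h1 _; under eq_fun do rewrite mulrC.
have -> : (fun z => e z * tp s z - 1) = fun z => (e z * h z - 1) + u z * e z.
  by apply/funext => z; rewrite /u; ring.
by rewrite [ltRHS]splitr; exact: (le_lt_trans (normLp_add p1' Leh Leu) (ltrD hn0 neu)).
Qed.

(** [eigen_bound] with [f = 1] makes the approximants of [eigen_dens] analytic; Hoelder with [1 / e]
    in [L^q] then compares the coefficients of [s] and of [1 / e]. *)
Lemma inv_eigen_approx (d : R) (n : int) : 0 < d -> exists s, [/\ analytic s,
  N (fun z => e z * tp s z - 1) < d & absC (fourier (tp s) n - fourier (fun z => (e z)^-1) n) < d].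
Proof.
move=> d0; have [K K0 hK] := eigen_bound; have Li := inv_eigen_Lq.
set B := pi *+ 2 * normLp q (fun z => (e z)^-1).
have B0 : 0 <= B by rewrite mulr_ge0 ?normLp_ge0// ltW// pi2_gt0.
have B1 : 0 < B + 1 by rewrite ltr_wpDl.
have K1 : 0 < K + 1 by rewrite ltr_wpDl.
have c0 : 0 < (B + 1) * (K + 1) by exact: mulr_gt0.
have [s0 hs0] := eigen_dens (divr_gt0 d0 c0); exists (tpP s0).
have as_ : analytic (tpP s0) by rewrite /analytic all_filter; apply/allP => x _; exact: implybb.
have h1 := Hs_sub p1 (Hs_mul_tp he as_) H1.
have n1 : N (fun z => e z * tp (tpP s0) z - 1) * (B + 1) < d.
  have h2 := hK s0 _ H1; rewrite -(ltr_pdivlMr _ _ B1).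
  apply: (le_lt_trans h2); apply: (@le_lt_trans _ _ ((K + 1) * N (fun z => e z * tp s0 z - 1))).
    by rewrite ler_wpM2r ?normLp_ge0// lerDl.
  by rewrite mulrC -(ltr_pdivlMr _ _ K1) -mulrA -invfM.
have n0 := normLp_ge0 p (fun z => e z * tp (tpP s0) z - 1).
split => //.
  by apply: le_lt_trans n1; rewrite ler_peMr// lerDr.
apply: le_lt_trans n1.
have [Lh nh] := hoelderC q0 p0 (etrans (addrC _ _) (pq_inv p1)) Li (Hs_Lp h1).
have Ltp : Lp 1 (tp (tpP s0)) by exact: inLp_tp.
have Li1 := inL1_pn q1 Li.
rewrite -fourier_sub//.
have -> : fourier (fun z => tp (tpP s0) z - (e z)^-1) n =
    fourier (fun z => (e z)^-1 * (e z * tp (tpP s0) z - 1)) n.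
  apply: fourier_aeq; [by apply: inLp_m; exact: inLp_sub Ltp Li1|exact: (inLp_m Lh)|].
  by apply: (aeD1 eigen_neq0) => x _ e0; rewrite mulrBr mulKf// mulr1.
apply: (le_trans (fourier_abs n Lh)); apply: (le_trans nh); rewrite -/B mulrC.
by apply: ler_wpM2l => //; rewrite lerDl.
Qed.

Lemma inv_contra (A V P : R) : 1 - A < P * V -> A < V -> P * V + 2 * V = 1 -> 0 < V -> False.
Proof. by lra. Qed.

(** Analytic [s] with [e s] near 1 approximate [1 / e] coefficientwise, so negative coefficients
    vanish. The zeroth one does not, because [sigma s(0)] is close to 1. *)
Lemma inv_eigen : Hs q (fun z => (e z)^-1) /\ fourier (fun z => (e z)^-1) 0 != 0.
Proof.
split.
  split; first exact: inv_eigen_Lq.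
  move=> n n0; apply: absC_eq0; apply/eqP; rewrite eq_le absC_ge0 andbT.
  apply/ler_addgt0Pr => d d0; rewrite add0r; have [s [as_ _ h]] := inv_eigen_approx n d0.
  apply/ltW; move: h; have hs := Hs_tp p1 as_; by rewrite hs.2// sub0r absCN.
apply/eqP => h0; have d0 : 0 < (pi *+ 2 + 2 : R)^-1 by rewrite invr_gt0 addr_gt0// pi2_gt0.
have [s [as_ h1 h2]] := inv_eigen_approx 0 d0.
have hd := Hs_sub p1 (Hs_mul_tp he as_) H1.
have := fourier_norm 0 p1 (Hs_Lp hd); rewrite fourier_sub; [|exact: (Hs_L1 p1 (Hs_mul_tp he as_))|exact: (Hs_L1 p1 H1)].
rewrite (fourier_mul_analytic Le1 he.2 as_).
rewrite (@eq_fourier _ (fun=> 1) (fun z => 1 * z ^ (0 : int))); last by move=> x; rewrite expr0z mulr1.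
rewrite fourier_monomial eqxx -/sg; rewrite h0 subr0 fourier_tp in h2.
have := absCB (tpcoef s 0 * sg) 1; rewrite absC1 absCM asg mulr1 => h3 h4.
have h5 := le_trans h3 h4; have pp := pi2_gt0 R.
have h6 : pi *+ 2 * N (fun z => e z * tp s z - 1) < pi *+ 2 * (pi *+ 2 + 2)^-1 by rewrite ltr_pM2l.
have h7 := le_lt_trans h5 h6.
have h8 : 1 - absC (tpcoef s 0) < pi *+ 2 * (pi *+ 2 + 2)^-1 by apply: le_lt_trans h7; rewrite distrC; exact: ler_norm.
have h9 : (pi *+ 2 : R) * (pi *+ 2 + 2)^-1 + 2 * (pi *+ 2 + 2)^-1 = 1.
  by rewrite -mulrDl mulfV// lt0r_neq0// addr_gt0.
exact: (inv_contra h8 h2 h9 d0).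
Qed.

(** By [G e = sigma \tilde e], the function [E = conj (1 / \tilde e)] of [H^q] satisfies
    [\bar G E = conj (sigma / e)], which has no positive coefficients and a nonzero constant term.
    So [T(\bar G)] maps [E t^n] to a polynomial of degree [n], and the triangular argument of
    [coburn_poly] applies. *)
Lemma dual_poly : forall n : nat, Rg q (Toep (fconj G)) (fun z => z ^ n%:Z).
Proof.
have [hi i0] := inv_eigen; have LGc := Linf_conj LG.
have Li1 := Hs_L1 q1 hi.
pose E z := (tilde (fun w => (e w)^-1) z)^*%C.
have hE : Hs q E.
  split; first by apply: inLp_conj; apply: inLp_tilde; exact: Hs_Lp.
  move=> n n0; rewrite fourier_conj; last exact: inLp_tilde.
  by rewrite fourier_tilde// opprK hi.2// conjc0.
pose co (k : int) := (sg * fourier (fun z => (e z)^-1) (- k))^*%C.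
have te0 : aeD (fun x => tilde e (circ x) != 0).
  by apply: (aeD1 (aeD_rfl eigen_neq0)) => x _ /=; rewrite circ_rfl.
have GE (m : nat) k : fourier (fun z => fconj G z * (E z * z ^ m%:Z)) k = co (k - m%:Z).
  rewrite /co -fourier_scale// -fourier_conj; last exact: inLp_scale.
  rewrite -fourier_mon; apply: fourier_aeq.
  - apply: measC_mul; first by apply: measC_conj; case: LG.
    by apply: measC_mul; [exact: (Hs_m hE)|exact: measC_mon].
  - apply: measC_mul; last exact: measC_mon.
    by apply: measC_conj; apply: measC_scale; exact: (inLp_m Li1).
  apply: (aeD3 eigen_neq0 te0 Ge) => x _ h1 h2 h3.
  rewrite mulrA; congr (_ * _); rewrite /fconj /E -conjM; congr (_^*)%C.
  rewrite /tilde in h2 h3 *.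
  by apply: (mulIf h1); rewrite mulrAC h3 mulfK// divfK.
have cob k : 0 < k -> co k = 0 by move=> k0; rewrite /co hi.2 ?mulr0 ?conjc0// oppr_lt0.
have co0 : co 0 != 0 by rewrite /co oppr0 conjc_eq0 mulf_neq0.
have Tblo := Toep_blo q1 LGc.
elim/ltn_ind => n IH.
have hF := Hs_mon n hE.
pose c (j : 'I_n.+1) := co (j%:Z - n%:Z).
have hS : Hs q (fun z => \sum_(j < n.+1) c j * z ^ j%:Z).
  by apply: Hs_sum => // j; apply: Hs_scale => //; exact: Hs_zn.
have hT : aeq (Toep (fconj G) (fun z => E z * z ^ n%:Z)) (fun z => \sum_(j < n.+1) c j * z ^ j%:Z).
  apply/(ToepC q1 LGc hF hS) => k k0; rewrite GE fourier_poly; case: eqP => // _.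
  case: insubP => [j jm ej|]; first by rewrite /c ej gez0_abs.
  rewrite -leqNgt => nk; apply: cob; rewrite subr_gt0 -(gez0_abs k0) ltz_nat//.
have hR : Rg q (Toep (fconj G)) (fun z => \sum_(j < n.+1) c j * z ^ j%:Z) by exists (fun z => E z * z ^ n%:Z).
have hl : Rg q (Toep (fconj G)) (fun z => \sum_(j < n) (c (widen_ord (leqnSn n) j)) * z ^ j%:Z).
  by apply: (Rg_sum q1 Tblo) => j; apply: (Rg_scale q1 Tblo); exact: IH.
have cn : c ord_max = co 0 by rewrite /c /= subrr.
have := Rg_scale q1 Tblo (co 0)^-1 (Rg_lin q1 Tblo (-1) hR hl).
apply: Rg_aeq; apply: aeq_eq => x.
by rewrite big_ord_recr /= cn mulN1r addrAC subrr add0r mulKf.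
Qed.

End Eigen.

Lemma dual_alg (P M K x y : R) : 2 * (P * (M * (K * x)) * y) = P * (2 * M * K * y) * x.
Proof. by ring. Qed.

(** For a polynomial [s], let [h = T(G) f] be the analytic part of [conj s]. The integral of [g s]
    is the conjugate of the pairing of [h] with [g], that is of [f] with [T(\bar G) g]. The open
    mapping bound for [f] and [converse_hoelder] with [e = 1] turn this into a lower bound for
    [T(\bar G)]. *)
Lemma dual_bound : exists2 K : R, 0 <= K & forall g, Hs q g ->
  normLp q g <= K * normLp q (Toep (fconj G) g).
Proof.
have [M M0 hM] := open_mapping p1 Gblo Gonto; have [K K0 hK] := riesz_tp p1.
have LGc := Linf_conj LG; have pp := pi2_gt0 R.
exists (2 * M * K); first by rewrite !mulr_ge0.
move=> g hg; have hT := Toep_Hs q1 LGc hg; have [nT enT] : exists x, x = normLp q (Toep (fconj G) g) by exists (normLp q (Toep (fconj G) g)).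
rewrite -enT; have nT0 : 0 <= nT by rewrite enT; exact: normLp_ge0.
have [] := @converse_hoelder R p g (fun=> 1) (2 * M * K * nT) p1 (Hs_L1 q1 hg) _ _ _.
- exact: inLp_cst (ltW p0).
- by rewrite !mulr_ge0.
- move=> s; have -> : (fun z => 1 * tp s z) = tp s by apply/funext => z; rewrite mul1r.
  pose t := tpconj s; have at_ : analytic (tpP t) by rewrite /analytic all_filter; apply/allP => x _; exact: implybb.
  have hh := Hs_tp p1 at_; have [f [hf ef nf]] := hM _ hh.
  have Lt : Lp p (tp t) by exact: inLp_tp (ltW p0).
  have e1 : cint (fun z => g z * tp s z) = pair g (tp (tpP t)).
    apply: (mulfI (c2pi_neq0 R)); rewrite cint_tp_mul; last exact: (Hs_L1 q1 hg).
    rewrite pair_tp; last exact: (Hs_L1 q1 hg).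
    rewrite big_filter big_map [RHS]big_mkcond; apply: eq_bigr => x _ /=; rewrite conjcK.
    by case: leP => // x0; rewrite hg.2// mulr0.
  have Lf := Hs_Lp hf; have Lg := Hs_Lp hg; have LGf := Linf_mulLp p0 LG Lf; have LGg := Linf_mulLp q0 LGc Lg.
  have e2 : pair (tp (tpP t)) g = pair f (Toep (fconj G) g).
    have -> : pair (tp (tpP t)) g = pair (fun z => G z * f z) g.
      have hQ : Qs p (fun z => G z * f z - tp (tpP t) z) by apply/(ToepP p1 LG hf hh).
      have := pair_Qs p1 hQ hg; rewrite (pair_subl p1 LGf (Hs_Lp hh) Lg) => /eqP.
      by rewrite subr_eq0 => /eqP.
    have -> : pair (fun z => G z * f z) g = pair f (fun z => fconj G z * g z).
      by apply: eq_cint => x _; rewrite /fconj conjM conjcK mulrCA mulrA.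
    have hQ : Qs q (fun z => fconj G z * g z - Toep (fconj G) g z).
      by apply/(ToepP q1 LGc hg hT); exact: aeq_refl.
    have hf' : Hs (conjexp q) f by rewrite qq.
    have h0 := pair_Qs q1 hQ hf'.
    have : pair f (fun z => fconj G z * g z - Toep (fconj G) g z) = 0.
      have := pair_conj p1 Lf (inLp_sub (ltW q1) LGg (Hs_Lp hT)).
      by rewrite h0 => /esym/eqP; rewrite conjc_eq0 => /eqP.
    by rewrite (pair_subr p1 Lf LGg (Hs_Lp hT)) => /eqP; rewrite subr_eq0 => /eqP.
  have -> : absC (cint (fun z => g z * tp s z)) = absC (pair f (Toep (fconj G) g)).
    by rewrite e1 -e2 (pair_conj p1 (Hs_Lp hh) Lg) absC_conj.
  have [_ h1] := pair_L1 p1 Lf (Hs_Lp hT); rewrite -enT in h1; apply: (le_trans h1).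
  have n1 : N f <= M * (K * N (tp s)).
    have <- : N (tp t) = N (tp s) by apply: normLp_ab => x; rewrite /ab tp_conj absC_conj.
    exact: (le_trans nf (ler_wpM2l M0 (hK t))).
  have h2 := ler_wpM2r nT0 (ler_wpM2l (ltW pp) n1).
  exact: (eq_ind _ (fun X => 2 * (pi *+ 2 * N f * nT) <= X) (ler_wpM2l (ler0n R 2) h2) _ (dual_alg (pi *+ 2) M K (N (tp s)) nT)).
by under eq_fun do rewrite divr1.
Qed.

Lemma dual_inj : inj q (Toep (fconj G)).
Proof.
have [K K0 hK] := dual_bound => g hg h0.
apply: normLp_eq0 (Hs_Lp hg) _ => //; apply/eqP; rewrite eq_le normLp_ge0 andbT.
apply: (le_trans (hK g hg)); rewrite (normLp_aeq0 q0 _ h0) ?mulr0//.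
exact: (Hs_m (Toep_Hs q1 (Linf_conj LG) hg)).
Qed.

(** The range is dense by [dual_poly], and [dual_bound] makes approximate preimages a Cauchy
    sequence, summed as a telescoping series. *)
Lemma dual_onto : onto q (Toep (fconj G)).
Proof.
have [K K0 hK] := dual_bound; have LGc := Linf_conj LG.
have Tblo := Toep_blo q1 LGc.
have [e he ee] := Gonto H1.
move=> h hh; have [F hF] := boolp.choice (dense_approx q1 Tblo (dual_poly he ee) hh).
have hFs k : Hs q (F k) by have [] := hF k.
pose u k : C -> C := if k is k'.+1 then fun z => F k z - F k' z else F 0%N.
have su k z : \sum_(0 <= i < k.+1) u i z = F k z.
  elim: k => [|k IH]; first by rewrite big_nat1.
  by rewrite big_nat_recr//= IH addrC subrK.
have hu k : Hs q (u k) by case: k => [|k]; [exact: hFs|apply: Hs_sub].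
pose B := normLp q (F 0%N) + K * 3.
have B0 : 0 <= B by rewrite addr_ge0 ?normLp_ge0// mulr_ge0.
have hTF k := Toep_Hs q1 LGc (hFs k).
have nu k : normLp q (u k) <= B * 2^-1 ^+ k.
  case: k => [|k]; first by rewrite expr0 mulr1 lerDl mulr_ge0.
  apply: (@le_trans _ _ (K * (2^-1 ^+ k.+1 + 2^-1 ^+ k))).
    apply: (le_trans (hK _ (hu k.+1))); apply: ler_wpM2l => //.
    have -> : normLp q (Toep (fconj G) (u k.+1)) =
        normLp q (fun z => (Toep (fconj G) (F k.+1) z - h z) - (Toep (fconj G) (F k) z - h z)).
      apply: normLp_aeq.
      - exact: (Hs_m (Toep_Hs q1 LGc (hu k.+1))).
      - by apply: (@Hs_m _ q); apply: Hs_sub => //; exact: Hs_sub.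
      by apply: (aeD1 (blo_sub Tblo (hFs k.+1) (hFs k))) => x _ ->; ring.
    apply: (le_trans (normLp_sub (ltW q1) (Hs_Lp (Hs_sub q1 (hTF _) hh)) (Hs_Lp (Hs_sub q1 (hTF _) hh)))).
    by apply: lerD; exact: (hF _).2.
  rewrite /B mulrDl; apply: ler_wpDl; first by rewrite mulr_ge0 ?normLp_ge0// ltW// half_gt0.
  by rewrite exprS le_eqVlt; apply/orP; left; apply/eqP; field.
have [f hf nf] := Hs_complete q1 B0 hu nu; exists f => //.
have [L L0 hL] := blo_bound Tblo.
have hd := Hs_sub q1 (Toep_Hs q1 LGc hf) hh.
have : aeq (fun z => Toep (fconj G) f z - h z) (fun=> 0).
  apply: normLp_eq0 (Hs_Lp hd) _ => //; apply/eqP; rewrite eq_le normLp_ge0 andbT.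
  apply: (@le_half_eps _ _ _ (L * (2 * B) + 1)) => k; rewrite add0r.
  have hfS := Hs_sub q1 hf (hFs k).
  have -> : normLp q (fun z => Toep (fconj G) f z - h z) =
      normLp q (fun z => Toep (fconj G) (fun w => f w - F k w) z + (Toep (fconj G) (F k) z - h z)).
    apply: normLp_aeq; [exact: (Hs_m hd)| |].
      exact: (Hs_m (Hs_add q1 (Toep_Hs q1 LGc hfS) (Hs_sub q1 (hTF k) hh))).
    by apply: (aeD1 (blo_sub Tblo hf (hFs k))) => x _ ->; ring.
  apply: (le_trans (normLp_add (ltW q1) (Hs_Lp (Toep_Hs q1 LGc hfS)) (Hs_Lp (Hs_sub q1 (hTF k) hh)))).
  rewrite mulrDl mul1r; apply: lerD; last exact: (hF k).2.
  apply: (le_trans (hL _ hfS)); rewrite -[leRHS]mulrA; apply: ler_wpM2l => //.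
  have -> : (fun w => f w - F k w) = fun w => f w - \sum_(0 <= i < k.+1) u i w by apply/funext => w; rewrite su.
  apply: (le_trans (nf k.+1)); rewrite halfS ler_pdivrMr// ler_peMr ?ler1n//.
  by rewrite mulr_ge0 ?mulr_ge0// ltW// half_gt0.
by move=> hz; apply: (aeD1 hz) => x _ /eqP; rewrite subr_eq0 => /eqP.
Qed.

End Duality.
(** * Reduction to the matrix W *)

Section Core.
Variable R : realType.
Local Notation C := R[i].
Implicit Types (f g h u w : C -> C) (z : C).
Hint Resolve mD : core.
Variable p : R.
Hypothesis p1 : 1 < p.
Let p1' : 1 <= p. Proof. exact: ltW. Qed.
Let p0 : 0 < p. Proof. exact: lt_trans p1. Qed.
Variables (n : nat) (a b : C -> C).
Hypotheses (Ga : GL a) (Gb : GL b).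
Hypothesis hab : aeq (fun z => a z * tilde a z) (fun z => b z * tilde b z).
Local Notation c := (subc a b).
Local Notation d := (subd a b).
Let S z := c z * z ^ (- (2 * n)%:Z).
Let G z := d z * z ^ (2 * n)%:Z.
Hypotheses (Sinj : inj p (Toep S)) (Sonto : onto p (Toep S)).
Hypotheses (SG : Sym G) (Ginj : inj p (Toep G)) (Gonto : onto p (Toep G)).
Variable e : C -> C.
Hypotheses (he : Hs p e) (ee : aeq (Toep G e) (fun=> 1)).

Let La : Linf a. Proof. by case: Ga. Qed.
Let Lb : Linf b. Proof. by case: Gb. Qed.
Let Lib : Linf (fun z => (b z)^-1). Proof. by case: Gb. Qed.
Let Ltia : Linf (fun z => (tilde a z)^-1). Proof. by case: (GL_tilde Ga). Qed.
Let Lc : Linf c. Proof. exact: Linf_mul. Qed.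
Let Ld : Linf d. Proof. by apply: Linf_mul => //; case: (GL_tilde Gb). Qed.
Let LS : Linf S. Proof. exact: Linf_mon. Qed.
Let LG : Linf G. Proof. exact: Linf_mon. Qed.

Let ae_all : aeD (fun x => [/\ a (circ x) != 0, b (circ x) != 0, tilde a (circ x) != 0, tilde b (circ x) != 0 &
  a (circ x) * tilde a (circ x) = b (circ x) * tilde b (circ x)]).
Proof.
have [_ _ a0] := Ga; have [_ _ b0] := Gb; have [_ _ ta0] := GL_tilde Ga; have [_ _ tb0] := GL_tilde Gb.
by apply: (aeD3 a0 b0 (aeD3 ta0 tb0 hab (fun x _ k1 k2 k3 => conj k1 (conj k2 k3)))) => x _ ? ? [? [? ?]].
Qed.

Lemma matched_alg1 (u v u' v' f j : C) : v' != 0 -> u * u' = v * v' -> u / v' * (u' * j + v' * f) = u * f + v * j.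
Proof.
move=> v0 h; have -> : u / v' * (u' * j + v' * f) = u * u' / v' * j + u * f by field.
by rewrite h; field.
Qed.

Lemma matched_alg2 (u v u' v' f j w jw : C) : v != 0 -> v' != 0 -> u * u' = v * v' -> u / v' * jw = w ->
  u / v * (f - (v'^-1 * jw - u' / v' * j)) = j - (v^-1 * w - u / v * f).
Proof.
move=> v0 v'0 h <-.
have -> : u / v * (f - (v'^-1 * jw - u' / v' * j)) = u / v * f - u / v' * jw / v + u * u' / (v * v') * j.
  by field; rewrite v0 v'0.
by rewrite h mulfV ?mulf_neq0//; field; rewrite v0 v'0.
Qed.

Lemma flipJ_mul f g x : flipJ (fun z => f z * g z) (circ x) = tilde f (circ x) * flipJ g (circ x).
Proof. by rewrite /flipJ /tilde mulrCA. Qed.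

(** The map [w -> d J w] is an involution because [d \tilde d = 1]; averaging over it produces
    symmetric functions. *)
Lemma flipJ_Linf f : aeq (fun z => d z * flipJ (fun t => d t * flipJ f t) z) f.
Proof.
apply: (aeD1 ae_all) => x _ [a0 b0 ta0 tb0 h].
rewrite flipJ_mul flipJK mulrA /subd /tilde invrK mulrACA -/(tilde a _) h -invfM.
by rewrite -/(tilde b _) [X in _ / X]mulrC mulfV ?mul1r// mulf_neq0.
Qed.

(** Here [w = J u]. The second claim is the identity [w / b - c f = J f], multiplied by [- t^(-n)]:
    its right-hand side is antianalytic. *)
Lemma TH_sol_sym f : Hs p f -> let w z := a z * f z + b z * flipJ f z in
  aeq (fun z => d z * flipJ w z) w /\
  Qs p (fun z => S z * (f z * z ^ n%:Z) - z ^ (- n%:Z) * ((b z)^-1 * w z)).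
Proof.
move=> hf w; split.
  apply: (aeD1 ae_all) => x _ [a0 b0 ta0 tb0 h].
  have -> : flipJ w (circ x) = tilde a (circ x) * flipJ f (circ x) + tilde b (circ x) * f (circ x).
    rewrite -[f (circ x) in RHS]flipJK -!flipJ_mul /flipJ /w mulrDr; by [].
  exact: matched_alg1.
have hJ := Qs_scale p1 (-1) (Qs_mon n (Qs_flipJ p1 hf)).
have mw : measC w.
  by apply: measC_add; apply: measC_mul; [case: La|exact: (Hs_m hf)|case: Lb|apply: measC_flipJ; exact: (Hs_m hf)].
apply: (Qs_aeq _ _ hJ).
  apply: measC_sub; apply: measC_mul.
  - by case: LS.
  - by apply: measC_mul; [exact: (Hs_m hf)|exact: measC_mon].
  - exact: measC_mon.
  - by apply: measC_mul; [case: Lib|].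
apply: (aeD1 ae_all) => x _ [a0 b0 ta0 tb0 h].
rewrite /S /w mulrACA circXD.
have -> : - (2 * n)%:Z + n%:Z = - n%:Z :> int by rewrite mul2n -addnn PoszD opprD addrNK.
rewrite /subc; move: (circ x ^ _) (flipJ f _) => Z J; by field.
Qed.

(** Converse of [TH_sol_sym]. The defect [r = w / b - c f] ought to be [J f]; symmetry of [w] gives
    [c (f - J r) = J f - r], so [t^n (f - J r)] lies in the kernel of [T(S)] and vanishes. *)
Lemma TH_sol_full f w : Hs p f -> Lp p w -> aeq (fun z => d z * flipJ w z) w ->
  Qs p (fun z => S z * (f z * z ^ n%:Z) - z ^ (- n%:Z) * ((b z)^-1 * w z)) ->
  aeq (fun z => a z * f z + b z * flipJ f z) w.
Proof.
move=> hf hw hsym hQ.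
pose r z := (b z)^-1 * w z - c z * f z.
have Lr : Lp p r by apply: inLp_sub => //; apply: Linf_mulLp => //; exact: Hs_Lp.
have mr := inLp_m Lr.
have e2n : - (2 * n)%:Z + n%:Z = - n%:Z :> int by rewrite mul2n -addnn PoszD opprD addrNK.
have hr : Qs p (fun z => r z * z ^ (- n%:Z)).
  apply: (Qs_aeq _ _ (Qs_scale p1 (-1) hQ)).
    by apply: measC_mul => //; exact: measC_mon.
  by apply: aeq_eq => x; rewrite /S /r mulrACA circXD e2n; ring.
have hJr := Hs_flipJ p1 hr.
pose g z := f z * z ^ n%:Z - flipJ (fun t => r t * t ^ (- n%:Z)) z.
have hg : Hs p g by apply: Hs_sub => //; exact: Hs_mon.
have ec : aeD (fun x => c (circ x) * (f (circ x) - flipJ r (circ x)) = flipJ f (circ x) - r (circ x)).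
  apply: (aeD2 ae_all hsym) => x _ [a0 b0 ta0 tb0 h] hs.
  have -> : flipJ r (circ x) = (tilde b (circ x))^-1 * flipJ w (circ x) - tilde a (circ x) / tilde b (circ x) * flipJ f (circ x).
    by rewrite /flipJ /r /tilde /subc; ring.
  exact: matched_alg2.
have gz : aeq g (fun=> 0).
  apply: Sinj => //; apply/(Toep0 p1 LS hg).
  have hQ2 := Qs_sub p1 (Qs_mon n (Qs_flipJ p1 hf)) hr.
  apply: (Qs_aeq _ _ hQ2); first by apply: measC_mul; [case: LS|exact: (Hs_m hg)].
  apply: (aeD1 ec) => x _ hx; rewrite -mulrBl -hx /g /S.
  have -> : flipJ (fun t => r t * t ^ (- n%:Z)) (circ x) = flipJ r (circ x) * circ x ^ n%:Z.
    by rewrite /flipJ circVX opprK mulrA.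
  by rewrite -mulrBl mulrACA circXD e2n.
have fJ : aeq f (flipJ r).
  apply: (aeD1 gz) => x _; rewrite /g.
  have -> : flipJ (fun t => r t * t ^ (- n%:Z)) (circ x) = flipJ r (circ x) * circ x ^ n%:Z.
    by rewrite /flipJ circVX opprK mulrA.
  rewrite -mulrBl => /eqP; rewrite mulf_eq0 expfz_eq0 (negPf (circ_neq0 x)) andbF orbF subr_eq0.
  by move/eqP.
apply: (aeD2 ae_all (flipJ_aeq fJ)) => x _ [a0 b0 ta0 tb0 h] ->.
by rewrite flipJK /r /subc; field.
Qed.

Let sg := fourier e 0.
Let sg2 : sg * sg = 1. Proof. by have [_ h] := eigen p1 SG Ginj he ee; rewrite -h expr2. Qed.
Let Ge : aeq (fun z => G z * e z) (fun z => sg * tilde e z). Proof. by have [] := eigen p1 SG Ginj he ee. Qed.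
Let nz_e : ~ aeq e (fun=> 0).
Proof.
move=> h; have : sg = 0.
  by apply: etrans (fourier0 R 0); apply: (fourier_aeq 0 (Hs_m he) (measC_cst 0) h).
by move=> s0; move: sg2; rewrite s0 mul0r => /eqP; rewrite eq_sym oner_eq0.
Qed.
Let de : aeq (fun z => d z * e z) (fun z => sg * tilde e z * z ^ (- (2 * n)%:Z)).
Proof.
apply: (aeD1 Ge) => x _ <-; rewrite /G [RHS]mulrAC -(mulrA (d _)) circXD subrr.
by rewrite expr0z mulr1.
Qed.
Let te_pos (k : int) : 0 < k -> fourier (tilde e) k = 0.
Proof. exact: (tilde_Hs p1 he). Qed.
Let Le1 := Hs_L1 p1 he.
Let Lte1 := inLp_tilde Le1.

Lemma fourier_G_shift (m : nat) (k : int) :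
  fourier (fun z => G z * (e z * z ^ m%:Z)) k = sg * fourier (tilde e) (k - m%:Z).
Proof.
rewrite -fourier_mon -fourier_scale; last exact: inLp_mon.
apply: fourier_aeq.
- by apply: measC_mul; [case: LG|exact: (Hs_m (Hs_mon m he))].
- by apply: measC_scale; apply: measC_mul; [exact: (inLp_m Lte1)|exact: measC_mon].
by apply: (aeD1 Ge) => x _ h; rewrite !mulrA h.
Qed.

(** [G e t^m = sigma \tilde e t^m] has top coefficient 1, at exponent [m], so the highest
    coefficient of [G u] is removed by subtracting a multiple of [e t^m]; once no nonnegative
    exponent is left, [T(G)] is injective. *)
Lemma poly_times_eigen (m : nat) u : Hs p u -> (forall k : int, m%:Z <= k -> fourier (fun z => G z * u z) k = 0) ->
  exists q : nat -> C, aeq u (fun z => \sum_(0 <= j < m) q j * (e z * z ^ j%:Z)).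
Proof.
elim: m u => [|m IH] u hu h0.
  exists (fun=> 0); have : aeq u (fun=> 0).
    apply: Ginj => //; apply/(ToepC p1 LG hu (Hs0 p1)) => k k0; by rewrite fourier0 h0.
  by move=> h; apply: (aeD1 h) => x _ ->; rewrite big_geq.
pose al := fourier (fun z => G z * u z) m%:Z.
have hm := Hs_mon m he; have hs := Hs_scale p1 al hm.
have hu' := Hs_sub p1 hu hs.
have LGu := inL1_pn p1 (Linf_mulLp p0 LG (Hs_Lp hu)).
have LGe := inL1_pn p1 (Linf_mulLp p0 LG (Hs_Lp hm)).
have [k mk|q hq] := IH _ hu'.
  rewrite (@eq_fourier _ _ (fun z => G z * u z - al * (G z * (e z * z ^ m%:Z)))); last first.
    by move=> x; rewrite mulrBr; congr (_ - _); rewrite mulrCA.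
  rewrite fourier_sub//; last exact: inLp_scale.
  rewrite fourier_scale// fourier_G_shift.
  have [->|km] := eqVneq k m%:Z.
    by rewrite subrr fourier_tilde// oppr0 sg2 mulr1 subrr.
  have mk' : m%:Z < k by rewrite lt_neqAle eq_sym km.
  have t0 : fourier (tilde e) (k - m%:Z) = 0 by apply: te_pos; rewrite subr_gt0.
  by rewrite t0 !mulr0 subr0 h0// -addn1 PoszD lezD1.
exists (fun j => if j == m then al else q j); apply: (aeD1 hq) => x _.
move/eqP; rewrite subr_eq => /eqP ->; rewrite big_nat_recr//= eqxx; congr (_ + _).
by apply: eq_big_nat => j /andP[_ jm]; rewrite ltn_eqF.
Qed.

Let u_ (k : nat) z := e z * (z ^ (n%:Z - k%:Z - 1) + sg * z ^ (n + k)%:Z).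

(** Pairs the exponents [j] and [2 n - 1 - j], which the symmetry [u -> J (d u)] interchanges. *)
Lemma sum_split2 (F : nat -> C) : \sum_(0 <= j < 2 * n) F j = \sum_(k < n) (F (n - k.+1)%N + F (n + k)%N).
Proof.
rewrite mul2n -addnn (big_cat_nat (leq0n n) (leq_addr n n)) /= big_split /=; congr (_ + _).
  by rewrite big_nat_rev /= big_mkord; apply: eq_bigr => k _; rewrite add0n.
by rewrite -{1}[n]add0n big_addn addnK big_mkord; apply: eq_bigr => k _; rewrite addnC.
Qed.

Let ek (k : 'I_n) : n%:Z - k%:Z - 1 = (n - k.+1)%N%:Z :> int.
Proof. by rewrite -subzn// intS opprD addrA addrAC. Qed.

Lemma u_Hs (k : 'I_n) : Hs p (u_ k).
Proof.
have h1 := Hs_mon (n - k.+1) he; have h2 := Hs_scale p1 sg (Hs_mon (n + k) he).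
have := Hs_add p1 h1 h2; rewrite (_ : (fun z => _) = u_ k)//.
by apply/funext => z; rewrite /u_ ek; ring.
Qed.

Let circN1 x : circ x ^ (-1 : int) = (circ x)^-1 :> C.
Proof. by rewrite -(circVX x 1) expr1z. Qed.

Lemma u_sym (k : 'I_n) : aeq (fun z => d z * u_ k z) (flipJ (u_ k)).
Proof.
apply: (aeD1 de) => x _; rewrite /flipJ /u_ mulrA; move: sg2; move: sg => s s2 ->.
rewrite /tilde !circVX; set E := e _; set X := circ x ^ (- (2 * n)%:Z).
transitivity (E * (s * (X * circ x ^ (n%:Z - k%:Z - 1)) + (s * s) * (X * circ x ^ (n + k)%:Z))); first by ring.
rewrite s2 mul1r -circN1.
transitivity (E * (circ x ^ (-1 : int) * circ x ^ (- (n%:Z - k%:Z - 1)) + s * (circ x ^ (-1 : int) * circ x ^ (- (n + k)%:Z)))); last by ring.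
rewrite !circXD addrC; congr (_ * (_ ^ _ + _ * _ ^ _)); rewrite mul2n -addnn !PoszD; ring.
Qed.

(** The symmetry gives [G u = t^(2n) J u], which has no coefficients from [2 n] on, so [u] is [e]
    times a polynomial of degree below [2 n]. Averaging this expansion with its image under
    [u -> J (d u)] combines paired exponents into the [u_ k]. *)
Lemma kernel_span u : Hs p u -> aeq (fun z => d z * u z) (flipJ u) ->
  exists c0 : 'I_n -> C, aeq u (fun z => \sum_k c0 k * u_ k z).
Proof.
move=> hu hs.
have [k mk|q hq] := @poly_times_eigen (2 * n) u hu.
  have hQ := Qs_flipJ p1 hu.
  have -> : fourier (fun z => G z * u z) k = fourier (fun z => flipJ u z * z ^ (2 * n)%:Z) k.
    apply: fourier_aeq.
    - by apply: measC_mul; [case: LG|exact: (Hs_m hu)].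
    - by apply: measC_mul; [exact: (inLp_m (Qs_Lp hQ))|exact: measC_mon].
    by apply: (aeD1 hs) => x _ <-; rewrite /G mulrAC.
  by rewrite fourier_mon hQ.2// subr_ge0.
have dej : aeD (fun x => forall j : nat, flipJ (fun z => d z * (e z * z ^ j%:Z)) (circ x) = sg * (e (circ x) * circ x ^ ((2 * n)%:Z - 1 - j%:Z))).
  apply: (aeD1 (aeD_rfl de)) => x _ /= h j; rewrite circ_rfl in h.
  rewrite /flipJ mulrA h /tilde invrK !circVX opprK.
  have -> : (2 * n)%:Z - 1 - j%:Z = -1 + ((2 * n)%:Z + - j%:Z) :> int by ring.
  by rewrite -!circXD circN1; ring.
have hu2 : aeq u (fun z => \sum_(0 <= j < 2 * n) q j * (sg * (e z * z ^ ((2 * n)%:Z - 1 - j%:Z)))).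
  have hq' : aeq (fun z => d z * u z) (fun z => d z * \sum_(0 <= j < 2 * n) q j * (e z * z ^ j%:Z)) by apply: (aeD1 hq) => x _ ->.
  apply: (aeD3 (flipJ_aeq hq') (flipJ_aeq hs) dej) => x _ h1 h2 h3.
  rewrite -[LHS](flipJK u) -h2 h1 /flipJ mulr_sumr mulr_sumr; apply: eq_bigr => j _.
  by rewrite -h3 /flipJ; ring.
exists (fun k : 'I_n => 2^-1 * (q (n - k.+1)%N + sg * q (n + k)%N)).
apply: (aeD2 hq hu2) => x _ h1 h2.
have -> : u (circ x) = 2^-1 * (\sum_(0 <= j < 2 * n) (q j * (e (circ x) * circ x ^ j%:Z) + q j * (sg * (e (circ x) * circ x ^ ((2 * n)%:Z - 1 - j%:Z))))).
  by rewrite big_split /= -h1 -h2 half_double.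
rewrite sum_split2 mulr_sumr; apply: eq_bigr => k _; rewrite -[RHS]mulrA; congr (_ * _).
rewrite /u_ ek.
have -> : (2 * n)%:Z - 1 - (n - k.+1)%N%:Z = (n + k)%:Z :> int.
  by rewrite -ek mul2n -addnn !PoszD; ring.
have -> : (2 * n)%:Z - 1 - (n + k)%N%:Z = (n - k.+1)%N%:Z :> int.
  by rewrite -ek mul2n -addnn !PoszD; ring.
set X := circ x ^ _; set Y := circ x ^ _; set E := e _; set A := q _; set B := q _.
have -> : (A + sg * B) * (E * (X + sg * Y)) = A * (E * X) + sg * A * (E * Y) + sg * B * (E * X) + (sg * sg) * B * (E * Y) by ring.
rewrite sg2; ring.
Qed.

Lemma kernel_indep (c0 : 'I_n -> C) : aeq (fun z => \sum_k c0 k * u_ k z) (fun=> 0) -> forall k, c0 k = 0.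
Proof.
move=> h; pose cc (k : nat) : C := if insub k is Some i then c0 i else 0.
have ecc (k : 'I_n) : cc k = c0 k by rewrite /cc valK.
pose F (j : nat) : C := if (j < n)%N then cc (n - j.+1)%N else sg * cc (j - n)%N.
have hF : aeq (fun z => \sum_(j < 2 * n) F j * (e z * z ^ j%:Z)) (fun=> 0).
  apply: (aeD1 h) => x _ h1; rewrite -[RHS]h1.
  rewrite -(big_mkord xpredT (fun j => F j * (e (circ x) * circ x ^ j%:Z))) sum_split2; apply: eq_bigr => k _.
  have nk : (n - k.+1 < n)%N by rewrite ltn_subrL (leq_ltn_trans _ (ltn_ord k)).
  rewrite /F nk ltnNge leq_addr /= addKn ecc.
  have -> : (n - (n - k.+1).+1)%N = k by rewrite subnS subKn// .
  by rewrite ecc /u_ ek; ring.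
have := shift_indep p1 he nz_e hF => hz k.
have nk : (n - k.+1 < n)%N by rewrite ltn_subrL (leq_ltn_trans _ (ltn_ord k)).
have nk2 : (n - k.+1 < 2 * n)%N by rewrite (leq_trans nk)// leq_pmull.
have := hz (Ordinal nk2); rewrite /F /= nk.
have -> : (n - (n - k.+1).+1)%N = k by rewrite subnS subKn.
by rewrite ecc.
Qed.

Variable om : 'I_n -> C -> C.
Let B z := (tilde a z)^-1 * z ^ (- n%:Z).
Hypotheses (homH : forall k, Hs p (om k)) (hom : forall k, aeq (Toep S (om k)) (Toep B (u_ k))).
Let LB : Linf B. Proof. exact: Linf_mon. Qed.

(** The factor [1 / \tilde a] in [B] equals [d / b] by the matching condition, and [d u_k = J u_k];
    this gives [om k] the form of the second condition in [TH_sol_sym], with [w = J u_k]. *)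
Lemma omega_Qs (k : 'I_n) : Qs p (fun z => S z * om k z - z ^ (- n%:Z) * ((b z)^-1 * flipJ (u_ k) z)).
Proof.
have hu := u_Hs k; have hT := Toep_Hs p1 LB hu.
have q1 : Qs p (fun z => S z * om k z - Toep B (u_ k) z) by apply/(ToepP p1 LS (homH k) hT).
have q2 : Qs p (fun z => B z * u_ k z - Toep B (u_ k) z) by apply/(ToepP p1 LB hu hT); exact: aeq_refl.
apply: (Qs_aeq _ _ (Qs_sub p1 q1 q2)).
  apply: measC_sub; apply: measC_mul; [by case: LS|exact: (Hs_m (homH k))|exact: measC_mon|].
  by apply: measC_mul; [case: Lib|apply: measC_flipJ; exact: (Hs_m hu)].
apply: (aeD2 ae_all (u_sym k)) => x _ [a0 b0 ta0 tb0 h] <-.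
rewrite opprB addrA addrNK; congr (_ - _); rewrite /B /subd.
have -> : a (circ x) = b (circ x) * tilde b (circ x) / tilde a (circ x) by rewrite -h mulfK.
by move: (circ x ^ _) (u_ k _) => Z U; field; rewrite b0 tb0 ta0.
Qed.

Let FO (c0 : 'I_n -> C) z := \sum_k c0 k * om k z.
Let UO (c0 : 'I_n -> C) z := \sum_k c0 k * u_ k z.
Let FO_Hs c0 : Hs p (FO c0). Proof. by apply: Hs_sum => // k; apply: Hs_scale. Qed.
Let UO_Hs c0 : Hs p (UO c0). Proof. by apply: Hs_sum => // k; apply: Hs_scale => //; exact: u_Hs. Qed.
Let flipJ_UO c0 z : flipJ (UO c0) z = \sum_k c0 k * flipJ (u_ k) z.
Proof. by rewrite /flipJ /UO mulr_sumr; apply: eq_bigr => k _; rewrite mulrCA. Qed.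
Let UO_sym c0 : aeq (fun z => d z * UO c0 z) (flipJ (UO c0)).
Proof.
apply: (aeD1 (aeD_ord u_sym)) => x _ h; rewrite flipJ_UO /UO mulr_sumr.
by apply: eq_bigr => k _; rewrite -h mulrCA.
Qed.
Let FO_Qs c0 : Qs p (fun z => S z * FO c0 z - z ^ (- n%:Z) * ((b z)^-1 * flipJ (UO c0) z)).
Proof.
have -> : (fun z => S z * FO c0 z - z ^ (- n%:Z) * ((b z)^-1 * flipJ (UO c0) z)) =
    fun z => \sum_k c0 k * (S z * om k z - z ^ (- n%:Z) * ((b z)^-1 * flipJ (u_ k) z)).
  apply/funext => z; rewrite flipJ_UO /FO !mulr_sumr -sumrB; apply: eq_bigr => k _; ring.
elim: (index_enum _) => [|k s IH].
  under eq_fun do rewrite big_nil.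
  by split; [exact: inLp0|move=> m _; exact: fourier0].
by under eq_fun do rewrite big_cons; apply: Qs_add => //; apply: Qs_scale => //; exact: omega_Qs.
Qed.

Let W : 'M[C]_n := \matrix_(j, k) fourier (om k) j%:Z.
Let fourier_FO c0 (j : 'I_n) : fourier (FO c0) j%:Z = (W *m \col_k c0 k) j 0.
Proof.
rewrite fourier_sum => [|k]; last by apply: inLp_scale => //; exact: (Hs_L1 p1 (homH k)).
rewrite mxE; apply: eq_bigr => k _; rewrite !mxE mulrC fourier_scale//.
exact: (Hs_L1 p1 (homH k)).
Qed.

Let zero_col c0 : (\col_k c0 k : 'cV[C]_n) = 0 -> forall k, c0 k = 0.
Proof. by move=> h k; have /(congr1 (fun M : 'cV_n => M k 0)) := h; rewrite !mxE. Qed.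

Lemma TH_inj_of_det : \det W != 0 -> inj p (TH a b).
Proof.
move=> dW f hf /(THP p1 La Lb hf (Hs0 p1)); set w0 := (fun z => _ - 0).
have [hsym hQ] := TH_sol_sym hf; set w := (fun z => a z * f z + b z * flipJ f z) in hsym hQ.
have -> : w0 = w by apply/funext => z; rewrite /w0 subr0.
move=> hw; have hu := Hs_flipJ p1 hw.
have hs : aeq (fun z => d z * flipJ w z) (flipJ (flipJ w)).
  by apply: (aeD1 hsym) => x _ ->; rewrite flipJK.
have [c0 hc0] := kernel_span hu hs.
have ew : aeq w (flipJ (UO c0)) by apply: (aeD1 (flipJ_aeq hc0)) => x _ <-; rewrite flipJK.
have hfm := Hs_mon n hf.
have hd : Hs p (fun z => f z * z ^ n%:Z - FO c0 z) by exact: Hs_sub.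
have hz : aeq (fun z => f z * z ^ n%:Z - FO c0 z) (fun=> 0).
  apply: Sinj => //; apply/(Toep0 p1 LS hd).
  apply: (Qs_aeq _ _ (Qs_sub p1 hQ (FO_Qs c0))); first by apply: measC_mul; [case: LS|exact: (Hs_m hd)].
  by apply: (aeD1 ew) => x _; rewrite /w => ->; ring.
have hcol : W *m (\col_k c0 k) = 0.
  apply/colP => j; rewrite -fourier_FO [RHS]mxE.
  have := hfm; move=> _; have <- : fourier (fun z => f z * z ^ n%:Z) j%:Z = 0.
    by rewrite fourier_mon hf.2// subr_lt0 ltz_nat.
  apply: fourier_aeq; [exact: (Hs_m (FO_Hs c0))|exact: (Hs_m hfm)|].
  by apply: (aeD1 hz) => x _ /eqP; rewrite subr_eq0 => /eqP.
have uW : W \in unitmx by rewrite unitmxE unitfE.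
have /zero_col c00 : (\col_k c0 k : 'cV[C]_n) = 0 by rewrite -(mulKmx uW (\col_k c0 k)) hcol mulmx0.
apply: (aeD1 hz) => x _; rewrite /FO big1 => [|k _]; last by rewrite c00 mul0r.
by rewrite subr0 => /eqP; rewrite mulf_eq0 expfz_eq0 (negPf (circ_neq0 x)) andbF orbF => /eqP.
Qed.

(** A symmetric [w] with [w - h] antianalytic is constructed. Then [T(S) F0 = P (t^(-n) w / b)] is
    solved, and [F0] is corrected by a combination of the [om k] until it is divisible by [t^n]; the
    correction changes [w] by an antianalytic symmetric function. *)
Lemma TH_onto_of_det : \det W != 0 -> onto p (TH a b).
Proof.
move=> dW h hh.
have LJh := inL1_pn; have Qh := Qs_flipJ p1 hh.
have LdJ : Lp p (fun z => d z * flipJ h z) by apply: Linf_mulLp => //; exact: Qs_Lp.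
have hP := Hs_rieszP p1 LdJ.
have hh' := Hs_sub p1 hh hP.
(* For [w0 = h + J u0], the difference [d J w0 - h = d u0 + d J h - h] has to be antianalytic; a
   solution [u0] divisible by [t^(2n)] exists because [T(G)] is onto. *)
have [v hv ev] := Gonto hh'.
pose u0 z := v z * z ^ (2 * n)%:Z; have hu0 : Hs p u0 by exact: Hs_mon.
have Ldu : Lp p (fun z => d z * u0 z) by apply: Linf_mulLp => //; exact: Hs_Lp.
have q0 : Qs p (fun z => d z * u0 z + d z * flipJ h z - h z).
  have q1 : Qs p (fun z => G z * v z - (h z - rieszP (fun z0 => d z0 * flipJ h z0) z)) by apply/(ToepP p1 LG hv hh').
  have q2 := Qs_rieszQ p1 LdJ.
  have := Qs_add p1 q1 q2; rewrite (_ : (fun z => _) = (fun z => d z * u0 z + d z * flipJ h z - h z))//.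
  by apply/funext => z; rewrite /rieszQ /G /u0; ring.
pose w0 z := h z + flipJ u0 z.
have Ju0 := Qs_flipJ p1 hu0.
pose w1 z := d z * flipJ w0 z.
have Lw0 : Lp p w0 by apply: inLp_add => //; [exact: (Hs_Lp hh)|exact: (Qs_Lp Ju0)].
have [LJw0 _] := flipJ_Lp Lw0.
have Lw1 : Lp p w1 by exact: Linf_mulLp.
have q1 : Qs p (fun z => w1 z - h z).
  apply: (Qs_aeq _ _ q0); first by apply: measC_sub; [exact: (inLp_m Lw1)|exact: (Hs_m hh)].
  apply: aeq_eq => x; rewrite /w1.
  have -> : flipJ w0 (circ x) = flipJ h (circ x) + u0 (circ x).
    by rewrite -[u0 (circ x)](flipJK u0) {1}/flipJ /w0 mulrDr.
  by rewrite mulrDr [in RHS](addrC (d _ * flipJ h _)).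
(* The mean of [w0] and [d J w0] is symmetric, and both differ from [h] by antianalytic
   functions. *)
pose w z := 2^-1 * (w0 z + w1 z).
have Lw : Lp p w by apply: inLp_scale => //; exact: inLp_add.
have wsym : aeq (fun z => d z * flipJ w z) w.
  apply: (aeD1 (flipJ_Linf w0)) => x _ hx.
  have -> : flipJ w (circ x) = 2^-1 * (flipJ w0 (circ x) + flipJ w1 (circ x)) by rewrite /flipJ /w; ring.
  by rewrite mulrCA mulrDr hx addrC.
have qw : Qs p (fun z => w z - h z).
  have := Qs_scale p1 2^-1 (Qs_add p1 Ju0 q1); rewrite (_ : (fun z => _) = (fun z => w z - h z))//.
  by apply/funext => z; rewrite /w /w0; field.
pose x1 z := z ^ (- n%:Z) * ((b z)^-1 * w z).
have Lx1 : Lp p x1.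
  have := inLp_mon (- n%:Z) (Linf_mulLp p0 Lib Lw); rewrite (_ : (fun z => _) = x1)//.
  by apply/funext => z; rewrite /x1 mulrC.
have hPx := Hs_rieszP p1 Lx1; have [F0 hF0 eF0] := Sonto hPx.
have qF0 : Qs p (fun z => S z * F0 z - x1 z).
  have q3 : Qs p (fun z => S z * F0 z - rieszP x1 z) by apply/(ToepP p1 LS hF0 hPx).
  have := Qs_sub p1 q3 (Qs_rieszQ p1 Lx1); rewrite (_ : (fun z => _) = (fun z => S z * F0 z - x1 z))//.
  by apply/funext => z; rewrite /rieszQ; ring.
have uW : W \in unitmx by rewrite unitmxE unitfE.
pose cv : 'cV[C]_n := - (invmx W *m \col_j fourier F0 j%:Z).
pose c0 k := cv k 0.
have ecv : \col_k c0 k = cv by apply/colP => k; rewrite mxE.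
pose F z := F0 z + FO c0 z.
have hF : Hs p F by exact: Hs_add.
have F_0 (j : nat) : (j < n)%N -> fourier F j%:Z = 0.
  move=> jn; rewrite fourier_add; [|exact: (Hs_L1 p1 hF0)|exact: (Hs_L1 p1 (FO_Hs c0))].
  by rewrite (fourier_FO c0 (Ordinal jn)) ecv mulmxN mulKVmx// !mxE subrr.
have hf := Hs_div hF F_0; set f := (fun z => F z * z ^ (- n%:Z)) in hf.
pose w2 z := w z + flipJ (UO c0) z.
have QJU := Qs_flipJ p1 (UO_Hs c0).
have Lw2 : Lp p w2 by apply: inLp_add => //; exact: (Qs_Lp QJU).
have w2sym : aeq (fun z => d z * flipJ w2 z) w2.
  apply: (aeD2 wsym (UO_sym c0)) => x _ h1 h2.
  have -> : flipJ w2 (circ x) = flipJ w (circ x) + UO c0 (circ x).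
    by rewrite -[UO c0 (circ x)](flipJK (UO c0)) {1}/flipJ /w2 mulrDr.
  by rewrite mulrDr h1 h2.
have q4 : Qs p (fun z => S z * (f z * z ^ n%:Z) - z ^ (- n%:Z) * ((b z)^-1 * w2 z)).
  apply: (Qs_aeq _ _ (Qs_add p1 qF0 (FO_Qs c0))).
    apply: measC_sub; apply: measC_mul; [by case: LS|exact: (Hs_m (Hs_mon n hf))|exact: measC_mon|].
    by apply: measC_mul; [case: Lib|exact: (inLp_m Lw2)].
  apply: aeq_eq => x; have -> : f (circ x) * circ x ^ n%:Z = F (circ x).
    by rewrite /f -mulrA circXD addNr expr0z mulr1.
  by rewrite /x1 /w2 /F; ring.
have eq2 := TH_sol_full hf Lw2 w2sym q4.
exists f => //; apply/(THP p1 La Lb hf hh).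
apply: (Qs_aeq _ _ (Qs_add p1 qw QJU)).
  apply: measC_sub; last exact: (Hs_m hh).
  apply: measC_add; apply: measC_mul; [by case: La|exact: (Hs_m hf)|by case: Lb|].
  by apply: measC_flipJ; exact: (Hs_m hf).
by apply: (aeD1 eq2) => x _ ->; rewrite /w2; ring.
Qed.

(** A null vector of [W] makes the combination of the [om k] divisible by [t^n]; the quotient solves
    the homogeneous equation, so it is 0, and with it the corresponding combination of the
    independent [u_ k]. *)
Lemma det_of_TH_inj : inj p (TH a b) -> \det W != 0.
Proof.
move=> hinj; rewrite -unitfE -unitmxE -unitmx_tr; apply: mulmx_unit_solve => c0 hc.
have F_0 (j : nat) : (j < n)%N -> fourier (FO c0) j%:Z = 0.
  move=> jn; rewrite (fourier_FO c0 (Ordinal jn)) mxE; apply: etrans (hc (Ordinal jn)).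
  by apply: eq_bigr => k _; rewrite !mxE mulrC.
have hf := Hs_div (FO_Hs c0) F_0; set f := (fun z => FO c0 z * z ^ (- n%:Z)) in hf.
have QJU := Qs_flipJ p1 (UO_Hs c0).
have q4 : Qs p (fun z => S z * (f z * z ^ n%:Z) - z ^ (- n%:Z) * ((b z)^-1 * flipJ (UO c0) z)).
  apply: (Qs_aeq _ _ (FO_Qs c0)).
    apply: measC_sub; apply: measC_mul; [by case: LS|exact: (Hs_m (Hs_mon n hf))|exact: measC_mon|].
    by apply: measC_mul; [case: Lib|exact: (inLp_m (Qs_Lp QJU))].
  apply: aeq_eq => x; have -> : f (circ x) * circ x ^ n%:Z = FO c0 (circ x).
    by rewrite /f -mulrA circXD addNr expr0z mulr1.
  by [].
have wsym : aeq (fun z => d z * flipJ (flipJ (UO c0)) z) (flipJ (UO c0)).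
  by apply: (aeD1 (UO_sym c0)) => x _ <-; rewrite flipJK.
have eq2 := TH_sol_full hf (Qs_Lp QJU) wsym q4.
have hT : aeq (TH a b f) (fun=> 0).
  apply/(THP p1 La Lb hf (Hs0 p1)); apply: (Qs_aeq _ _ QJU).
    apply: measC_sub; last exact: measC_cst.
    apply: measC_add; apply: measC_mul; [by case: La|exact: (Hs_m hf)|by case: Lb|].
    by apply: measC_flipJ; exact: (Hs_m hf).
  by apply: (aeD1 eq2) => x _ ->; rewrite subr0.
have fz := hinj _ hf hT.
apply: kernel_indep; apply: (aeD2 (flipJ_aeq (aeq_sym eq2)) (aeD2 (flipJ_aeq fz) fz (fun x _ k1 k2 => conj k1 k2))) => x _ h1 [h2 h3].
have := h1; rewrite flipJK /UO => ->.
have h4 : f (circ x) = 0 by [].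
have e2 : flipJ f (circ x) = 0 by rewrite h2 /flipJ mulr0.
have f' : f (circ x)^-1 = 0.
  by move: e2; rewrite /flipJ => /eqP; rewrite mulf_eq0 invr_eq0 (negPf (circ_neq0 x)) => /eqP.
by rewrite /flipJ invrK f' h4 !mulr0 addr0 mulr0.
Qed.
End Core.

(** * Bounded inverses, adjoints and regular pairs *)

Section Invertibility.
Variable R : realType.
Local Notation C := R[i].
Implicit Types (a b f g h : C -> C) (z : C).

Lemma Toep_congr (p : R) f g : 1 < p -> Linf f -> Linf g -> aeq f g ->
  (inj p (Toep f) -> inj p (Toep g)) /\ (onto p (Toep f) -> onto p (Toep g)).
Proof.
move=> p1 Lf Lg e.
have efg k : Hs p k -> aeq (Toep f k) (Toep g k).
  move=> hk; have hg := Toep_Hs p1 Lg hk; apply/(ToepC p1 Lf hk hg) => n n0.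
  rewrite /Toep (fourier_rieszP p1)//; last by apply: Linf_mulLp (Hs_Lp hk) => //; exact: lt_trans p1.
  apply: fourier_aeq.
  - by apply: measC_mul; [case: Lf|exact: (Hs_m hk)].
  - by apply: measC_mul; [case: Lg|exact: (Hs_m hk)].
  by apply: (aeD1 e) => x _ ->.
split=> H k hk; first by move=> h0; apply: H => //; exact: aeq_trans (efg _ hk) h0.
by have [u hu eu] := H k hk; exists u => //; exact: aeq_trans (aeq_sym (efg _ hu)) eu.
Qed.

Lemma Toep_opp (p : R) g : 1 < p -> Linf g ->
  (inj p (Toep g) -> inj p (Toep (fun z => - g z))) /\ (onto p (Toep g) -> onto p (Toep (fun z => - g z))).
Proof.
move=> p1 Lg; have p0 : 0 < p by exact: lt_trans p1.
have LN : Linf (fun z => - g z).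
  apply: (Linf_ab _ _ Lg); first by apply: measC_opp; case: Lg.
  by apply: aeD_all => x _; rewrite /ab absCN.
split=> H k hk.
  move=> /(Toep0 p1 LN hk) /(Qs_scale p1 (-1)) h0; apply: H => //; apply/(Toep0 p1 Lg hk).
  by move: h0; under eq_fun do rewrite mulN1r mulNr opprK.
have hm := Hs_opp p1 hk; have [u hu eu] := H _ hm; exists u => //.
have /(ToepP p1 Lg hu hm)/(Qs_scale p1 (-1)) hQ := eu; apply/(ToepP p1 LN hu hk).
by move: hQ; under eq_fun do rewrite mulN1r opprB -opprD addrC; under [X in _ -> Qs _ X]eq_fun do rewrite mulNr -opprD.
Qed.

(** Preimages are chosen with the open mapping bound; uniqueness makes the choice linear almost
    everywhere. *)
Lemma invertible_of_bij (p : R) A : 1 < p -> isBLOp p A -> inj p A -> onto p A -> invertible p A.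
Proof.
move=> p1 Ablo hi ho; have [M M0 hM] := open_mapping p1 Ablo ho.
have ch h : exists f, Hs p h -> [/\ Hs p f, aeq (A f) h & normLp p f <= M * normLp p h].
  by have [hh|nh] := pselect (Hs p h); [have [f hf] := hM h hh; exists f|exists h].
have [B hB] := boolp.choice ch.
have uniq_sol f g : Hs p f -> Hs p g -> aeq (A f) (A g) -> aeq f g.
  move=> hf hg e; have : aeq (fun z => f z - g z) (fun=> 0).
    apply: hi; first exact: Hs_sub.
    by apply: (aeD2 (blo_sub Ablo hf hg) e) => x _ -> ->; rewrite subrr.
  by move=> h; apply: (aeD1 h) => x _ /eqP; rewrite subr_eq0 => /eqP.
exists B; split; [split; [|split]|split].
- by move=> f /HsE hf; apply/HsE; have [] := hB f hf.
- move=> f g l /HsE hf /HsE hg; have hfg := Hs_add p1 hf (Hs_scale p1 l hg).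
  have [h1 e1 _] := hB _ hf; have [h2 e2 _] := hB _ hg; have [h3 e3 _] := hB _ hfg.
  apply: uniq_sol => //; first by apply: Hs_add => //; exact: Hs_scale.
  apply: aeq_trans e3 _; apply: aeq_trans _ (aeq_sym (blo_lin Ablo l h1 h2)).
  by apply: (aeD2 e1 e2) => x _ -> ->.
- by exists M => f /HsE hf; have [] := hB f hf.
- move=> f /HsE hf; have [h1 e1 _] := hB _ (blo_Hs Ablo hf); exact: uniq_sol.
by move=> f /HsE hf; have [] := hB f hf.
Qed.

Lemma left_invertible_inj (p : R) A : 1 < p -> isBLOp p A -> leftInvertible p A -> inj p A.
Proof.
move=> p1 Ablo [B [Bblo hB]] f hf h0; have /HsE hf' := hf.
apply: aeq_trans (aeq_sym (hB f hf')) _.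
apply: aeq_trans (blo_aeq p1 Bblo (blo_Hs Ablo hf) (Hs0 p1) h0) _.
exact: (blo_0 p1 Bblo).
Qed.

Lemma right_invertible_onto (p : R) A : rightInvertible p A -> onto p A.
Proof.
move=> [B [Bblo hB]] h hh; exists (B h); first exact: (blo_Hs Bblo hh).
by apply: hB; exact/HsE.
Qed.

Section Adjoint.
Variables (p : R) (a b : C -> C).
Hypotheses (p1 : 1 < p) (La : Linf a) (Lb : Linf b).
Local Notation q := (conjexp p).
Let q1 : 1 < q. Proof. by have [] := conj_exp p1. Qed.
Let p0 : 0 < p. Proof. exact: lt_trans p1. Qed.
Let q0 : 0 < q. Proof. exact: lt_trans q1. Qed.
Let qq : conjexp q = p. Proof. by have [] := conj_exp p1. Qed.
Local Notation A := (TH a b).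
Local Notation A' := (TH (fconj a) (tilde (fconj b))).
Let La' := Linf_conj La.
Let Lb' := Linf_tilde (Linf_conj Lb).

(** In the Hankel part the substitution [z -> 1/z] moves [J] to the other side of the pairing and
    turns [\bar b] into [\tilde{\bar b}]. *)
Lemma TH_adjoint f g : Hs p f -> Hs q g -> pair (A f) g = pair f (A' g).
Proof.
move=> hf hg; have hA := TH_Hs p1 La Lb hf; have hA' := TH_Hs q1 La' Lb' hg.
have Lf := Hs_Lp hf; have Lg := Hs_Lp hg.
have [LJf _] := flipJ_Lp Lf; have [LJg _] := flipJ_Lp Lg.
have Laf := Linf_mulLp p0 La Lf; have LbJ := Linf_mulLp p0 Lb LJf.
have Lag := Linf_mulLp q0 La' Lg; have LbJg := Linf_mulLp q0 Lb' LJg.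
have q2 : Qs p (fun z => a z * f z + b z * flipJ f z - A f z) by apply/(THP p1 La Lb hf hA); exact: aeq_refl.
have q3 : Qs q (fun z => fconj a z * g z + tilde (fconj b) z * flipJ g z - A' g z).
  by apply/(THP q1 La' Lb' hg hA'); exact: aeq_refl.
have LBf := inLp_add (ltW p1) Laf LbJ; have LBg := inLp_add (ltW q1) Lag LbJg.
have e1 : pair (A f) g = pair (fun z => a z * f z + b z * flipJ f z) g.
  have := pair_Qs p1 q2 hg; rewrite (pair_subl p1 LBf (Hs_Lp hA) Lg) => /eqP.
  by rewrite subr_eq0 => /eqP ->.
have e2 : pair f (A' g) = pair f (fun z => fconj a z * g z + tilde (fconj b) z * flipJ g z).
  have hf' : Hs (conjexp q) f by rewrite qq.
  have := pair_Qs q1 q3 hf'.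
  rewrite (pair_conj p1 Lf (inLp_sub (ltW q1) LBg (Hs_Lp hA'))) (pair_subr p1 Lf LBg (Hs_Lp hA')).
  by move/eqP; rewrite conjc_eq0 subr_eq0 => /eqP ->.
rewrite e1 e2 (pair_addl p1 Laf LbJ Lg).
have -> : pair f (fun z => fconj a z * g z + tilde (fconj b) z * flipJ g z) =
    pair f (fun z => fconj a z * g z) + pair f (fun z => tilde (fconj b) z * flipJ g z).
  have [L1 _] := pair_L1 p1 Lf Lag; have [L2 _] := pair_L1 p1 Lf LbJg.
  by rewrite /pair -(cint_add L1 L2); apply: eq_cint => x _; rewrite /fconj conjD; ring.
congr (_ + _).
  by apply: eq_cint => x _; rewrite /fconj conjM conjcK; ring.
have [L1 _] := pair_L1 p1 LbJ Lg.
rewrite /pair -(cint_tilde L1); apply: eq_cint => x _.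
rewrite /tilde /fconj /flipJ conjM conjcK conjM invrK.
have -> : ((circ x)^-1^*)%C = circ x by rewrite circ_conj conjcK.
ring.
Qed.

Lemma adjoint_inj : onto p A -> inj q A'.
Proof.
move=> ho g hg h0; apply: (pair_eq0 q1 hg) => h; rewrite qq => hh.
have [f hf ef] := ho h hh; have hA := TH_Hs p1 La Lb hf.
rewrite (pair_conj p1 (Hs_Lp hh) (Hs_Lp hg)).
have -> : pair h g = pair (A f) g.
  apply: cint_aeq; [| |by apply: (aeD1 ef) => x _ ->].
    by have [L1 _] := pair_L1 p1 (Hs_Lp hh) (Hs_Lp hg); exact: inLp_m L1.
  by have [L1 _] := pair_L1 p1 (Hs_Lp hA) (Hs_Lp hg); exact: inLp_m L1.
rewrite TH_adjoint//.
have -> : pair f (A' g) = cint (fun=> 0).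
  apply: cint_aeq; [|exact: measC_cst|by apply: (aeD1 h0) => x _; rewrite /fconj => ->; rewrite conjc0 mulr0].
  by have [L1 _] := pair_L1 p1 (Hs_Lp hf) (Hs_Lp (TH_Hs q1 La' Lb' hg)); exact: inLp_m L1.
by rewrite cint0 conjc0.
Qed.

Lemma inj_of_adjoint_onto : onto q A' -> inj p A.
Proof.
move=> ho f hf h0; apply: (pair_eq0 p1 hf) => k hk.
have [g hg eg] := ho k hk; have hA' := TH_Hs q1 La' Lb' hg.
have -> : pair f k = pair f (A' g).
  apply: cint_aeq; [| |by apply: (aeD1 eg) => x _; rewrite /fconj => ->].
    by have [L1 _] := pair_L1 p1 (Hs_Lp hf) (Hs_Lp hk); exact: inLp_m L1.
  by have [L1 _] := pair_L1 p1 (Hs_Lp hf) (Hs_Lp hA'); exact: inLp_m L1.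
rewrite -TH_adjoint// -[RHS](cint0 R).
apply: cint_aeq; [|exact: measC_cst|by apply: (aeD1 h0) => x _ ->; rewrite mul0r].
by have [L1 _] := pair_L1 p1 (Hs_Lp (TH_Hs p1 La Lb hf)) (Hs_Lp hg); exact: inLp_m L1.
Qed.
End Adjoint.

Definition shiftc (n : nat) a b : C -> C := fun z => subc a b z * z ^ (- (2 * n)%:Z).
Definition shiftd (n : nat) a b : C -> C := fun z => subd a b z * z ^ (2 * n)%:Z.

(** The Fredholm data are stored as bijectivity of the shifted Toeplitz operators, since this form
    passes to the pairs [(a, -b)] and [(\bar a, \tilde{\bar b})] without computing indices there. *)
Record regular (p : R) (n : nat) a b : Prop := Regular {
  reg_a : GL a; reg_b : GL b;
  reg_match : aeq (fun z => a z * tilde a z) (fun z => b z * tilde b z);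
  reg_c_inj : inj p (Toep (shiftc n a b)); reg_c_onto : onto p (Toep (shiftc n a b));
  reg_d_inj : inj p (Toep (shiftd n a b)); reg_d_onto : onto p (Toep (shiftd n a b)) }.

Lemma GL_Linf g : GL g -> Linf g. Proof. by case. Qed.

Lemma matched_sym a b : GL a -> GL b -> aeq (fun z => a z * tilde a z) (fun z => b z * tilde b z) ->
  Sym (subc a b) /\ Sym (subd a b).
Proof.
move=> Ga Gb hab; have [_ _ b0] := Gb; have [_ _ tb0] := GL_tilde Gb.
split; (split; first by [exact: GL_mul (GL_inv Gb)|exact: GL_mul (GL_inv (GL_tilde Gb))]).
  apply: (aeD3 b0 tb0 hab) => x _ h1 h2; rewrite /subc /tilde => e.
  by rewrite mulrACA e -invfM mulfV// mulf_neq0.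
apply: (aeD3 b0 tb0 hab) => x _ h1 h2; rewrite /subd /tilde invrK => e.
by rewrite mulrACA e -invfM [X in _ / X]mulrC mulfV// mulf_neq0.
Qed.

Lemma inFTH_regular (p : R) (n : nat) a b : 1 < p -> (0 < n)%N ->
  inFTH p a b (- (2 * n)%:Z) (2 * n)%:Z -> regular p n a b.
Proof.
move=> p1 n0 [hm [Fc Fd]]; have n2 : (0 < 2 * n)%N by rewrite muln_gt0.
have [Ga Gb [Gc _] [Gd _]] := matching_GL p1 (n2 : 0 < (2 * n)%:Z) hm Fd.
have [_ [_ hab]] := hm.
split => //.
- exact: (neg_shift_inj p1 Gc n2 Fc).
- exact: (neg_shift_onto p1 Gc n2 Fc).
- exact: (pos_shift_inj p1 Gd n2 Fd).
- exact: (pos_shift_onto p1 Gd n2 Fd).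
Qed.

Lemma regular_sym (p : R) n a b : regular p n a b -> Sym (shiftc n a b) /\ Sym (shiftd n a b).
Proof.
by case=> Ga Gb hab _ _ _ _; have [h1 h2] := matched_sym Ga Gb hab; split; exact: sym_mon.
Qed.

Lemma regular_opp (p : R) n a b : 1 < p -> regular p n a b -> regular p n a (fun z => - b z).
Proof.
move=> p1 hr; have [[[Lc _ _] _] [[Ld _ _] _]] := regular_sym hr; have [Ga Gb hab h1 h2 h3 h4] := hr.
have ec : shiftc n a (fun z => - b z) = fun z => - shiftc n a b z.
  by apply/funext => z; rewrite /shiftc /subc invrN mulrN mulNr.
have ed : shiftd n a (fun z => - b z) = fun z => - shiftd n a b z.
  by apply/funext => z; rewrite /shiftd /subd /tilde invrN mulrN mulNr.
have [Lb Lib b0] := Gb.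
have LN g : Linf g -> Linf (fun z => - g z).
  move=> Lg; apply: (Linf_ab _ _ Lg); first by apply: measC_opp; case: Lg.
  by apply: aeD_all => x _; rewrite /ab absCN.
apply: Regular; first exact: Ga.
- split; [exact: (LN _ Lb)|by under eq_fun do rewrite invrN; exact: LN|].
  by apply: (aeD1 b0) => x _; rewrite oppr_eq0.
- by apply: (aeD1 hab) => x _ ->; rewrite /tilde mulrNN.
- by rewrite ec; have [h _] := Toep_opp p1 Lc; exact: h.
- by rewrite ec; have [_ h] := Toep_opp p1 Lc; exact: h.
- by rewrite ed; have [h _] := Toep_opp p1 Ld; exact: h.
- by rewrite ed; have [_ h] := Toep_opp p1 Ld; exact: h.
Qed.

(** Conjugation turns [t] into [1/t] on the circle, so the shifted [d] of the given pair conjugates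
    to the shifted [c] of the adjoint pair and vice versa; their bijectivity on [H^q] is [dual_inj]
    and [dual_onto]. *)
Lemma regular_adjoint (p : R) n a b : 1 < p -> regular p n a b ->
  regular (conjexp p) n (fconj a) (tilde (fconj b)).
Proof.
move=> p1 hr; have [q1 _ _] := conj_exp p1.
have [Sc Sd] := regular_sym hr; have [Ga Gb hab h1 h2 h3 h4] := hr.
have Gc := GL_conj (proj1 Sc); have Gd := GL_conj (proj1 Sd).
have conjV (w : C) : ((w^-1)^*)%C = (w^*)%C^-1.
  by apply: eqCplx; rewrite ?cReC ?cImC ?cReV ?cImV ?cReC ?cImC sqrrN// mulNr opprK.
have Ga' := GL_conj Ga; have Gb' := GL_tilde (GL_conj Gb).
have hab' : aeq (fun z => fconj a z * tilde (fconj a) z) (fun z => tilde (fconj b) z * tilde (tilde (fconj b)) z).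
  apply: (aeD1 hab) => x _; rewrite /tilde /fconj invrK -conjM => ->.
  by rewrite conjM mulrC.
have [Sc' Sd'] := matched_sym Ga' Gb' hab'.
have Lc' : Linf (shiftc n (fconj a) (tilde (fconj b))) by apply: Linf_mon; exact: GL_Linf (proj1 Sc').
have Ld' : Linf (shiftd n (fconj a) (tilde (fconj b))) by apply: Linf_mon; exact: GL_Linf (proj1 Sd').
have ec : aeq (fconj (shiftd n a b)) (shiftc n (fconj a) (tilde (fconj b))).
  by apply: aeq_eq => x; rewrite /fconj /shiftd /shiftc /subd /subc /tilde !conjM conjV conj_circX.
have ed : aeq (fconj (shiftc n a b)) (shiftd n (fconj a) (tilde (fconj b))).
  by apply: aeq_eq => x; rewrite /fconj /shiftd /shiftc /subd /subc /tilde !conjM conjV conj_circX invrK opprK.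
have [c1 c2] := Toep_congr q1 (GL_Linf Gd) Lc' ec.
have [d1 d2] := Toep_congr q1 (GL_Linf Gc) Ld' ed.
split => //.
- by apply: c1; exact: dual_inj.
- by apply: c2; exact: dual_onto.
- by apply: d1; exact: dual_inj.
- by apply: d2; exact: dual_onto.
Qed.

Section Regular.
Variables (p : R) (n : nat) (a b : C -> C).
Hypotheses (p1 : 1 < p) (hr : regular p n a b).
Let Ga : GL a. Proof. by case: hr. Qed.
Let Gb : GL b. Proof. by case: hr. Qed.
Let hab := reg_match hr.
Let SG := proj2 (regular_sym hr).
Let LS : Linf (shiftc n a b). Proof. by have [[[]]] := regular_sym hr. Qed.
Let B z := (tilde a z)^-1 * z ^ (- n%:Z).
Let LB : Linf B. Proof. by apply: Linf_mon; case: (GL_tilde Ga). Qed.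

(** Injectivity makes the matrix nondegenerate, and nondegeneracy gives surjectivity. The matrix is
    built from [e = T(G)^(-1) 1] and preimages under [T(S)], which bijectivity of the shifted
    operators supplies. *)
Lemma regular_TH_onto : inj p (TH a b) -> onto p (TH a b).
Proof.
move=> hi; have H1 : Hs p (fun=> 1) by have := Hs_zn p1 0; under eq_fun do rewrite expr0z.
have [e he ee] := reg_d_onto hr H1.
have hu (k : 'I_n) := u_Hs p1 he k.
have ch (k : 'I_n) : exists f, Hs p f /\ aeq (Toep (shiftc n a b) f) (Toep B (fun z => e z * (z ^ (n%:Z - k%:Z - 1) + fourier e 0 * z ^ (n + k)%:Z))).
  by have [f hf ef] := reg_c_onto hr (Toep_Hs p1 LB (hu k)); exists f.
have [om hom] := boolp.choice ch.
have dW := det_of_TH_inj p1 Ga Gb hab (reg_c_inj hr) SG (reg_d_inj hr) he ee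
  (fun k => (hom k).1) (fun k => (hom k).2) hi.
exact: (TH_onto_of_det p1 Ga Gb hab (reg_c_inj hr) (reg_c_onto hr) SG (reg_d_inj hr) (reg_d_onto hr) he ee
  (fun k => (hom k).1) (fun k => (hom k).2) dW).
Qed.

Lemma regular_TH_invertible : inj p (TH a b) -> invertible p (TH a b).
Proof.
move=> hi; apply: (invertible_of_bij p1 (TH_blo p1 (GL_Linf Ga) (GL_Linf Gb)) hi).
exact: regular_TH_onto.
Qed.

Variable dp : C -> C.
Hypothesis hdp : normWHplus p (subd a b) n dp.
Let e z := (dp z)^-1.

(** Multiplied by [e t^(2n)], the factorization reads [G e = sigma \tilde e] with [sigma] the
    signature, so [P (G e)] is the constant [sigma e(0)], which the normalisation at infinity makes
    1. The signature is a coefficient of [dp], not of [e]; it equals [e(0)] because [e(0)^2 = 1] by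
    [eigen]. *)
Lemma plus_factor_eigen : [/\ Hs p e, aeq (Toep (shiftd n a b) e) (fun=> 1) & signature dp = fourier e 0].
Proof.
have [[_ [/HsE he [_ [_ [ed _]]]]] h0] := hdp.
have LG : Linf (shiftd n a b) by case: SG => -[].
have [[_ _ G0] _] := SG.
have H1 : Hs p (fun=> 1) by have := Hs_zn p1 0; under eq_fun do rewrite expr0z.
have Le1 := Hs_L1 p1 he; have Lt := inLp_tilde Le1.
have eG : aeq (fun z => shiftd n a b z * e z) (fun z => signature dp * tilde e z).
  apply: (aeD2 ed G0) => x _ h g0.
  have d0 : dp (circ x) != 0.
    by apply: contraNneq g0 => z0; rewrite /shiftd h z0 mulr0 mul0r.
  rewrite /shiftd h /e /tilde [X in X / _]mulrAC mulfK//.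
  by rewrite -(mulrA (signature dp / dp (circ x)^-1)) circXD addNr expr0z mulr1.
have f0 : signature dp * fourier e 0 = 1.
  have h0' : fourier (fun z => signature dp * tilde e z) 0 = 1 by exact: h0.
  by move: h0'; rewrite (fourier_scale _ _ Lt) (fourier_tilde 0).
have ee : aeq (Toep (shiftd n a b) e) (fun=> 1).
  apply/(ToepC p1 LG he H1) => k k0.
  rewrite (@eq_fourier _ (fun=> 1) (fun z => 1 * z ^ (0 : int))); last by move=> x; rewrite expr0z mulr1.
  rewrite fourier_monomial.
  have -> : fourier (fun z => shiftd n a b z * e z) k = signature dp * fourier (tilde e) k.
    rewrite -fourier_scale//; apply: fourier_aeq eG.
      by apply: measC_mul; [case: LG|exact: (Hs_m he)].
    by apply: measC_scale; exact: (inLp_m Lt).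
  have [->|kn] := eqVneq k 0; first by rewrite fourier_tilde// oppr0.
  by rewrite (tilde_Hs p1 he) ?mulr0// lt_neqAle eq_sym kn.
split => //; have [_ s2] := eigen p1 SG (reg_d_inj hr) he ee.
have e0 : fourier e 0 != 0.
  by apply/eqP => z0; move: f0; rewrite z0 mulr0 => /eqP; rewrite eq_sym oner_eq0.
by apply: (mulIf e0); rewrite f0 -expr2.
Qed.

Lemma det_Wmat : \det (Wmat p n a b dp) != 0 <-> inj p (TH a b).
Proof.
have [he ee sg] := plus_factor_eigen.
have hu (k : 'I_n) := u_Hs p1 he k.
have hom (k : 'I_n) : Hs p (omega p n a b dp k) /\
    aeq (Toep (shiftc n a b) (omega p n a b dp k)) (Toep B (fun z => e z * (z ^ (n%:Z - k%:Z - 1) + fourier e 0 * z ^ (n + k)%:Z))).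
  have [f hf ef] := reg_c_onto hr (Toep_Hs p1 LB (hu k)).
  have [/HsE h1 h2] : inHp p (omega p n a b dp k) /\ aeq (Toep (shiftc n a b) (omega p n a b dp k))
     (Toep B (fun z => (dp z)^-1 * (z ^ (n%:Z - k%:Z - 1) + signature dp * z ^ (n + k)%:Z))).
    apply: (epsilon_spec (inhabits (fun _ : C => 0 : C)) (fun g => inHp p g /\ aeq (Toep (shiftc n a b) g)
     (Toep B (fun z => (dp z)^-1 * (z ^ (n%:Z - k%:Z - 1) + signature dp * z ^ (n + k)%:Z))))).
    by exists f; rewrite sg; split; [exact/HsE|exact: ef].
  by rewrite sg in h2.
split=> [dW|hi].
  exact: (TH_inj_of_det p1 Ga Gb hab (reg_c_inj hr) SG (reg_d_inj hr) he ee
    (fun k => (hom k).1) (fun k => (hom k).2) dW).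
exact: (det_of_TH_inj p1 Ga Gb hab (reg_c_inj hr) SG (reg_d_inj hr) he ee
  (fun k => (hom k).1) (fun k => (hom k).2) hi).
Qed.
End Regular.
End Invertibility.

Theorem theorem5p4 (R : realType) (p : R) (n : nat) (a b : R[i] -> R[i]) :
  1 < p -> (0 < n)%N ->
  inFTH p a b (- (2 * n)%:Z) (2 * n)%:Z ->
  (* (a) *)
  (forall dp, normWHplus p (subd a b) n dp ->
     (leftInvertible p (TH a b) <-> \det (Wmat p n a b dp) != 0)) /\
  (* (b) *)
  (forall dq, normWHplus (conjexp p) (subd (fconj a) (tilde (fconj b))) n dq ->
     (rightInvertible p (TH a b) <->
        \det (Wmat (conjexp p) n (fconj a) (tilde (fconj b)) dq) != 0)) /\
  (* (c) *)
  (forall dp dq, normWHplus p (subd a b) n dp ->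
     normWHplus (conjexp p) (subd (fconj a) (tilde (fconj b))) n dq ->
     (invertible p (TH a b) <->
        \det (Wmat p n a b dp) != 0 /\
        \det (Wmat (conjexp p) n (fconj a) (tilde (fconj b)) dq) != 0)) /\
  (* (d) *)
  (forall dp dpm, normWHplus p (subd a b) n dp ->
     normWHplus p (subd a (fun z => - b z)) n dpm ->
     \det (Wmat p n a b dp) != 0 ->
     \det (Wmat p n a (fun z => - b z) dpm) != 0 ->
     invertible p (TH a b) /\ invertible p (TH a (fun z => - b z))).
Proof.
move=> p1 n0 hF; have hr := inFTH_regular p1 n0 hF.
have hr' := regular_adjoint p1 hr; have [q1 _ _] := conj_exp p1.
have La := GL_Linf (reg_a hr); have Lb := GL_Linf (reg_b hr).
have Ablo := TH_blo p1 La Lb.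
have ha dp : normWHplus p (subd a b) n dp ->
     (leftInvertible p (TH a b) <-> \det (Wmat p n a b dp) != 0).
  move=> hdp; rewrite (det_Wmat p1 hr hdp); split; first exact: left_invertible_inj.
  by move=> /(regular_TH_invertible p1 hr)[B [h1 [h2 _]]]; exists B.
have hb dq : normWHplus (conjexp p) (subd (fconj a) (tilde (fconj b))) n dq ->
     (rightInvertible p (TH a b) <->
        \det (Wmat (conjexp p) n (fconj a) (tilde (fconj b)) dq) != 0).
  move=> hdq; rewrite (det_Wmat q1 hr' hdq); split.
    by move=> /right_invertible_onto; exact: adjoint_inj.
  (* For the adjoint pair injectivity implies surjectivity, which by duality gives injectivity of
     [T(a) + H(b)]; regularity then yields a two-sided inverse. *)
  move=> /(regular_TH_onto q1 hr') /(inj_of_adjoint_onto p1 La Lb).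
  by move=> /(regular_TH_invertible p1 hr)[B [h1 [_ h2]]]; exists B.
split => //; split => //; split.
  move=> dp dq hdp hdq; split=> [[B [h1 [h2 h3]]]|[/(det_Wmat p1 hr hdp) hi _]].
    by split; [apply/(ha _ hdp); exists B|apply/(hb _ hdq); exists B].
  exact: (regular_TH_invertible p1 hr hi).
move=> dp dpm hdp hdpm /(det_Wmat p1 hr hdp) h1.
(* Changing the sign of [b] preserves regularity, and for a regular pair injectivity gives
   invertibility. *)
have hrm := regular_opp p1 hr; move=> /(det_Wmat p1 hrm hdpm) h2.
by split; [exact: (regular_TH_invertible p1 hr h1)|exact: (regular_TH_invertible p1 hrm h2)].
Qed.
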